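(* Let a mean field game (MFG) as described in the context satisfy Assumptions 1, 2 and 3, and suppose it is $\kappa$-herding for some $\kappa\ge 0$ with constant $\rho\in(0,\infty)$. Run Algorithm 1 with step sizes $$\lambda_k=\frac{\lambda_0}{\sqrt{k+1}},\quad \alpha_k=\frac{\alpha_0}{\sqrt{k+1}},\quad \beta_k=\frac{\beta_0}{\sqrt{k+1}},\quad \xi_k=\frac{\xi_0}{\sqrt{k+1}},$$ where $c_J$ and the constants $\lambda_0,\alpha_0,\beta_0,\xi_0>0$ satisfy the step-size conditions listed in the context. Then there exists a constant $C>0$ independent of $k$ such that for all $k$ with $k\ge\tau_k$, $$\min_{0\le t<k}\mathbb{E}\big[\varepsilon_t^{\pi}+\varepsilon_t^{\mu}+\varepsilon_t^{V}+\varepsilon_t^{J}\big]\le C\left(\frac{\log^3(k+1)}{\sqrt{k+1}}+\kappa\right).$$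
   Context: Mean field game. $\mathcal{S}$ and $\mathcal{A}$ are finite sets; $\Delta_{\mathcal{S}}$, $\Delta_{\mathcal{A}}$ are the probability simplices over them. A mean field is $\mu\in\Delta_{\mathcal{S}}$. The MFG consists of a transition kernel $\mathcal{P}^{\mu}(s'\mid s,a)$ (a probability distribution over $s'\in\mathcal{S}$ for every $s\in\mathcal{S},a\in\mathcal{A},\mu\in\Delta_{\mathcal{S}}$) and a reward $r(s,a,\mu)\in[0,1]$. A policy is a map $\pi:\mathcal{S}\to\Delta_{\mathcal{A}}$, identified with a vector in $\mathbb{R}^{|\mathcal{S}||\mathcal{A}|}$; all norms $\|\cdot\|$ are Euclidean. For a policy $\pi$ and mean field $\mu$ let $P^{\pi,\mu}_{s',s}=\sum_{a}\mathcal{P}^{\mu}(s'\mid s,a)\pi(a\mid s)$ and let $\nu^{\pi,\mu}\in\Delta_{\mathcal{S}}$ be its stationary distribution. Define $J(\pi,\mu)=\mathbb{E}_{s\sim\nu^{\pi,\mu},a\sim\pi(\cdot\mid s)}[r(s,a,\mu)]$ and the differential value function $V^{\pi,\mu}\in\mathbb{R}^{|\mathcal{S}|}$, $V^{\pi,\mu}(s)=\mathbb{E}[\sum_{t=0}^\infty (r(s_t,a_t,\mu)-J(\pi,\mu))\mid s_0=s]$ where $a_t\sim\pi(\cdot\mid s_t)$, $s_{t+1}\sim\mathcal{P}^{\mu}(\cdot\mid s_t,a_t)$. For each policy $\pi$, $\mu^\star(\pi)\in\Delta_{\mathcal{S}}$ denotes the (assumed unique) mean field with $\mu^\star(\pi)=\nu^{\pi,\mu^\star(\pi)}$,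 and $\ell(\pi)=J(\pi,\mu^\star(\pi))$. Softmax policies: for $\theta\in\mathbb{R}^{|\mathcal{S}||\mathcal{A}|}$, $\pi_\theta(a\mid s)=\exp(\theta(s,a))/\sum_{a'}\exp(\theta(s,a'))$. $e_s\in\mathbb{R}^{|\mathcal{S}|}$ is the indicator vector of $s$. The total variation distance is $d_{TV}(\phi_1,\phi_2)=\frac12\sup_{\psi:\mathcal{X}\to[-1,1]}|\int\psi\,d\phi_1-\int\psi\,d\phi_2|$. Herding: given $\kappa\ge0$, the MFG is $\kappa$-herding if there is $0<\rho<\infty$ with $\ell(\pi)-\ell(\pi')\le\rho\big(J(\pi,\mu^\star(\pi))-J(\pi',\mu^\star(\pi))\big)+\kappa\|\pi-\pi'\|$ for all policies $\pi,\pi'$. Assumption 1 (uniform geometric ergodicity): for every $\pi,\mu$ the Markov chain with transition $P^{\pi,\mu}$ is irreducible and aperiodic, and there are $C_0\ge1$, $C_1\in(0,1)$ with $\sup_s d_{TV}(\mathbb{P}(s_k=\cdot\mid s_0=s),\nu^{\pi,\mu})\le C_0C_1^k$ for all $k\ge0$. Assumption 2: there is $\delta\in(0,1)$ with $\|\nu^{\pi,\mu_1}-\nu^{\pi,\mu_2}\|\le\delta\|\mu_1-\mu_2\|$ for all $\pi,\mu_1,\mu_2$. Assumption 3: there is $L>0$ such that for all distributions $d_1,d_2$ on $\mathcal{S}$, policies $\pi_1,\pi_2$, mean fields $\mu_1,\mu_2$, and all $s,a$, with $s\sim d_1$, $s'\sim P^{\pi_1,\mu_1}(\cdot\mid s)$,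 $\hat s\sim d_2$, $\hat s'\sim P^{\pi_2,\mu_2}(\cdot\mid\hat s)$: $|r(s,a,\mu_1)-r(s,a,\mu_2)|\le L\|\mu_1-\mu_2\|$; $d_{TV}(\mathbb{P}(s'=\cdot),\mathbb{P}(\hat s'=\cdot))\le d_{TV}(d_1,d_2)+L(\|\pi_1-\pi_2\|+\|\mu_1-\mu_2\|)$; $d_{TV}(\nu^{\pi_1,\mu_1},\nu^{\pi_2,\mu_2})\le L(\|\pi_1-\pi_2\|+\|\mu_1-\mu_2\|)$; $\|\mu^\star(\pi_1)-\mu^\star(\pi_2)\|\le L\|\pi_1-\pi_2\|$. Moreover there is $B_V>0$ with $\|V^{\pi,\mu}\|\le B_V$ for all $\pi,\mu$. Algorithm 1. Fix $c_J>0$ and step sizes $\alpha_k,\beta_k,\xi_k,\lambda_k>0$. Initialize $\theta_0\in\mathbb{R}^{|\mathcal{S}||\mathcal{A}|}$, $\hat V_0\in\mathbb{R}^{|\mathcal{S}|}$, $\hat J_0\in\mathbb{R}$, $\hat\mu_0\in\Delta_{\mathcal{S}}$, $f_0=0$, $g_0^V=0$, $g_0^J=0$, $h_0=0$, and an initial state $s_0$. For $k=0,1,2,\dots$: draw $a_k\sim\pi_{\theta_k}(\cdot\mid s_k)$, observe $r_k=r(s_k,a_k,\hat\mu_k)$ and $s_{k+1}\sim\mathcal{P}^{\hat\mu_k}(\cdot\mid s_k,a_k)$; set $\theta_{k+1}=\theta_k+\alpha_kf_k$; $\hat\mu_{k+1}=\Pi_{\Delta_{\mathcal{S}}}(\hat\mu_k+\xi_kh_k)$;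 $\hat V_{k+1}=\Pi_{B_V}(\hat V_k+\beta_kg^V_k)$; $\hat J_{k+1}=\Pi_{[0,1]}(\hat J_k+\beta_kg^J_k)$; $f_{k+1}=(1-\lambda_k)f_k+\lambda_k(r_k+\hat V_k(s_{k+1})-\hat V_k(s_k))\nabla_\theta\log\pi_{\theta_k}(a_k\mid s_k)$; $g^V_{k+1}=(1-\lambda_k)g^V_k+\lambda_k(r_k-\hat J_k+\hat V_k(s_{k+1})-\hat V_k(s_k))e_{s_k}$; $g^J_{k+1}=(1-\lambda_k)g^J_k+\lambda_kc_J(r_k-\hat J_k)$; $h_{k+1}=(1-\lambda_k)h_k+\lambda_k(e_{s_k}-\hat\mu_k)$. Here $\Pi_{\Delta_{\mathcal{S}}}$ is Euclidean projection onto the simplex, $\Pi_{B_V}$ Euclidean projection onto the $\ell_2$-ball of radius $B_V$, $\Pi_{[0,1]}$ projection onto $[0,1]$. Expectations are over the randomness of the algorithm. Metrics. Let $\mathcal{E}$ be the span of the all-ones vector $\mathbf{1}\in\mathbb{R}^{|\mathcal{S}|}$ and $\Pi_{\mathcal{E}_\perp}=I-\mathbf{1}\mathbf{1}^\top/|\mathcal{S}|$. Define $\varepsilon^\pi_k=\|\nabla_\theta J(\pi_{\theta_k},\mu)|_{\mu=\mu^\star(\pi_{\theta_k})}\|^2$ (gradient in $\theta$ with $\mu$ held fixed, then set to $\mu^\star(\pi_{\theta_k})$), $\varepsilon^\mu_k=\|\hat\mu_k-\mu^\star(\pi_{\theta_k})\|^2$, $\varepsilon^V_k=\|\Pi_{\mathcal{E}_\perp}(\hat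 V_k-V^{\pi_{\theta_k},\hat\mu_k})\|^2$, $\varepsilon^J_k=(\hat J_k-J(\pi_{\theta_k},\hat\mu_k))^2$. Mixing time. For $c>0$, $\tau^{\pi,\mu}(c)=\min\{k\in\mathbb{N}:\sup_s d_{TV}(\mathbb{P}(\hat s_k=\cdot\mid\hat s_0=s),\nu^{\pi,\mu})\le c\}$ for the chain $\hat s_k\sim P^{\pi,\mu}(\cdot\mid\hat s_{k-1})$; $\tau_k=\sup_{\pi,\mu}\tau^{\pi,\mu}(\alpha_k)$. Constants. $L_V\ge1$ is a constant such that for all $\theta_1,\theta_2,\mu_1,\mu_2$ the quantities $\|\Pi_{\mathcal{E}_\perp}(V^{\pi_{\theta_1},\mu_1}-V^{\pi_{\theta_2},\mu_2})\|$, $|J(\pi_{\theta_1},\mu_1)-J(\pi_{\theta_2},\mu_2)|$, $\|\nabla_\theta J(\pi_{\theta_1},\mu_1)-\nabla_\theta J(\pi_{\theta_2},\mu_2)\|$, $\|\nabla_\mu J(\pi_{\theta_1},\mu_1)-\nabla_\mu J(\pi_{\theta_2},\mu_2)\|$ are each at most $L_V(\|\theta_1-\theta_2\|+\|\mu_1-\mu_2\|)$. $L_{TV}$ is a constant such that $d_{TV}(\nu^{\pi_1,\mu_1}\otimes\pi_1\otimes\mathcal{P}^{\mu_1},\nu^{\pi_2,\mu_2}\otimes\pi_2\otimes\mathcal{P}^{\mu_2})\le L_{TV}(\|\pi_1-\pi_2\|+\|\mu_1-\mu_2\|)$ for all $\pi_i,\mu_i$, where $\nu\otimes\pi\otimes\mathcal{P}^\mu$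 is the joint law of $(s,a,s')$ with $s\sim\nu,a\sim\pi(\cdot\mid s),s'\sim\mathcal{P}^\mu(\cdot\mid s,a)$. $\gamma\in(0,1)$ is a constant such that $V^\top\mathbb{E}_{s\sim\nu^{\pi_\theta,\mu},a\sim\pi_\theta(\cdot\mid s),s'\sim\mathcal{P}^\mu(\cdot\mid s,a)}[e_s(e_{s'}-e_s)^\top]V\le-\gamma\|V\|^2$ for all $\theta,\mu$ and all $V$ with $V^\top\mathbf{1}=0$. Set $B_F=B_V+1$, $B_G=2(B_V+c_J+2)$, $B_H=2$, $L_F=10B_V+L+2B_FL_{TV}+5$, $L_G=2B_GL_{TV}+(L+1)(c_J+1)+2$, $L_H=L+1$. Step-size conditions: $c_J\ge1/\gamma$; $\alpha_0\le\xi_0\le\beta_0\le\lambda_0\le1/4$; $\alpha_0\le\min\{\lambda_0/(192(L_F^2+L_G^2+L_H^2+L_V^2+L^2/(1-\delta)+\rho)),\,C_\beta\beta_0,\,C_\xi\xi_0\}$; $\xi_0\le\min\{\lambda_0/(64(L_H^2L_F^2+L_G^2+L_V^2/\gamma+1/(1-\delta))),\,(1-\delta)\gamma\beta_0/(6912(L_F^4L_V^2+L_F^2L_G^2L_H^2L_V^2+L_F^2L_H^4L_V^2+L_V^2))\}$; $\beta_0\le\min\{\lambda_0/(72|\mathcal{S}|L_G^2+36L_F^2+8/\gamma),\,\gamma/(4L_G^2),\,(1-\delta)/(2L_H^2)\}$; where $C_\xi=\min\{\frac{1-\delta}{32\rho L_F^2},\frac{1-\delta}{4\rho},\frac{L_H}{2L_FL_V},\frac{1-\delta}{16LL_FL_V}\}$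 and $C_\beta=\min\{\frac{\gamma}{4},\frac{\rho\gamma}{512(L_F^2+L_G^2+L_H^2+L_V^2+L^2/(1-\delta))},\sqrt{\frac{\gamma}{3456|\mathcal{S}|(L_F^4L_G^4+L_F^2L_H^2+\rho L_F^2+L_V^2/\gamma+L^2L_F^2(1-\delta))}},\frac{\gamma}{2\rho}\}$. *)

(* Defs.v *)
From mathcomp Require Import all_boot all_order all_algebra.
From mathcomp Require Import all_classical all_reals all_analysis.
Import Order.TTheory GRing.Theory Num.Theory.
Import numFieldNormedType.Exports.
Local Open Scope classical_set_scope.
Local Open Scope ring_scope.

Set Implicit Arguments.
Unset Strict Implicit.
Unset Printing Implicit Defensive.

Section Vectors.
Variable R : realType.

Definition norm2 (I : finType) (v : {ffun I -> R}) : R :=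
  Num.sqrt (\sum_(i : I) v i ^+ 2).

Definition unitv (I : finType) (i : I) : {ffun I -> R} :=
  [ffun j => (j == i)%:R].

Definition onesv (I : finType) : {ffun I -> R} := [ffun _ => 1].

Definition simplex (I : finType) (v : {ffun I -> R}) : Prop :=
  (forall i, 0 <= v i) /\ \sum_(i : I) v i = 1.

Definition dTV (X : finType) (p q : {ffun X -> R}) : R :=
  2^-1 * sup [set `| \sum_(x : X) psi x * p x - \sum_(x : X) psi x * q x |
               | psi in [set psi : X -> R | forall x, -1 <= psi x <= 1]].

Definition proj (T : choiceType) (d : T -> T -> R) (C : set T) (x : T) : T :=
  xget x [set y | C y /\ forall z, C z -> d x y <= d x z].

Definition proj_simplex (I : finType) (x : {ffun I -> R}) : {ffun I -> R} :=
  proj (fun u v => norm2 (u - v)) (@simplex I) x.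

Definition proj_ball (I : finType) (B : R) (x : {ffun I -> R}) : {ffun I -> R} :=
  proj (fun u v => norm2 (u - v)) [set v | norm2 v <= B] x.

Definition proj_01 (x : R) : R :=
  proj (fun u v : R => `|u - v|) [set y | 0 <= y <= 1] x.

Definition grad (I : finType) (F : {ffun I -> R} -> R) (x : {ffun I -> R})
  : {ffun I -> R} :=
  [ffun i => derive1 (fun t : R => F (x + t *: unitv i)) 0].

End Vectors.

Section MFG.
Variables (R : realType) (S A : finType).

(* kernel  P mu s a s' = P^mu(s' | s, a);  reward r s a mu *)
Notation kernel := ({ffun S -> R} -> S -> A -> S -> R).
Notation reward := (S -> A -> {ffun S -> R} -> R).
(* policies pi(a|s) = pi (s,a), identified with vectors in R^{|S||A|} *)
Notation policy := {ffun S * A -> R}.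

Definition is_policy (pi : policy) : Prop :=
  forall s, simplex [ffun a => pi (s, a)].

Definition is_kernel (P : kernel) : Prop :=
  forall mu, simplex mu -> forall s a, simplex [ffun s' => P mu s a s'].

Definition reward_bounded (r : reward) : Prop :=
  forall s a mu, simplex mu -> 0 <= r s a mu <= 1.

(* P^{pi,mu}_{s',s} written as chain s s' *)
Definition chain (P : kernel) (pi : policy) (mu : {ffun S -> R}) (s s' : S) : R :=
  \sum_(a : A) P mu s a s' * pi (s, a).

Fixpoint npow (P : kernel) (pi : policy) (mu : {ffun S -> R}) (n : nat) (s s' : S)
  : R :=
  match n with
  | 0 => (s == s')%:R
  | n'.+1 => \sum_(x : S) npow P pi mu n' s x * chain P pi mu x s'
  end.

Definition stationary (P : kernel) (pi : policy) (mu nu : {ffun S -> R}) : Prop :=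
  simplex nu /\ forall s', nu s' = \sum_(s : S) chain P pi mu s s' * nu s.

Definition nu (P : kernel) (pi : policy) (mu : {ffun S -> R}) : {ffun S -> R} :=
  xget 0 [set v | stationary P pi mu v].

Definition J (P : kernel) (r : reward) (pi : policy) (mu : {ffun S -> R}) : R :=
  \sum_(s : S) nu P pi mu s * \sum_(a : A) pi (s, a) * r s a mu.

Definition Vfun (P : kernel) (r : reward) (pi : policy) (mu : {ffun S -> R})
  : {ffun S -> R} :=
  [ffun s => limn (series (fun t : nat =>
     \sum_(s' : S) npow P pi mu t s s' *
        (\sum_(a : A) pi (s', a) * r s' a mu - J P r pi mu)))].

Definition mustar (P : kernel) (pi : policy) : {ffun S -> R} :=
  xget 0 [set mu | simplex mu /\ mu = nu P pi mu].

Definition ell (P : kernel) (r : reward) (pi : policy) : R :=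
  J P r pi (mustar P pi).

Definition mf_unique (P : kernel) : Prop :=
  forall pi, is_policy pi -> exists! mu, simplex mu /\ mu = nu P pi mu.

Definition softmax (theta : {ffun S * A -> R}) : policy :=
  [ffun sa => expR (theta sa) / \sum_(b : A) expR (theta (sa.1, b))].

Definition proj_perp (v : {ffun S -> R}) : {ffun S -> R} :=
  v - ((\sum_(s : S) v s) / #|S|%:R) *: onesv R S.

Definition herding (P : kernel) (r : reward) (kappa rho : R) : Prop :=
  0 < rho /\
  forall pi pi', is_policy pi -> is_policy pi' ->
    ell P r pi - ell P r pi' <=
    rho * (J P r pi (mustar P pi) - J P r pi' (mustar P pi))
    + kappa * norm2 (pi - pi').

Definition maxTV (P : kernel) (pi : policy) (mu : {ffun S -> R}) (k : nat) : R :=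
  \big[Num.max/0]_(s : S) dTV [ffun s' => npow P pi mu k s s'] (nu P pi mu).

Definition irreducible (P : kernel) (pi : policy) (mu : {ffun S -> R}) : Prop :=
  forall s s', exists n, 0 < npow P pi mu n s s'.

(* every state has period gcd{n >= 1 : P^n(s,s) > 0} = 1 *)
Definition aperiodic (P : kernel) (pi : policy) (mu : {ffun S -> R}) : Prop :=
  forall s (d : nat), (1 < d)%N ->
    exists n : nat, [/\ (0 < n)%N, 0 < npow P pi mu n s s & ~~ (d %| n)%N].

Definition Assumption1 (P : kernel) : Prop :=
  (forall pi mu, is_policy pi -> simplex mu ->
     irreducible P pi mu /\ aperiodic P pi mu) /\
  exists C0 C1 : R, [/\ 1 <= C0, 0 < C1 < 1 &
    forall pi mu, is_policy pi -> simplex mu ->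
      forall k : nat, maxTV P pi mu k <= C0 * C1 ^+ k].

Definition Assumption2 (P : kernel) (delta : R) : Prop :=
  0 < delta < 1 /\
  forall pi mu1 mu2, is_policy pi -> simplex mu1 -> simplex mu2 ->
    norm2 (nu P pi mu1 - nu P pi mu2) <= delta * norm2 (mu1 - mu2).

Definition step_law (P : kernel) (pi : policy) (mu d : {ffun S -> R}) : {ffun S -> R} :=
  [ffun s' => \sum_(s : S) d s * chain P pi mu s s'].

Definition Assumption3 (P : kernel) (r : reward) (L BV : R) : Prop :=
  0 < L /\
  [/\ (forall s a mu1 mu2, simplex mu1 -> simplex mu2 ->
         `|r s a mu1 - r s a mu2| <= L * norm2 (mu1 - mu2)),
      (forall d1 d2 pi1 pi2 mu1 mu2, simplex d1 -> simplex d2 ->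
         is_policy pi1 -> is_policy pi2 -> simplex mu1 -> simplex mu2 ->
         dTV (step_law P pi1 mu1 d1) (step_law P pi2 mu2 d2) <=
         dTV d1 d2 + L * (norm2 (pi1 - pi2) + norm2 (mu1 - mu2))),
      (forall pi1 pi2 mu1 mu2, is_policy pi1 -> is_policy pi2 ->
         simplex mu1 -> simplex mu2 ->
         dTV (nu P pi1 mu1) (nu P pi2 mu2) <=
         L * (norm2 (pi1 - pi2) + norm2 (mu1 - mu2))),
      (forall pi1 pi2, is_policy pi1 -> is_policy pi2 ->
         norm2 (mustar P pi1 - mustar P pi2) <= L * norm2 (pi1 - pi2)) &
      0 < BV /\ (forall pi mu, is_policy pi -> simplex mu ->
         norm2 (Vfun P r pi mu) <= BV)].

Definition LV_prop (P : kernel) (r : reward) (LV : R) : Prop :=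
  1 <= LV /\
  forall (th1 th2 : {ffun S * A -> R}) (mu1 mu2 : {ffun S -> R}),
    simplex mu1 -> simplex mu2 ->
    let d := norm2 (th1 - th2) + norm2 (mu1 - mu2) in
    [/\ norm2 (proj_perp (Vfun P r (softmax th1) mu1 - Vfun P r (softmax th2) mu2))
          <= LV * d,
        `|J P r (softmax th1) mu1 - J P r (softmax th2) mu2| <= LV * d,
        norm2 (grad (fun th => J P r (softmax th) mu1) th1
               - grad (fun th => J P r (softmax th) mu2) th2) <= LV * d &
        norm2 (grad (fun m => J P r (softmax th1) m) mu1
               - grad (fun m => J P r (softmax th2) m) mu2) <= LV * d].

Definition joint (P : kernel) (pi : policy) (mu : {ffun S -> R}) : {ffun S * A * S -> R} :=
  [ffun x => nu P pi mu x.1.1 * pi (x.1.1, x.1.2) * P mu x.1.1 x.1.2 x.2].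

Definition LTV_prop (P : kernel) (LTV : R) : Prop :=
  forall pi1 pi2 mu1 mu2, is_policy pi1 -> is_policy pi2 ->
    simplex mu1 -> simplex mu2 ->
    dTV (joint P pi1 mu1) (joint P pi2 mu2) <=
    LTV * (norm2 (pi1 - pi2) + norm2 (mu1 - mu2)).

Definition gamma_prop (P : kernel) (gamma : R) : Prop :=
  0 < gamma < 1 /\
  forall (th : {ffun S * A -> R}) (mu V : {ffun S -> R}), simplex mu ->
    \sum_(s : S) V s = 0 ->
    \sum_(s : S) nu P (softmax th) mu s * \sum_(a : A) softmax th (s, a) *
       \sum_(s' : S) P mu s a s' * (V s * (V s' - V s))
    <= - gamma * norm2 V ^+ 2.

Definition mixing_time (P : kernel) (pi : policy) (mu : {ffun S -> R}) (c : R) : nat :=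
  xget 0%N [set k | maxTV P pi mu k <= c /\
                    forall j, maxTV P pi mu j <= c -> (k <= j)%N].

Record astate := AState {
  th : {ffun S * A -> R}; muh : {ffun S -> R}; Vh : {ffun S -> R}; Jh : R;
  fv : {ffun S * A -> R}; gV : {ffun S -> R}; gJ : R; hv : {ffun S -> R} }.

Definition gradlogpi (theta : {ffun S * A -> R}) (s : S) (a : A) : {ffun S * A -> R} :=
  grad (fun th' => ln (softmax th' (s, a))) theta.

Definition step (r : reward) (cJ BV : R) (al be xi la : nat -> R) (k : nat)
  (x : astate) (s : S) (a : A) (s' : S) : astate :=
  let rk := r s a (muh x) in
  AState (th x + al k *: fv x)
         (proj_simplex (muh x + xi k *: hv x))
         (proj_ball BV (Vh x + be k *: gV x))
         (proj_01 (Jh x + be k * gJ x))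
         ((1 - la k) *: fv x
            + (la k * (rk + Vh x s' - Vh x s)) *: gradlogpi (th x) s a)
         ((1 - la k) *: gV x + (la k * (rk - Jh x + Vh x s' - Vh x s)) *: unitv R s)
         ((1 - la k) * gJ x + la k * (cJ * (rk - Jh x)))
         ((1 - la k) *: hv x + la k *: (unitv R s - muh x)).

(* expectation of g(state after t more iterations), starting at iteration k
   from algorithm state x and Markov state s:
   a ~ pi_{theta}(.|s), s' ~ P^{muhat}(.|s,a) *)
Fixpoint expect (P : kernel) (r : reward) (cJ BV : R) (al be xi la : nat -> R)
  (g : astate -> R) (t k : nat) (x : astate) (s : S) {struct t} : R :=
  match t with
  | 0 => g x
  | t'.+1 => \sum_(a : A) softmax (th x) (s, a) *
             \sum_(s' : S) P (muh x) s a s' *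
               expect P r cJ BV al be xi la g t' k.+1 (step r cJ BV al be xi la k x s a s') s'
  end.

Definition eps_total (P : kernel) (r : reward) (x : astate) : R :=
  let pi := softmax (th x) in
  norm2 (grad (fun th' => J P r (softmax th') (mustar P pi)) (th x)) ^+ 2
  + norm2 (muh x - mustar P pi) ^+ 2
  + norm2 (proj_perp (Vh x - Vfun P r pi (muh x))) ^+ 2
  + (Jh x - J P r pi (muh x)) ^+ 2.

Definition init_state (theta0 : {ffun S * A -> R}) (mu0 V0 : {ffun S -> R}) (J0 : R)
  : astate := AState theta0 mu0 V0 J0 0 0 0 0.

End MFG.

Definition stepsz (R : realType) (c0 : R) (k : nat) : R :=
  c0 / Num.sqrt (k%:R + 1).

Definition cB_F (R : realType) (BV : R) : R := BV + 1.
Definition cB_G (R : realType) (BV cJ : R) : R := 2 * (BV + cJ + 2).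
Definition cL_F (R : realType) (BV L LTV : R) : R :=
  10 * BV + L + 2 * cB_F BV * LTV + 5.
Definition cL_G (R : realType) (BV cJ L LTV : R) : R :=
  2 * cB_G BV cJ * LTV + (L + 1) * (cJ + 1) + 2.
Definition cL_H (R : realType) (L : R) : R := L + 1.

(* step-size conditions; "a <= min{x,y,..}" is written as a conjunction *)
Definition stepsize_ok (R : realType) (nS : nat)
  (cJ gamma delta rho L LV LTV BV al0 be0 xi0 la0 : R) : Prop :=
  let LF := cL_F BV L LTV in
  let LG := cL_G BV cJ L LTV in
  let LH := cL_H L in
  let Cxi := Num.min (Num.min ((1 - delta) / (32 * rho * LF ^+ 2)) ((1 - delta) / (4 * rho)))
                     (Num.min (LH / (2 * LF * LV)) ((1 - delta) / (16 * L * LF * LV))) in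
  let Cbe := Num.min (Num.min (gamma / 4)
                (rho * gamma / (512 * (LF ^+ 2 + LG ^+ 2 + LH ^+ 2 + LV ^+ 2
                                       + L ^+ 2 / (1 - delta)))))
              (Num.min (Num.sqrt (gamma / (3456 * nS%:R *
                  (LF ^+ 4 * LG ^+ 4 + LF ^+ 2 * LH ^+ 2 + rho * LF ^+ 2
                   + LV ^+ 2 / gamma + L ^+ 2 * LF ^+ 2 * (1 - delta)))))
                (gamma / (2 * rho))) in
  [/\ cJ >= 1 / gamma,
      [/\ al0 <= xi0, xi0 <= be0, be0 <= la0 & la0 <= 1 / 4],
      [/\ al0 <= la0 / (192 * (LF ^+ 2 + LG ^+ 2 + LH ^+ 2 + LV ^+ 2
                                 + L ^+ 2 / (1 - delta) + rho)),
          al0 <= Cbe * be0 & al0 <= Cxi * xi0],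
      xi0 <= la0 / (64 * (LH ^+ 2 * LF ^+ 2 + LG ^+ 2 + LV ^+ 2 / gamma
                           + 1 / (1 - delta))) /\
      xi0 <= (1 - delta) * gamma * be0 /
             (6912 * (LF ^+ 4 * LV ^+ 2 + LF ^+ 2 * LG ^+ 2 * LH ^+ 2 * LV ^+ 2
                      + LF ^+ 2 * LH ^+ 4 * LV ^+ 2 + LV ^+ 2)) &
      [/\ be0 <= la0 / (72 * nS%:R * LG ^+ 2 + 36 * LF ^+ 2 + 8 / gamma),
          be0 <= gamma / (4 * LG ^+ 2) &
          be0 <= (1 - delta) / (2 * LH ^+ 2)]].

(* Main.v *)
(** Only kappa = 0 needs an argument: if kappa > 0, the constant C kappa dominates the error at t = 0.
    For kappa = 0, herding makes ascent along the partial gradient at the induced mean field an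
    ascent step for ell up to the factor rho. The Lyapunov function is -ell / rho plus weighted
    squares of the errors of the mean field, of the critic and of the average reward, and of the
    four momentum variables with respect to their stationary targets. The step-size conditions make
    the quadratic form in its first-order drift at most -(alpha_k / 100) times the optimality gap.
    The remaining first-order term is Markovian noise with zero stationary mean, which is removed by
    adding eta_k times its Poisson solution (eta_k = 1 / sqrt (k + 1)); the errors are then O(eta_k^2),
    and summing gives a bound log (k + 1) / sqrt (k + 1), stronger than the required log^3.

    The projection of the critic onto the ball does not contract its error modulo constants. The
    Lyapunov function therefore also measures the distance of the constant mode of the critic to an
    interval, together with two cross terms that cancel the resulting linear drift.

    A negative constant L_TV forces all policies and all mean fields to coincide, so there is one
    state and one action, and the dynamics reduce to a damped oscillator. *)

Require Import Defs.
From mathcomp Require Import all_boot all_order all_algebra.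
From mathcomp Require Import all_classical all_reals all_analysis.
From mathcomp Require Import ring lra.
Import Order.TTheory GRing.Theory Num.Theory.
Import numFieldNormedType.Exports.
Local Open Scope classical_set_scope.
Local Open Scope ring_scope.

Set Implicit Arguments.
Unset Strict Implicit.
Unset Printing Implicit Defensive.

(** * Euclidean vectors and total variation *)

(** The linear drift left by the ball projection is [oz] times the sum of the coordinates of [gV].
    That sum splits into [gJ / cJ] and [qz], a momentum average of critic increments with zero
    stationary mean. The [qz] part decays by its own recursion. The other part is, up to a factor,
    the step of [Jh], hence telescopes as long as the projection onto [0, 1] does not clip; the
    clipped amount is at most proportional to a decaying quantity [pen], and a multiple of [pen]
    joins the Lyapunov function. To stay small the cross term compares [Jh] with [ell], so its
    change contains [oz] times the change of [ell]. This is of first order in the step size. It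
    turns the weight 1 of the actor term into a number [om], which the bound [1 / (2 * gamma)] on
    [oz] keeps in [1/2, 3/2], and the quadratic form must be negative for all these weights. The
    initial [V0] and [J0] are arbitrary, so the a priori bounds hold only from iteration 1 on. *)

Section Euclidean.
Variable (R : realType) (I : finType).
Implicit Types u v w : {ffun I -> R}.

Definition dot u v : R := \sum_i u i * v i.

Lemma dotC u v : dot u v = dot v u.
Proof. by apply: eq_bigr => i _; rewrite mulrC. Qed.

Lemma dotDl u v w : dot (u + v) w = dot u w + dot v w.
Proof. by rewrite -big_split; apply: eq_bigr => i _; rewrite ffunE mulrDl. Qed.

Lemma dotDr u v w : dot w (u + v) = dot w u + dot w v.
Proof. by rewrite dotC dotDl !(dotC w). Qed.

Lemma dotZl c u w : dot (c *: u) w = c * dot u w.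
Proof. by rewrite big_distrr; apply: eq_bigr => i _; rewrite ffunE -mulrA. Qed.

Lemma dotZr c u w : dot w (c *: u) = c * dot w u.
Proof. by rewrite dotC dotZl dotC. Qed.

Lemma dotNl u w : dot (- u) w = - dot u w.
Proof. by rewrite -scaleN1r dotZl mulN1r. Qed.

Lemma dotNr u w : dot w (- u) = - dot w u.
Proof. by rewrite dotC dotNl dotC. Qed.

Lemma dotBl u v w : dot (u - v) w = dot u w - dot v w.
Proof. by rewrite dotDl dotNl. Qed.

Lemma dotBr u v w : dot w (u - v) = dot w u - dot w v.
Proof. by rewrite dotDr dotNr. Qed.

Lemma dot0l w : dot 0 w = 0.
Proof. by rewrite -(scale0r (0 : {ffun I -> R})) dotZl mul0r. Qed.

Lemma dot_ge0 u : 0 <= dot u u.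
Proof. by apply: sumr_ge0 => i _; rewrite -expr2 sqr_ge0. Qed.

Lemma norm2E u : norm2 u = Num.sqrt (dot u u).
Proof. by congr Num.sqrt; apply: eq_bigr => i _; rewrite expr2. Qed.

Lemma norm2_ge0 u : 0 <= norm2 u.
Proof. exact: sqrtr_ge0. Qed.

Lemma norm2_sqr u : norm2 u ^+ 2 = dot u u.
Proof. by rewrite norm2E sqr_sqrtr ?dot_ge0. Qed.

Lemma norm2_0 : norm2 (0 : {ffun I -> R}) = 0.
Proof. by rewrite norm2E dot0l sqrtr0. Qed.

Lemma norm2Z c u : norm2 (c *: u) = `|c| * norm2 u.
Proof.
by rewrite !norm2E dotZl dotZr mulrA -expr2 sqrtrM ?sqr_ge0// sqrtr_sqr.
Qed.

Lemma norm2N u : norm2 (- u) = norm2 u.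
Proof. by rewrite -scaleN1r norm2Z normrN1 mul1r. Qed.

Lemma norm2_subC u v : norm2 (u - v) = norm2 (v - u).
Proof. by rewrite -norm2N opprB. Qed.

Lemma norm2_coord u i : `|u i| <= norm2 u.
Proof.
rewrite -sqrtr_sqr /norm2 ler_wsqrtr// (bigD1 i)//= lerDl.
by apply: sumr_ge0 => j _; rewrite sqr_ge0.
Qed.

Lemma norm2_eq0 u : norm2 u = 0 -> u = 0.
Proof.
move=> h; apply/ffunP => i; have := norm2_coord u i.
by rewrite h normr_le0 ffunE => /eqP.
Qed.

Lemma norm2_le u c : 0 <= c -> dot u u <= c ^+ 2 -> norm2 u <= c.
Proof. by move=> c0 h; rewrite -(@ler_pXn2r _ 2) ?nnegrE ?norm2_ge0// norm2_sqr. Qed.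

Lemma norm2D_sqr u v :
  norm2 (u + v) ^+ 2 = norm2 u ^+ 2 + 2 * dot u v + norm2 v ^+ 2.
Proof. by rewrite !norm2_sqr dotDl !dotDr (dotC v u); ring. Qed.

Lemma norm2B_sqr u v :
  norm2 (u - v) ^+ 2 = norm2 u ^+ 2 - 2 * dot u v + norm2 v ^+ 2.
Proof. by rewrite !norm2_sqr dotBl !dotBr (dotC v u); ring. Qed.

Lemma dot_CS u v : `|dot u v| <= norm2 u * norm2 v.
Proof.
have [->|v0] := eqVneq v 0; first by rewrite dotC dot0l normr0 mulr_ge0 ?norm2_ge0.
have nv : 0 < norm2 v.
  by rewrite lt_neqAle norm2_ge0 andbT eq_sym; apply: contra v0 => /eqP/norm2_eq0 ->.
have nv2 : 0 < norm2 v ^+ 2 by rewrite exprn_gt0.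
rewrite -(@ler_pXn2r _ 2) ?nnegrE ?mulr_ge0 ?norm2_ge0// real_normK ?num_real//.
(* This vector is [norm2 v ^+ 2] times the component of [u] orthogonal to [v]. *)
have := dot_ge0 (norm2 v ^+ 2 *: u - dot u v *: v).
rewrite dotBl !dotBr !dotZl !dotZr -!norm2_sqr (dotC v u) => h.
rewrite exprMn -(ler_pM2l nv2) -subr_ge0; apply: le_trans h _.
by rewrite le_eqVlt; apply/orP; left; apply/eqP; ring.
Qed.

Lemma dot_le u v : dot u v <= norm2 u * norm2 v.
Proof. exact: le_trans (ler_norm _) (dot_CS u v). Qed.

Lemma dot_le_bound u v a b :
  norm2 u <= a -> norm2 v <= b -> dot u v <= a * b.
Proof.
move=> ua vb; apply: le_trans (dot_le u v) _.
by apply: ler_pM => //; rewrite norm2_ge0.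
Qed.

Lemma norm2D u v : norm2 (u + v) <= norm2 u + norm2 v.
Proof.
rewrite -(@ler_pXn2r _ 2) ?nnegrE ?addr_ge0 ?norm2_ge0// norm2D_sqr.
have := dot_le u v; nra.
Qed.

Lemma norm2B u v : norm2 (u - v) <= norm2 u + norm2 v.
Proof. by rewrite -(norm2N v) norm2D. Qed.

Lemma norm2_dist w u v : norm2 (u - v) <= norm2 (u - w) + norm2 (w - v).
Proof. by have := norm2D (u - w) (w - v); rewrite addrA subrK. Qed.

Lemma norm2_subr_le u v : norm2 u <= norm2 v + norm2 (u - v).
Proof. by have := norm2D v (u - v); rewrite addrC subrK. Qed.

Lemma norm2_sum (J : Type) (s : seq J) (Pr : pred J) (F : J -> {ffun I -> R}) :
  norm2 (\sum_(j <- s | Pr j) F j) <= \sum_(j <- s | Pr j) norm2 (F j).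
Proof.
elim/big_rec2: _ => [|j x y _ h]; first by rewrite norm2_0.
by apply: le_trans (norm2D _ _) _; rewrite lerD2l.
Qed.

Lemma norm2_wsum (J : finType) (p : J -> R) (Z : J -> {ffun I -> R}) B :
  (forall j, norm2 (Z j) <= B) ->
  norm2 (\sum_j p j *: Z j) <= (\sum_j `|p j|) * B.
Proof.
move=> ZB; apply: le_trans (norm2_sum _ _ _) _.
rewrite mulr_suml; apply: ler_sum => j _; rewrite norm2Z.
by apply: ler_wpM2l.
Qed.

Lemma norm2_le_sum u : norm2 u <= \sum_i `|u i|.
Proof.
apply: norm2_le; first by apply: sumr_ge0.
rewrite expr2 mulr_suml; apply: ler_sum => i _.
rewrite -expr2 -real_normK ?num_real// expr2; apply: ler_wpM2l => //.
by rewrite (bigD1 i)//= lerDl sumr_ge0.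
Qed.

Lemma unitvE (i : I) j : unitv R i j = (j == i)%:R.
Proof. by rewrite ffunE. Qed.

Lemma dot_unitv u (i : I) : dot u (unitv R i) = u i.
Proof.
rewrite /dot (bigD1 i)//= unitvE eqxx mulr1 big1 ?addr0// => j /negbTE ji.
by rewrite unitvE ji mulr0.
Qed.

Lemma norm2_unitv (i : I) : norm2 (unitv R i) = 1.
Proof. by rewrite norm2E dot_unitv unitvE eqxx sqrtr1. Qed.

Lemma simplex_le1 u : simplex u -> forall i, u i <= 1.
Proof. by move=> [u0 <-] i; rewrite (bigD1 i)//= lerDl sumr_ge0. Qed.

Lemma simplex_norm2 u : simplex u -> norm2 u <= 1.
Proof.
move=> [u0 u1]; apply: le_trans (norm2_le_sum u) _.
by rewrite -u1 ler_sum// => i _; rewrite ger0_norm.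
Qed.

Lemma simplex_avg_le u (g : I -> R) B :
  simplex u -> (forall i, `|g i| <= B) -> `|\sum_i u i * g i| <= B.
Proof.
move=> [u0 u1] gB; apply: le_trans (ler_norm_sum _ _ _) _.
rewrite -[leRHS]mul1r -u1 mulr_suml; apply: ler_sum => i _.
by rewrite normrM (ger0_norm (u0 i)) ler_wpM2l.
Qed.

Lemma ffun_avg_le (p g : I -> R) B :
  simplex [ffun i => p i] -> (forall i, `|g i| <= B) -> `|\sum_i p i * g i| <= B.
Proof.
move=> hp gB; rewrite (eq_bigr (fun i => [ffun j => p j] i * g i)).
  exact: simplex_avg_le.
by move=> i _; rewrite ffunE.
Qed.

Lemma simplex_jensen_sqr u (g : I -> R) :
  simplex u -> (\sum_i u i * g i) ^+ 2 <= \sum_i u i * g i ^+ 2.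
Proof.
move=> [u0 u1]; set m := \sum_i u i * g i.
have : 0 <= \sum_i u i * (g i - m) ^+ 2.
  by apply: sumr_ge0 => i _; rewrite mulr_ge0 ?sqr_ge0.
have E (c : R) : \sum_i u i * (g i - c) ^+ 2 =
    \sum_i u i * g i ^+ 2 - 2 * c * (\sum_i u i * g i) + c ^+ 2 * \sum_i u i.
  rewrite !mulr_sumr -sumrB -big_split; apply: eq_bigr => i _ /=; ring.
by rewrite E u1 -/m => h; rewrite -subr_ge0; apply: le_trans h _; lra.
Qed.

End Euclidean.

Section TotalVariation.
Variables (R : realType) (X : finType).
Implicit Types p q : {ffun X -> R}.

Lemma dTV_test p q (psi : X -> R) : (forall x, -1 <= psi x <= 1) ->
  `|\sum_x psi x * p x - \sum_x psi x * q x| <= 2 * dTV p q.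
Proof.
move=> hpsi; rewrite /dTV mulrA divff ?mul1r ?pnatr_eq0//.
apply: ub_le_sup; last by exists psi.
exists (\sum_x (`|p x| + `|q x|)) => _ [f hf <-].
rewrite -sumrB; apply: le_trans (ler_norm_sum _ _ _) _; apply: ler_sum => x _.
have f1 : `|f x| <= 1 by rewrite ler_norml.
apply: le_trans (ler_normB _ _) _; rewrite !normrM.
by apply: lerD; rewrite -[leRHS]mul1r ler_wpM2r.
Qed.

Lemma dTV_L1 p q : \sum_x `|p x - q x| <= 2 * dTV p q.
Proof.
(* The sign of [p - q] is an optimal test function. *)
apply: le_trans (@dTV_test p q (fun x => Num.sg (p x - q x)) _); last first.
  by move=> x; rewrite -ler_norml normr_sg; case: (_ == _).
apply: le_trans (ler_norm _); rewrite -sumrB; apply: ler_sum => x _.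
by rewrite -mulrBr normrEsg.
Qed.

Lemma dTV_ge0 p q : 0 <= dTV p q.
Proof.
have : 0 <= \sum_x `|p x - q x| by apply: sumr_ge0.
by move=> /le_trans/(_ (dTV_L1 p q)); rewrite pmulr_rge0.
Qed.

Lemma dTV_refl p : dTV p p = 0.
Proof.
rewrite /dTV (_ : [set _ | _ in _] = [set 0]); first by rewrite sup1 mulr0.
apply/seteqP; split=> [_ [psi _ <-]|_ ->]; first by rewrite /= subrr normr0.
exists (fun=> 0); last by rewrite subrr normr0.
by move=> x; apply/andP; split; lra.
Qed.

Lemma dTV_expect p q (g : X -> R) B : 0 <= B -> (forall x, `|g x| <= B) ->
  `|\sum_x p x * g x - \sum_x q x * g x| <= 2 * dTV p q * B.
Proof.
move=> B0 gB; rewrite -sumrB; apply: le_trans (ler_norm_sum _ _ _) _.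
apply: (@le_trans _ _ (\sum_x `|p x - q x| * B)).
  by apply: ler_sum => x _; rewrite -mulrBl normrM ler_wpM2l.
by rewrite -mulr_suml ler_wpM2r// dTV_L1.
Qed.

(* Centring the test function at 1/2 saves the factor 2 of [dTV_expect]. *)
Lemma dTV_expect01 p q (g : X -> R) : simplex p -> simplex q ->
  (forall x, 0 <= g x <= 1) ->
  `|\sum_x p x * g x - \sum_x q x * g x| <= dTV p q.
Proof.
move=> [_ p1] [_ q1] g01.
have E (d : {ffun X -> R}) : \sum_x d x = 1 ->
    \sum_x d x * (g x - 2^-1) = \sum_x d x * g x - 2^-1.
  move=> d1; rewrite -[2^-1 in RHS]mul1r -d1 mulr_suml -sumrB.
  by apply: eq_bigr => x _; rewrite mulrBr.
have := @dTV_expect p q (fun x => g x - 2^-1) 2^-1.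
rewrite mulrAC divff ?pnatr_eq0// mul1r (E p)// (E q)// opprB addrA subrK.
apply; first by lra.
by move=> x; have /andP[] := g01 x; rewrite ler_norml => ? ?; apply/andP; split; lra.
Qed.

Lemma norm2_dTV p q : norm2 (p - q) <= 2 * dTV p q.
Proof.
apply: le_trans (norm2_le_sum _) (le_trans _ (dTV_L1 p q)).
by apply: ler_sum => x _; rewrite !ffunE.
Qed.

Lemma norm2_dTV_expect (I : finType) p q (Z : X -> {ffun I -> R}) B :
  0 <= B -> (forall x, norm2 (Z x) <= B) ->
  norm2 (\sum_x p x *: Z x - \sum_x q x *: Z x) <= 2 * dTV p q * B.
Proof.
move=> B0 ZB; rewrite -sumrB.
under eq_bigr do rewrite -scalerBl.
apply: le_trans (norm2_wsum _ ZB) _.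
by rewrite ler_wpM2r// dTV_L1.
Qed.

End TotalVariation.

(** * Projections *)

Section Projections.
Variable R : realType.

Section Convex.
Variables (I : finType) (C : set {ffun I -> R}).
Hypothesis C_convex : forall u v (t : R), C u -> C v -> 0 <= t <= 1 ->
  C (u + t *: (v - u)).

(** By the variational inequality the angle at [y] between [x] and [z] is not acute, so the squared
    distance from [x] to [z] is at least that from [y] to [z]. Every later use aims at a target
    inside the projection set. *)
Lemma nearest_point_contracts x y : C y ->
  (forall z, C z -> norm2 (x - y) <= norm2 (x - z)) ->
  forall z, C z -> norm2 (y - z) <= norm2 (x - z).
Proof.
move=> Cy ymin z Cz.
suff VI : dot (x - y) (z - y) <= 0.
  rewrite -(@ler_pXn2r _ 2) ?nnegrE ?norm2_ge0//.
  have -> : x - z = (x - y) - (z - y) by rewrite opprB addrA subrK.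
  by rewrite [leRHS]norm2B_sqr (norm2_subC y z); have := sqr_ge0 (norm2 (x - y)); lra.
rewrite leNgt; apply/negP => d0; set d := dot _ _ in d0.
pose D := norm2 (z - y) ^+ 2; have D0 : 0 <= D by exact: sqr_ge0.
(* Moving from [y] towards [z] by [t] changes the squared distance to [x] by [t * (t * D - 2 * d)],
   which is negative because [t * D < d]. *)
pose t := d / (d + D); have dD : 0 < d + D by lra.
have t01 : 0 <= t <= 1.
  by rewrite /t divr_ge0 ?ler_pdivrMr//; lra.
have := ymin _ (C_convex Cy Cz t01).
rewrite opprD addrA -(@ler_pXn2r _ 2) ?nnegrE ?norm2_ge0// [leRHS]norm2B_sqr.
rewrite dotZr norm2Z exprMn real_normK ?num_real// -/d -/D => h.
have {}h : 2 * t * d <= t ^+ 2 * D by lra.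
have tE : t * (d + D) = d by rewrite /t divfK// gt_eqF.
have t0 : 0 < t by rewrite divr_gt0.
have {}h : 2 * d <= t * D by rewrite -(ler_pM2l t0); lra.
nra.
Qed.

Lemma proj_contracts x :
  (exists y, C y /\ forall z, C z -> norm2 (x - y) <= norm2 (x - z)) ->
  let p := Defs.proj (fun u v => norm2 (u - v)) C x in
  C p /\ forall z, C z -> norm2 (p - z) <= norm2 (x - z).
Proof.
move=> ex p; have [Cp pmin] : C p /\ forall z, C z -> norm2 (x - p) <= norm2 (x - z).
  exact: (@xgetPex _ x _ ex).
by split=> //; apply: nearest_point_contracts.
Qed.

End Convex.

Lemma simplex_convex (I : finType) (u v : {ffun I -> R}) (t : R) :
  simplex u -> simplex v -> 0 <= t <= 1 -> simplex (u + t *: (v - u)).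
Proof.
move=> [u0 u1] [v0 v1] /andP[t0 t1]; split=> [i|].
  have -> : (u + t *: (v - u)) i = (1 - t) * u i + t * v i by rewrite !ffunE /GRing.scale/=; ring.
  by rewrite addr_ge0// mulr_ge0// subr_ge0.
under eq_bigr do rewrite !ffunE.
by rewrite big_split /= -mulr_sumr sumrB u1 v1 subrr mulr0 addr0.
Qed.

(* The nearest point of the simplex is [i |-> max (x i - t) 0] for the t making it sum to 1. *)
Lemma simplex_nearest (I : finType) (i0 : I) (x : {ffun I -> R}) :
  exists y, simplex y /\ forall z, simplex z -> norm2 (x - y) <= norm2 (x - z).
Proof.
pose pos (r : R) := 2^-1 * (r + `|r|).
have pos0 r : 0 <= pos r by rewrite /pos; have := ler_norm (- r); rewrite normrN; lra.
have posge r : 0 <= r -> pos r = r by move=> r0; rewrite /pos ger0_norm//; lra.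
have posle r : r <= 0 -> pos r = 0 by move=> r0; rewrite /pos ler0_norm//; lra.
pose f (t : R) := \sum_i pos (x i - t).
have cf : continuous f.
  rewrite /f => t; apply: cvg_big => [|i _]; [exact: add_continuous|]; apply: cvgM; first exact: cvg_cst.
  have h : (x i - t0) @[t0 --> t] --> x i - t by apply: cvgB; [exact: cvg_cst|exact: cvg_id].
  by apply: cvgD => //; apply: cvg_norm.
pose M := \sum_i `|x i|.
have xM i : `|x i| <= M by rewrite /M (bigD1 i)//= lerDl sumr_ge0.
have M0 : 0 <= M by apply: sumr_ge0.
have fM : f M = 0.
  rewrite /f big1// => i _; rewrite posle// subr_le0.
  exact: le_trans (ler_norm _) (xM i).
(* The summand at [i0] alone is at least 1, which is where an inhabited index set matters. *)
have fm : 1 <= f (- M - 1).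
  rewrite /f (bigD1 i0)//= posge; last first.
    by have := xM i0; rewrite ler_norml => /andP[]; lra.
  apply: le_trans (_ : x i0 - (- M - 1) <= _); last by rewrite lerDl sumr_ge0.
  by have := xM i0; rewrite ler_norml => /andP[]; lra.
have [t _ ft] : exists2 t, t \in `[- M - 1, M] & f t = 1.
  apply: IVT; first by lra.
    exact: continuous_subspaceT.
  by rewrite fM ge_min le_max fm ler01 orbT.
exists [ffun i => pos (x i - t)]; split.
  split=> [i|]; first by rewrite ffunE.
  by rewrite -ft; apply: eq_bigr => i _; rewrite ffunE.
set y := [ffun _ => _] => z [z0 z1].
have y1 : \sum_i y i = 1 by rewrite -ft; apply: eq_bigr => i _; rewrite ffunE.
(* Each product is at most [t * (z i - y i)]: with equality where [x i >= t], and elsewhere because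
   [y i = 0 <= z i] and [x i < t]. The bounds sum to zero since [y] and [z] have the same total. *)
have VI : dot (x - y) (z - y) <= 0.
  apply: (@le_trans _ _ (\sum_i t * (z i - y i))); last first.
    by rewrite -mulr_sumr sumrB z1 y1 subrr mulr0.
  apply: ler_sum => i _; rewrite !ffunE; have := z0 i.
  have [h|h] := leP 0 (x i - t); first by rewrite posge// => _; nra.
  by rewrite (posle _ (ltW h)) !subr0 => ?; nra.
rewrite -(@ler_pXn2r _ 2) ?nnegrE ?norm2_ge0//.
have -> : x - z = (x - y) - (z - y) by rewrite opprB addrA subrK.
by rewrite [leRHS]norm2B_sqr; have := sqr_ge0 (norm2 (z - y)); lra.
Qed.

Lemma proj_simplexP (I : finType) (i0 : I) (x : {ffun I -> R}) :
  simplex (proj_simplex x) /\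
  forall z, simplex z -> norm2 (proj_simplex x - z) <= norm2 (x - z).
Proof.
apply: (@proj_contracts _ (@simplex R I)); first exact: simplex_convex.
exact: simplex_nearest.
Qed.

Lemma proj_ballP (I : finType) (B : R) (x : {ffun I -> R}) : 0 < B ->
  norm2 (proj_ball B x) <= B /\
  forall z, norm2 z <= B -> norm2 (proj_ball B x - z) <= norm2 (x - z).
Proof.
move=> B0; apply: (@proj_contracts _ [set v | norm2 v <= B]) => /=.
  move=> u v t hu hv /andP[t0 t1].
  have -> : u + t *: (v - u) = (1 - t) *: u + t *: v.
    by apply/ffunP => i; rewrite !ffunE /GRing.scale/=; ring.
  apply: le_trans (norm2D _ _) _; rewrite !norm2Z !ger0_norm ?subr_ge0//; nra.
have [h|h] := leP (norm2 x) B.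
  by exists x; split=> // z _; rewrite subrr norm2_0 norm2_ge0.
have x0 : 0 < norm2 x by lra.
exists ((B / norm2 x) *: x); split.
  rewrite norm2Z ger0_norm; last by rewrite divr_ge0 ?ltW.
  by rewrite divfK// gt_eqF.
move=> z hz; have -> : x - (B / norm2 x) *: x = (1 - B / norm2 x) *: x.
  by apply/ffunP => i; rewrite !ffunE /GRing.scale/=; ring.
rewrite norm2Z ger0_norm; last by rewrite subr_ge0 ler_pdivrMr// mul1r ltW.
rewrite mulrBl mul1r divfK ?gt_eqF//.
by have := norm2_subr_le x z; lra.
Qed.

Lemma proj_01P (x : R) :
  [/\ 0 <= proj_01 x <= 1, (0 <= x <= 1 -> proj_01 x = x),
      (x <= 0 -> proj_01 x = 0) & (1 <= x -> proj_01 x = 1)].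
Proof.
have [] : [set y : R | 0 <= y <= 1] (proj_01 x) /\
    forall z, [set y : R | 0 <= y <= 1] z -> `|x - proj_01 x| <= `|x - z|.
  apply: (@xgetPex _ x [set y | _ y /\ _]).
  have [x0|x0] := leP x 0; last have [x1|x1] := leP x 1.
  - exists 0; split=> [|z /andP[z0 z1]]; first by rewrite /= lexx ler01.
    by rewrite !ler0_norm; lra.
  - by exists x; split=> [|z _]; rewrite /= ?(ltW x0)//= subrr normr0.
  - exists 1; split=> [|z /andP[z0 z1]]; first by rewrite /= lexx ler01.
    by rewrite !ger0_norm; lra.
set p := proj_01 x => /= p01 pmin; split=> // [x01|x0|x1].
- have := pmin x x01; rewrite subrr normr0 normr_le0 subr_eq0.
  by move=> /eqP.
- have := pmin 0; rewrite lexx ler01 => /(_ isT).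
  by move: p01 => /andP[? ?]; rewrite !ler0_norm; lra.
- have := pmin 1; rewrite lexx ler01 => /(_ isT).
  by move: p01 => /andP[? ?]; rewrite !ger0_norm; lra.
Qed.

End Projections.

(** * Expectations along the algorithm *)

Section Supermartingale.
Variables (R : realType) (S A : finType).
Variables (P : {ffun S -> R} -> S -> A -> S -> R) (r : S -> A -> {ffun S -> R} -> R).
Variables (cJ BV : R) (al be xi la : nat -> R).

(** The one-step conditional expectation, in the shape obtained by unfolding [expect] once. *)
Definition mean_step (x : astate R S A) (s : S) (phi : A -> S -> R) : R :=
  \sum_a softmax (th x) (s, a) * \sum_s' P (muh x) s a s' * phi a s'.

Lemma mean_stepD x s phi psi :
  mean_step x s (fun a s' => phi a s' + psi a s') =
  mean_step x s phi + mean_step x s psi.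
Proof.
rewrite -big_split; apply: eq_bigr => a _; rewrite /= -mulrDr -big_split.
by congr (_ * _); apply: eq_bigr => s' _; rewrite /= mulrDr.
Qed.

Lemma mean_stepZ x s c phi :
  mean_step x s (fun a s' => c * phi a s') = c * mean_step x s phi.
Proof.
rewrite mulr_sumr; apply: eq_bigr => a _; rewrite mulrCA; congr (_ * _).
by rewrite mulr_sumr; apply: eq_bigr => s' _; rewrite mulrCA.
Qed.

Lemma mean_step_sum x s (J : finType) (phi : J -> A -> S -> R) :
  mean_step x s (fun a s' => \sum_j phi j a s') = \sum_j mean_step x s (phi j).
Proof.
rewrite exchange_big; apply: eq_bigr => a _; rewrite -mulr_sumr exchange_big.
by congr (_ * _); apply: eq_bigr => s' _; rewrite mulr_sumr.
Qed.

Hypothesis Pker : is_kernel P.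
Variable a0 : A.

Lemma softmax_simplex (th : {ffun S * A -> R}) s : simplex [ffun a => softmax th (s, a)].
Proof.
have Z0 : 0 < \sum_b expR (th (s, b)).
  by rewrite (bigD1 a0)//= ltr_pwDl ?expR_gt0 ?sumr_ge0// => b _; rewrite expR_ge0.
split=> [a|].
  by rewrite !ffunE divr_ge0 ?expR_ge0 ?(ltW Z0).
under eq_bigr do rewrite !ffunE /=.
by rewrite -mulr_suml divff// gt_eqF.
Qed.

Lemma softmax_policy (th : {ffun S * A -> R}) : is_policy (softmax th).
Proof. by move=> s; exact: softmax_simplex. Qed.

Lemma softmax_ge0 (th : {ffun S * A -> R}) s a : 0 <= softmax th (s, a).
Proof. by have [/(_ a)] := softmax_simplex th s; rewrite ffunE. Qed.

Lemma softmax_sum1 (th : {ffun S * A -> R}) s : \sum_a softmax th (s, a) = 1.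
Proof. by have [_ <-] := softmax_simplex th s; apply: eq_bigr => a _; rewrite ffunE. Qed.

Lemma kernel_ge0 mu s a s' : simplex mu -> 0 <= P mu s a s'.
Proof. by move=> /Pker/(_ s a)[/(_ s')]; rewrite ffunE. Qed.

Lemma kernel_sum1 mu s a : simplex mu -> \sum_s' P mu s a s' = 1.
Proof. by move=> /Pker/(_ s a)[_ <-]; apply: eq_bigr => s' _; rewrite ffunE. Qed.

Lemma mean_step_const x s c : simplex (muh x) -> mean_step x s (fun _ _ => c) = c.
Proof.
move=> hx; rewrite -[RHS]mul1r -(softmax_sum1 (th x) s) mulr_suml.
by apply: eq_bigr => a _; rewrite -mulr_suml kernel_sum1// mul1r.
Qed.

Lemma mean_step_le x s phi psi : simplex (muh x) ->
  (forall a s', phi a s' <= psi a s') -> mean_step x s phi <= mean_step x s psi.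
Proof.
move=> hx h; apply: ler_sum => a _; apply: ler_wpM2l; first exact: softmax_ge0.
by apply: ler_sum => s' _; rewrite ler_wpM2l ?kernel_ge0.
Qed.

Local Notation step := (step r cJ BV al be xi la).
Local Notation expect := (expect P r cJ BV al be xi la).

(** Telescoping of a drift inequality, with [- B] bounding the final value of [W] from below. As
    [expect] peels iterations off at the front, the induction generalises over the starting
    iteration, the state and the Markov state, and applies [mean_step] to the inductive bound. The
    invariant is required along every path, so no null sets appear. *)
Lemma expect_supermartingale (Inv : nat -> astate R S A -> Prop)
    (W : nat -> astate R S A -> S -> R) (w c : nat -> R) (e : astate R S A -> R) B :
  (forall k x, Inv k x -> simplex (muh x)) ->
  (forall k x s a s', Inv k x -> Inv k.+1 (step k x s a s')) ->
  (forall k x s, Inv k x ->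
     mean_step x s (fun a s' => W k.+1 (step k x s a s') s') + w k * e x
       <= W k x s + c k) ->
  (forall k x s, Inv k x -> - B <= W k x s) ->
  forall T k x s, Inv k x ->
  \sum_(t < T) w (k + t)%N * expect e t k x s <= W k x s + B + \sum_(t < T) c (k + t)%N.
Proof.
move=> Imu Istep drift Wlb; elim=> [|T IH] k x s Ix.
  by rewrite !big_ord0 addr0 -lerBlDr sub0r Wlb.
rewrite !big_ord_recl /= !addn0.
under eq_bigr do rewrite /bump add1n -addSnnS.
under [in leRHS]eq_bigr do rewrite /bump add1n -addSnnS.
have -> : \sum_(t < T) w (k.+1 + t)%N * mean_step x s
     (fun a s' => expect e t k.+1 (step k x s a s') s') =
   mean_step x s (fun a s' => \sum_(t < T) w (k.+1 + t)%N * expect e t k.+1 (step k x s a s') s').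
  by rewrite mean_step_sum; apply: eq_bigr => t _; rewrite mean_stepZ.
have hx := Imu _ _ Ix.
have : mean_step x s (fun a s' =>
      \sum_(t < T) w (k.+1 + t)%N * expect e t k.+1 (step k x s a s') s') <=
    mean_step x s (fun a s' =>
      W k.+1 (step k x s a s') s' + (B + \sum_(t < T) c (k.+1 + t)%N)).
  apply: mean_step_le => // a s'; rewrite addrA; apply: IH; exact: Istep.
rewrite mean_stepD mean_step_const// => h.
have := drift k x s Ix; lra.
Qed.

End Supermartingale.

(** * Step-size sums and the passage from weighted sums to a minimum *)

Section Rates.
Variable R : realType.

Definition eta (k : nat) : R := (Num.sqrt (k%:R + 1))^-1.

Lemma stepszE (c : R) k : stepsz c k = c * eta k.
Proof. by []. Qed.

Lemma sqrt_succ_gt0 k : 0 < Num.sqrt (k%:R + 1 : R).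
Proof. by rewrite sqrtr_gt0 ltr_pwDr. Qed.

Lemma eta_gt0 k : 0 < eta k.
Proof. by rewrite invr_gt0 sqrt_succ_gt0. Qed.

Lemma eta_sqr k : eta k ^+ 2 = (k%:R + 1)^-1.
Proof. by rewrite exprVn sqr_sqrtr// addr_ge0. Qed.

Lemma eta_anti k m : (k <= m)%N -> eta m <= eta k.
Proof.
move=> km; rewrite lef_pV2 ?posrE ?sqrt_succ_gt0// ler_wsqrtr// lerD2r.
by rewrite ler_nat.
Qed.

Lemma eta_le1 k : eta k <= 1.
Proof.
apply: le_trans (eta_anti (leq0n k)) _.
by rewrite /eta add0r sqrtr1 invr1.
Qed.

(** The Poisson correction carries the weight [eta k]; changing this weight from one iteration to
    the next has to be an error of second order. *)
Lemma eta_diff k : 0 <= eta k - eta k.+1 <= eta k ^+ 2.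
Proof.
have e1 := eta_gt0 k; have e2 := eta_gt0 k.+1; have e3 := eta_anti (leqnSn k).
have q1 := eta_sqr k; have q2 := eta_sqr k.+1; rewrite subr_ge0 e3/=.
have h : 0 < (k%:R + 1 : R) by rewrite ltr_pwDr.
have E : (eta k - eta k.+1) * (eta k + eta k.+1) = eta k ^+ 2 * eta k.+1 ^+ 2.
  rewrite -subr_sqr q1 q2 -natr1; field; apply/andP; split; apply: lt0r_neq0; lra.
have l1 := eta_le1 k.+1.
rewrite -(ler_pM2r (addr_gt0 e1 e2)) E.
by rewrite ler_wpM2l ?sqr_ge0//; nra.
Qed.

Lemma sum_eta_sqr T : \sum_(t < T) eta t.+1 ^+ 2 <= ln (T%:R + 1).
Proof.
elim: T => [|T IH]; first by rewrite big_ord0 add0r ln1.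
rewrite big_ord_recr /= eta_sqr -natr1.
have T0 : 0 < (T%:R + 1 : R) by rewrite ltr_pwDr.
have T1 : 0 < (T%:R + 1 + 1 : R) by rewrite ltr_pwDr// ltW.
(* The inequality [ln (1 + y) <= y] at [y = - 1 / (T + 2)] bounds the new summand by the increment
   of the logarithm. The sum starts at [eta 1], so no additive constant is left. *)
have := @le_ln1Dx R (- (T%:R + 1 + 1)^-1).
have -> : 1 + - (T%:R + 1 + 1)^-1 = (T%:R + 1) / (T%:R + 1 + 1) :> R.
  by field; apply: lt0r_neq0.
rewrite ln_div ?posrE// => h.
have {}h : ln (T%:R + 1) - ln (T%:R + 1 + 1) <= - (T%:R + 1 + 1)^-1 :> R.
  by apply: h; rewrite ltrN2 invf_lt1//; lra.
by move: IH h; set L1 := ln _; set L2 := ln _; lra.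
Qed.

(** If all values before [k] exceeded the claimed bound, each weight being at least [eta k], the
    weighted sum over the indices 1 to [k - 1] would be too large. Index 0 is left out because the
    initial state need not satisfy the a priori bounds. *)
Lemma min_rate (u : nat -> R) (B C : R) : 0 <= B -> 0 <= C ->
  (forall T, \sum_(t < T) eta t.+1 * u t.+1 <= B + C * \sum_(t < T) eta t.+1 ^+ 2) ->
  exists2 C' : R, 0 < C' & forall k, (1 < k)%N -> exists t, (t < k)%N /\
    u t <= C' * (ln (k%:R + 1) ^+ 3 / Num.sqrt (k%:R + 1)).
Proof.
move=> B0 C0 h.
pose c : R := ln 2; have c0 : 0 < c by rewrite ln_gt0// ltr1n.
(* The factor 3 compensates [k / (k + 2) >= 1 / 3]. Since [ln (k + 1) >= c], the powers of [c] let
   the cube of the logarithm dominate both [B] and [C * ln]; the final 1 makes the contradiction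
   strict. *)
pose C' := 3 * (B / c ^+ 3 + C / c ^+ 2) + 1.
have C'0 : 0 < C'.
  by rewrite /C' ltr_wpDl// mulr_ge0// addr_ge0// divr_ge0// exprn_ge0// ltW.
exists C' => // k k1.
have [|no] := pselect (exists t, (t < k)%N /\
  u t <= C' * (ln (k%:R + 1) ^+ 3 / Num.sqrt (k%:R + 1))); first by [].
exfalso; set M := C' * _ in no.
have uM t : (t < k)%N -> M < u t.
  by move=> tk; rewrite ltNge; apply/negP => ?; apply: no; exists t.
case: k k1 @M no uM => // k k1 M no uM.
set l := ln (k.+1%:R + 1 : R) in M no uM.
have cl : c <= l.
  by rewrite ler_ln ?posrE// ?ltr_pwDr// -[2]/(1 + 1) lerD2r ler1n.
have l0 : 0 < l by exact: lt_le_trans cl.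
have s0 : 0 < Num.sqrt (k.+1%:R + 1 : R) := sqrt_succ_gt0 _.
have M0 : 0 < M by rewrite mulr_gt0// divr_gt0// exprn_gt0.
have k0 : (k%:R : R) >= 1 by rewrite ler1n.
have lo : k%:R * (eta k.+1 * M) <= \sum_(t < k) eta t.+1 * u t.+1.
  rewrite mulr_natl -[X in _ *+ X]card_ord -sumr_const; apply: ler_sum => t _.
  have tk := ltn_ord t; apply: ler_pM; [exact/ltW/eta_gt0|exact: ltW| |].
    by apply: eta_anti; rewrite ltnS ltnW.
  by apply/ltW/uM; rewrite ltnS.
have hi : B + C * \sum_(t < k) eta t.+1 ^+ 2 <= B + C * l.
  rewrite lerD2l ler_wpM2l// (le_trans (sum_eta_sqr k))// ler_ln ?posrE ?ltr_pwDr//.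
  by rewrite lerD2r ler_nat.
have {lo hi} := le_trans lo (le_trans (h k) hi).
have -> : k%:R * (eta k.+1 * M) = (k%:R / (k.+1%:R + 1)) * (C' * l ^+ 3).
  rewrite -eta_sqr /M -/(eta _); ring.
have kk : 3^-1 <= k%:R / (k.+1%:R + 1) :> R.
  rewrite ler_pdivlMr ?ltr_pwDr// -(@natr1 R k); lra.
have l3 : l ^+ 3 > 0 by rewrite exprn_gt0.
have C'l : C' * l ^+ 3 = 3 * (B * (l / c) ^+ 3 + C * l * (l / c) ^+ 2) + l ^+ 3.
  by rewrite /C'; field; apply: lt0r_neq0.
have lc : 1 <= l / c by rewrite ler_pdivlMr// mul1r.
have lc2 : 1 <= (l / c) ^+ 2 by rewrite exprn_ege1.
have lc3 : 1 <= (l / c) ^+ 3 by rewrite exprn_ege1.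
have h1 : B <= B * (l / c) ^+ 3 by rewrite ler_peMr.
have h2 : C * l <= C * l * (l / c) ^+ 2 by rewrite ler_peMr// mulr_ge0// ltW.
have h3 : 3^-1 * (C' * l ^+ 3) <= k%:R / (k.+1%:R + 1) * (C' * l ^+ 3).
  by rewrite ler_wpM2r// mulr_ge0 ?ltW.
move: h3; rewrite C'l; lra.
Qed.

End Rates.

(** * Softmax policies *)

Section Calculus.
Variable R : realType.

Lemma is_derive_bigsum (J : finType) (F : J -> R -> R) (dF : J -> R) (x : R) :
  (forall j, is_derive x 1 (F j) (dF j)) ->
  is_derive x 1 (fun t => \sum_j F j t) (\sum_j dF j).
Proof.
move=> h; elim: (index_enum J) => [|j s IH].
  rewrite big_nil (_ : (fun _ => _) = cst 0); first exact: is_derive_cst.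
  by apply/funext => t; rewrite big_nil.
rewrite big_cons (_ : (fun _ => _) = F j + (fun t => \sum_(j <- s) F j t)).
  exact: is_deriveD.
by apply/funext => t; rewrite big_cons.
Qed.

Lemma is_derive_line (a b x : R) : is_derive x 1 (fun t => a + t * b) b.
Proof.
have h := is_deriveD (is_derive_cst a x 1)
  (is_deriveM (is_derive_id x (1 : R)) (is_derive_cst b x 1)).
rewrite (_ : (fun t => a + t * b) = cst a + (id * cst b)); last first.
  by apply/funext => t.
apply: is_derive_eq h _.
by rewrite /= scaler0 !add0r /GRing.scale/= mulr1.
Qed.

Lemma MVT01 (f df : R -> R) : (forall t : R, is_derive t 1 f (df t)) ->
  exists2 c, 0 <= c <= 1 & f 1 - f 0 = df c.
Proof.
move=> h; have [c|c c01 E] := @MVT_segment R f df 0 1 ler01 (fun t _ => h t).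
  apply: continuous_subspaceT => t; apply: differentiable_continuous.
  by apply/derivable1_diffP; have [] := h t.
by exists c => //; rewrite E subr0 mulr1.
Qed.

End Calculus.

Section Softmax.
Variables (R : realType) (S A : finType) (a0 : A).
Implicit Types (theta d : {ffun S * A -> R}) (s : S) (a : A).

(** The directional derivative of [softmax] at [theta] along [d]: in each state, the matrix diag(p)
    - p p^T applied to [d]. *)
Definition dsoftmax theta d : {ffun S * A -> R} :=
  [ffun x => softmax theta x * (d x - \sum_b softmax theta (x.1, b) * d (x.1, b))].

Definition score theta s a : {ffun S * A -> R} :=
  [ffun x => (x.1 == s)%:R * ((x.2 == a)%:R - softmax theta x)].

Lemma softmaxE theta s a :
  softmax theta (s, a) = expR (theta (s, a)) / \sum_b expR (theta (s, b)).
Proof. by rewrite ffunE. Qed.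

Lemma dsoftmaxE theta d s a : dsoftmax theta d (s, a) =
  softmax theta (s, a) * (d (s, a) - \sum_b softmax theta (s, b) * d (s, b)).
Proof. by rewrite ffunE. Qed.

Lemma scoreE theta s a s' b :
  score theta s a (s', b) = (s' == s)%:R * ((b == a)%:R - softmax theta (s', b)).
Proof. by rewrite ffunE. Qed.

Lemma softmax_den_gt0 theta s : 0 < \sum_b expR (theta (s, b)).
Proof. by rewrite (bigD1 a0)//= ltr_pwDl ?expR_gt0 ?sumr_ge0// => b _; rewrite expR_ge0. Qed.

Lemma softmax_gt0 theta s a : 0 < softmax theta (s, a).
Proof. by rewrite softmaxE divr_gt0 ?expR_gt0 ?softmax_den_gt0. Qed.

Lemma softmax_le1 theta s a : softmax theta (s, a) <= 1.
Proof.
by have /(_ a) := simplex_le1 (softmax_simplex a0 theta s); rewrite ffunE.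
Qed.

Lemma is_derive_softmax theta d s a (t : R) :
  is_derive t 1 (fun u => softmax (theta + u *: d) (s, a))
            (dsoftmax (theta + t *: d) d (s, a)).
Proof.
pose num b (u : R) := expR (theta (s, b) + u * d (s, b)).
have numE u b : expR ((theta + u *: d) (s, b)) = num b u by rewrite /num !ffunE.
have dnum b : is_derive t 1 (num b) (num b t * d (s, b)).
  by apply: (@is_derive1_comp _ expR _ _ (num b t)); exact: is_derive_line.
have dden := is_derive_bigsum dnum.
have den0 : \sum_b num b t != 0.
  have := softmax_den_gt0 (theta + t *: d) s; under eq_bigr do rewrite numE.
  by move=> h; rewrite gt_eqF.
have := is_deriveM (dnum a) (is_deriveV den0 dden).
rewrite (_ : num a * _ = (fun u => softmax (theta + u *: d) (s, a))); last first.
  apply/funext => u; rewrite softmaxE numE.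
  by under eq_bigr do rewrite numE.
move=> h; apply: is_derive_eq.
rewrite [RHS]ffunE /=.
have E b : softmax (theta + t *: d) (s, b) = num b t / \sum_b num b t.
  by rewrite softmaxE numE; under eq_bigr do rewrite numE.
under [in RHS]eq_bigr do rewrite E mulrAC.
by rewrite -mulr_suml E /GRing.scale/=; field.
Qed.

(** In each state the probabilities satisfy p^2 <= p, and the variance of [d] under p is at most its
    second moment. *)
Lemma norm2_dsoftmax theta d : norm2 (dsoftmax theta d) <= norm2 d.
Proof.
apply: norm2_le; first exact: norm2_ge0.
have split (v : {ffun S * A -> R}) : dot v v = \sum_s \sum_a v (s, a) ^+ 2.
  by rewrite pair_bigA; apply: eq_bigr => -[s a] _; rewrite expr2.
rewrite norm2_sqr !split; apply: ler_sum => s _.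
set m := \sum_b softmax theta (s, b) * d (s, b).
apply: (@le_trans _ _ (\sum_a softmax theta (s, a) * (d (s, a) - m) ^+ 2)).
  apply: ler_sum => a _; rewrite ffunE /= -/m exprMn ler_wpM2r ?sqr_ge0//.
  by have := softmax_gt0 theta s a; have := softmax_le1 theta s a; nra.
apply: (@le_trans _ _ (\sum_a softmax theta (s, a) * d (s, a) ^+ 2)); last first.
  apply: ler_sum => a _; rewrite -[leRHS]mul1r ler_wpM2r ?sqr_ge0//.
  exact: softmax_le1.
have E (c : R) : \sum_a softmax theta (s, a) * (d (s, a) - c) ^+ 2 =
    \sum_a softmax theta (s, a) * d (s, a) ^+ 2
    - 2 * c * \sum_a softmax theta (s, a) * d (s, a)
    + c ^+ 2 * \sum_a softmax theta (s, a).
  rewrite !mulr_sumr -sumrB -big_split; apply: eq_bigr => a _ /=; ring.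
by rewrite E softmax_sum1// -/m; have := sqr_ge0 m; lra.
Qed.

Lemma softmax_lipschitz theta1 theta2 :
  norm2 (softmax theta1 - softmax theta2) <= norm2 (theta1 - theta2).
Proof.
rewrite norm2_subC (norm2_subC theta1).
set u := softmax theta2 - _; set d := theta2 - theta1.
(* The mean value theorem is scalar, so the curve is paired with the difference [u] of its own
   endpoints; this yields [dot u u] on the left. *)
have [|c _ E] := @MVT01 R (fun t => \sum_x u x * softmax (theta1 + t *: d) x)
    (fun t => \sum_x u x * dsoftmax (theta1 + t *: d) d x).
  move=> t; apply: is_derive_bigsum => -[s a].
  exact: (is_deriveZ (u (s, a)) (is_derive_softmax theta1 d s a t)).
have [->|u0] := eqVneq (norm2 u) 0; first exact: norm2_ge0.
have {}u0 : 0 < norm2 u by rewrite lt_neqAle eq_sym u0 norm2_ge0.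
rewrite -(ler_pM2l u0) -expr2 norm2_sqr.
have -> : dot u u = dot u (dsoftmax (theta1 + c *: d) d).
  rewrite -[RHS]E scale1r scale0r addr0 (addrC theta1 d) /d subrK -sumrB.
  by apply: eq_bigr => x _; rewrite -mulrBr !ffunE.
apply: dot_le_bound => //; exact: norm2_dsoftmax.
Qed.

(** The mean value theorem gives the derivative at an intermediate point, and what remains is the
    variation of [dsoftmax] over a distance at most [norm2 d]. The 2 comes from the varying factor p
    times the centred direction, [#|A|] from the varying mean of [d]. *)
Lemma softmax_taylor theta d s a :
  `|softmax (theta + d) (s, a) - softmax theta (s, a) - dsoftmax theta d (s, a)|
    <= (2 + #|A|%:R) * norm2 d ^+ 2.
Proof.
have [t t01 E] := MVT01 (is_derive_softmax theta d s a).
rewrite scale1r scale0r addr0 in E; rewrite E !dsoftmaxE.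
set p' := softmax (theta + t *: d); set p := softmax theta.
set m' := \sum_b p' _ * _; set m := \sum_b p _ * _.
have nd x : `|d x| <= norm2 d by exact: norm2_coord.
have pp x : `|p' x - p x| <= norm2 d.
  have := norm2_coord (p' - p) x; rewrite !ffunE => /le_trans; apply.
  apply: le_trans (softmax_lipschitz _ _) _; rewrite addrC addKr norm2Z.
  by rewrite ger0_norm ?ler_piMl ?norm2_ge0//; case/andP: t01.
have d0 := norm2_ge0 d.
have m'd : `|m'| <= norm2 d.
  have := @simplex_avg_le R A [ffun b => p' (s, b)] (fun b => d (s, b)) (norm2 d)
    (softmax_simplex a0 _ s) (fun b => nd _).
  by under eq_bigr do rewrite ffunE.
have mm : `|m' - m| <= #|A|%:R * norm2 d ^+ 2.
  rewrite -sumrB; apply: le_trans (ler_norm_sum _ _ _) _.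
  rewrite -sum1_card natr_sum mulr_suml; apply: ler_sum => b _.
  by rewrite -mulrBl normrM mul1r expr2 ler_pM.
have -> : p' (s, a) * (d (s, a) - m') - p (s, a) * (d (s, a) - m) =
   (p' (s, a) - p (s, a)) * (d (s, a) - m') - p (s, a) * (m' - m) by ring.
apply: le_trans (ler_normB _ _) _; rewrite [leRHS]mulrDl; apply: lerD.
  rewrite normrM expr2 mulrCA; apply: ler_pM => //.
  by apply: le_trans (ler_normB _ _) _; have := nd (s, a); lra.
rewrite normrM -[leRHS]mul1r ler_pM// gtr0_norm ?softmax_gt0//.
exact: softmax_le1.
Qed.

Lemma gradlogpiE theta s a : gradlogpi theta s a = score theta s a.
Proof.
apply/ffunP => -[s' b]; rewrite scoreE ffunE derive1E.
have h := is_derive_softmax theta (unitv R (s', b)) s a 0.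
rewrite scale0r addr0 in h.
have p0 := softmax_gt0 theta s a.
have hl : is_derive (softmax (theta + 0 *: unitv R (s', b)) (s, a)) 1 (@ln R)
   (softmax theta (s, a))^-1 by rewrite scale0r addr0; exact: is_derive1_ln.
rewrite (@derive_val _ _ _ _ _ _ _
  (@is_derive1_comp _ (@ln R) (fun t => softmax (theta + t *: unitv R (s', b)) (s, a)) 0 _ _ hl h)).
rewrite dsoftmaxE mulrA mulVf ?gt_eqF// mul1r unitvE xpair_eqE.
rewrite (bigD1 b)//= big1 ?addr0; last first.
  by move=> c /negbTE cb; rewrite unitvE xpair_eqE cb andbF mulr0.
rewrite unitvE xpair_eqE eqxx andbT (eq_sym s s') (eq_sym a b).
by have [->|_] := eqVneq s' s; rewrite ?mul1r ?mulr1 ?mul0r ?mulr0 ?subr0 ?andbF.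
Qed.

Lemma norm2_score theta s a : norm2 (score theta s a) <= 2.
Proof.
have -> : score theta s a = unitv R (s, a) -
    [ffun x => (x.1 == s)%:R * softmax theta x].
  apply/ffunP => -[s' b]; rewrite scoreE [RHS]ffunE unitvE xpair_eqE.
  rewrite [X in _ = _ + X]ffunE [X in _ = _ - X]ffunE /=.
  by have [->|_] := eqVneq s' s; rewrite ?mul1r ?mul0r ?subr0.
apply: le_trans (norm2B _ _) _; rewrite norm2_unitv.
suff : norm2 [ffun x => (x.1 == s)%:R * softmax theta x] <= 1 by lra.
apply: le_trans (norm2_le_sum _) _.
rewrite -[leRHS](softmax_sum1 a0 theta s) [leLHS](eq_bigr (fun x =>
   if x.1 == s then softmax theta (s, x.2) else 0)); last first.
  move=> [s' b] _; rewrite ffunE /=; have [->|_] := eqVneq s' s.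
    by rewrite mul1r gtr0_norm// softmax_gt0.
  by rewrite mul0r normr0.
rewrite -(pair_bigA _ (fun s' b => if s' == s then softmax theta (s, b) else 0))/=.
rewrite (bigD1 s)//= eqxx [X in _ + X]big1 ?addr0// => s' /negbTE ->.
by rewrite big1.
Qed.

Lemma norm2_score_diff theta1 theta2 s a :
  norm2 (score theta1 s a - score theta2 s a) <= norm2 (theta1 - theta2).
Proof.
apply: le_trans (softmax_lipschitz theta1 theta2).
apply: norm2_le; first exact: norm2_ge0.
rewrite norm2_sqr; apply: ler_sum => x _; rewrite !ffunE.
case: (x.1 == s) => /=; last by rewrite !mul0r subrr mul0r -expr2 sqr_ge0.
rewrite !mul1r le_eqVlt; apply/orP; left; apply/eqP; ring.
Qed.

(** The likelihood-ratio identity, which makes the expected actor increment a directional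
    derivative. *)
Lemma dsoftmax_score theta d s a :
  dsoftmax theta d (s, a) = softmax theta (s, a) * dot (score theta s a) d.
Proof.
rewrite ffunE /=; congr (_ * _); rewrite /dot.
rewrite [RHS](eq_bigr (fun x => if x.1 == s then
   ((x.2 == a)%:R - softmax theta (s, x.2)) * d (s, x.2) else 0)); last first.
  move=> [s' b] _; rewrite scoreE /=; have [->|_] := eqVneq s' s.
    by rewrite mul1r.
  by rewrite !mul0r.
rewrite -(pair_bigA _ (fun s' b => if s' == s then
   ((b == a)%:R - softmax theta (s, b)) * d (s, b) else 0))/=.
rewrite [RHS](bigD1 s)//= eqxx [X in _ = _ + X]big1 ?addr0; last first.
  by move=> s' /negbTE ->; rewrite big1.
under [RHS]eq_bigr do rewrite mulrBl.
rewrite sumrB; congr (_ - _); rewrite [RHS](bigD1 a)//= eqxx mul1r big1 ?addr0//.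
by move=> b /negbTE ->; rewrite mul0r.
Qed.

End Softmax.

(** * Poisson's equation for a uniformly ergodic chain *)

Section Geometric.
Variables (R : realType) (C1 : R).
Hypothesis C1_01 : 0 < C1 < 1.

(** Exact statements about the stationary law are obtained as limits of approximate [n]-step
    statements through this lemma. *)
Lemma geometric_le0 (x K : R) : (forall k, x <= K * C1 ^+ k) -> x <= 0.
Proof.
case/andP: C1_01 => C1_0 C1_1 h.
have nC1 : `|C1| < 1 by rewrite gtr0_norm.
have cK := @cvg_geometric R K C1 nC1.
rewrite -(cvg_lim (@Rhausdorff R) cK).
by apply: limr_ge; [exact: cvgP cK|exact: nearW].
Qed.

Lemma sum_geometric_le n : \sum_(t < n) C1 ^+ t <= (1 - C1)^-1.
Proof.
case/andP: C1_01 => C1_0 C1_1.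
have h : (\sum_(t < n) C1 ^+ t) * (1 - C1) = 1 - C1 ^+ n.
  elim: n => [|n IH]; first by rewrite big_ord0 mul0r expr0 subrr.
  by rewrite big_ord_recr /= mulrDl IH exprS; ring.
rewrite -[leRHS]mul1r ler_pdivlMr ?subr_gt0// h.
by rewrite gerBl exprn_ge0// ltW.
Qed.

End Geometric.

Section MarkovChain.
Variables (R : realType) (S A : finType).
Variables (P : {ffun S -> R} -> S -> A -> S -> R) (C0 C1 : R).
Hypothesis Pker : is_kernel P.
Hypothesis C0_ge1 : 1 <= C0.
Hypothesis C1_01 : 0 < C1 < 1.
Hypothesis ergodic : forall pi mu, is_policy pi -> simplex mu ->
  forall k, maxTV P pi mu k <= C0 * C1 ^+ k.

Local Notation policy := {ffun S * A -> R}.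

(** Same series as in [Vfun], so the differential value function is the instance where [g] is the
    mean reward under the policy. *)
Definition pois (pi : policy) (mu : {ffun S -> R}) (g : S -> R) (s : S) : R :=
  limn (series (fun t => \sum_s' npow P pi mu t s s' *
    (g s' - \sum_x nu P pi mu x * g x))).

(** The sum of the series [2 * C0 * C1 ^+ t]: a bound in the supremum norm for the map from a
    function to its Poisson solution. *)
Definition mixK : R := 2 * C0 / (1 - C1).

Lemma mixK_ge0 : 0 <= mixK.
Proof.
case/andP: C1_01 => _ /ltW h; rewrite divr_ge0 ?subr_ge0//.
by have := C0_ge1; lra.
Qed.

Section Chain.
Variables (pi : policy) (mu : {ffun S -> R}).
Hypothesis hpi : is_policy pi.
Hypothesis hmu : simplex mu.
Local Notation chn := (chain P pi mu).
Local Notation npw := (npow P pi mu).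
Local Notation nuv := (nu P pi mu).

Lemma policy_ge0 s a : 0 <= pi (s, a).
Proof. by have [/(_ a)] := hpi s; rewrite ffunE. Qed.

Lemma policy_sum1 s : \sum_a pi (s, a) = 1.
Proof. by have [_ <-] := hpi s; apply: eq_bigr => a _; rewrite ffunE. Qed.

Lemma chain_ge0 s s' : 0 <= chn s s'.
Proof.
by apply: sumr_ge0 => a _; rewrite mulr_ge0 ?policy_ge0 ?(kernel_ge0 Pker).
Qed.

Lemma chain_avg g s : \sum_s' chn s s' * g s' =
  \sum_a pi (s, a) * \sum_s' P mu s a s' * g s'.
Proof.
under [RHS]eq_bigr do rewrite mulr_sumr.
rewrite exchange_big; apply: eq_bigr => s' _ /=; rewrite mulr_suml.
by apply: eq_bigr => a _; rewrite mulrA (mulrC (pi _)).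
Qed.

Lemma chain_sum1 s : \sum_s' chn s s' = 1.
Proof.
have := chain_avg (fun _ => 1) s; under eq_bigr do rewrite mulr1.
move=> ->; rewrite -[RHS](policy_sum1 s); apply: eq_bigr => a _.
under eq_bigr do rewrite mulr1.
by rewrite (kernel_sum1 Pker)// mulr1.
Qed.

Lemma npow_ge0 n s s' : 0 <= npw n s s'.
Proof.
elim: n s' => [|n IH] s' /=; first by [].
by apply: sumr_ge0 => x _; rewrite mulr_ge0 ?chain_ge0.
Qed.

Lemma npow_sum1 n s : \sum_s' npw n s s' = 1.
Proof.
elim: n => [|n IH] /=.
  by rewrite (bigD1 s)//= eqxx big1 ?addr0// => i; rewrite eq_sym => /negbTE ->.
rewrite exchange_big -[RHS]IH; apply: eq_bigr => x _ /=.
by rewrite -mulr_sumr chain_sum1 mulr1.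
Qed.

Lemma npowS_avg n s g :
  \sum_s' npw n.+1 s s' * g s' = \sum_x npw n s x * \sum_s' chn x s' * g s'.
Proof.
under [RHS]eq_bigr do rewrite mulr_sumr.
rewrite exchange_big; apply: eq_bigr => s' _ /=; rewrite mulr_suml.
by apply: eq_bigr => x _; rewrite mulrA.
Qed.

Lemma npow0_avg s g : \sum_s' npw 0 s s' * g s' = g s.
Proof.
rewrite (bigD1 s)//= eqxx mul1r big1 ?addr0// => i.
by rewrite eq_sym => /negbTE ->; rewrite mul0r.
Qed.

(** [npow] adds transitions at the end of the path, whereas Poisson's equation splits off the first
    one. *)
Lemma npowS_avgl n s g :
  \sum_s' npw n.+1 s s' * g s' = \sum_x chn s x * \sum_s' npw n x s' * g s'.
Proof.
elim: n g => [|n IH] g.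
  by rewrite npowS_avg npow0_avg; apply: eq_bigr => x _; rewrite npow0_avg.
rewrite npowS_avg (IH (fun y => \sum_s' chn y s' * g s')).
by apply: eq_bigr => x _; rewrite -npowS_avg.
Qed.

Lemma npow_nu_TV n s : dTV [ffun s' => npw n s s'] nuv <= C0 * C1 ^+ n.
Proof.
apply: le_trans (ergodic hpi hmu n).
exact: (@le_bigmax _ _ S 0 (fun s => dTV [ffun s' => npw n s s'] nuv)).
Qed.

Lemma npow_expect n s g B : 0 <= B -> (forall x, `|g x| <= B) ->
  `|\sum_s' npw n s s' * g s' - \sum_x nuv x * g x| <= 2 * C0 * B * C1 ^+ n.
Proof.
move=> B0 gB; have := dTV_expect [ffun s' => npw n s s'] nuv B0 gB.
under eq_bigr do rewrite ffunE.
move=> /le_trans; apply.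
have -> : 2 * C0 * B * C1 ^+ n = 2 * (C0 * C1 ^+ n) * B by ring.
by rewrite ler_wpM2r// ler_wpM2l// npow_nu_TV.
Qed.

Variable s0 : S.

(** [nu] is defined by choice with default value 0. Instead of constructing a stationary law, the
    mixing bound is used: it forces [npow n s0] to converge to [nuv], so positivity and total mass
    pass to the limit. *)
Lemma nu_simplex : simplex nuv.
Proof.
have pick1 (d : S -> R) s' : \sum_x d x * (x == s')%:R = d s'.
  by rewrite (bigD1 s')//= eqxx mulr1 big1 ?addr0// => i /negbTE ->; rewrite mulr0.
have ind1 (s' x : S) : `|(x == s')%:R : R| <= 1 by case: eqP; rewrite ?normr1 ?normr0.
split=> [s'|].
  rewrite -oppr_le0; apply: (geometric_le0 C1_01 (K := 2 * C0 * 1)) => k.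
  have := npow_expect k s0 ler01 (ind1 s'); rewrite !pick1 ler_norml => /andP[_].
  by have := npow_ge0 k s0 s'; lra.
apply/eqP; rewrite -subr_eq0 -normr_le0.
apply: (geometric_le0 C1_01 (K := 2 * C0 * 1)) => k.
have := @npow_expect k s0 (fun=> 1) 1 ler01 (fun=> _).
rewrite normr1 => /(_ (fun=> lexx _)).
under eq_bigr do rewrite mulr1; under [X in `|_ - X|]eq_bigr do rewrite mulr1.
by rewrite npow_sum1 distrC.
Qed.

(** The average of [g] after [k + 1] steps is the average of its one-step mean after [k] steps; both
    sides of the claim are limits of these averages. *)
Lemma nu_stationary g :
  \sum_s nuv s * \sum_s' chn s s' * g s' = \sum_s nuv s * g s.
Proof.
pose B := \sum_x `|g x|.
have gB x : `|g x| <= B by rewrite /B (bigD1 x)//= lerDl sumr_ge0.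
have B0 : 0 <= B by apply: sumr_ge0.
pose Pg s := \sum_s' chn s s' * g s'.
have PgB x : `|Pg x| <= B.
  have := @simplex_avg_le R S [ffun s' => chn x s'] g B _ gB.
  under eq_bigr do rewrite ffunE; apply; split=> [i|]; first by rewrite ffunE chain_ge0.
  by under eq_bigr do rewrite ffunE; exact: chain_sum1.
apply/eqP; rewrite -subr_eq0 -normr_le0.
apply: (geometric_le0 C1_01 (K := 2 * C0 * B * (1 + C1))) => k.
have h1 := npow_expect k s0 B0 PgB.
have h2 := npow_expect k.+1 s0 B0 gB; rewrite npowS_avg in h2.
have -> : 2 * C0 * B * (1 + C1) * C1 ^+ k =
  2 * C0 * B * C1 ^+ k + 2 * C0 * B * C1 ^+ k.+1 by rewrite exprS; ring.
rewrite distrC in h1; have := lerD h1 h2; apply: le_trans.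
exact: ler_distD.
Qed.

Section Poisson.
Variables (g : S -> R) (B : R).
Hypotheses (B0 : 0 <= B) (gB : forall x, `|g x| <= B).
Local Notation gbar := (\sum_x nuv x * g x).
Let u s t := \sum_s' npw t s s' * (g s' - gbar).

Lemma centered_npowE s t : u s t = \sum_s' npw t s s' * g s' - gbar.
Proof.
rewrite /u; under eq_bigr do rewrite mulrBr.
by rewrite sumrB -mulr_suml npow_sum1 mul1r.
Qed.

Lemma centered_npow_le s t : `|u s t| <= 2 * C0 * B * C1 ^+ t.
Proof. by rewrite centered_npowE; exact: npow_expect. Qed.

Lemma pois_cvg s : cvgn (series (u s)).
Proof.
apply: normed_cvg; apply: (@series_le_cvg _ _ (geometric (2 * C0 * B) C1)).
- by move=> n /=; exact: normr_ge0.
- by move=> n /=; rewrite !mulr_ge0 ?exprn_ge0//; case/andP: C1_01; have := C0_ge1; lra.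
- exact: centered_npow_le.
by apply: is_cvg_geometric_series; case/andP: C1_01 => ? ?; rewrite gtr0_norm.
Qed.

Lemma pois_bound s : `|pois pi mu g s| <= mixK * B.
Proof.
have bd n : `|series (u s) n| <= mixK * B.
  rewrite /series/= big_mkord; apply: le_trans (ler_norm_sum _ _ _) _.
  apply: (@le_trans _ _ (\sum_(t < n) 2 * C0 * B * C1 ^+ t)).
    by apply: ler_sum => t _; exact: centered_npow_le.
  rewrite -mulr_sumr /mixK [leRHS]mulrAC ler_wpM2l ?sum_geometric_le//.
  by rewrite !mulr_ge0//; have := C0_ge1; lra.
have cv := @pois_cvg s.
by rewrite ler_norml; apply/andP; split; [apply: limr_ge|apply: limr_le] => //;
   apply: nearW => n; have := bd n; rewrite ler_norml => /andP[].
Qed.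

Lemma pois_eq s :
  pois pi mu g s = g s - gbar + \sum_s' chn s s' * pois pi mu g s'.
Proof.
have cv x : series (u x) n @[n --> \oo] --> pois pi mu g x by exact: pois_cvg.
(* Poisson's equation already holds for partial sums, up to a shift of the index. *)
have E n : series (u s) n.+1 = g s - gbar + \sum_s' chn s s' * series (u s') n.
  rewrite /series/= big_mkord big_ord_recl /= /u npow0_avg; congr (_ + _).
  under [RHS]eq_bigr do rewrite big_mkord mulr_sumr.
  rewrite [RHS]exchange_big; apply: eq_bigr => t _ /=.
  by rewrite -(npowS_avgl t s (fun s' => g s' - gbar)).
have c1 : series (u s) n.+1 @[n --> \oo] --> pois pi mu g s.
  by rewrite (cvg_shiftS (series (u s))).
have c2 : series (u s) n.+1 @[n --> \oo] -->
    g s - gbar + \sum_s' chn s s' * pois pi mu g s'.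
  rewrite (_ : (fun n => _) = (fun n => g s - gbar + \sum_s' chn s s' * series (u s') n)).
    apply: cvgD; first exact: cvg_cst.
    apply: cvg_big => [|s' _]; first exact: add_continuous.
    by apply: cvgM; [exact: cvg_cst|exact: cv].
  exact/funext.
exact: (cvg_unique _ c1 c2).
Qed.

(** Poisson's equation determines its solution only up to a constant; this normalisation is what
    makes solutions for two different chains comparable. *)
Lemma pois_mean0 : \sum_s nuv s * pois pi mu g s = 0.
Proof.
have inv t : \sum_s nuv s * u s t = 0.
  under eq_bigr do rewrite centered_npowE mulrBr.
  rewrite sumrB -mulr_suml; have [_ ->] := nu_simplex; rewrite mul1r.
  elim: t => [|t IH].
    under eq_bigr do rewrite npow0_avg.
    by rewrite subrr.
  under eq_bigr do rewrite npowS_avgl.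
  by rewrite nu_stationary.
have c1 : (\sum_s nuv s * series (u s) n) @[n --> \oo] --> \sum_s nuv s * pois pi mu g s.
  apply: cvg_big => [|s _]; first exact: add_continuous.
  by apply: cvgM; [exact: cvg_cst|exact: pois_cvg].
have c2 : (\sum_s nuv s * series (u s) n) @[n --> \oo] --> (0 : R).
  rewrite (_ : (fun n => _) = (fun=> 0)); first exact: cvg_cst.
  apply/funext => n; rewrite /series/=.
  under eq_bigr do rewrite big_mkord mulr_sumr.
  by rewrite exchange_big big1// => t _ /=; exact: inv.
exact: (cvg_unique _ c1 c2).
Qed.

End Poisson.

(* Any solution of a Poisson equation is, up to its mean, controlled by the right-hand side. *)
Lemma poisson_stable (D e : S -> R) E : 0 <= E -> (forall s, `|e s| <= E) ->
  (forall s, D s = e s + \sum_s' chn s s' * D s') ->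
  forall s, `|D s - \sum_x nuv x * D x| <= mixK * E.
Proof.
move=> E0 eE DE s; pose B := \sum_x `|D x|.
have DB x : `|D x| <= B by rewrite /B (bigD1 x)//= lerDl sumr_ge0.
have B0 : 0 <= B by apply: sumr_ge0.
(* Averaging the equation over the stationary law shows that a right-hand side for which it is
   solvable is centred, so its [n]-step means decay. *)
have e0 : \sum_x nuv x * e x = 0.
  have : \sum_x nuv x * D x = \sum_x nuv x * e x + \sum_x nuv x * \sum_s' chn x s' * D s'.
    by rewrite -big_split; apply: eq_bigr => x _; rewrite {1}DE mulrDr.
  by rewrite nu_stationary => h; lra.
(* Iterating the equation [n] times; the last term tends to the mean of [D]. *)
have it n : D s = \sum_(t < n) (\sum_x npw t s x * e x) + \sum_x npw n s x * D x.
  elim: n => [|n IH]; first by rewrite big_ord0 add0r npow0_avg.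
  rewrite big_ord_recr /= npowS_avg {1}IH -addrA; congr (_ + _).
  by rewrite -big_split; apply: eq_bigr => x _; rewrite {1}DE mulrDr.
rewrite -subr_le0; apply: (geometric_le0 C1_01 (K := 2 * C0 * B)) => n.
rewrite lerBlDr {1}(it n) -addrA addrC; apply: le_trans (ler_normD _ _) _.
apply: lerD; first exact: npow_expect.
apply: le_trans (ler_norm_sum _ _ _) _.
apply: (@le_trans _ _ (\sum_(t < n) 2 * C0 * E * C1 ^+ t)).
  apply: ler_sum => t _; have := npow_expect t s E0 eE.
  by rewrite e0 subr0.
rewrite -mulr_sumr /mixK [leRHS]mulrAC ler_wpM2l ?sum_geometric_le//.
by rewrite !mulr_ge0//; have := C0_ge1; lra.
Qed.

End Chain.

(** The difference of the two solutions solves Poisson's equation of the first chain, with a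
    right-hand side made of the difference of the centred data and of the difference of the kernels
    applied to the second solution. [poisson_stable] then bounds it up to its mean, and since each
    solution is centred for its own law, the mean is controlled by the distance of the stationary
    laws. *)
Lemma pois_lipschitz pi1 pi2 mu1 mu2 (g1 g2 : S -> R) (s0 : S) (B eg eP en : R) :
  is_policy pi1 -> is_policy pi2 -> simplex mu1 -> simplex mu2 ->
  0 <= B -> (forall x, `|g1 x| <= B) -> (forall x, `|g2 x| <= B) ->
  0 <= eg -> (forall x, `|g1 x - g2 x| <= eg) ->
  0 <= eP -> (forall s, \sum_s' `|chain P pi1 mu1 s s' - chain P pi2 mu2 s s'| <= eP) ->
  0 <= en -> \sum_s `|nu P pi1 mu1 s - nu P pi2 mu2 s| <= en ->
  forall s, `|pois pi1 mu1 g1 s - pois pi2 mu2 g2 s| <=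
    mixK * (2 * eg + B * en + mixK * B * eP) + mixK * B * en.
Proof.
move=> hpi1 hpi2 hmu1 hmu2 B0 g1B g2B eg0 hg eP0 hP en0 hn s.
have K0 := mixK_ge0.
set h1 := pois pi1 mu1 g1; set h2 := pois pi2 mu2 g2.
have h2B x : `|h2 x| <= mixK * B by exact: pois_bound.
have diff_sum (p q f : S -> R) F : (forall x, `|f x| <= F) -> 0 <= F ->
    `|\sum_x p x * f x - \sum_x q x * f x| <= F * \sum_x `|p x - q x|.
  move=> fF F0; rewrite -sumrB mulr_sumr; apply: le_trans (ler_norm_sum _ _ _) _.
  by apply: ler_sum => x _; rewrite -mulrBl normrM mulrC ler_wpM2r.
pose e x := (g1 x - g2 x) - (\sum_y nu P pi1 mu1 y * g1 y - \sum_y nu P pi2 mu2 y * g2 y)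
   + (\sum_y chain P pi1 mu1 x y * h2 y - \sum_y chain P pi2 mu2 x y * h2 y).
have eE x : `|e x| <= 2 * eg + B * en + mixK * B * eP.
  have n1 : `|\sum_y nu P pi1 mu1 y * g1 y - \sum_y nu P pi2 mu2 y * g2 y| <= eg + B * en.
    apply: le_trans (ler_distD (\sum_y nu P pi1 mu1 y * g2 y) _ _) _.
    apply: lerD.
      rewrite -sumrB; under eq_bigr do rewrite -mulrBr.
      by apply: simplex_avg_le => //; exact: nu_simplex.
    by apply: le_trans (diff_sum _ _ _ _ g2B B0) _; rewrite ler_wpM2l.
  have n2 : `|\sum_y chain P pi1 mu1 x y * h2 y - \sum_y chain P pi2 mu2 x y * h2 y|
      <= mixK * B * eP.
    apply: le_trans (diff_sum _ _ _ _ h2B _) _; first exact: mulr_ge0.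
    by rewrite ler_wpM2l// mulr_ge0.
  apply: le_trans (ler_normD _ _) (lerD _ n2).
  by apply: le_trans (ler_normB _ _) _; have := hg x; lra.
have E0 : 0 <= 2 * eg + B * en + mixK * B * eP.
  have h1B := mulr_ge0 (mulr_ge0 K0 B0) eP0; have h2B0 := mulr_ge0 B0 en0; lra.
have DE x : h1 x - h2 x = e x + \sum_y chain P pi1 mu1 x y * (h1 y - h2 y).
  under eq_bigr do rewrite mulrBr.
  rewrite sumrB /h1 (pois_eq hpi1 hmu1 B0 g1B) -/h1 {1}/h2 (pois_eq hpi2 hmu2 B0 g2B) -/h2 /e.
  lra.
have st := poisson_stable hpi1 hmu1 s0 E0 eE DE s.
have D1 : `|\sum_x nu P pi1 mu1 x * (h1 x - h2 x)| <= mixK * B * en.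
  under eq_bigr do rewrite mulrBr.
  have z1 : \sum_x nu P pi1 mu1 x * h1 x = 0 := pois_mean0 hpi1 hmu1 s0 B0 g1B.
  have z2 : \sum_x nu P pi2 mu2 x * h2 x = 0 := pois_mean0 hpi2 hmu2 s0 B0 g2B.
  rewrite sumrB z1 -[X in X - _]z2 distrC.
  apply: le_trans (diff_sum _ _ _ _ h2B _) _; first exact: mulr_ge0.
  by rewrite ler_wpM2l// mulr_ge0.
rewrite -[X in `|X|](subrK (\sum_x nu P pi1 mu1 x * (h1 x - h2 x))).
by apply: le_trans (ler_normD _ _) _; exact: lerD.
Qed.

End MarkovChain.

(** * Regularity of the mean field game *)

Section ProjPerp.
Variables (R : realType) (S : finType) (s0 : S).
Implicit Types u v : {ffun S -> R}.

Definition avg v : R := (\sum_s v s) / #|S|%:R.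

Lemma card_gt0R : 0 < #|S|%:R :> R.
Proof. by rewrite ltr0n; apply/card_gt0P; exists s0. Qed.

Lemma proj_perpE v s : proj_perp v s = v s - avg v.
Proof. by rewrite !ffunE /GRing.scale/= mulr1. Qed.

Lemma proj_perp_sum0 v : \sum_s proj_perp v s = 0.
Proof.
under eq_bigr do rewrite proj_perpE.
rewrite sumrB sumr_const -mulr_natr divfK ?subrr// gt_eqF//.
exact: card_gt0R.
Qed.

Lemma proj_perpB u v : proj_perp (u - v) = proj_perp u - proj_perp v.
Proof.
apply/ffunP => s; rewrite proj_perpE [RHS]ffunE [X in _ = _ + X]ffunE !proj_perpE.
rewrite /avg; under eq_bigr do rewrite !ffunE.
by rewrite sumrB !ffunE; ring.
Qed.

Lemma dot_const v (c : R) : dot v [ffun=> c] = c * \sum_s v s.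
Proof. by rewrite mulr_sumr; apply: eq_bigr => s _; rewrite ffunE mulrC. Qed.

Lemma proj_perp_decomp v : v = proj_perp v + [ffun=> avg v].
Proof. by apply/ffunP => s; rewrite ffunE proj_perpE ffunE subrK. Qed.

Lemma norm2_const (c : R) : norm2 [ffun _ : S => c] ^+ 2 = c ^+ 2 * #|S|%:R.
Proof.
rewrite norm2_sqr dot_const; under eq_bigr do rewrite ffunE.
by rewrite sumr_const -mulr_natr; ring.
Qed.

Lemma norm2_perp_const v (c : R) : \sum_s v s = 0 ->
  norm2 (v + [ffun=> c]) ^+ 2 = norm2 v ^+ 2 + c ^+ 2 * #|S|%:R.
Proof. by move=> v0; rewrite norm2D_sqr dot_const v0 norm2_const mulr0 mulr0 addr0. Qed.

Lemma norm2_proj_perp v : norm2 (proj_perp v) <= norm2 v.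
Proof.
rewrite -(@ler_pXn2r _ 2) ?nnegrE ?norm2_ge0// {2}(proj_perp_decomp v).
by rewrite norm2_perp_const ?proj_perp_sum0// lerDl mulr_ge0// sqr_ge0.
Qed.

Lemma proj_perp_id v : \sum_s v s = 0 -> proj_perp v = v.
Proof.
by move=> v0; apply/ffunP => s; rewrite proj_perpE /avg v0 mul0r subr0.
Qed.

End ProjPerp.

Section Gradient.
Variables (R : realType) (I : finType).

(** [grad] collects derivatives along the axes, and a quadratic remainder identifies them without
    any smoothness of [F] away from [x]. *)
Lemma grad_of_taylor (F : {ffun I -> R} -> R) (x g : {ffun I -> R}) (C : R) :
  (forall d, `|F (x + d) - F x - dot g d| <= C * norm2 d ^+ 2) -> grad F x = g.
Proof.
move=> h; apply/ffunP => i; rewrite ffunE /derive1; apply: cvg_lim => //.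
apply/cvgrPdist_le => e e0; near=> t.
have t0 : t != 0 by near: t; exact: nbhs_dnbhs_neq.
have := h (t *: unitv R i).
rewrite dotZr dot_unitv norm2Z norm2_unitv mulr1 real_normK ?num_real//.
rewrite addr0 scale0r addr0 /GRing.scale/=.
set A := F _; set B := F x => {}h.
have -> : g i - t^-1 * (A - B) = - (t^-1 * (A - B - t * g i)) by field.
rewrite normrN normrM normfV ler_pdivrMl ?normr_gt0//.
apply: le_trans h _; rewrite -real_normK ?num_real// expr2 mulrCA.
rewrite ler_wpM2l//.
have C0 : 0 < `|C| + 1 by rewrite ltr_wpDl.
apply: (@le_trans _ _ ((`|C| + 1) * `|t|)).
  by rewrite ler_wpM2r// (le_trans (ler_norm C))// lerDl.
rewrite mulrC -ler_pdivlMr//; near: t.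
apply: (@dnbhs0_le R R). exact: divr_gt0.
Unshelve. all: by end_near.
Qed.

End Gradient.

Section Model.
Variables (R : realType) (S A : finType).
Variables (P : {ffun S -> R} -> S -> A -> S -> R) (r : S -> A -> {ffun S -> R} -> R).
Variables (C0 C1 delta L BV LV LTV gamma : R).

(** The assumptions with the ergodicity constants named and with [LTV] nonnegative. The degenerate
    case instantiates it with [LTV = 0]. *)
Record regular_mfg : Prop := RegularMFG {
  reg_kernel : is_kernel P;
  reg_reward : reward_bounded r;
  reg_C0 : 1 <= C0;
  reg_C1 : 0 < C1 < 1;
  reg_ergodic : forall pi mu, is_policy pi -> simplex mu ->
    forall k, maxTV P pi mu k <= C0 * C1 ^+ k;
  reg_contraction : Assumption2 P delta;
  reg_lipschitz : Assumption3 P r L BV;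
  reg_unique : mf_unique P;
  reg_LV : LV_prop P r LV;
  reg_LTV : LTV_prop P LTV;
  reg_LTV_ge0 : 0 <= LTV;
  reg_gamma : gamma_prop P gamma }.

Hypothesis reg : regular_mfg.
Variables (s0 : S) (a0 : A).

Local Notation policy := {ffun S * A -> R}.
Local Notation mfield := {ffun S -> R}.
Local Notation Ker := (reg_kernel reg).

Definition ravg (pi : policy) (mu : mfield) (s : S) : R := \sum_a pi (s, a) * r s a mu.

Lemma reward_abs s a mu : simplex mu -> `|r s a mu| <= 1.
Proof. by move=> /(reg_reward reg s a)/andP[r0 r1]; rewrite ger0_norm. Qed.

Lemma L_gt0 : 0 < L.
Proof. by have [] := reg_lipschitz reg. Qed.

Lemma BV_gt0 : 0 < BV.
Proof. by have [_ [_ _ _ _ []]] := reg_lipschitz reg. Qed.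

Lemma LV_ge1 : 1 <= LV.
Proof. by have [] := reg_LV reg. Qed.

Lemma gamma_01 : 0 < gamma < 1.
Proof. by have [] := reg_gamma reg. Qed.

Lemma delta_01 : 0 < delta < 1.
Proof. by have [] := reg_contraction reg. Qed.

Section FixedPolicy.
Variables (pi : policy) (mu : mfield).
Hypotheses (hpi : is_policy pi) (hmu : simplex mu).
Local Notation chn := (chain P pi mu).
Local Notation nuv := (nu P pi mu).
Local Notation V := (Vfun P r pi mu).

Lemma nu_mfg_simplex : simplex nuv.
Proof. exact: (nu_simplex (reg_kernel reg) (reg_C1 reg) (reg_ergodic reg) hpi hmu s0). Qed.

Lemma nu_inv g : \sum_s nuv s * \sum_s' chn s s' * g s' = \sum_s nuv s * g s.
Proof.
exact: (nu_stationary (reg_kernel reg) (reg_C1 reg) (reg_ergodic reg) hpi hmu s0).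
Qed.

Lemma ravg_01 s : 0 <= ravg pi mu s <= 1.
Proof.
apply/andP; split.
  apply: sumr_ge0 => a _; rewrite mulr_ge0 ?(policy_ge0 hpi)//.
  by have /andP[] := reg_reward reg s a hmu.
rewrite -(policy_sum1 hpi s); apply: ler_sum => a _.
rewrite -[leRHS]mulr1 ler_wpM2l ?(policy_ge0 hpi)//.
by have /andP[] := reg_reward reg s a hmu.
Qed.

Lemma JE : J P r pi mu = \sum_s nuv s * ravg pi mu s.
Proof. by []. Qed.

Lemma J_01 : 0 <= J P r pi mu <= 1.
Proof.
have [n0 n1] := nu_mfg_simplex; rewrite JE; apply/andP; split.
  by apply: sumr_ge0 => s _; rewrite mulr_ge0//; case/andP: (ravg_01 s).
rewrite -n1; apply: ler_sum => s _; rewrite -[leRHS]mulr1 ler_wpM2l//.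
by case/andP: (ravg_01 s).
Qed.

Lemma V_norm : norm2 V <= BV.
Proof. by have [_ [_ _ _ _ [_]]] := reg_lipschitz reg; exact. Qed.

Lemma V_bellman s : V s = ravg pi mu s - J P r pi mu + \sum_s' chn s s' * V s'.
Proof.
have E x : V x = pois P pi mu (ravg pi mu) x by rewrite ffunE.
have B x : `|ravg pi mu x| <= 1.
  by have /andP[? ?] := ravg_01 x; rewrite ger0_norm.
rewrite E (pois_eq (reg_kernel reg) (reg_C0 reg) (reg_C1 reg) (reg_ergodic reg) hpi hmu ler01 B).
by congr (_ + _); apply: eq_bigr => x _; rewrite E.
Qed.

(** The relative action value without the term [- J], a constant that disappears when [Qfun] is
    summed against weights of total zero. *)
Definition Qfun (s : S) (a : A) : R := r s a mu + \sum_s' P mu s a s' * V s'.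

Lemma Qfun_abs s a : `|Qfun s a| <= 1 + BV.
Proof.
apply: le_trans (ler_normD _ _) _; apply: lerD; first exact: reward_abs.
apply: (ffun_avg_le (Ker hmu s a)) => x.
exact: le_trans (norm2_coord _ _) V_norm.
Qed.

Lemma Qfun_avg (p : A -> R) s : \sum_a p a * Qfun s a =
  \sum_a p a * r s a mu + \sum_a p a * \sum_s' P mu s a s' * V s'.
Proof. by rewrite -big_split; apply: eq_bigr => a _; rewrite /Qfun mulrDr. Qed.

End FixedPolicy.

(** Bellman's equation of [pi] is averaged over the stationary law of [pi'], whose invariance
    cancels the value function. *)
Lemma performance_difference pi pi' mu :
  is_policy pi -> is_policy pi' -> simplex mu ->
  J P r pi' mu - J P r pi mu =
  \sum_s nu P pi' mu s * \sum_a (pi' (s, a) - pi (s, a)) * Qfun pi mu s a.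
Proof.
move=> hpi hpi' hmu.
have E s : \sum_a (pi' (s, a) - pi (s, a)) * Qfun pi mu s a =
    (ravg pi' mu s + \sum_s' chain P pi' mu s s' * Vfun P r pi mu s')
    - (Vfun P r pi mu s + J P r pi mu).
  under eq_bigr do rewrite mulrBl; rewrite sumrB !Qfun_avg -!chain_avg.
  by rewrite -!/(ravg _ _ _) (V_bellman hpi hmu s); ring.
under eq_bigr do rewrite E mulrBr !mulrDr.
rewrite sumrB !big_split /= (nu_inv hpi' hmu) -mulr_suml.
have [_ ->] := nu_mfg_simplex hpi' hmu.
by rewrite JE; ring.
Qed.

Lemma nu_lipschitz pi1 pi2 mu1 mu2 :
  is_policy pi1 -> is_policy pi2 -> simplex mu1 -> simplex mu2 ->
  dTV (nu P pi1 mu1) (nu P pi2 mu2) <= L * (norm2 (pi1 - pi2) + norm2 (mu1 - mu2)).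
Proof. by have [_ [_ _ + _ _]] := reg_lipschitz reg; exact. Qed.

Lemma reward_lipschitz s a mu1 mu2 : simplex mu1 -> simplex mu2 ->
  `|r s a mu1 - r s a mu2| <= L * norm2 (mu1 - mu2).
Proof. by have [_ [+ _ _ _ _]] := reg_lipschitz reg; exact. Qed.

Lemma mustarP pi : is_policy pi ->
  simplex (mustar P pi) /\ mustar P pi = nu P pi (mustar P pi).
Proof.
move=> hpi; have [mu [[h1 h2] _]] := reg_unique reg hpi.
by apply: (@xgetPex _ 0 [set mu | simplex mu /\ mu = nu P pi mu]); exists mu.
Qed.

Lemma mustar_lipschitz pi1 pi2 : is_policy pi1 -> is_policy pi2 ->
  norm2 (mustar P pi1 - mustar P pi2) <= L * norm2 (pi1 - pi2).
Proof. by have [_ [_ _ _ + _]] := reg_lipschitz reg; exact. Qed.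

Lemma nu_mustar pi mu : is_policy pi -> simplex mu ->
  norm2 (nu P pi mu - mustar P pi) <= delta * norm2 (mu - mustar P pi).
Proof.
move=> hpi hmu; have [h1 h2] := mustarP hpi.
rewrite {1}h2; have [_] := reg_contraction reg; exact.
Qed.

(** Since [mustar] is a fixed point of a contraction with factor [delta], the direction [nu - mu]
    points towards it with rate [1 - delta]. *)
Lemma dot_nu_mustar pi mu : is_policy pi -> simplex mu ->
  dot (nu P pi mu - mu) (mu - mustar P pi) <= - (1 - delta) * norm2 (mu - mustar P pi) ^+ 2.
Proof.
move=> hpi hmu; have h := nu_mustar hpi hmu.
have -> : nu P pi mu - mu = (nu P pi mu - mustar P pi) - (mu - mustar P pi).
  by rewrite opprB addrA subrK.
rewrite dotBl -norm2_sqr.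
have := dot_le_bound h (lexx (norm2 (mu - mustar P pi))); lra.
Qed.

Lemma norm2_nu_sub pi mu : is_policy pi -> simplex mu ->
  norm2 (nu P pi mu - mu) <= 2 * norm2 (mu - mustar P pi).
Proof.
move=> hpi hmu; have h := nu_mustar hpi hmu.
apply: le_trans (norm2_dist (mustar P pi) _ _) _.
rewrite (norm2_subC (mustar P pi)).
have /andP[_ d1] := delta_01; have := norm2_ge0 (mu - mustar P pi); nra.
Qed.

(** One [L] comes from the stationary law, where rewards in [0, 1] save a factor 2, and one from the
    reward. *)
Lemma J_mu_lipschitz pi mu1 mu2 : is_policy pi -> simplex mu1 -> simplex mu2 ->
  `|J P r pi mu1 - J P r pi mu2| <= 2 * L * norm2 (mu1 - mu2).
Proof.
move=> hpi h1 h2; rewrite !JE.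
apply: le_trans (ler_distD (\sum_s nu P pi mu2 s * ravg pi mu1 s) _ _) _.
rewrite -mulrA mulr_natl mulr2n; apply: lerD.
  apply: le_trans (dTV_expect01 (nu_mfg_simplex hpi h1) (nu_mfg_simplex hpi h2) _) _.
    by move=> s; exact: ravg_01.
  have := nu_lipschitz hpi hpi h1 h2.
  by rewrite subrr norm2_0 add0r.
rewrite -sumrB; under eq_bigr do rewrite -mulrBr.
apply: simplex_avg_le; first exact: nu_mfg_simplex.
move=> s; rewrite /ravg -sumrB; under eq_bigr do rewrite -mulrBr.
by apply: (ffun_avg_le (hpi s)) => a; exact: reward_lipschitz.
Qed.

Lemma chain_lipschitz pi1 pi2 mu1 mu2 s :
  is_policy pi1 -> is_policy pi2 -> simplex mu1 -> simplex mu2 ->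
  \sum_s' `|chain P pi1 mu1 s s' - chain P pi2 mu2 s s'| <=
  2 * (L * (norm2 (pi1 - pi2) + norm2 (mu1 - mu2))).
Proof.
move=> hp1 hp2 h1 h2.
(* Starting both chains from the same point mass turns the bound on laws into a bound on the rows of
   the transition matrices. *)
have us : simplex (unitv R s).
  split=> [i|]; first by rewrite unitvE.
  rewrite (bigD1 s)//= unitvE eqxx big1 ?addr0// => i /negbTE.
  by rewrite unitvE => ->.
have E pi mu s' : step_law P pi mu (unitv R s) s' = chain P pi mu s s'.
  rewrite ffunE (bigD1 s)//= unitvE eqxx mul1r big1 ?addr0// => i /negbTE.
  by rewrite unitvE => ->; rewrite mul0r.
have [_ [_ h _ _ _]] := reg_lipschitz reg.
have {}h := h _ _ _ _ _ _ us us hp1 hp2 h1 h2; rewrite dTV_refl add0r in h.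
have {}h := le_trans (dTV_L1 _ _) (ler_wpM2l (ler0n R 2) h).
by apply: le_trans h; apply: ler_sum => s' _; rewrite !E.
Qed.

Lemma kernel_lipschitz mu1 mu2 s a s' : simplex mu1 -> simplex mu2 ->
  `|P mu1 s a s' - P mu2 s a s'| <= 2 * L * norm2 (mu1 - mu2).
Proof.
(* Under the policy that always plays [a], the chain is the kernel itself. *)
move=> h1 h2; pose d : policy := [ffun x => (x.2 == a)%:R].
have hd : is_policy d.
  move=> x; split=> [b|]; first by rewrite !ffunE.
  rewrite (bigD1 a)//= !ffunE eqxx big1 ?addr0// => b /negbTE.
  by rewrite !ffunE /= => ->.
have E mu : chain P d mu s s' = P mu s a s'.
  rewrite /chain (bigD1 a)//= ffunE eqxx mulr1 big1 ?addr0// => b /negbTE.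
  by rewrite ffunE /= => ->; rewrite mulr0.
have := chain_lipschitz s hd hd h1 h2.
rewrite subrr norm2_0 add0r -!E mulrA; apply: le_trans.
by rewrite [leRHS](bigD1 s')//= lerDl sumr_ge0.
Qed.

End Model.

(** * Stationary means of the sampled increments *)

Section StationaryMeans.
Variables (R : realType) (S A : finType).
Variables (P : {ffun S -> R} -> S -> A -> S -> R) (r : S -> A -> {ffun S -> R} -> R).
Variables (C0 C1 delta L BV LV LTV gamma : R).
Hypothesis reg : regular_mfg P r C0 C1 delta L BV LV LTV gamma.
Variables (s0 : S) (a0 : A).

Local Notation policy := {ffun S * A -> R}.
Local Notation mfield := {ffun S -> R}.
Local Notation Ker := (reg_kernel reg).
Implicit Types (th : {ffun S * A -> R}) (mu V : {ffun S -> R}).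

Definition stat_mean th mu (f : S -> A -> S -> R) : R :=
  \sum_s nu P (softmax th) mu s *
    \sum_a softmax th (s, a) * \sum_s' P mu s a s' * f s a s'.

Definition zF th mu V s a s' : {ffun S * A -> R} :=
  (r s a mu + V s' - V s) *: score th s a.

Definition zG mu V (j : R) s a s' : {ffun S -> R} :=
  (r s a mu - j + V s' - V s) *: unitv R s.

(** Written as a sum over triples because [LTV_prop] compares the joint laws of state, action and
    next state. *)
Definition joint_mean (I : finType) th mu (Z : S -> A -> S -> {ffun I -> R}) :=
  \sum_(x : S * A * S) joint P (softmax th) mu x *: Z x.1.1 x.1.2 x.2.

Definition Fbar th mu V := joint_mean th mu (zF th mu V).
Definition Gbar th mu V j := joint_mean th mu (zG mu V j).

Lemma spol th : is_policy (softmax th).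
Proof. exact: softmax_policy a0 th. Qed.

Lemma joint_sum th mu (f : S -> A -> S -> R) :
  \sum_x joint P (softmax th) mu x * f x.1.1 x.1.2 x.2 = stat_mean th mu f.
Proof.
transitivity (\sum_s \sum_a \sum_s' joint P (softmax th) mu (s, a, s') * f s a s').
  by rewrite pair_bigA pair_bigA; apply: eq_bigr => -[[s a] s'] _.
apply: eq_bigr => s _; rewrite mulr_sumr; apply: eq_bigr => a _.
rewrite !mulr_sumr; apply: eq_bigr => s' _.
by rewrite ffunE /=; ring.
Qed.

Lemma dot_joint_mean (I : finType) th mu (Z : S -> A -> S -> {ffun I -> R}) w :
  dot (joint_mean th mu Z) w = stat_mean th mu (fun s a s' => dot (Z s a s') w).
Proof.
rewrite -joint_sum /joint_mean.
elim: (index_enum _) => [|x l IH]; first by rewrite !big_nil dot0l.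
by rewrite !big_cons dotDl dotZl IH.
Qed.

Lemma joint_mean_coord (I : finType) th mu (Z : S -> A -> S -> {ffun I -> R}) i :
  joint_mean th mu Z i = stat_mean th mu (fun s a s' => Z s a s' i).
Proof.
rewrite -dot_unitv dot_joint_mean; congr stat_mean.
by apply/funext => s; apply/funext => a; apply/funext => s'; rewrite dot_unitv.
Qed.

Lemma joint_simplex th mu : simplex mu -> simplex (joint P (softmax th) mu).
Proof.
move=> hmu; have [n0 n1] := nu_mfg_simplex reg s0 (spol th) hmu; split.
  move=> x; rewrite ffunE !mulr_ge0//; last exact: (kernel_ge0 Ker).
  exact: (policy_ge0 (spol th)).
have := joint_sum th mu (fun _ _ _ => 1); under eq_bigr do rewrite mulr1.
move=> ->; rewrite -[RHS]n1; apply: eq_bigr => s _ /=.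
have E a : \sum_s' P mu s a s' * 1 = 1.
  by under eq_bigr do rewrite mulr1; exact: (kernel_sum1 Ker s a hmu).
under eq_bigr do rewrite E mulr1.
by rewrite (softmax_sum1 a0) mulr1.
Qed.

Lemma joint_mean_diff (I : finType) th1 th2 mu1 mu2
    (Z1 Z2 : S -> A -> S -> {ffun I -> R}) B e : simplex mu1 -> simplex mu2 ->
  0 <= B -> (forall s a s', norm2 (Z1 s a s') <= B) ->
  (forall s a s', norm2 (Z1 s a s' - Z2 s a s') <= e) ->
  norm2 (joint_mean th1 mu1 Z1 - joint_mean th2 mu2 Z2) <=
  2 * (LTV * (norm2 (th1 - th2) + norm2 (mu1 - mu2))) * B + e.
Proof.
move=> h1 h2 B0 ZB Ze.
apply: le_trans (norm2_dist (\sum_x joint P (softmax th2) mu2 x *: Z1 x.1.1 x.1.2 x.2) _ _) _.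
apply: lerD.
  apply: le_trans (norm2_dTV_expect _ _ B0 _) _; first by move=> x; exact: ZB.
  rewrite ler_wpM2r// ler_wpM2l//.
  apply: le_trans (reg_LTV reg (spol th1) (spol th2) h1 h2) _.
  by rewrite ler_wpM2l ?(reg_LTV_ge0 reg)// lerD2r softmax_lipschitz.
rewrite /joint_mean -sumrB; under eq_bigr do rewrite -scalerBr.
apply: le_trans (norm2_wsum _ (fun x => Ze x.1.1 x.1.2 x.2)) _.
have [j0 j1] := joint_simplex th2 h2.
under eq_bigr do rewrite ger0_norm//.
by rewrite j1 mul1r.
Qed.

Lemma zF_abs mu V s a s' : simplex mu -> norm2 V <= BV ->
  `|r s a mu + V s' - V s| <= 1 + 2 * BV.
Proof.
move=> hmu hV; have := reward_abs reg s a hmu.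
have := norm2_coord V s; have := norm2_coord V s'.
move=> h1 h2 h3; apply: le_trans (ler_normB _ _) _.
by have := ler_normD (r s a mu) (V s'); lra.
Qed.

(** The factor 4 is dictated by the total variation term: a factor 2 from [dTV] times the bound
    [2 * (1 + 2 * BV)] on the increments gives [8 * BV * LTV], while [cL_F] contains
    [2 * BV * LTV]. *)
Lemma Fbar_lipschitz th1 th2 mu1 mu2 V1 V2 : simplex mu1 -> simplex mu2 ->
  norm2 V1 <= BV -> norm2 V2 <= BV ->
  norm2 (Fbar th1 mu1 V1 - Fbar th2 mu2 V2) <=
  4 * cL_F BV L LTV * (norm2 (th1 - th2) + norm2 (mu1 - mu2) + norm2 (V1 - V2)).
Proof.
move=> h1 h2 hV1 hV2; have B0 := BV_gt0 reg; have L0 := L_gt0 reg.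
have T0 := reg_LTV_ge0 reg.
apply: le_trans (@joint_mean_diff _ th1 th2 mu1 mu2 (zF th1 mu1 V1) (zF th2 mu2 V2)
  (2 * (1 + 2 * BV)) (2 * (L * norm2 (mu1 - mu2) + 2 * norm2 (V1 - V2))
     + (1 + 2 * BV) * norm2 (th1 - th2)) h1 h2 _ _ _) _.
- by lra.
- move=> s a s'; rewrite norm2Z mulrC.
  by apply: ler_pM; rewrite ?norm2_ge0 ?norm2_score// zF_abs.
- move=> s a s'; rewrite /zF; set c1 := _ + _ - _; set c2 := _ + _ - _.
  have E (u v : policy) (c c' : R) : c *: u - c' *: v = (c - c') *: u + c' *: (u - v).
    by rewrite scalerBl scalerBr addrA subrK.
  rewrite E; apply: le_trans (norm2D _ _) _; rewrite !norm2Z; apply: lerD.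
    rewrite mulrC; apply: ler_pM; rewrite ?norm2_ge0 ?norm2_score//.
    have -> : c1 - c2 = (r s a mu1 - r s a mu2) + ((V1 - V2) s' - (V1 - V2) s).
      by rewrite /c1 /c2 !ffunE; ring.
    apply: le_trans (ler_normD _ _) _.
    apply: lerD; first exact: (reward_lipschitz reg).
    apply: le_trans (ler_normB _ _) _.
    by have := norm2_coord (V1 - V2) s; have := norm2_coord (V1 - V2) s'; lra.
  apply: ler_pM; rewrite ?norm2_ge0 ?norm2_score_diff//.
  exact: zF_abs.
set x := norm2 _; set y := norm2 _; set z := norm2 _.
have x0 : 0 <= x := norm2_ge0 _; have y0 : 0 <= y := norm2_ge0 _.
have z0 : 0 <= z := norm2_ge0 _.
rewrite /cL_F /cB_F.
have := mulr_ge0 (ltW B0) x0; have := mulr_ge0 (ltW B0) y0; have := mulr_ge0 (ltW B0) z0.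
have := mulr_ge0 (ltW L0) x0; have := mulr_ge0 (ltW L0) z0; have := mulr_ge0 (ltW L0) y0.
have := mulr_ge0 T0 x0; have := mulr_ge0 T0 y0; have := mulr_ge0 T0 z0.
have := mulr_ge0 (mulr_ge0 (ltW B0) T0) z0; nra.
Qed.

Lemma Gbar_lipschitz cJ th1 th2 mu1 mu2 V1 V2 j1 j2 : 1 <= cJ ->
  simplex mu1 -> simplex mu2 -> norm2 V1 <= BV -> norm2 V2 <= BV ->
  0 <= j1 <= 1 ->
  norm2 (Gbar th1 mu1 V1 j1 - Gbar th2 mu2 V2 j2) <=
  cL_G BV cJ L LTV *
    (norm2 (th1 - th2) + norm2 (mu1 - mu2) + norm2 (V1 - V2) + `|j1 - j2|).
Proof.
move=> cJ1 h1 h2 hV1 hV2 hj; have B0 := BV_gt0 reg; have L0 := L_gt0 reg.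
have T0 := reg_LTV_ge0 reg.
apply: le_trans (@joint_mean_diff _ th1 th2 mu1 mu2 (zG mu1 V1 j1) (zG mu2 V2 j2)
  (1 + 2 * BV) (L * norm2 (mu1 - mu2) + 2 * norm2 (V1 - V2) + `|j1 - j2|) h1 h2 _ _ _) _.
- by lra.
- move=> s a s'; rewrite norm2Z norm2_unitv mulr1.
  have := norm2_coord V1 s; have := norm2_coord V1 s'.
  have /andP[r0 r1] := reg_reward reg s a h1; case/andP: hj => j0 j1'.
  rewrite !ler_norml => /andP[? ?] /andP[? ?]; apply/andP; split; lra.
- move=> s a s'; rewrite /zG -scalerBl norm2Z norm2_unitv mulr1.
  have -> : r s a mu1 - j1 + V1 s' - V1 s - (r s a mu2 - j2 + V2 s' - V2 s) =
     (r s a mu1 - r s a mu2) + ((V1 - V2) s' - (V1 - V2) s) - (j1 - j2).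
    by rewrite !ffunE; ring.
  apply: le_trans (ler_normB _ _) _; rewrite lerD2r.
  apply: le_trans (ler_normD _ _) _; apply: lerD; first exact: (reward_lipschitz reg).
  apply: le_trans (ler_normB _ _) _.
  by have := norm2_coord (V1 - V2) s; have := norm2_coord (V1 - V2) s'; lra.
set x := norm2 _; set y := norm2 _; set z := norm2 _; set w := `|_|.
have x0 : 0 <= x := norm2_ge0 _; have y0 : 0 <= y := norm2_ge0 _.
have z0 : 0 <= z := norm2_ge0 _; have w0 : 0 <= w := normr_ge0 _.
have c2 : 2 * (1 + 2 * BV) * LTV <= 4 * (BV + cJ + 2) * LTV by rewrite ler_wpM2r//; lra.
have G0 : 0 <= 4 * (BV + cJ + 2) * LTV by rewrite !mulr_ge0//; lra.
have LL : L * cJ >= L by rewrite ler_peMr// ltW.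
have -> : cL_G BV cJ L LTV = 4 * (BV + cJ + 2) * LTV + (L * cJ + L + cJ + 3).
  by rewrite /cL_G /cB_G; ring.
set g := 4 * _ * _ in c2 G0 *.
have := ler_wpM2r x0 c2; have := ler_wpM2r y0 c2.
have k1 := mulr_ge0 G0 z0; have k2 := mulr_ge0 G0 w0.
have k3 : (L + 1) * y <= (L * cJ + L + cJ + 3) * y by rewrite ler_wpM2r//; lra.
have k4 : 0 <= (L * cJ + L + cJ + 3) * x by rewrite mulr_ge0//; lra.
have k5 : 2 * z <= (L * cJ + L + cJ + 3) * z by rewrite ler_wpM2r//; lra.
have k6 : w <= (L * cJ + L + cJ + 3) * w by rewrite ler_peMl//; lra.
lra.
Qed.

Lemma hbar_lipschitz th1 th2 mu1 mu2 : simplex mu1 -> simplex mu2 ->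
  norm2 ((nu P (softmax th1) mu1 - mu1) - (nu P (softmax th2) mu2 - mu2)) <=
  2 * cL_H L * (norm2 (th1 - th2) + norm2 (mu1 - mu2)).
Proof.
move=> h1 h2; have L0 := L_gt0 reg.
have E (u v w z : mfield) : u - v - (w - z) = (u - w) - (v - z).
  by apply/ffunP => i; rewrite !ffunE; ring.
rewrite E; apply: le_trans (norm2B _ _) _; rewrite /cL_H.
have := norm2_dTV (nu P (softmax th1) mu1) (nu P (softmax th2) mu2).
have := nu_lipschitz reg (spol th1) (spol th2) h1 h2.
have := softmax_lipschitz a0 th1 th2 => h.
have := ler_wpM2l (ltW L0) h; have := norm2_ge0 (th1 - th2).
have := norm2_ge0 (mu1 - mu2); lra.
Qed.

End StationaryMeans.

(** * Policy gradient and critic *)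

Section PolicyGradient.
Variables (R : realType) (S A : finType).
Variables (P : {ffun S -> R} -> S -> A -> S -> R) (r : S -> A -> {ffun S -> R} -> R).
Variables (C0 C1 delta L BV LV LTV gamma : R).
Hypothesis reg : regular_mfg P r C0 C1 delta L BV LV LTV gamma.
Variables (s0 : S) (a0 : A).

Local Notation policy := {ffun S * A -> R}.
Local Notation mfield := {ffun S -> R}.
Local Notation Ker := (reg_kernel reg).
Local Notation spol := (spol a0).
Local Notation Vpi th mu := (Vfun P r (softmax th) mu).
Local Notation Jpi th mu := (J P r (softmax th) mu).
Implicit Types (th : {ffun S * A -> R}) (mu V : {ffun S -> R}).

Lemma dsoftmax_sum0 th d s : \sum_a dsoftmax th d (s, a) = 0.
Proof.
under eq_bigr do rewrite dsoftmaxE mulrBr.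
by rewrite sumrB -mulr_suml (softmax_sum1 a0) mul1r subrr.
Qed.

Lemma dot_Fbar th mu V d : simplex mu -> dot (Fbar P r th mu V) d =
  \sum_s nu P (softmax th) mu s * \sum_a dsoftmax th d (s, a) *
    (r s a mu + \sum_s' P mu s a s' * V s').
Proof.
move=> hmu; rewrite dot_joint_mean; apply: eq_bigr => s _; congr (_ * _).
have E a : softmax th (s, a) * \sum_s' P mu s a s' * dot (zF r th mu V s a s') d =
    dsoftmax th d (s, a) * (r s a mu + \sum_s' P mu s a s' * V s')
    - dsoftmax th d (s, a) * V s.
  rewrite dsoftmax_score.
  have -> : \sum_s' P mu s a s' * dot (zF r th mu V s a s') d =
     (\sum_s' P mu s a s' * (r s a mu - V s) + \sum_s' P mu s a s' * V s')
        * dot (score th s a) d.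
    rewrite -big_split mulr_suml; apply: eq_bigr => s' _ /=.
    by rewrite dotZl; ring.
  by rewrite -mulr_suml (kernel_sum1 Ker s a hmu); ring.
by under eq_bigr do rewrite E; rewrite sumrB -mulr_suml dsoftmax_sum0 mul0r subr0.
Qed.

Definition taylorK : R := 2 * L * (#|A|%:R * (1 + BV)) + #|A|%:R * (2 + #|A|%:R) * (1 + BV).

(** The stationary law is known to be Lipschitz in the policy, not differentiable. The performance
    difference formula makes this sufficient: the inner sum is already of order [norm2 d], so
    replacing the new stationary law by the old one costs second order, and only the softmax needs
    to be linearised. *)
Lemma J_taylor th mu d : simplex mu ->
  `|Jpi (th + d) mu - Jpi th mu - dot (Fbar P r th mu (Vpi th mu)) d|
    <= taylorK * norm2 d ^+ 2.
Proof.
move=> hmu; have B0 := BV_gt0 reg; have L0 := L_gt0 reg; have d0 := norm2_ge0 d.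
rewrite (performance_difference reg s0 (spol th) (spol (th + d)) hmu) dot_Fbar//.
set nu' := nu P (softmax (th + d)) mu; set nu0 := nu P (softmax th) mu.
have dpi : norm2 (softmax (th + d) - softmax th) <= norm2 d.
  by apply: le_trans (softmax_lipschitz a0 _ _) _; rewrite addrC addKr.
pose D s := \sum_a (softmax (th + d) (s, a) - softmax th (s, a)) * Qfun P r (softmax th) mu s a.
pose E s := \sum_a dsoftmax th d (s, a) * Qfun P r (softmax th) mu s a.
have QB s a : `|Qfun P r (softmax th) mu s a| <= 1 + BV := Qfun_abs reg (spol th) hmu s a.
have cardE (c : R) : \sum_(a : A) c = #|A|%:R * c by rewrite sumr_const mulr_natl.
have DB s : `|D s| <= #|A|%:R * (1 + BV) * norm2 d.
  rewrite /D -mulrA -cardE; apply: le_trans (ler_norm_sum _ _ _) _.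
  apply: ler_sum => a _; rewrite normrM mulrC; apply: ler_pM => //.
  by have := norm2_coord (softmax (th + d) - softmax th) (s, a); rewrite !ffunE => /le_trans; apply.
have DE s : `|D s - E s| <= #|A|%:R * (2 + #|A|%:R) * (1 + BV) * norm2 d ^+ 2.
  rewrite /D /E -sumrB.
  have -> : #|A|%:R * (2 + #|A|%:R) * (1 + BV) * norm2 d ^+ 2 =
    \sum_(a : A) (2 + #|A|%:R) * norm2 d ^+ 2 * (1 + BV) by rewrite cardE; ring.
  apply: le_trans (ler_norm_sum _ _ _) _; apply: ler_sum => a _.
  rewrite -mulrBl normrM; apply: ler_pM => //; exact: softmax_taylor.
have -> : \sum_s nu' s * D s - \sum_s nu0 s * E s =
    (\sum_s nu' s * D s - \sum_s nu0 s * D s) + \sum_s nu0 s * (D s - E s).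
  by under [X in _ = _ + X]eq_bigr do rewrite mulrBr; rewrite sumrB addrA subrK.
apply: le_trans (ler_normD _ _) _; rewrite /taylorK [leRHS]mulrDl; apply: lerD.
  have c0 : 0 <= #|A|%:R * (1 + BV) * norm2 d by rewrite !mulr_ge0//; lra.
  apply: le_trans (dTV_expect _ _ c0 DB) _.
  have := nu_lipschitz reg (spol (th + d)) (spol th) hmu hmu.
  rewrite subrr norm2_0 addr0 => /le_trans/(_ (ler_wpM2l (ltW L0) dpi)) h.
  have -> : 2 * L * (#|A|%:R * (1 + BV)) * norm2 d ^+ 2 =
    2 * (L * norm2 d) * (#|A|%:R * (1 + BV) * norm2 d) by ring.
  by rewrite ler_wpM2r// ler_wpM2l.
exact: simplex_avg_le (nu_mfg_simplex reg s0 (spol th) hmu) DE.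
Qed.

Lemma grad_J th mu : simplex mu ->
  grad (fun th' => Jpi th' mu) th = Fbar P r th mu (Vpi th mu).
Proof. by move=> hmu; apply: grad_of_taylor => d; exact: J_taylor. Qed.

Lemma chain_perp th mu V s : simplex mu ->
  \sum_s' chain P (softmax th) mu s s' * V s' - V s =
  \sum_s' chain P (softmax th) mu s s' * proj_perp V s' - proj_perp V s.
Proof.
move=> hmu; under [in RHS]eq_bigr do rewrite proj_perpE mulrBr.
rewrite sumrB -mulr_suml (chain_sum1 Ker (spol th) hmu) proj_perpE; ring.
Qed.

(** The squared norm of the difference [F] is computed by pairing it with itself. Constants in the
    critic drop out since [dsoftmax] sums to zero over actions, which leaves at most [U * norm2 D],
    where [U] is a mean absolute deviation of [F]. Jensen's inequality gives [U <= norm2 F], hence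
    the constant 1. *)
Lemma Fbar_V_diff th mu V V' : simplex mu ->
  norm2 (Fbar P r th mu V - Fbar P r th mu V') <= norm2 (proj_perp (V - V')).
Proof.
move=> hmu; set F := _ - _; set D := proj_perp _.
have [n0 n1] := nu_mfg_simplex reg s0 (spol th) hmu.
pose X s a := \sum_s' P mu s a s' * D s'.
have XB s a : `|X s a| <= norm2 D.
  by apply: (ffun_avg_le (Ker hmu s a)) => s'; exact: norm2_coord.
pose m s := \sum_b softmax th (s, b) * F (s, b).
pose W := \sum_s nu P (softmax th) mu s * \sum_a softmax th (s, a) * (F (s, a) - m s) * X s a.
have FW : dot F F = W.
  rewrite {1}/F dotBl !dot_Fbar// -sumrB; apply: eq_bigr => s _; rewrite -mulrBr; congr (_ * _).
  rewrite -sumrB.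
  transitivity (\sum_a dsoftmax th F (s, a) * (X s a + avg (V - V'))).
    apply: eq_bigr => a _; rewrite -mulrBr; congr (_ * _).
    rewrite opprD addrACA subrr add0r -sumrB /X.
    have -> : avg (V - V') = \sum_s' P mu s a s' * avg (V - V').
      by rewrite -mulr_suml (kernel_sum1 Ker s a hmu) mul1r.
    rewrite -big_split; apply: eq_bigr => s' _ /=.
    by rewrite -mulrBr -mulrDr proj_perpE subrK !ffunE.
  under eq_bigr do rewrite mulrDr.
  rewrite big_split /= -mulr_suml dsoftmax_sum0 mul0r addr0.
  by apply: eq_bigr => a _; rewrite dsoftmaxE.
pose U := \sum_s nu P (softmax th) mu s * \sum_a softmax th (s, a) * `|F (s, a) - m s|.
have WU : W <= U * norm2 D.
  apply: le_trans (ler_norm _) _; rewrite /W /U mulr_suml.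
  apply: le_trans (ler_norm_sum _ _ _) _; apply: ler_sum => s _.
  rewrite normrM (ger0_norm (n0 s)) -mulrA ler_wpM2l// mulr_suml.
  apply: le_trans (ler_norm_sum _ _ _) _; apply: ler_sum => a _.
  by rewrite !normrM (gtr0_norm (softmax_gt0 a0 th s a)) ler_wpM2l// mulr_ge0// ltW// softmax_gt0.
have U0 : 0 <= U.
  apply: sumr_ge0 => s _; rewrite mulr_ge0// sumr_ge0// => a _.
  by rewrite mulr_ge0// ltW// softmax_gt0.
have p0 s a : 0 <= softmax th (s, a) by rewrite ltW// softmax_gt0.
have UF : U ^+ 2 <= norm2 F ^+ 2.
  apply: le_trans (simplex_jensen_sqr _ (nu_mfg_simplex reg s0 (spol th) hmu)) _.
  rewrite norm2_sqr /dot.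
  have -> : \sum_x F x * F x = \sum_s \sum_a F (s, a) ^+ 2.
    by rewrite pair_bigA; apply: eq_bigr => -[s a] _; rewrite expr2.
  apply: ler_sum => s _.
  have js : (\sum_a softmax th (s, a) * `|F (s, a) - m s|) ^+ 2 <= \sum_a F (s, a) ^+ 2.
    have := simplex_jensen_sqr (fun a => `|F (s, a) - m s|) (spol th s).
    under eq_bigr do rewrite ffunE; move=> /le_trans; apply.
    under eq_bigr do rewrite ffunE real_normK ?num_real//.
    have E (c : R) : \sum_a softmax th (s, a) * (F (s, a) - c) ^+ 2 =
        \sum_a softmax th (s, a) * F (s, a) ^+ 2
        - 2 * c * \sum_a softmax th (s, a) * F (s, a)
        + c ^+ 2 * \sum_a softmax th (s, a).
      rewrite !mulr_sumr -sumrB -big_split; apply: eq_bigr => a _ /=; ring.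
    rewrite E (softmax_sum1 a0) -/(m s).
    have h : \sum_a softmax th (s, a) * F (s, a) ^+ 2 <= \sum_a F (s, a) ^+ 2.
      by apply: ler_sum => a _; rewrite ler_piMl ?sqr_ge0// softmax_le1.
    by have := sqr_ge0 (m s); lra.
  rewrite -[leRHS]mul1r; apply: ler_pM => //; first exact: sqr_ge0.
  exact: (simplex_le1 (nu_mfg_simplex reg s0 (spol th) hmu)).
have {}UF : U <= norm2 F by rewrite -(@ler_pXn2r _ 2) ?nnegrE ?norm2_ge0.
have F0 := norm2_ge0 F; have D0 := norm2_ge0 D.
rewrite leNgt; apply/negP => DF.
have F1 : 0 < norm2 F by lra.
have : norm2 F ^+ 2 <= norm2 F * norm2 D.
  by rewrite norm2_sqr FW (le_trans WU)// ler_wpM2r.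
by rewrite expr2 ler_pM2l//; lra.
Qed.

Section Critic.
Variables (th : policy) (mu V : mfield) (j : R).
Hypothesis hmu : simplex mu.
Let D := proj_perp (V - Vpi th mu).
Local Notation nuv := (nu P (softmax th) mu).
Local Notation chn := (chain P (softmax th) mu).

(** Bellman's equation replaces the mean reward by the value function, so the critic direction
    depends on [V] only through its error modulo constants. *)
Lemma Gbar_coord s : Gbar P r th mu V j s =
  nuv s * (Jpi th mu - j + (\sum_s' chn s s' * D s' - D s)).
Proof.
rewrite joint_mean_coord /stat_mean.
rewrite (bigD1 s)//= [X in _ + X]big1 ?addr0; last first.
  move=> x /negbTE xs; rewrite big1 ?mulr0// => a _; rewrite big1 ?mulr0// => s' _.
  by rewrite ffunE unitvE eq_sym xs /GRing.scale/= !mulr0.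
congr (_ * _); rewrite /D -chain_perp//.
have -> : \sum_s' chn s s' * (V - Vpi th mu) s' - (V - Vpi th mu) s =
   (\sum_s' chn s s' * V s' - V s) - (\sum_s' chn s s' * Vpi th mu s' - Vpi th mu s).
  have -> : \sum_s' chn s s' * (V - Vpi th mu) s' =
     \sum_s' chn s s' * V s' - \sum_s' chn s s' * Vpi th mu s'.
    by rewrite -sumrB; apply: eq_bigr => s' _; rewrite -mulrBr !ffunE.
  rewrite [(V - _) s]ffunE [(- Vpi th mu) s]ffunE; ring.
have := V_bellman reg (spol th) hmu s.
set Vs := Vpi th mu s; set PV := \sum_s' chn s s' * Vpi th mu s' => bell.
have -> : \sum_a softmax th (s, a) * \sum_s' P mu s a s' * zG r mu V j s a s' s =
   \sum_a softmax th (s, a) * r s a mu + \sum_s' chn s s' * V s' - (j + V s).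
  rewrite chain_avg -big_split /= -[j + V s]mul1r -(softmax_sum1 a0 th s) mulr_suml -sumrB.
  apply: eq_bigr => a _; rewrite -mulrDr -mulrBr; congr (_ * _).
  rewrite -[r s a mu]mul1r -[j + V s]mul1r -(kernel_sum1 Ker s a hmu) !mulr_suml.
  rewrite -big_split -sumrB; apply: eq_bigr => s' _ /=.
  rewrite [zG _ _ _ _ _ _ _ _]ffunE unitvE eqxx /GRing.scale/=.
  ring.
by rewrite -/(ravg r (softmax th) mu s); move: bell; lra.
Qed.

Lemma norm2_Gbar : norm2 (Gbar P r th mu V j) <= `|Jpi th mu - j| + 2 * norm2 D.
Proof.
have hn := nu_mfg_simplex reg s0 (spol th) hmu; have [n0 n1] := hn.
apply: le_trans (norm2_le_sum _) _; set b := `|_| + _.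
have -> : b = \sum_s nuv s * b by rewrite -mulr_suml n1 mul1r.
apply: ler_sum => s _; rewrite Gbar_coord normrM (ger0_norm (n0 s)) ler_wpM2l//.
apply: le_trans (ler_normD _ _) _; rewrite lerD2l.
apply: le_trans (ler_normB _ _) _; rewrite mulr_natl mulr2n.
apply: lerD; last exact: norm2_coord.
have hc : simplex [ffun s' => chn s s'].
  split=> [x|]; first by rewrite ffunE (chain_ge0 Ker (spol th) hmu).
  by under eq_bigr do rewrite ffunE; rewrite (chain_sum1 Ker (spol th) hmu).
by apply: (ffun_avg_le hc) => x; exact: norm2_coord.
Qed.

(** In the mean, the constant mode of the critic is driven by the error of the average reward alone.
    This links it to the recursion of [Jh]. *)
Lemma Gbar_sum : \sum_s Gbar P r th mu V j s = Jpi th mu - j.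
Proof.
have [n0 n1] := nu_mfg_simplex reg s0 (spol th) hmu.
under eq_bigr do rewrite Gbar_coord mulrDr [X in _ + X]mulrBr.
rewrite big_split /= -mulr_suml n1 mul1r sumrB.
by rewrite (nu_inv reg s0 (spol th) hmu) subrr addr0.
Qed.

Lemma dot_Gbar : dot (Gbar P r th mu V j) D <=
  - gamma * norm2 D ^+ 2 + `|Jpi th mu - j| * norm2 D.
Proof.
have hn := nu_mfg_simplex reg s0 (spol th) hmu; have [n0 n1] := hn.
have -> : dot (Gbar P r th mu V j) D = (Jpi th mu - j) * dot nuv D +
    \sum_s nuv s * (D s * (\sum_s' chn s s' * D s' - D s)).
  rewrite mulr_sumr -big_split; apply: eq_bigr => s _ /=.
  by rewrite Gbar_coord; ring.
rewrite addrC; apply: lerD.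
  have [_ h] := reg_gamma reg.
  apply: le_trans (h th mu D hmu (proj_perp_sum0 s0 _)).
  apply: ler_sum => s _; rewrite ler_wpM2l// le_eqVlt; apply/orP; left; apply/eqP.
  rewrite chain_avg mulrBr mulr_sumr.
  have -> : D s * D s = \sum_a softmax th (s, a) * (D s * D s).
    by rewrite -mulr_suml (softmax_sum1 a0) mul1r.
  rewrite -sumrB; apply: eq_bigr => a _; rewrite mulrCA -mulrBr; congr (_ * _).
  have -> : D s * D s = \sum_s' P mu s a s' * (D s * D s).
    by rewrite -mulr_suml (kernel_sum1 Ker s a hmu) mul1r.
  rewrite mulr_sumr -sumrB; apply: eq_bigr => s' _; ring.
apply: le_trans (ler_norm _) _; rewrite normrM ler_wpM2l//.
apply: le_trans (dot_CS _ _) _; rewrite ler_piMl ?norm2_ge0//.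
exact: simplex_norm2.
Qed.

End Critic.

Lemma stat_mean_telescope th mu V : simplex mu ->
  stat_mean P th mu (fun s a s' => V s' - V s) = 0.
Proof.
move=> hmu; rewrite /stat_mean.
transitivity (\sum_s nu P (softmax th) mu s *
    (\sum_s' chain P (softmax th) mu s s' * V s' - V s)).
  apply: eq_bigr => s _; congr (_ * _).
  rewrite chain_avg -[V s in RHS]mul1r -(softmax_sum1 a0 th s) mulr_suml -sumrB.
  apply: eq_bigr => a _; rewrite -mulrBr; congr (_ * _).
  rewrite -[V s in RHS]mul1r -(kernel_sum1 Ker s a hmu) mulr_suml -sumrB.
  by apply: eq_bigr => s' _; rewrite mulrBr.
under eq_bigr do rewrite mulrBr.
by rewrite sumrB (nu_inv reg s0 (spol th) hmu) subrr.
Qed.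

(** The numerator 1/2 bounds the standard deviation of a reward in [0, 1]. Unlike [BV], this bound
    is tied to [gamma], as the actor weight in [actor_weight] requires. *)
Lemma Vperp_bound th mu : simplex mu -> norm2 (proj_perp (Vpi th mu)) <= (2 * gamma)^-1.
Proof.
move=> hmu; set y := proj_perp _; have /andP[g0 g1] := gamma_01 reg.
have hn := nu_mfg_simplex reg s0 (spol th) hmu; have [n0 n1] := hn.
have y0 := norm2_ge0 y.
pose c s := ravg r (softmax th) mu s - Jpi th mu.
pose w : mfield := [ffun s => nu P (softmax th) mu s * c s].
have G : gamma * norm2 y ^+ 2 <= dot w y.
  (* testing Bellman's equation against [y] and using the negativity of the drift matrix *)
  have := dot_Gbar th 0 (Jpi th mu) hmu; rewrite subrr normr0 mul0r addr0.
  have -> : proj_perp (0 - Vpi th mu) = - y.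
    by rewrite proj_perpB (_ : proj_perp 0 = 0) ?sub0r//; apply: proj_perp_id;
       rewrite big1// => i _; rewrite ffunE.
  rewrite norm2N dotNr.
  have -> : Gbar P r th mu 0 (Jpi th mu) = w.
    apply/ffunP => s; rewrite Gbar_coord// subrr add0r -chain_perp// [RHS]ffunE; congr (_ * _).
    have := V_bellman reg (spol th) hmu s; rewrite /c.
    have oppE (f : mfield) x : (0 - f) x = - f x by rewrite sub0r ffunE.
    have -> : \sum_s' chain P (softmax th) mu s s' * (0 - Vpi th mu) s' =
      - \sum_s' chain P (softmax th) mu s s' * Vpi th mu s'.
      by rewrite -sumrN; apply: eq_bigr => s' _; rewrite oppE mulrN.
    rewrite oppE.
    lra.
  lra.
have W : norm2 w <= 2^-1.
  apply: norm2_le; first by lra.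
  apply: (@le_trans _ _ (\sum_s nu P (softmax th) mu s * c s ^+ 2)).
    apply: ler_sum => s _; rewrite ffunE.
    have n01 : nu P (softmax th) mu s <= 1 by exact: simplex_le1.
    have -> : nu P (softmax th) mu s * c s * (nu P (softmax th) mu s * c s) =
      nu P (softmax th) mu s * (nu P (softmax th) mu s * c s ^+ 2) by ring.
    by rewrite ler_wpM2l// ler_piMl ?sqr_ge0.
  have E (k : R) : \sum_s nu P (softmax th) mu s * (ravg r (softmax th) mu s - k) ^+ 2 =
      \sum_s nu P (softmax th) mu s * ravg r (softmax th) mu s ^+ 2
      - 2 * k * \sum_s nu P (softmax th) mu s * ravg r (softmax th) mu s
      + k ^+ 2 * \sum_s nu P (softmax th) mu s.
    rewrite !mulr_sumr -sumrB -big_split; apply: eq_bigr => s _ /=; ring.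
  rewrite /c E n1 -JE.
  have le1 : \sum_s nu P (softmax th) mu s * ravg r (softmax th) mu s ^+ 2 <= Jpi th mu.
    rewrite JE; apply: ler_sum => s _; rewrite ler_wpM2l// expr2.
    by have /andP[? ?] := ravg_01 reg (spol th) hmu s; rewrite ler_piMl.
  by have := sqr_ge0 (Jpi th mu - 2^-1); nra.
have {}G : gamma * norm2 y ^+ 2 <= 2^-1 * norm2 y.
  by apply: le_trans G _; apply: dot_le_bound.
have [->|yn] := eqVneq (norm2 y) 0; first by rewrite invr_ge0; lra.
have {}yn : 0 < norm2 y by rewrite lt_neqAle eq_sym yn.
have {}G : gamma * norm2 y <= 2^-1 by rewrite -(ler_pM2r yn) -mulrA -expr2.
by rewrite invfM mulrC ler_pdivlMl// mulrC -ler_pdivlMl// ?invrK; lra.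
Qed.

End PolicyGradient.

(** * Weights and step sizes *)

Section DriftForm.
Variable R : realFieldType.

(* [raw_drift] below, per unit of the actor step, after rescaling m and r by the Lipschitz constants
   and j and q by gamma; the coefficients are the weights and the worst step-size ratios. *)
Definition drift_form (om G m v j p q q2 r : R) : R :=
  - om * G ^+ 2 + om * (G * (p + m + v))
  - 80 * m ^+ 2 + 80 * (m * r) + 5 * (m * (G + p + m + v))
  - 2 * v ^+ 2 + 2 * (v * (j + q)) + 1 / 29 * (v * (G + p + m + v))
  + 1 / (48 * 72) * (v * (2 * m + r))
  + 2 * ((j + 2 * m) * (2 * v + j + q)) + 1 / 144 * ((q + q2) * (2 * v + j + q))
  - 128 * j ^+ 2 + 128 * (j * q2) + 64 / 29 * (j * (G + p + m + v))
  + 1 / 54 * (j * (2 * m + r))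
  - 40 * p ^+ 2 + 1 / 6 * (p * (G + p + m + v)) + 1 / 2 * (p * (2 * m + r))
  + 8 / 9 * (p * (2 * v + j + q))
  - 48 * q ^+ 2 + 1 / 4 * (q * (G + p + m + v)) + 3 / 4 * (q * (2 * m + r))
  + 2 / 3 * (q * (2 * v + j + q + (j + q2)))
  - 640 * q2 ^+ 2 + 5 / 3 * (q2 * (G + p + m + v)) + 5 / 54 * (q2 * (2 * m + r))
  + 80 / 9 * (q2 * (j + q2))
  - 120 * 100 * r ^+ 2 + 125 / 36 * (r * (G + p + m + v + (2 * m + r))).

(* The squares certify diagonal dominance of the quadratic form in a rescaled basis. *)
Lemma drift_form_low G m v j p q q2 r :
  drift_form (1 / 2) G m v j p q q2 r <= - (1 / 100) * (G ^+ 2 + m ^+ 2 + v ^+ 2 + j ^+ 2).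
Proof.
rewrite /drift_form.
have := sqr_ge0 ((9 * 100 + 43) * G - (100 * 100) * m).
have := sqr_ge0 ((59 * 100 + 17) * G - (100 * 100) * v).
have := sqr_ge0 (89 * G - (25 * 100) * j).
have := sqr_ge0 (169 * G - (50 * 100) * p).
have := sqr_ge0 (169 * G - (50 * 100) * q).
have := sqr_ge0 (4 * G - (6 * 100 + 25) * q2).
have := sqr_ge0 (3 * G - (50 * 100) * r).
have := sqr_ge0 ((59 * 100 + 17) * m - (9 * 100 + 43) * v).
have := sqr_ge0 ((3 * 100 + 56) * m - (9 * 100 + 43) * j).
have := sqr_ge0 ((3 * 100 + 38) * m - (9 * 100 + 43) * p).
have := sqr_ge0 ((3 * 100 + 38) * m - (9 * 100 + 43) * q).
have := sqr_ge0 (64 * m - (9 * 100 + 43) * q2).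
have := sqr_ge0 (6 * m - (9 * 100 + 43) * r).
have := sqr_ge0 ((3 * 100 + 56) * v - (59 * 100 + 17) * j).
have := sqr_ge0 ((3 * 100 + 38) * v - (59 * 100 + 17) * p).
have := sqr_ge0 ((3 * 100 + 38) * v - (59 * 100 + 17) * q).
have := sqr_ge0 (64 * v - (59 * 100 + 17) * q2).
have := sqr_ge0 (6 * v - (59 * 100 + 17) * r).
have := sqr_ge0 (169 * j - 178 * p).
have := sqr_ge0 (169 * j - 178 * q).
have := sqr_ge0 (16 * j - 89 * q2).
have := sqr_ge0 (3 * j - 178 * r).
have := sqr_ge0 (1 * p - 1 * q).
have := sqr_ge0 (32 * p - 169 * q2).
have := sqr_ge0 (3 * p - 169 * r).
have := sqr_ge0 (32 * q - 169 * q2).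
have := sqr_ge0 (3 * q - 169 * r).
have := sqr_ge0 (3 * q2 - 32 * r).
have := sqr_ge0 G.
have := sqr_ge0 m.
have := sqr_ge0 v.
have := sqr_ge0 j.
have := sqr_ge0 p.
have := sqr_ge0 q.
have := sqr_ge0 q2.
have := sqr_ge0 r.
lra.
Qed.

Lemma drift_form_high G m v j p q q2 r :
  drift_form (3 / 2) G m v j p q q2 r <= - (1 / 100) * (G ^+ 2 + m ^+ 2 + v ^+ 2 + j ^+ 2).
Proof.
rewrite /drift_form.
have := sqr_ge0 (3 * G - 20 * m).
have := sqr_ge0 ((4 * 100 + 47) * G - (4 * 100) * v).
have := sqr_ge0 (113 * G - (20 * 100) * j).
have := sqr_ge0 ((6 * 100 + 51) * G - (100 * 100) * p).
have := sqr_ge0 ((5 * 100 + 83) * G - (100 * 100) * q).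
have := sqr_ge0 (19 * G - (20 * 100) * q2).
have := sqr_ge0 (9 * G - (100 * 100) * r).
have := sqr_ge0 (149 * m - 20 * v).
have := sqr_ge0 (113 * m - (3 * 100) * j).
have := sqr_ge0 ((2 * 100 + 17) * m - (5 * 100) * p).
have := sqr_ge0 ((5 * 100 + 83) * m - (15 * 100) * q).
have := sqr_ge0 (19 * m - (3 * 100) * q2).
have := sqr_ge0 (3 * m - (5 * 100) * r).
have := sqr_ge0 (113 * v - (22 * 100 + 35) * j).
have := sqr_ge0 ((2 * 100 + 17) * v - (37 * 100 + 25) * p).
have := sqr_ge0 ((5 * 100 + 83) * v - (111 * 100 + 75) * q).
have := sqr_ge0 (19 * v - (22 * 100 + 35) * q2).
have := sqr_ge0 (3 * v - (37 * 100 + 25) * r).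
have := sqr_ge0 ((6 * 100 + 51) * j - (5 * 100 + 65) * p).
have := sqr_ge0 ((5 * 100 + 83) * j - (5 * 100 + 65) * q).
have := sqr_ge0 (19 * j - 113 * q2).
have := sqr_ge0 (9 * j - (5 * 100 + 65) * r).
have := sqr_ge0 ((5 * 100 + 83) * p - (6 * 100 + 51) * q).
have := sqr_ge0 (95 * p - (6 * 100 + 51) * q2).
have := sqr_ge0 (3 * p - (2 * 100 + 17) * r).
have := sqr_ge0 (95 * q - (5 * 100 + 83) * q2).
have := sqr_ge0 (9 * q - (5 * 100 + 83) * r).
have := sqr_ge0 (9 * q2 - 95 * r).
have := sqr_ge0 G.
have := sqr_ge0 m.
have := sqr_ge0 v.
have := sqr_ge0 j.
have := sqr_ge0 p.
have := sqr_ge0 q.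
have := sqr_ge0 q2.
have := sqr_ge0 r.
lra.
Qed.

(** The form is affine in [om], so the certificates at the two endpoints interpolate. *)
Lemma drift_form_neg om G m v j p q q2 r : 1 / 2 <= om <= 3 / 2 ->
  drift_form om G m v j p q q2 r <= - (1 / 100) * (G ^+ 2 + m ^+ 2 + v ^+ 2 + j ^+ 2).
Proof.
case/andP => o1 o2; have lo := drift_form_low G m v j p q q2 r.
have hi := drift_form_high G m v j p q q2 r.
have -> : drift_form om G m v j p q q2 r =
    (3 / 2 - om) * drift_form (1 / 2) G m v j p q q2 r
    + (om - 1 / 2) * drift_form (3 / 2) G m v j p q q2 r.
  by rewrite /drift_form; field.
set e := - _ * _ in lo hi *.
have -> : e = (3 / 2 - om) * e + (om - 1 / 2) * e by lra.
by apply: lerD; rewrite ler_wpM2l// subr_ge0.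
Qed.

End DriftForm.

Section StepSizes.
Variables (R : realType) (nS : nat).
Variables (cJ gamma delta rho L LV LTV BV a b x l : R).
Hypotheses (a0 : 0 < a) (b0 : 0 < b) (x0 : 0 < x) (l0 : 0 < l).
Hypotheses (rho0 : 0 < rho) (gamma01 : 0 < gamma < 1) (delta01 : 0 < delta < 1).
Hypotheses (L0 : 0 < L) (LV1 : 1 <= LV) (LTV0 : 0 <= LTV) (BV0 : 0 < BV) (nS0 : (0 < nS)%N).
Hypothesis ok : stepsize_ok nS cJ gamma delta rho L LV LTV BV a b x l.

Let LF := cL_F BV L LTV.
Let LG := cL_G BV cJ L LTV.
Let LH := cL_H L.
Let D := 1 - delta.
(** One constant above both [LV] and [L]: the rescaled error [lipM * m] then dominates [LV * m] and
    [L * m] at once. *)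
Definition lipM : R := Num.sqrt (LV ^+ 2 + L ^+ 2).

Lemma gamma_gt0 : 0 < gamma. Proof. by case/andP: gamma01. Qed.
Lemma gamma_lt1 : gamma < 1. Proof. by case/andP: gamma01. Qed.
Lemma gap_gt0 : 0 < D. Proof. by case/andP: delta01 => ? ?; rewrite subr_gt0. Qed.
Lemma gap_lt1 : D < 1. Proof. by case/andP: delta01 => ? ?; rewrite /D; lra. Qed.

Lemma gamma_cJ_ge1 : 1 <= gamma * cJ.
Proof. by case: ok => h _ _ _ _; rewrite -ler_pdivrMl ?gamma_gt0// mulrC. Qed.

Lemma cJ_gt1 : 1 < cJ.
Proof. by have := gamma_cJ_ge1; have := gamma_gt0; have := gamma_lt1; nra. Qed.

Lemma LF_ge : 5 + L <= LF.
Proof.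
rewrite /LF /cL_F /cB_F; have := mulr_ge0 (ltW BV0) LTV0; have := BV0; have := LTV0; lra.
Qed.

Lemma LG_ge : cJ + 3 <= LG.
Proof.
rewrite /LG /cL_G /cB_G; have c1 := cJ_gt1; have := mulr_ge0 (ltW BV0) LTV0.
have := mulr_gt0 L0 (lt_trans ltr01 c1); have := L0; have := LTV0.
have : 0 <= cJ * LTV by rewrite mulr_ge0// ltW// (lt_trans ltr01).
lra.
Qed.

Lemma LG_gamma : gamma^-1 <= LG.
Proof.
have h : gamma^-1 <= cJ by rewrite -div1r ler_pdivrMr ?gamma_gt0// mulrC; exact: gamma_cJ_ge1.
by have := LG_ge; lra.
Qed.

Lemma LH_ge : 1 <= LH /\ LH <= LF.
Proof. by have := LF_ge; have := L0; rewrite /LH /cL_H; lra. Qed.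

Lemma lipM_sqr : lipM ^+ 2 = LV ^+ 2 + L ^+ 2.
Proof. by rewrite sqr_sqrtr// addr_ge0 ?sqr_ge0. Qed.

Lemma lipM_ge : [/\ LV <= lipM, L <= lipM, 1 <= lipM & lipM <= LF * LV].
Proof.
have m0 : 0 <= lipM by exact: sqrtr_ge0.
have LV0 : 0 <= LV by have := LV1; lra.
have lv : LV <= lipM.
  by rewrite -(@ler_pXn2r _ 2) ?nnegrE// lipM_sqr; have := sqr_ge0 L; lra.
split=> //; [|have := LV1; lra|].
  rewrite -(@ler_pXn2r _ 2) ?nnegrE ?(ltW L0)// lipM_sqr.
  by have := sqr_ge0 LV; lra.
have h := LF_ge; have l00 := L0.
have F0 : 0 <= LF by lra.
rewrite -(@ler_pXn2r _ 2) ?nnegrE ?mulr_ge0// lipM_sqr exprMn.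
have h1 : 1 + L ^+ 2 <= LF ^+ 2 by nra.
have h2 : 1 <= LV ^+ 2 by rewrite exprn_ege1.
have h3 := ler_wpM2r (sqr_ge0 LV) h1; have := sqr_ge0 L; nra.
Qed.

Lemma steps_le : [/\ a <= x, x <= b, b <= l & l <= 1 / 4].
Proof. by case: ok => _ [? ? ? ?] _ _ _. Qed.

(* a <= l / (k * (e + rest)) gives e * (a / l) <= 1 / k, in the cross-multiplied form *)
Lemma le_div_part (u w k e s : R) : 0 < k -> 0 <= w -> 0 < s -> 0 <= u -> e <= s ->
  u <= w / (k * s) -> k * (e * u) <= w.
Proof.
move=> k0 w0 s_0 u0 es; rewrite ler_pdivlMr ?mulr_gt0// => h.
have := ler_wpM2r u0 es; rewrite -(ler_pM2l k0) => h2; nra.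
Qed.

(** Here [e] stands for a summand of the denominator, or anything below the whole sum, so that one
    condition yields a bound for each cross term. *)
Lemma actor_step_le (e : R) : e <= LF ^+ 2 + LG ^+ 2 + LH ^+ 2 + LV ^+ 2 + L ^+ 2 / (1 - delta) + rho ->
  192 * (e * a) <= l.
Proof.
move=> he; case: ok => _ _ [h _ _] _ _.
apply: (le_div_part _ _ _ _ he h) => //; [exact: ltW| |exact: ltW].
have := rho0; have q1 := sqr_ge0 LF; have q2 := sqr_ge0 LG; have q3 := sqr_ge0 LH.
have q4 := sqr_ge0 LV; have q5 : 0 <= L ^+ 2 / (1 - delta).
  by rewrite divr_ge0 ?sqr_ge0// ltW// gap_gt0.
lra.
Qed.

Lemma field_step_le (e : R) : e <= LH ^+ 2 * LF ^+ 2 + LG ^+ 2 + LV ^+ 2 / gamma + 1 / (1 - delta) ->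
  64 * (e * x) <= l.
Proof.
move=> he; case: ok => _ _ _ [h _] _.
apply: (le_div_part _ _ _ _ he h) => //; [exact: ltW| |exact: ltW].
have q1 : 0 <= LH ^+ 2 * LF ^+ 2 by rewrite mulr_ge0 ?sqr_ge0.
have q2 := sqr_ge0 LG; have q4 : 0 <= LV ^+ 2 / gamma by rewrite divr_ge0 ?sqr_ge0// ltW// gamma_gt0.
have q5 : 0 < 1 / (1 - delta) by rewrite divr_gt0 ?gap_gt0.
lra.
Qed.

Lemma critic_step_le : [/\ 72 * (LG ^+ 2 * b) <= l, 36 * (LF ^+ 2 * b) <= l & 8 * (gamma^-1 * b) <= l].
Proof.
case: ok => _ _ _ _ [h _ _].
have nR : 1 <= nS%:R :> R by rewrite ler1n.
have q1 := sqr_ge0 LF; have q2 := sqr_ge0 LG.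
have g_0 : 0 < gamma^-1 by rewrite invr_gt0 gamma_gt0.
have nG : LG ^+ 2 <= nS%:R * LG ^+ 2 by rewrite ler_peMl.
have s0 : 0 < 72 * nS%:R * LG ^+ 2 + 36 * LF ^+ 2 + 8 / gamma by rewrite -mulrA; lra.
move: h; rewrite -/LF -/LG ler_pdivlMr// => h.
have h1 := mulr_ge0 q1 (ltW b0); have h2 := mulr_ge0 (ltW g_0) (ltW b0).
have h3 := mulr_ge0 q2 (ltW b0); have h4 := ler_wpM2r (ltW b0) nG.
by split; lra.
Qed.

Lemma Cxi_parts : [/\ 32 * (rho * LF ^+ 2 * a) <= D * x,
  16 * (L * LF * LV * a) <= D * x & 2 * (LF * LV * a) <= LH * x].
Proof.
case: ok => _ _ [_ _ h] _ _.
have F0 : 0 < LF by have := LF_ge; have := L0; lra.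
have LV0 : 0 < LV by have := LV1; lra.
have x_0 := ltW x0.
move: h; rewrite !minr_pMl// !le_min => /andP[/andP[h1 h2] /andP[h3 h4]].
move: h1 h2 h3 h4; rewrite -/LF -/LH -/D => h1 h2 h3 h4.
split.
- by move: h1; rewrite mulrAC ler_pdivlMr ?mulr_gt0 ?exprn_gt0//; lra.
- by move: h4; rewrite mulrAC ler_pdivlMr ?mulr_gt0//; lra.
- by move: h3; rewrite mulrAC ler_pdivlMr ?mulr_gt0//; lra.
Qed.

Lemma Cbe_parts : 2 * (rho * a) <= gamma * b /\ 58 * (LV * a) <= gamma * b.
Proof.
case: ok => _ _ [_ + _] _ _; have b_0 := ltW b0.
(* Keeping only the summand [LV ^+ 2 / gamma] under the root leaves [gamma / LV] divided by the
   square root of 3456, of which 58 is the integer part. *)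
have : 58 ^+ 2 <= 3456 :> R by rewrite -natrX ler_nat.
move: (3456 : R) => k k58; have k0 : 0 < k by lra.
rewrite !minr_pMl// !le_min => /andP[/andP[_ _] /andP[h3 h4]].
split; first by move: h4; rewrite mulrAC ler_pdivlMr ?mulr_gt0//; lra.
have LV0 : 0 < LV by have := LV1; lra.
have g_0 := gamma_gt0.
have nR : 1 <= nS%:R :> R by rewrite ler1n.
move: h3; rewrite -/LF -/LG -/LH; set s := _ + L ^+ 2 * _ * _; set q := Num.sqrt _ => h3.
have sV : LV ^+ 2 / gamma <= s.
  rewrite /s; have q1 : 0 <= LF ^+ 4 * LG ^+ 4 by rewrite mulr_ge0// exprn_even_ge0.
  have q2 : 0 <= LF ^+ 2 * LH ^+ 2 by rewrite mulr_ge0 ?sqr_ge0.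
  have q3 : 0 <= rho * LF ^+ 2 by rewrite mulr_ge0 ?sqr_ge0// ltW.
  have q4 : 0 <= L ^+ 2 * LF ^+ 2 * (1 - delta).
    apply: mulr_ge0 (ltW gap_gt0); apply: mulr_ge0; exact: sqr_ge0.
  lra.
have s0 : 0 < s by apply: lt_le_trans sV; rewrite divr_gt0// exprn_gt0.
have q0 : 0 <= q by exact: sqrtr_ge0.
have q2 : q ^+ 2 * (58 * LV) ^+ 2 <= gamma ^+ 2.
  rewrite /q sqr_sqrtr; last by rewrite divr_ge0 ?mulr_ge0 ?(ltW g_0) ?(ltW k0) ?(ltW s0).
  rewrite mulrAC ler_pdivrMr; last by rewrite !mulr_gt0// ltr0n.
  have e1 : gamma * (LV ^+ 2 / gamma) = LV ^+ 2 by field; rewrite gt_eqF.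
  have := ler_wpM2l (ltW g_0) sV; rewrite e1 => e2.
  have e3 : gamma * s <= nS%:R * (gamma * s) by rewrite ler_peMl// mulr_ge0// ltW.
  have e4 : (58 * LV) ^+ 2 <= k * (nS%:R * (gamma * s)).
    apply: (@le_trans _ _ (k * LV ^+ 2)); first by rewrite exprMn ler_wpM2r// sqr_ge0.
    by rewrite ler_wpM2l ?(ltW k0)//; apply: le_trans e2 e3.
  have -> : gamma ^+ 2 * (k * nS%:R * s) = gamma * (k * (nS%:R * (gamma * s))) by ring.
  by rewrite ler_wpM2l// ltW.
have {}q2 : q * (58 * LV) <= gamma.
  by rewrite -(@ler_pXn2r _ 2) ?nnegrE ?(ltW g_0) ?mulr_ge0// ?(ltW LV0)// exprMn.
have := ler_wpM2r (ltW b0) q2; have := ler_wpM2l (ltW LV0) h3; lra.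
Qed.

Lemma x_b (e : R) : e <= LF ^+ 4 * LV ^+ 2 + LF ^+ 2 * LG ^+ 2 * LH ^+ 2 * LV ^+ 2
    + LF ^+ 2 * LH ^+ 4 * LV ^+ 2 + LV ^+ 2 -> 48 * 144 * (e * x) <= D * gamma * b.
Proof.
have -> : 48 * 144 = 6912 :> R by rewrite -natrM.
move=> he; case: ok => _ _ _ [_ h] _.
apply: (le_div_part _ _ _ _ he h).
- by rewrite ltr0n.
- by rewrite !mulr_ge0 ?ltW// ?gap_gt0 ?gamma_gt0.
- have LV0 : 0 < LV ^+ 2 by rewrite exprn_gt0//; have := LV1; lra.
  have e4 (u : R) : 0 <= u ^+ 4 by rewrite exprn_even_ge0.
  have e2 (u : R) : 0 <= u ^+ 2 by exact: sqr_ge0.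
  have q1 := mulr_ge0 (e4 LF) (e2 LV).
  have q2 := mulr_ge0 (mulr_ge0 (mulr_ge0 (e2 LF) (e2 LG)) (e2 LH)) (e2 LV).
  have q3 := mulr_ge0 (mulr_ge0 (e2 LF) (e4 LH)) (e2 LV).
  by rewrite ltr_wpDl// !addr_ge0.
- exact: ltW.
Qed.

Lemma LV_pos : 0 < LV. Proof. by have := LV1; lra. Qed.
Lemma LF_ge5 : 5 <= LF. Proof. by have := LF_ge; have := L0; lra. Qed.
Lemma LG_ge4 : 4 <= LG. Proof. by have := LG_ge; have := cJ_gt1; lra. Qed.

(** This and the following ratios are the cross coefficients of [raw_drift] after rescaling.
    Multiplied by the numerical factors of the weights they become the coefficients of [drift_form];
    here [80 / 16 = 5]. *)
Lemma ratio_m : lipM * (L * a / (x * D)) <= 1 / 16.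
Proof.
have [_ h _] := Cxi_parts; have [_ _ m1 mF] := lipM_ge; have d0 := gap_gt0.
rewrite mulrA ler_pdivrMr ?mulr_gt0//.
have La : 0 <= L * a by rewrite mulr_ge0 ?ltW.
have := ler_wpM2r La mF; lra.
Qed.

Lemma ratio_aLV : a * LV / (b * gamma) <= 1 / 58 /\ a * LV / b <= 1 / 58.
Proof.
have [_ h] := Cbe_parts; have g_0 := gamma_gt0; have g_1 := gamma_lt1.
have gb : gamma * b <= b by rewrite ler_piMl ?ltW.
by split; rewrite ler_pdivrMr ?mulr_gt0//; lra.
Qed.

Lemma xLV_le : 48 * 144 * (LV * x) <= gamma * b.
Proof.
have V1 := LV1; have e4 (u : R) : 0 <= u ^+ 4 by rewrite exprn_even_ge0.
have e2 (u : R) : 0 <= u ^+ 2 by exact: sqr_ge0.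
have q1 := mulr_ge0 (e4 LF) (e2 LV).
have q2 := mulr_ge0 (mulr_ge0 (mulr_ge0 (e2 LF) (e2 LG)) (e2 LH)) (e2 LV).
have q3 := mulr_ge0 (mulr_ge0 (e2 LF) (e4 LH)) (e2 LV).
have h : LV <= LV ^+ 2 by rewrite ler_eXnr.
have := @x_b LV; set s := _ + _ => /(_ _) hx.
have {}hx := hx (ltac:(rewrite /s; lra)).
have gb : 0 <= gamma * b by rewrite mulr_ge0 ?ltW// gamma_gt0.
by apply: le_trans hx _; rewrite -mulrA ler_piMl// ltW// gap_lt1.
Qed.

Lemma ratio_xLV : x * LV / (b * gamma) <= 1 / (48 * 144) /\ x * LV / b <= 1 / (48 * 144).
Proof.
have h := xLV_le; have g_0 := gamma_gt0; have g_1 := gamma_lt1.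
have gb : gamma * b <= b by rewrite ler_piMl ?ltW.
by split; rewrite ler_pdivrMr ?mulr_gt0//; lra.
Qed.

Lemma ratio_bg : b / (l * gamma) <= 1 / 288.
Proof.
have [h _ _] := critic_step_le; have h1 := LG_gamma; have h2 := LG_ge4; have g_0 := gamma_gt0.
rewrite ler_pdivrMr ?mulr_gt0//.
(* One factor [LG] is at least 4, the other at least [gamma^-1]; hence [288 = 72 * 4]. *)
have h3 : 4 * gamma^-1 <= LG ^+ 2.
  by rewrite expr2; apply: ler_pM => //; rewrite invr_ge0 ltW.
have := ler_wpM2r (ltW b0) h3 => h4.
have h5 : 288 * (gamma^-1 * b) <= l by lra.
have := ler_wpM2r (ltW g_0) h5.
have -> : 288 * (gamma^-1 * b) * gamma = 288 * b by field; rewrite gt_eqF.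
lra.
Qed.

Lemma ratio_F : [/\ LF * (a / l) <= 1 / 960, LF * (x / l) <= 1 / 320 & LF * (b / l) <= 1 / 180].
Proof.
have F5 := LF_ge5; have [H1 _] := LH_ge.
have F2 : 5 * LF <= LF ^+ 2 by rewrite expr2 ler_wpM2r//; lra.
have i0 : 0 <= L ^+ 2 / (1 - delta) by rewrite divr_ge0 ?sqr_ge0// ltW// gap_gt0.
have V0 : 0 <= LV ^+ 2 / gamma by rewrite divr_ge0 ?sqr_ge0// ltW// gamma_gt0.
have i1 : 0 < 1 / (1 - delta) by rewrite divr_gt0// gap_gt0.
have q2 := sqr_ge0 LG; have q3 := sqr_ge0 LH; have q4 := sqr_ge0 LV; have r0 := rho0.
have HF : LF ^+ 2 <= LH ^+ 2 * LF ^+ 2 by rewrite ler_peMl ?sqr_ge0// exprn_ege1.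
have h1 : 192 * (LF ^+ 2 * a) <= l by apply: actor_step_le; lra.
have h2 : 64 * (LF ^+ 2 * x) <= l by apply: field_step_le; lra.
have [_ h3 _] := critic_step_le.
have k1 := ler_wpM2r (ltW a0) F2; have k2 := ler_wpM2r (ltW x0) F2.
have k3 := ler_wpM2r (ltW b0) F2.
by split; rewrite mulrA ler_pdivrMr//; lra.
Qed.

Lemma ratio_G : [/\ LG / gamma * (a / l) <= 1 / 192, LG / gamma * (x / l) <= 1 / 64,
  LG / gamma * (b / l) <= 1 / 72 & LG * cJ * (b / l) <= 1 / 72].
Proof.
have G4 := LG_ge4; have Gg := LG_gamma; have Gc := LG_ge.
have i0 : 0 <= L ^+ 2 / (1 - delta) by rewrite divr_ge0 ?sqr_ge0// ltW// gap_gt0.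
have V0 : 0 <= LV ^+ 2 / gamma by rewrite divr_ge0 ?sqr_ge0// ltW// gamma_gt0.
have i1 : 0 < 1 / (1 - delta) by rewrite divr_gt0// gap_gt0.
have q2 := sqr_ge0 LF; have q3 := sqr_ge0 LH; have q4 := sqr_ge0 LV; have r0 := rho0.
have q5 : 0 <= LH ^+ 2 * LF ^+ 2 by rewrite mulr_ge0.
have h1 : 192 * (LG ^+ 2 * a) <= l by apply: actor_step_le; lra.
have h2 : 64 * (LG ^+ 2 * x) <= l by apply: field_step_le; lra.
have [h3 _ _] := critic_step_le.
have G2 : LG / gamma <= LG ^+ 2 by rewrite expr2 ler_wpM2l//; lra.
have G3 : LG * cJ <= LG ^+ 2 by rewrite expr2 ler_wpM2l//; lra.
have k1 := ler_wpM2r (ltW a0) G2; have k2 := ler_wpM2r (ltW x0) G2.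
have k3 := ler_wpM2r (ltW b0) G2; have k4 := ler_wpM2r (ltW b0) G3.
by split; rewrite mulrA ler_pdivrMr//; lra.
Qed.

Lemma ratio_c : [/\ cJ * LV * (a / l) <= 1 / 384, cJ * LV * (x / l) <= 1 / (48 * 144),
  cJ * cJ * (b / l) <= 1 / 72 & cJ * (b / l) <= 1 / 72].
Proof.
have G4 := LG_ge4; have Gc := LG_ge; have c1 := cJ_gt1.
have i0 : 0 <= L ^+ 2 / (1 - delta) by rewrite divr_ge0 ?sqr_ge0// ltW// gap_gt0.
have q2 := sqr_ge0 LF; have q3 := sqr_ge0 LH; have r0 := rho0.
have h1 : 192 * ((LG ^+ 2 + LV ^+ 2) * a) <= l by apply: actor_step_le; lra.
have [h3 _ _] := critic_step_le.
have V0 := LV_pos.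
have cG : cJ * cJ <= LG ^+ 2 by rewrite expr2; apply: ler_pM; lra.
have cV : 2 * (cJ * LV) <= LG ^+ 2 + LV ^+ 2 by have := sqr_ge0 (cJ - LV); lra.
have cc : cJ <= cJ * cJ by rewrite ler_peMl//; lra.
have k1 := ler_wpM2r (ltW a0) cV; have k3 := ler_wpM2r (ltW b0) cG.
have k4 := ler_wpM2r (ltW b0) cc.
have g_1 := gamma_lt1; have g_0 := gamma_gt0.
have gb : gamma * b <= b by rewrite ler_piMl ?ltW.
have c0 : 0 <= cJ by lra.
have k5 := ler_wpM2l c0 (le_trans xLV_le gb).
have l_0 := l0.
by split; rewrite mulrA ler_pdivrMr//; lra.
Qed.

Lemma ratio_H : lipM * LH / D * (x / l) <= 1 / (48 * 144) /\
  lipM * LH / D * (a / l) <= 1 / (48 * 144).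
Proof.
have [_ _ m1 mF] := lipM_ge; have d0 := gap_gt0; have F5 := LF_ge5; have [H1 HF] := LH_ge.
have V1 := LV1.
have h : 48 * 144 * (lipM * LH * x) <= D * gamma * b.
  apply: x_b.
  have e4 (u : R) : 0 <= u ^+ 4 by rewrite exprn_even_ge0.
  have e2 (u : R) : 0 <= u ^+ 2 by exact: sqr_ge0.
  have q2 := mulr_ge0 (mulr_ge0 (mulr_ge0 (e2 LF) (e2 LG)) (e2 LH)) (e2 LV).
  have q3 := mulr_ge0 (mulr_ge0 (e2 LF) (e4 LH)) (e2 LV).
  have : lipM * LH <= LF ^+ 4 * LV ^+ 2.
    apply: (@le_trans _ _ (LF * LV * LF)); first by apply: ler_pM => //; lra.
    rewrite mulrAC -expr2; apply: ler_pM; rewrite ?sqr_ge0//; first by lra.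
      by apply: ler_weXn2l => //; lra.
    by rewrite ler_eXnr.
  have := e2 LV; lra.
have [ax xb bl _] := steps_le.
have gb : gamma * b <= b by rewrite ler_piMl ?ltW// gamma_lt1.
have hl := ler_wpM2l (ltW d0) (le_trans gb bl); rewrite mulrA in hl.
have mH : 0 <= lipM * LH by rewrite mulr_ge0//; lra.
have k := ler_wpM2l mH ax.
have E u : lipM * LH / D * (u / l) = lipM * LH * u / (D * l).
  by field; rewrite !gt_eqF.
by split; rewrite E ler_pdivrMr ?mulr_gt0//; lra.
Qed.

(* The numerical factors are one choice for which [drift_form] is negative. *)
Definition wt_m : R := 40 * lipM ^+ 2 * (a / (x * D)).
Definition wt_v : R := a / (b * gamma).
Definition wt_j : R := 64 / gamma ^+ 2 * (a / (b * cJ)).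
Definition wt_f : R := 20 * (a / l).
Definition wt_g : R := 24 / gamma ^+ 2 * (a / l).
Definition wt_c : R := 320 * (a / l).
Definition wt_h : R := 60 * 100 * (lipM / D) ^+ 2 * (a / l).

Lemma wt_ge0 : [/\ 0 <= wt_m, 0 <= wt_v, 0 <= wt_j, 0 <= wt_f &
  [/\ 0 <= wt_g, 0 <= wt_c & 0 <= wt_h]].
Proof.
have c0 : 0 <= cJ by have := cJ_gt1; lra.
have al := divr_ge0 (ltW a0) (ltW l0).
have ax := divr_ge0 (ltW a0) (mulr_ge0 (ltW x0) (ltW gap_gt0)).
have av := divr_ge0 (ltW a0) (mulr_ge0 (ltW b0) (ltW gamma_gt0)).
have aj := divr_ge0 (ltW a0) (mulr_ge0 (ltW b0) c0).
split=> //.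
- exact: mulr_ge0 (mulr_ge0 (ler0n _ _) (sqr_ge0 _)) ax.
- exact: mulr_ge0 (divr_ge0 (ler0n _ _) (sqr_ge0 _)) aj.
- exact: mulr_ge0 (ler0n _ _) al.
split.
- exact: mulr_ge0 (divr_ge0 (ler0n _ _) (sqr_ge0 _)) al.
- exact: mulr_ge0 (ler0n _ _) al.
- exact: mulr_ge0 (mulr_ge0 (mulr_ge0 (ler0n _ _) (ler0n _ _)) (sqr_ge0 _)) al.
Qed.

(** First-order part of the one-step change of the Lyapunov function, per unit of [eta], with the
    noise removed. The arguments are the actor weight, the gradient norm, the errors of mean field,
    critic and average reward, and the tracking errors of the momenta; [ph], [hh], [gg] and [gj]
    bound the momenta themselves. *)
Definition raw_drift (om G m v j p q1 q2 r' : R) : R :=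
  let ph := G + p + LV * m + v in let hh := 2 * m + r' in
  let gg := 2 * v + j + q1 in let gj := cJ * j + q2 in
  a * (- om * G ^+ 2 + om * (G * (p + LV * m + v)))
  + wt_m * (- 2 * x * D * m ^+ 2 + 2 * m * (x * r' + L * a * ph))
  + wt_v * (- 2 * b * gamma * v ^+ 2 + 2 * b * v * (j + q1) + 2 * v * LV * (a * ph + x * hh))
  + wt_v * (2 / cJ * ((j + 2 * L * m) * (b * gg)))
  + wt_v * (2 * b / l * ((q1 + q2) * (b * gg)))
  + wt_j * (- 2 * b * cJ * j ^+ 2 + 2 * j * (b * q2 + LV * (a * ph + x * hh)))
  + wt_f * (- 2 * l * p ^+ 2 + 2 * p * (4 * LF * (a * ph + x * hh + b * gg)))
  + wt_g * (- 2 * l * q1 ^+ 2 + 2 * q1 * (LG * (a * ph + x * hh + b * gg + b * gj)))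
  + wt_c * (- 2 * l * q2 ^+ 2 + 2 * q2 * (cJ * (LV * (a * ph + x * hh) + b * gj)))
  + wt_h * (- 2 * l * r' ^+ 2 + 2 * r' * (2 * LH * (a * ph + x * hh))).

Lemma ler_prod (c c' u u' v v' : R) : 0 <= c -> c <= c' -> 0 <= u -> u <= u' ->
  0 <= v -> v <= v' -> c * (u * v) <= c' * (u' * v').
Proof. by move=> *; apply: ler_pM => //; [exact: mulr_ge0|exact: ler_pM]. Qed.

Lemma ler_prodc (c rh k c' u v v' : R) : 0 <= c -> 0 <= rh -> rh <= k -> c * k = c' ->
  0 <= u -> 0 <= v -> v <= v' -> c * rh * (u * v) <= c' * (u * v').
Proof.
move=> c0 r0 rk <- u0 v0 vv; apply: ler_prod => //; first exact: mulr_ge0.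
exact: ler_wpM2l.
Qed.

Lemma raw_drift_le om G m v j p q1 q2 r' : 1 / 2 <= om <= 3 / 2 ->
  0 <= G -> 0 <= m -> 0 <= v -> 0 <= j -> 0 <= p -> 0 <= q1 -> 0 <= q2 -> 0 <= r' ->
  raw_drift om G m v j p q1 q2 r' <=
  - (a / 100) * (G ^+ 2 + m ^+ 2 + v ^+ 2 + j ^+ 2).
Proof.
have n100 : - (1 / 100) <= 0 :> R by rewrite oppr_le0; exact: divr_ge0 ler01 (ler0n _ _).
move=> hom G0 m0 v0 j0 p0 q10 q20 r0.
have [mLV mL m1 mF] := lipM_ge; have d0 := gap_gt0; have d1 := gap_lt1; have g_0 := gamma_gt0; have g_1 := gamma_lt1.
have c1 := cJ_gt1; have gc := gamma_cJ_ge1; have V0 := LV_pos.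
have G_0 : 0 < LG := lt_le_trans (ltr0Sn R 3) LG_ge4.
have F_0 : 0 < LF := lt_le_trans (ltr0Sn R 4) LF_ge5.
have H_0 : 0 < LH by have [h _] := LH_ge; exact: lt_le_trans ltr01 h.
have c0 : 0 < cJ := lt_trans ltr01 c1.
have Lm0 : 0 < lipM := lt_le_trans ltr01 m1.
(* In these variables every diagonal term is a numerical multiple of [a]. As [lipM >= 1],
   [gamma < 1] and [D < 1], they dominate the original ones, so cross terms may be enlarged to
   them. *)
pose mt := lipM * m; pose jt := j / gamma; pose qt := q1 / gamma; pose rt := lipM * r' / D.
have mt0 : 0 <= mt by rewrite mulr_ge0// ltW.
have jt0 : 0 <= jt by rewrite divr_ge0// ltW.
have qt0 : 0 <= qt by rewrite divr_ge0// ltW.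
have rt0 : 0 <= rt by rewrite divr_ge0 ?mulr_ge0// ltW.
have jE : j = gamma * jt by rewrite /jt mulrC divfK// gt_eqF.
have qE : q1 = gamma * qt by rewrite /qt mulrC divfK// gt_eqF.
have mm : m <= mt by rewrite ler_peMl.
have Vm : LV * m <= mt by rewrite ler_wpM2r.
have Lmm : L * m <= mt by rewrite ler_wpM2r.
have jj : j <= jt by rewrite jE ler_piMl// ltW.
have qq : q1 <= qt by rewrite qE ler_piMl// ltW.
have rr : r' <= rt.
  rewrite /rt ler_pdivlMr//; have := ler_wpM2r r0 m1; have := ler_wpM2l r0 (ltW d1); lra.
pose ph := G + p + LV * m + v; pose hh := 2 * m + r'; pose gg := 2 * v + j + q1.
pose pht := G + p + mt + v; pose hht := 2 * mt + rt; pose ggt := 2 * v + jt + qt.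
have V_m : 0 <= LV * m by rewrite mulr_ge0// ltW.
have ph0 : 0 <= ph := addr_ge0 (addr_ge0 (addr_ge0 G0 p0) V_m) v0.
have hh0 : 0 <= hh := addr_ge0 (mulr_ge0 (ler0n R 2) m0) r0.
have gg0 : 0 <= gg := addr_ge0 (addr_ge0 (mulr_ge0 (ler0n R 2) v0) j0) q10.
have pp : ph <= pht := lerD (lerD (lexx (G + p)) Vm) (lexx v).
have hp : hh <= hht := lerD (ler_wpM2l (ler0n R 2) mm) rr.
have gp : gg <= ggt := lerD (lerD (lexx (2 * v)) jj) qq.
have al0 : 0 <= a / l by rewrite divr_ge0 ?ltW.
have xl0 : 0 <= x / l by rewrite divr_ge0 ?ltW.
have bl0 : 0 <= b / l by rewrite divr_ge0 ?ltW.
have gcV : 0 < (gamma * cJ)^-1 by rewrite invr_gt0 mulr_gt0.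
have gcV1 : (gamma * cJ)^-1 <= 1 by rewrite invf_le1// mulr_gt0.
have om0 : 0 <= om.
  by case/andP: hom => h _; exact: le_trans (divr_ge0 ler01 (ler0n _ _)) h.
have T1 : - om * G ^+ 2 + om * (G * (p + LV * m + v)) <=
    - om * G ^+ 2 + om * (G * (p + mt + v)).
  rewrite lerD2l ler_wpM2l// ler_wpM2l// lerD2r lerD2l.
  exact: Vm.
have T2 : wt_m * (- 2 * x * D * m ^+ 2 + 2 * m * (x * r' + L * a * ph)) <=
   a * (- 80 * mt ^+ 2 + 80 * (mt * rt) + 5 * (mt * (G + p + mt + v))).
  have -> : wt_m * (- 2 * x * D * m ^+ 2 + 2 * m * (x * r' + L * a * ph)) =
     a * (- 80 * mt ^+ 2 + 80 * (mt * rt) + 80 * (lipM * (L * a / (x * D))) * (mt * ph)).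
    by rewrite /wt_m /mt /rt; field; rewrite !gt_eqF.
  have n0 : 0 <= lipM * (L * a / (x * D)).
    exact: mulr_ge0 (ltW Lm0) (divr_ge0 (mulr_ge0 (ltW L0) (ltW a0)) (mulr_ge0 (ltW x0) (ltW d0))).
  rewrite ler_pM2l// lerD2l.
  apply: (ler_prodc (ler0n _ _) n0 ratio_m); [by field|by []|by []|by []].
have T3 : wt_v * (- 2 * b * gamma * v ^+ 2 + 2 * b * v * (j + q1)
      + 2 * v * LV * (a * ph + x * hh)) <=
   a * (- 2 * v ^+ 2 + 2 * (v * (jt + qt)) + 1 / 29 * (v * pht) + 1 / (48 * 72) * (v * hht)).
  have -> : wt_v * (- 2 * b * gamma * v ^+ 2 + 2 * b * v * (j + q1)
      + 2 * v * LV * (a * ph + x * hh)) =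
     a * (- 2 * v ^+ 2 + 2 * (v * (jt + qt)) + 2 * (a * LV / (b * gamma)) * (v * ph)
       + 2 * (x * LV / (b * gamma)) * (v * hh)).
    by rewrite /wt_v /jt /qt; field; rewrite !gt_eqF.
  have [k1 _] := ratio_aLV; have [k2 _] := ratio_xLV.
  have n1 := divr_ge0 (mulr_ge0 (ltW a0) (ltW V0)) (mulr_ge0 (ltW b0) (ltW g_0)).
  have n2 := divr_ge0 (mulr_ge0 (ltW x0) (ltW V0)) (mulr_ge0 (ltW b0) (ltW g_0)).
  rewrite ler_pM2l// -!addrA !lerD2l; apply: lerD.
    apply: (ler_prodc (ler0n _ _) n1 k1); [by field|by []|by []|by []].
  apply: (ler_prodc (ler0n _ _) n2 k2); [by field|by []|by []|by []].
have T4 : wt_v * (2 / cJ * ((j + 2 * L * m) * (b * gg))) <=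
    a * (2 * ((jt + 2 * mt) * ggt)).
  have -> : wt_v * (2 / cJ * ((j + 2 * L * m) * (b * gg))) =
    a * (2 * (gamma * cJ)^-1 * ((j + 2 * L * m) * gg)).
    by rewrite /wt_v; field; rewrite !gt_eqF.
  have L_m : 0 <= L * m := mulr_ge0 (ltW L0) m0.
  rewrite -[2 * L * m]mulrA ler_pM2l//; apply: ler_prod; [| | | |exact: gg0|exact: gp].
  - exact: mulr_ge0 (ler0n _ _) (ltW gcV).
  - by rewrite -[leRHS]mulr1 ler_wpM2l.
  - exact: addr_ge0 j0 (mulr_ge0 (ler0n _ _) L_m).
  - exact: lerD jj (ler_wpM2l (ler0n _ _) Lmm).
have T5 : wt_v * (2 * b / l * ((q1 + q2) * (b * gg))) <=
    a * (1 / 144 * ((qt + q2) * ggt)).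
  have -> : wt_v * (2 * b / l * ((q1 + q2) * (b * gg))) =
    a * (2 * (b / (l * gamma)) * ((q1 + q2) * gg)).
    by rewrite /wt_v; field; rewrite !gt_eqF.
  have n : 0 <= b / (l * gamma) := divr_ge0 (ltW b0) (mulr_ge0 (ltW l0) (ltW g_0)).
  rewrite ler_pM2l//; apply: ler_prod; [| |exact: addr_ge0 q10 q20| |exact: gg0|exact: gp].
  - exact: mulr_ge0 (ler0n _ _) n.
  - have -> : 1 / 144 = 2 * (1 / 288) :> R by field.
    by rewrite ler_wpM2l// ratio_bg.
  - by rewrite lerD2r.
have T6 : wt_j * (- 2 * b * cJ * j ^+ 2 + 2 * j * (b * q2 + LV * (a * ph + x * hh))) <=
    a * (- 128 * jt ^+ 2 + 128 * (jt * q2) + 64 / 29 * (jt * pht) + 1 / 54 * (jt * hht)).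
  have -> : wt_j * (- 2 * b * cJ * j ^+ 2 + 2 * j * (b * q2 + LV * (a * ph + x * hh))) =
    a * (- 128 * jt ^+ 2 + 128 * (gamma * cJ)^-1 * (jt * q2)
      + 128 * ((gamma * cJ)^-1 * (a * LV / b)) * (jt * ph)
      + 128 * ((gamma * cJ)^-1 * (x * LV / b)) * (jt * hh)).
    by rewrite /wt_j /jt; field; rewrite !gt_eqF.
  have [_ k1] := ratio_aLV; have [_ k2] := ratio_xLV.
  have n1 : 0 <= a * LV / b := divr_ge0 (mulr_ge0 (ltW a0) (ltW V0)) (ltW b0).
  have n2 : 0 <= x * LV / b := divr_ge0 (mulr_ge0 (ltW x0) (ltW V0)) (ltW b0).
  have l1 : (gamma * cJ)^-1 * (a * LV / b) <= 1 / 58.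
    by apply: le_trans k1; rewrite ler_piMl.
  have l2 : (gamma * cJ)^-1 * (x * LV / b) <= 1 / (48 * 144).
    by apply: le_trans k2; rewrite ler_piMl.
  have n3 := mulr_ge0 (ltW gcV) n1; have n4 := mulr_ge0 (ltW gcV) n2.
  have gcV0 := ltW gcV.
  rewrite ler_pM2l// -!addrA !lerD2l; apply: lerD; last apply: lerD.
  - by rewrite -[X in _ <= X * _]mulr1; apply: (ler_prodc (ler0n _ _) gcV0 gcV1).
  - apply: (ler_prodc (ler0n _ _) n3 l1); [by field|by []|by []|by []].
  - apply: (ler_prodc (ler0n _ _) n4 l2); [by field|by []|by []|by []].
have T7 : wt_f * (- 2 * l * p ^+ 2 + 2 * p * (4 * LF * (a * ph + x * hh + b * gg))) <=
    a * (- 40 * p ^+ 2 + 1 / 6 * (p * pht) + 1 / 2 * (p * hht) + 8 / 9 * (p * ggt)).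
  have -> : wt_f * (- 2 * l * p ^+ 2 + 2 * p * (4 * LF * (a * ph + x * hh + b * gg))) =
    a * (- 40 * p ^+ 2 + 160 * (LF * (a / l)) * (p * ph) + 160 * (LF * (x / l)) * (p * hh)
       + 160 * (LF * (b / l)) * (p * gg)).
    by rewrite /wt_f; field; rewrite !gt_eqF.
  have [k1 k2 k3] := ratio_F.
  have n1 := mulr_ge0 (ltW F_0) al0; have n2 := mulr_ge0 (ltW F_0) xl0.
  have n3 := mulr_ge0 (ltW F_0) bl0.
  rewrite ler_pM2l// -!addrA !lerD2l; apply: lerD; last apply: lerD.
  - apply: (ler_prodc (ler0n _ _) n1 k1); [by field|by []|by []|by []].
  - apply: (ler_prodc (ler0n _ _) n2 k2); [by field|by []|by []|by []].
  - apply: (ler_prodc (ler0n _ _) n3 k3); [by field|by []|by []|by []].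
have T8 : wt_g * (- 2 * l * q1 ^+ 2
      + 2 * q1 * (LG * (a * ph + x * hh + b * gg + b * (cJ * j + q2)))) <=
    a * (- 48 * qt ^+ 2 + 1 / 4 * (qt * pht) + 3 / 4 * (qt * hht)
      + 2 / 3 * (qt * (ggt + (jt + q2)))).
  have -> : wt_g * (- 2 * l * q1 ^+ 2
      + 2 * q1 * (LG * (a * ph + x * hh + b * gg + b * (cJ * j + q2)))) =
    a * (- 48 * qt ^+ 2 + 48 * (LG / gamma * (a / l)) * (qt * ph)
      + 48 * (LG / gamma * (x / l)) * (qt * hh)
      + (48 * (LG / gamma * (b / l)) * (qt * (gg + q2)) + 48 * (LG * cJ * (b / l)) * (qt * jt))).
    by rewrite /wt_g /jt /qt; field; rewrite !gt_eqF.
  have [k1 k2 k3 k4] := ratio_G.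
  have Gg : 0 <= LG / gamma by rewrite divr_ge0 ?ltW.
  have Gc : 0 <= LG * cJ by rewrite mulr_ge0 ?ltW.
  have n1 := mulr_ge0 Gg al0; have n2 := mulr_ge0 Gg xl0; have n3 := mulr_ge0 Gg bl0.
  have n4 := mulr_ge0 Gc bl0.
  have -> : 2 / 3 * (qt * (ggt + (jt + q2))) =
    2 / 3 * (qt * (ggt + q2)) + 2 / 3 * (qt * jt) by ring.
  rewrite ler_pM2l// -!addrA !lerD2l; apply: lerD; last (apply: lerD; last apply: lerD).
  - apply: (ler_prodc (ler0n _ _) n1 k1); [by field|by []|by []|by []].
  - apply: (ler_prodc (ler0n _ _) n2 k2); [by field|by []|by []|by []].
  - apply: (ler_prodc (ler0n _ _) n3 k3); [by field|by []| |].
      rewrite !addrA; exact: addr_ge0 gg0 q20.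
    rewrite !addrA lerD2r; exact: gp.
  - apply: (ler_prodc (ler0n _ _) n4 k4); [by field|by []|by []|by []].
have T9 : wt_c * (- 2 * l * q2 ^+ 2
      + 2 * q2 * (cJ * (LV * (a * ph + x * hh) + b * (cJ * j + q2)))) <=
    a * (- 640 * q2 ^+ 2 + 5 / 3 * (q2 * pht) + 5 / 54 * (q2 * hht) + 80 / 9 * (q2 * (jt + q2))).
  have -> : wt_c * (- 2 * l * q2 ^+ 2
      + 2 * q2 * (cJ * (LV * (a * ph + x * hh) + b * (cJ * j + q2)))) =
    a * (- 640 * q2 ^+ 2 + 640 * (cJ * LV * (a / l)) * (q2 * ph)
      + 640 * (cJ * LV * (x / l)) * (q2 * hh)
      + (640 * (cJ * cJ * (b / l)) * (q2 * j) + 640 * (cJ * (b / l)) * (q2 * q2))).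
    by rewrite /wt_c; field; rewrite !gt_eqF.
  have [k1 k2 k3 k4] := ratio_c.
  have cV : 0 <= cJ * LV by rewrite mulr_ge0 ?ltW.
  have cc : 0 <= cJ * cJ by rewrite mulr_ge0 ?ltW.
  have n1 := mulr_ge0 cV al0; have n2 := mulr_ge0 cV xl0; have n3 := mulr_ge0 cc bl0.
  have n4 := mulr_ge0 (ltW c0) bl0.
  have -> : 80 / 9 * (q2 * (jt + q2)) = 80 / 9 * (q2 * jt) + 80 / 9 * (q2 * q2) by ring.
  rewrite ler_pM2l// -!addrA !lerD2l; apply: lerD; last (apply: lerD; last apply: lerD).
  - apply: (ler_prodc (ler0n _ _) n1 k1); [by field|by []|by []|by []].
  - apply: (ler_prodc (ler0n _ _) n2 k2); [by field|by []|by []|by []].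
  - apply: (ler_prodc (ler0n _ _) n3 k3); [by field|by []|exact: j0|exact: jj].
  - apply: (ler_prodc (ler0n _ _) n4 k4); [by field|by []|by []|by []].
have T10 : wt_h * (- 2 * l * r' ^+ 2 + 2 * r' * (2 * LH * (a * ph + x * hh))) <=
    a * (- 120 * 100 * rt ^+ 2 + 125 / 36 * (rt * (pht + hht))).
  have -> : wt_h * (- 2 * l * r' ^+ 2 + 2 * r' * (2 * LH * (a * ph + x * hh))) =
    a * (- 120 * 100 * rt ^+ 2 + (240 * 100 * (lipM * LH / D * (a / l)) * (rt * ph)
       + 240 * 100 * (lipM * LH / D * (x / l)) * (rt * hh))).
    by rewrite /wt_h /rt; field; rewrite !gt_eqF.
  have [k2 k1] := ratio_H.
  have HD : 0 <= lipM * LH / D by rewrite divr_ge0 ?mulr_ge0// ltW.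
  have n1 := mulr_ge0 HD al0; have n2 := mulr_ge0 HD xl0.
  have -> : 125 / 36 * (rt * (pht + hht)) = 125 / 36 * (rt * pht) + 125 / 36 * (rt * hht) by ring.
  rewrite ler_pM2l// lerD2l; apply: lerD.
    apply: (ler_prodc (mulr_ge0 (ler0n _ _) (ler0n _ _)) n1 k1); [by field|by []|by []|by []].
  apply: (ler_prodc (mulr_ge0 (ler0n _ _) (ler0n _ _)) n2 k2); [by field|by []|by []|by []].
have fin := drift_form_neg G mt v jt p qt q2 rt hom.
have fin2 : G ^+ 2 + m ^+ 2 + v ^+ 2 + j ^+ 2 <= G ^+ 2 + mt ^+ 2 + v ^+ 2 + jt ^+ 2.
  by rewrite lerD// ?lerD2r ?lerD2l// ler_pXn2r ?nnegrE.
have {}T1 := ler_wpM2l (ltW a0) T1.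
have {}fin := ler_wpM2l (ltW a0) (le_trans fin (ler_wnM2l n100 fin2)).
have sumT := lerD (lerD (lerD (lerD (lerD (lerD (lerD (lerD (lerD T1 T2) T3) T4) T5) T6) T7) T8) T9) T10.
rewrite /raw_drift /= -/ph -/hh -/gg; apply: le_trans sumT _.
have -> : - (a / 100) * (G ^+ 2 + m ^+ 2 + v ^+ 2 + j ^+ 2) =
  a * (- (1 / 100) * (G ^+ 2 + m ^+ 2 + v ^+ 2 + j ^+ 2)) by field.
apply: le_trans fin.
rewrite -!mulrDr le_eqVlt; apply/orP; left; apply/eqP; congr (_ * _).
by rewrite /drift_form /pht /hht /ggt; field.
Qed.

End StepSizes.

(** * Lipschitz observables and the Poisson corrector *)

Section BoundedLipschitz.
Variables (R : realType) (S A : finType).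
Variables (P : {ffun S -> R} -> S -> A -> S -> R) (r : S -> A -> {ffun S -> R} -> R).
Variables (C0 C1 delta L BV LV LTV gamma : R).
Hypothesis reg : regular_mfg P r C0 C1 delta L BV LV LTV gamma.
Variables (s0 : S) (a0 : A) (B0 : R).
Local Notation state := (astate R S A).
Local Notation Ker := (reg_kernel reg).
Local Notation spol := (spol a0).

(** The parameter [th] is left unrestricted: the observables depend on it through [softmax], which
    is bounded and Lipschitz. *)
Definition dom (z : state) : Prop :=
  [/\ simplex (muh z), norm2 (Vh z) <= BV, 0 <= Jh z <= 1 &
    [/\ norm2 (fv z) <= B0, norm2 (gV z) <= B0, `|gJ z| <= B0 & norm2 (hv z) <= B0]].

Definition sdist (z z' : state) : R :=
  norm2 (th z - th z') + norm2 (muh z - muh z') + norm2 (Vh z - Vh z') + `|Jh z - Jh z'|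
  + norm2 (fv z - fv z') + norm2 (gV z - gV z') + `|gJ z - gJ z'| + norm2 (hv z - hv z').

Lemma sdist_ge z z' :
  [/\ norm2 (th z - th z') <= sdist z z', norm2 (muh z - muh z') <= sdist z z',
      norm2 (Vh z - Vh z') <= sdist z z', `|Jh z - Jh z'| <= sdist z z' &
  [/\ norm2 (fv z - fv z') <= sdist z z', norm2 (gV z - gV z') <= sdist z z',
      `|gJ z - gJ z'| <= sdist z z', norm2 (hv z - hv z') <= sdist z z' &
      norm2 (th z - th z') + norm2 (muh z - muh z') <= sdist z z']].
Proof.
rewrite /sdist; have h1 := norm2_ge0 (th z - th z'); have h2 := norm2_ge0 (muh z - muh z').
have h3 := norm2_ge0 (Vh z - Vh z'); have h4 := normr_ge0 (Jh z - Jh z').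
have h5 := norm2_ge0 (fv z - fv z'); have h6 := norm2_ge0 (gV z - gV z').
have h7 := normr_ge0 (gJ z - gJ z'); have h8 := norm2_ge0 (hv z - hv z').
by do !split; lra.
Qed.

Lemma sdist_ge0 z z' : 0 <= sdist z z'.
Proof. by rewrite /sdist !addr_ge0 ?norm2_ge0. Qed.

(** The observables to which the Poisson corrector applies. Boundedness is part of the class because
    it makes the class closed under products. *)
Definition BL (phi : state -> R) : Prop := exists2 C : R, 0 <= C &
  forall z z', dom z -> dom z' ->
    `|phi z| <= C /\ `|phi z - phi z'| <= C * sdist z z'.

Lemma BL_intro phi (C C' : R) : 0 <= C -> 0 <= C' ->
  (forall z, dom z -> `|phi z| <= C) ->
  (forall z z', dom z -> dom z' -> `|phi z - phi z'| <= C' * sdist z z') -> BL phi.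
Proof.
move=> c c' h1 h2; exists (C + C'); first exact: addr_ge0.
move=> z z' dz dz'; have b := h1 _ dz; have b' := h2 _ _ dz dz'; split; first by lra.
by apply: le_trans b' _; rewrite ler_wpM2r ?sdist_ge0// lerDr.
Qed.

Lemma BL_const c : BL (fun=> c).
Proof.
apply: (@BL_intro _ `|c| 0) => // z z' _ _.
by rewrite subrr normr0 mul0r.
Qed.

Lemma BLD phi psi : BL phi -> BL psi -> BL (fun z => phi z + psi z).
Proof.
case=> C c h [C' c' h']; exists (C + C'); first exact: addr_ge0.
move=> z z' dz dz'; have [b1 b2] := h _ _ dz dz'; have [b1' b2'] := h' _ _ dz dz'.
split; first by apply: le_trans (ler_normD _ _) _; exact: lerD.
by rewrite opprD addrACA mulrDl; apply: le_trans (ler_normD _ _) _; exact: lerD.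
Qed.

Lemma BLM phi psi : BL phi -> BL psi -> BL (fun z => phi z * psi z).
Proof.
case=> C c h [C' c' h'].
apply: (@BL_intro _ (C * C') (C * C' + C * C')); [exact: mulr_ge0|by rewrite addr_ge0 ?mulr_ge0| |].
  by move=> z dz; rewrite normrM; have [? _] := h _ _ dz dz; have [? _] := h' _ _ dz dz; exact: ler_pM.
move=> z z' dz dz'; have [b1 b2] := h _ _ dz dz'; have [b1' b2'] := h' _ _ dz dz'.
have [b3 _] := h' _ _ dz' dz'.
have -> : phi z * psi z - phi z' * psi z' =
   phi z * (psi z - psi z') + (phi z - phi z') * psi z' by ring.
have [b4 _] := h _ _ dz' dz'.
apply: le_trans (ler_normD _ _) _; rewrite !normrM mulrDl; apply: lerD.
  by rewrite -mulrA; apply: ler_pM.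
by rewrite mulrAC; apply: ler_pM.
Qed.

Lemma BLZ c phi : BL phi -> BL (fun z => c * phi z).
Proof. by move=> h; apply: BLM => //; exact: BL_const. Qed.

Lemma BLN phi : BL phi -> BL (fun z => - phi z).
Proof.
move=> /(BLZ (-1)); congr BL; apply/funext => z; exact: mulN1r.
Qed.

Lemma BLB phi psi : BL phi -> BL psi -> BL (fun z => phi z - psi z).
Proof. by move=> h1 h2; apply: BLD => //; exact: BLN. Qed.

Lemma BL_bigsum (I : finType) (phi : I -> state -> R) :
  (forall i, BL (phi i)) -> BL (fun z => \sum_i phi i z).
Proof.
move=> h; elim: (index_enum I) => [|i l IH].
  have := BL_const 0; congr BL; apply/funext => z; by rewrite big_nil.
have := BLD (h i) IH; congr BL; apply/funext => z; by rewrite big_cons.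
Qed.

Lemma BL_uniform (I : finType) (phi : I -> state -> R) : (forall i, BL (phi i)) ->
  exists2 C : R, 0 <= C & forall i z z', dom z -> dom z' ->
    `|phi i z| <= C /\ `|phi i z - phi i z'| <= C * sdist z z'.
Proof.
move=> h.
have /choice[C hC] : forall i, exists C : R, 0 <= C /\ forall z z', dom z -> dom z' ->
    `|phi i z| <= C /\ `|phi i z - phi i z'| <= C * sdist z z'.
  by move=> i; have [C c hC] := h i; exists C.
exists (\sum_i C i); first by apply: sumr_ge0 => i _; have [] := hC i.
move=> i z z' dz dz'; have [c /(_ _ _ dz dz')[b1 b2]] := hC i.
have le : C i <= \sum_i C i.
  by rewrite (bigD1 i)//= lerDl sumr_ge0// => j _; have [] := hC j.
by split; [exact: le_trans le|apply: le_trans b2 _; rewrite ler_wpM2r ?sdist_ge0].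
Qed.

Lemma BL_coord (I : finType) (fld : state -> {ffun I -> R}) (B : R) i : 0 <= B ->
  (forall z, dom z -> norm2 (fld z) <= B) ->
  (forall z z', norm2 (fld z - fld z') <= sdist z z') -> BL (fun z => fld z i).
Proof.
move=> b h1 h2; apply: (@BL_intro _ B 1) => //.
  by move=> z dz; exact: le_trans (norm2_coord _ _) (h1 _ dz).
move=> z z' _ _; rewrite mul1r; apply: le_trans (h2 z z').
by have := norm2_coord (fld z - fld z') i; rewrite !ffunE.
Qed.

Hypothesis B0_ge0 : 0 <= B0.

Lemma BL_f i : BL (fun z => fv z i).
Proof.
apply: (@BL_coord _ (@fv R S A) B0) => // [z [_ _ _ []]//|z z'].
by have [_ _ _ _ []] := sdist_ge z z'.
Qed.

Lemma BL_gV i : BL (fun z => gV z i).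
Proof.
apply: (@BL_coord _ (@gV R S A) B0) => // [z [_ _ _ []]//|z z'].
by have [_ _ _ _ []] := sdist_ge z z'.
Qed.

Lemma BL_h i : BL (fun z => hv z i).
Proof.
apply: (@BL_coord _ (@hv R S A) B0) => // [z [_ _ _ []]//|z z'].
by have [_ _ _ _ []] := sdist_ge z z'.
Qed.

Lemma BL_V i : BL (fun z => Vh z i).
Proof.
apply: (@BL_coord _ (@Vh R S A) BV) => //; first exact/ltW/(BV_gt0 reg).
- by move=> z [].
- by move=> z z'; have [_ _ ? _ _] := sdist_ge z z'.
Qed.

Lemma BL_mu i : BL (fun z => muh z i).
Proof.
apply: (@BL_coord _ (@muh R S A) 1) => //.
- by move=> z [/simplex_norm2].
- by move=> z z'; have [_ ? _ _ _] := sdist_ge z z'.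
Qed.

Lemma BL_Jh : BL (@Jh R S A).
Proof.
apply: (@BL_intro _ 1 1) => // [z [_ _ /andP[? ?] _]|z z' _ _]; first by rewrite ger0_norm.
by rewrite mul1r; have [_ _ _ ? _] := sdist_ge z z'.
Qed.

Lemma BL_gJ : BL (@gJ R S A).
Proof.
apply: (@BL_intro _ B0 1) => // [z [_ _ _ []]//|z z' _ _].
by rewrite mul1r; have [_ _ _ _ []] := sdist_ge z z'.
Qed.

Lemma BL_softmax x : BL (fun z => softmax (th z) x).
Proof.
apply: (@BL_intro _ 1 1) => //.
  case: x => s a z _; rewrite gtr0_norm ?softmax_gt0//; exact: softmax_le1.
move=> z z' _ _; rewrite mul1r.
have [h _ _ _ _] := sdist_ge z z'.
apply: le_trans (le_trans (softmax_lipschitz a0 _ _) h).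
have := norm2_coord (softmax (th z) - softmax (th z')) x.
have E (u v : {ffun S * A -> R}) : (u - v) x = u x - v x by rewrite !ffunE.
by rewrite E.
Qed.

Lemma BL_reward s a : BL (fun z => r s a (muh z)).
Proof.
apply: (@BL_intro _ 1 L) => //; first exact/ltW/(L_gt0 reg).
  by move=> z [hmu _ _ _]; exact: (reward_abs reg).
move=> z z' [h1 _ _ _] [h2 _ _ _]; have [_ h _ _ _] := sdist_ge z z'.
by apply: le_trans (reward_lipschitz reg _ _ h1 h2) _; rewrite ler_wpM2l// ltW// (L_gt0 reg).
Qed.

Lemma BL_kernel s a s' : BL (fun z => P (muh z) s a s').
Proof.
have L0 := L_gt0 reg.
apply: (@BL_intro _ 1 (2 * L)) => //; first by lra.
  move=> z [hmu _ _ _]; rewrite ger0_norm ?(kernel_ge0 Ker)//.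
  by have := simplex_le1 (Ker hmu s a) s'; rewrite ffunE.
move=> z z' [h1 _ _ _] [h2 _ _ _]; have [_ h _ _ _] := sdist_ge z z'.
by apply: le_trans (kernel_lipschitz reg _ _ _ h1 h2) _; rewrite ler_wpM2l//; lra.
Qed.

Lemma nu_l1_lipschitz z z' : dom z -> dom z' ->
  \sum_s `|nu P (softmax (th z)) (muh z) s - nu P (softmax (th z')) (muh z') s|
    <= 2 * L * sdist z z'.
Proof.
move=> [h1 _ _ _] [h2 _ _ _]; have L0 := L_gt0 reg.
have [_ _ _ _ [_ _ _ _ h]] := sdist_ge z z'.
apply: le_trans (dTV_L1 _ _) _; rewrite -mulrA ler_pM2l//.
apply: le_trans (nu_lipschitz reg (spol _) (spol _) h1 h2) _.
rewrite ler_pM2l//; apply: le_trans h.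
by rewrite lerD2r (softmax_lipschitz a0).
Qed.

Lemma BL_nu s : BL (fun z => nu P (softmax (th z)) (muh z) s).
Proof.
have L0 := L_gt0 reg.
apply: (@BL_intro _ 1 (2 * L)) => //; first by lra.
  move=> z [hmu _ _ _]; have hn := nu_mfg_simplex reg s0 (spol (th z)) hmu.
  by have [n0 _] := hn; rewrite ger0_norm//; exact: simplex_le1.
move=> z z' dz dz'; apply: le_trans (nu_l1_lipschitz dz dz').
by rewrite (bigD1 s)//= lerDl sumr_ge0.
Qed.

Lemma BL_J : BL (fun z => J P r (softmax (th z)) (muh z)).
Proof.
have V1 := LV_ge1 reg.
apply: (@BL_intro _ 1 LV) => //; first by lra.
  by move=> z [hmu _ _ _]; have /andP[? ?] := J_01 reg s0 (spol (th z)) hmu; rewrite ger0_norm.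
move=> z z' [h1 _ _ _] [h2 _ _ _]; have [_ _ _ _ [_ _ _ _ h]] := sdist_ge z z'.
have [_ /(_ (th z) (th z') _ _ h1 h2)[_ hJ _ _]] := reg_LV reg.
by apply: le_trans hJ _; rewrite ler_wpM2l//; lra.
Qed.

Lemma BL_score s a x : BL (fun z => score (th z) s a x).
Proof.
case: x => s' b; have := BLZ (s' == s)%:R (BLB (BL_const (b == a)%:R) (BL_softmax (s', b))).
by congr BL; apply/funext => z; rewrite scoreE.
Qed.

Lemma BL_mean_step (f : state -> S -> A -> S -> R) s :
  (forall a s', BL (fun z => f z s a s')) -> BL (fun z => mean_step P z s (f z s)).
Proof.
move=> h; apply: BL_bigsum => a; apply: BLM; first exact: BL_softmax.
by apply: BL_bigsum => s'; apply: BLM => //; exact: BL_kernel.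
Qed.

Lemma BL_stat_mean (f : state -> S -> A -> S -> R) :
  (forall s a s', BL (fun z => f z s a s')) ->
  BL (fun z => stat_mean P (th z) (muh z) (f z)).
Proof.
move=> h; apply: BL_bigsum => s; apply: BLM; first exact: BL_nu.
by apply: BL_mean_step.
Qed.

Lemma BL_Fbar x : BL (fun z => Fbar P r (th z) (muh z) (Vh z) x).
Proof.
have := @BL_stat_mean (fun z s a s' => zF r (th z) (muh z) (Vh z) s a s' x).
have h s a s' : BL (fun z => zF r (th z) (muh z) (Vh z) s a s' x).
  have := BLM (BLB (BLD (BL_reward s a) (BL_V s')) (BL_V s)) (BL_score s a x).
  by congr BL; apply/funext => z; rewrite [zF _ _ _ _ _ _ _ _]ffunE.
by move=> /(_ h); congr BL; apply/funext => z; rewrite -joint_mean_coord.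
Qed.

Lemma BL_zF s a s' x : BL (fun z => zF r (th z) (muh z) (Vh z) s a s' x).
Proof.
have := BLM (BLB (BLD (BL_reward s a) (BL_V s')) (BL_V s)) (BL_score s a x).
by congr BL; apply/funext => z; rewrite [zF _ _ _ _ _ _ _ _]ffunE.
Qed.

Lemma BL_zG s a s' x : BL (fun z => zG r (muh z) (Vh z) (Jh z) s a s' x).
Proof.
have := BLM (BLB (BLD (BLB (BL_reward s a) BL_Jh) (BL_V s')) (BL_V s)) (BL_const (unitv R s x)).
by congr BL; apply/funext => z; rewrite [zG _ _ _ _ _ _ _ _]ffunE.
Qed.

Lemma BL_Gbar x : BL (fun z => Gbar P r (th z) (muh z) (Vh z) (Jh z) x).
Proof.
have := @BL_stat_mean _ (fun s a s' => BL_zG s a s' x).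
by congr BL; apply/funext => z; rewrite -joint_mean_coord.
Qed.

(* The Poisson solution converts the Markovian noise [N] into a martingale
   difference, up to a telescoping term and second-order errors. *)
Lemma corrector (N : state -> S -> R) : (forall s, BL (fun z => N z s)) ->
  (forall z, dom z -> \sum_s nu P (softmax (th z)) (muh z) s * N z s = 0) ->
  exists (Phi : state -> S -> R) (C : R), [/\ 0 <= C,
    forall z s, dom z -> `|Phi z s| <= C &
    forall z s (nxt : A -> S -> state) (K eta eta' : R), dom z ->
      (forall a s', dom (nxt a s')) -> (forall a s', sdist (nxt a s') z <= K * eta) ->
      0 <= eta -> 0 <= K -> 0 <= eta - eta' <= eta ^+ 2 -> 0 <= eta' ->
      mean_step P z s (fun a s' => eta' * Phi (nxt a s') s') <=
        eta * Phi z s - eta * N z s + C * (1 + K) * eta ^+ 2].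
Proof.
move=> NBL Nmean; have [B b hB] := BL_uniform NBL.
have c0 := reg_C0 reg; have c1 := reg_C1 reg; have er := reg_ergodic reg.
pose Phi z := pois P (softmax (th z)) (muh z) (N z).
have K0 : 0 <= mixK C0 C1 by exact: mixK_ge0.
have L0 := L_gt0 reg.
have NB z : dom z -> forall s, `|N z s| <= B by move=> dz s; have [] := hB s z z dz dz.
have PB z s : dom z -> `|Phi z s| <= mixK C0 C1 * B.
  move=> dz; have [hmu _ _ _] := dz.
  exact: (pois_bound Ker c0 c1 er (spol (th z)) hmu b (NB z dz)).
(* The constant of [pois_lipschitz] per unit of [sdist]: the data vary by [B], the kernel and the
   stationary law by [2 * L]. *)
pose CL := mixK C0 C1 * (2 * B + B * (2 * L) + mixK C0 C1 * B * (2 * L)) + mixK C0 C1 * B * (2 * L).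
have PL z z' s : dom z -> dom z' -> `|Phi z s - Phi z' s| <= CL * sdist z z'.
  move=> dz dz'; have [h1 _ _ _] := dz; have [h2 _ _ _] := dz'.
  have [_ _ _ _ [_ _ _ _ h]] := sdist_ge z z'; have d0 := sdist_ge0 z z'.
  have hP x : \sum_s' `|chain P (softmax (th z)) (muh z) x s' -
      chain P (softmax (th z')) (muh z') x s'| <= 2 * L * sdist z z'.
    apply: le_trans (chain_lipschitz reg x (spol _) (spol _) h1 h2) _.
    rewrite -mulrA ler_pM2l// ler_pM2l//; apply: le_trans h.
    by rewrite lerD2r (softmax_lipschitz a0).
  have e0 : 0 <= B * sdist z z' by rewrite mulr_ge0.
  have l0 : 0 <= 2 * L * sdist z z' by rewrite !mulr_ge0// ltW.
  have := pois_lipschitz Ker c0 c1 er s0 (spol (th z)) (spol (th z')) h1 h2 b (NB z dz)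
    (NB z' dz') e0 (fun x => (hB x z z' dz dz').2) l0 hP l0 (nu_l1_lipschitz dz dz') s.
  by move=> /le_trans; apply; rewrite /CL le_eqVlt; apply/orP; left; apply/eqP; ring.
have CL0 : 0 <= CL.
  have KB := mulr_ge0 K0 b; have L2 := mulr_ge0 (ler0n R 2) (ltW L0).
  exact: addr_ge0 (mulr_ge0 K0 (addr_ge0 (addr_ge0 (mulr_ge0 (ler0n R 2) b) (mulr_ge0 b L2)) (mulr_ge0 KB L2))) (mulr_ge0 KB L2).
exists Phi, (mixK C0 C1 * B + CL); split; first exact: addr_ge0 (mulr_ge0 K0 b) CL0.
  by move=> z s dz; apply: le_trans (PB z s dz) _; rewrite lerDl.
move=> z s nxt K eta eta' dz dn hn e0 k0 /andP[d0 d1] e'0; have [hmu _ _ _] := dz.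
have PE : Phi z s = N z s + mean_step P z s (fun _ s' => Phi z s').
  rewrite {1}/Phi (pois_eq Ker c0 c1 er (spol (th z)) hmu b (NB z dz)) Nmean// subr0.
  by rewrite chain_avg.
(* Two replacements, each of second order: the new state by the old one, by Lipschitz continuity
   over a move of size [K * eta], and [eta'] by [eta]. Afterwards Poisson's equation applies at the
   fixed state [z]. *)
have step1 a s' : eta' * Phi (nxt a s') s' <=
    eta * Phi z s' + (mixK C0 C1 * B + CL * K) * eta ^+ 2.
  have h1 := PL _ _ s' (dn a s') dz; have h2 := PB z s' dz.
  have h3 : Phi (nxt a s') s' - Phi z s' <= CL * (K * eta).
    apply: le_trans (ler_norm _) (le_trans h1 _).
    by rewrite ler_wpM2l.
  have h4 : (eta' - eta) * Phi z s' <= eta ^+ 2 * (mixK C0 C1 * B).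
    apply: le_trans (ler_norm _) _; rewrite normrM; apply: ler_pM => //.
    by rewrite distrC ger0_norm.
  have h5 := ler_wpM2l e'0 h3.
  have ee : eta' <= eta by lra.
  have h6 : eta' * (CL * (K * eta)) <= eta * (CL * (K * eta)).
    by rewrite ler_wpM2r// !mulr_ge0.
  lra.
apply: le_trans (mean_step_le Ker a0 s hmu step1) _.
rewrite mean_stepD mean_stepZ (mean_step_const Ker a0)// PE.
have q0 := sqr_ge0 eta; have m0 : 0 <= mixK C0 C1 * B by rewrite mulr_ge0.
have := mulr_ge0 (mulr_ge0 m0 k0) q0; have := mulr_ge0 CL0 q0.
lra.
Qed.

End BoundedLipschitz.

(** * Moving averages with a slowly moving target, and soft thresholding *)

Section Tracking.
Variable R : realType.

(** A momentum [z] with target [t] receives the sample [Z] while the target moves to [t']. The move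
    is bounded twice: by [e * T] with [T] expressed through the current errors, which enters the
    first-order part, and by [e * B] with a uniform constant, which serves for the remainder. The
    sampling error stays as an inner product, because it vanishes only in the stationary mean. *)
Lemma tracking_drift (I : finType) (z t t' Z : {ffun I -> R}) (l e B T : R) :
  0 <= l -> 0 <= e -> 0 <= B ->
  norm2 (z - t) <= B -> norm2 (Z - t) <= B ->
  norm2 (t - t') <= e * T -> norm2 (t - t') <= e * B ->
  norm2 ((1 - l * e) *: z + (l * e) *: Z - t') ^+ 2 <=
    norm2 (z - t) ^+ 2 + e * (- 2 * l * norm2 (z - t) ^+ 2 + 2 * norm2 (z - t) * T
      + 2 * l * dot (z - t) (Z - t)) + ((2 * l + 1) * B) ^+ 2 * e ^+ 2.
Proof.
move=> l0 e0 B0 hz hZ hT hB.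
set u := z - t; set w := Z - t; set d := t - t'.
have -> : (1 - l * e) *: z + (l * e) *: Z - t' = u + ((l * e) *: (w - u) + d).
  by apply/ffunP => i; rewrite !ffunE /GRing.scale/=; ring.
rewrite norm2D_sqr dotDr dotZr dotBr -norm2_sqr.
have h1 : dot u d <= norm2 u * (e * T) by apply: dot_le_bound.
have le0 : 0 <= l * e by exact: mulr_ge0.
have h2 : norm2 ((l * e) *: (w - u) + d) <= (2 * l + 1) * B * e.
  apply: le_trans (norm2D _ _) _; rewrite norm2Z ger0_norm//.
  have := norm2B w u; have := norm2_ge0 w; have := norm2_ge0 u => a1 a2 a3.
  have : l * e * norm2 (w - u) <= l * e * (B + B).
    by apply: ler_wpM2l => //; lra.
  by rewrite -/d in hB; lra.
have {}h2 : norm2 ((l * e) *: (w - u) + d) ^+ 2 <= ((2 * l + 1) * B * e) ^+ 2.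
  by rewrite ler_pXn2r ?nnegrE ?norm2_ge0// (le_trans (norm2_ge0 _) h2).
move: h2; rewrite [in X in _ <= X -> _]exprMn => h2.
by move: h1 h2; set n2 := norm2 (_ + d) ^+ 2; lra.
Qed.

Lemma tracking_drift1 (z t t' Z l e B T : R) :
  0 <= l -> 0 <= e -> 0 <= B -> `|z - t| <= B -> `|Z - t| <= B ->
  `|t - t'| <= e * T -> `|t - t'| <= e * B ->
  ((1 - l * e) * z + l * e * Z - t') ^+ 2 <=
    (z - t) ^+ 2 + e * (- 2 * l * (z - t) ^+ 2 + 2 * `|z - t| * T
      + 2 * l * ((z - t) * (Z - t))) + ((2 * l + 1) * B) ^+ 2 * e ^+ 2.
Proof.
(* Scalars are treated as vectors with one coordinate. *)
pose f (x : R) : {ffun unit -> R} := [ffun=> x].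
have dotE x y : dot (f x) (f y) = x * y.
  by rewrite /dot (big_pred1 tt) ?ffunE// => -[].
have nE x : norm2 (f x) = `|x| by rewrite norm2E dotE -expr2 sqrtr_sqr.
have sE x y : f x - f y = f (x - y) by apply/ffunP => i; rewrite !ffunE.
move=> l0 e0 B0 h1 h2 h3 h4.
have := @tracking_drift _ (f z) (f t) (f t') (f Z) l e B T l0 e0 B0.
rewrite !sE !nE dotE => /(_ h1 h2 h3 h4).
have -> : (1 - l * e) *: f z + (l * e) *: f Z - f t' = f ((1 - l * e) * z + l * e * Z - t').
  by apply/ffunP => i; rewrite !ffunE /GRing.scale/=.
by rewrite nE !real_normK ?num_real.
Qed.

Lemma sqr_le_add (y u w c : R) : 0 <= y -> y <= u + w -> 0 <= u -> 0 <= w ->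
  w <= c -> y ^+ 2 <= u ^+ 2 + 2 * u * w + c ^+ 2.
Proof.
move=> y0 h u0 w0 wc; have h1 : y ^+ 2 <= (u + w) ^+ 2.
  by rewrite ler_pXn2r ?nnegrE ?addr_ge0.
have h2 : w ^+ 2 <= c ^+ 2 by rewrite ler_pXn2r ?nnegrE// (le_trans w0).
by apply: le_trans h1 _; rewrite sqrrD; lra.
Qed.

Lemma norm2_step_sqr (I : finType) (u h m : {ffun I -> R}) (x e B : R) :
  0 <= x -> 0 <= e -> norm2 h <= B ->
  norm2 (u + (x * e) *: h - m) ^+ 2 <=
    norm2 (u - m) ^+ 2 + 2 * (x * e) * dot h (u - m) + (x * B * e) ^+ 2.
Proof.
move=> x0 e0 hB; have xe0 : 0 <= x * e by rewrite mulr_ge0.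
rewrite [u + _ - m]addrAC [leLHS]norm2D_sqr dotZr (dotC _ h) norm2Z ger0_norm//.
have : (x * e * norm2 h) ^+ 2 <= (x * B * e) ^+ 2.
  rewrite ler_pXn2r ?nnegrE ?mulr_ge0 ?norm2_ge0 ?(le_trans (norm2_ge0 _) hB)//.
  by rewrite mulrAC ler_wpM2r// ler_wpM2l.
lra.
Qed.

Definition clamp (T t : R) : R := Num.max (- T) (Num.min T t).
(** Soft thresholding: the signed excess of [t] over the interval [-T, T]. *)
Definition resid (T t : R) : R := t - clamp T t.

Lemma clamp_bound T t : 0 <= T -> - T <= clamp T t <= T.
Proof.
move=> T0; have TT : - T <= T by lra.
by rewrite /clamp le_max ge_max ge_min !lexx TT.
Qed.

Lemma residE T t : 0 <= T ->
  [\/ t <= - T /\ resid T t = t + T, - T <= t <= T /\ resid T t = 0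
    | T <= t /\ resid T t = t - T].
Proof.
move=> T0; rewrite /resid /clamp.
have [h|/ltW h] := leP t (- T).
  have tT : t <= T by lra.
  by constructor 1; rewrite (min_r tT) (max_l h) opprK.
have [h'|/ltW h'] := leP t T.
  by constructor 2; rewrite max_r// subrr h.
by constructor 3; rewrite max_r//; lra.
Qed.

Lemma resid_lipschitz T t t' : 0 <= T -> `|resid T t - resid T t'| <= `|t - t'|.
Proof.
move=> T0; have := residE t T0; have := residE t' T0.
case=> [[h1 ->]|[/andP[h1 h1'] ->]|[h1 ->]] [[h2 ->]|[/andP[h2 h2'] ->]|[h2 ->]];
  rewrite ler_norml; have := ler_norm (t - t'); have := ler_norm (- (t - t'));
  rewrite normrN => ? ?; apply/andP; split; lra.
Qed.

Lemma resid_min T t c : 0 <= T -> - T <= c <= T -> resid T t ^+ 2 <= (t - c) ^+ 2.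
Proof.
move=> T0 /andP[c1 c2]; have [[h ->]|[h ->]|[h ->]] := residE t T0.
- rewrite -[(t - c) ^+ 2]sqrrN -[(t + T) ^+ 2]sqrrN !expr2.
  by apply: ler_pM; lra.
- by rewrite expr0n/= sqr_ge0.
- by rewrite !expr2; apply: ler_pM; lra.
Qed.

Lemma resid_bound T t B : 0 <= T -> `|t| <= B -> T <= B -> `|resid T t| <= B - T.
Proof.
move=> T0; rewrite !ler_norml => /andP[t1 t2] TB.
have [[h ->]|[h ->]|[h ->]] := residE t T0; apply/andP; split; lra.
Qed.

End Tracking.

(** * One-step drift of the errors *)

Section OneStep.
Variables (R : realType) (S A : finType).
Variables (P : {ffun S -> R} -> S -> A -> S -> R) (r : S -> A -> {ffun S -> R} -> R).
Variables (C0 C1 delta L BV LV LTV gamma : R).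
Hypothesis reg : regular_mfg P r C0 C1 delta L BV LV LTV gamma.
Variables (s0 : S) (a0 : A) (cJ a b x l B0 : R).
Hypotheses (a_gt0 : 0 < a) (b_gt0 : 0 < b) (x_gt0 : 0 < x) (l_gt0 : 0 < l).
Hypotheses (l_le : l <= 1 / 4) (cJ_ge1 : 1 <= cJ).
Hypotheses (B0_F : 2 * (1 + 2 * BV) <= B0) (B0_c : cJ <= B0) (B0_h : 2 <= B0).

Local Notation state := (astate R S A).
Local Notation spol := (spol a0).
Local Notation step := (Defs.step r cJ BV (stepsz a) (stepsz b) (stepsz x) (stepsz l)).
Local Notation pi z := (softmax (th z)).
Local Notation mus z := (mustar P (softmax (th z))).
Local Notation Jz z := (J P r (softmax (th z)) (muh z)).
Local Notation nuz z := (nu P (softmax (th z)) (muh z)).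
Local Notation Vz z := (Vfun P r (softmax (th z)) (muh z)).
Local Notation Fz z := (Fbar P r (th z) (muh z) (Vh z)).
Local Notation Gz z := (Gbar P r (th z) (muh z) (Vh z) (Jh z)).
Local Notation dom := (dom BV B0).

Definition gradJ (z : state) : {ffun S * A -> R} :=
  grad (fun th' => J P r (softmax th') (mus z)) (th z).
Definition eG (z : state) := norm2 (gradJ z).
Definition em (z : state) := norm2 (muh z - mus z).
Definition dV (z : state) : {ffun S -> R} := proj_perp (Vh z - Vz z).
Definition ev (z : state) := norm2 (dV z).
Definition ej (z : state) := `|Jh z - Jz z|.
Definition rF (z : state) := fv z - Fz z.
Definition rG (z : state) := gV z - Gz z.
Definition rC (z : state) := gJ z - cJ * (Jz z - Jh z).
Definition rH (z : state) := hv z - (nuz z - muh z).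
(** The sizes bound the momenta by the errors. Every displacement of a target is thus charged to
    quantities that the Lyapunov function controls. *)
Definition sizeF (z : state) := eG z + norm2 (rF z) + LV * em z + ev z.
Definition sizeH (z : state) := 2 * em z + norm2 (rH z).
Definition sizeG (z : state) := 2 * ev z + ej z + norm2 (rG z).
Definition sizeC (z : state) := cJ * ej z + `|rC z|.

Lemma eps_totalE (z : state) : eps_total P r z = eG z ^+ 2 + em z ^+ 2 + ev z ^+ 2 + ej z ^+ 2.
Proof. by rewrite /eps_total /ej real_normK ?num_real. Qed.

Lemma B0_ge0 : 0 <= B0. Proof. exact: le_trans (ler0n R 2) B0_h. Qed.

Lemma step_th k (z : state) s c s' : th (step k z s c s') = th z + (a * eta R k) *: fv z.
Proof. by []. Qed.

Lemma step_f k (z : state) s c s' : fv (step k z s c s') =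
  (1 - l * eta R k) *: fv z + (l * eta R k) *: zF r (th z) (muh z) (Vh z) s c s'.
Proof.
rewrite /= stepszE; congr (_ + _); rewrite /zF -scalerA; congr (_ *: _).
by congr (_ *: _); exact: (gradlogpiE a0).
Qed.

Lemma step_gV k (z : state) s c s' : gV (step k z s c s') =
  (1 - l * eta R k) *: gV z + (l * eta R k) *: zG r (muh z) (Vh z) (Jh z) s c s'.
Proof. by rewrite /= stepszE /zG scalerA. Qed.

Lemma step_gJ k (z : state) s c s' : gJ (step k z s c s') =
  (1 - l * eta R k) * gJ z + l * eta R k * (cJ * (r s c (muh z) - Jh z)).
Proof. by []. Qed.

Lemma step_h k (z : state) s c s' : hv (step k z s c s') =
  (1 - l * eta R k) *: hv z + (l * eta R k) *: (unitv R s - muh z).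
Proof. by []. Qed.

Lemma step_mu k (z : state) s c s' : muh (step k z s c s') =
  proj_simplex (muh z + (x * eta R k) *: hv z).
Proof. by []. Qed.

Lemma step_V k (z : state) s c s' : Vh (step k z s c s') = proj_ball BV (Vh z + (b * eta R k) *: gV z).
Proof. by []. Qed.

Lemma step_J k (z : state) s c s' : Jh (step k z s c s') = proj_01 (Jh z + b * eta R k * gJ z).
Proof. by []. Qed.

Lemma eta_01 k : 0 <= eta R k /\ eta R k <= 1.
Proof. by split; [exact/ltW/eta_gt0|exact: eta_le1]. Qed.

Lemma norm2_convex (I : finType) (u w : {ffun I -> R}) (t B : R) : 0 <= t <= 1 ->
  norm2 u <= B -> norm2 w <= B -> norm2 ((1 - t) *: u + t *: w) <= B.
Proof.
case/andP => t0 t1 hu hw; apply: le_trans (norm2D _ _) _.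
by rewrite !norm2Z !ger0_norm ?subr_ge0//; nra.
Qed.

Lemma l_eta_01 k : 0 <= l * eta R k <= 1.
Proof.
have [e0 e1] := eta_01 k; apply/andP; split; first by rewrite mulr_ge0// ltW.
by have := ler_wpM2l (ltW l_gt0) e1; have := l_le; lra.
Qed.

Lemma norm2_zF (z : state) s c s' : simplex (muh z) -> norm2 (Vh z) <= BV ->
  norm2 (zF r (th z) (muh z) (Vh z) s c s') <= B0.
Proof.
move=> hmu hV; apply: le_trans B0_F; rewrite norm2Z mulrC.
by apply: ler_pM; rewrite ?norm2_ge0 ?norm2_score//; exact: (zF_abs reg).
Qed.

Lemma norm2_zG (z : state) s c s' : simplex (muh z) -> norm2 (Vh z) <= BV -> 0 <= Jh z <= 1 ->
  norm2 (zG r (muh z) (Vh z) (Jh z) s c s') <= B0.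
Proof.
move=> hmu hV /andP[j0 j1]; rewrite norm2Z norm2_unitv mulr1.
have := norm2_coord (Vh z) s; have := norm2_coord (Vh z) s'.
have /andP[r0 r1] := reg_reward reg s c hmu; have := BV_gt0 reg; have := B0_F.
by rewrite !ler_norml => ? ? /andP[? ?] /andP[? ?]; apply/andP; split; lra.
Qed.

Lemma norm2_unitv_sub (mu : {ffun S -> R}) s : simplex mu -> norm2 (unitv R s - mu) <= 2.
Proof.
by move=> h; apply: le_trans (norm2B _ _) _; rewrite norm2_unitv; have := simplex_norm2 h; lra.
Qed.

Lemma abs_zC (z : state) s c : simplex (muh z) -> 0 <= Jh z <= 1 ->
  `|cJ * (r s c (muh z) - Jh z)| <= B0.
Proof.
move=> hmu /andP[j0 j1]; apply: le_trans B0_c; have c0 : 0 <= cJ by have := cJ_ge1; lra.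
rewrite normrM ger0_norm// ler_piMr//.
by have /andP[r0 r1] := reg_reward reg s c hmu; rewrite ler_norml; apply/andP; split; lra.
Qed.

Lemma dom_step k (z : state) s c s' : dom z -> dom (step k z s c s').
Proof.
move=> [hmu hV hj [hf hg hc hh]]; have l01 := l_eta_01 k; split.
- by rewrite step_mu; have [] := proj_simplexP s0 (muh z + (x * eta R k) *: hv z).
- by rewrite step_V; have [] := proj_ballP (Vh z + (b * eta R k) *: gV z) (BV_gt0 reg).
- by rewrite step_J; have [] := proj_01P (Jh z + b * eta R k * gJ z).
split.
- by rewrite step_f; apply: norm2_convex => //; exact: norm2_zF.
- by rewrite step_gV; apply: norm2_convex => //; exact: norm2_zG.
- rewrite step_gJ; case/andP: l01 => t0 t1.
  apply: le_trans (ler_normD _ _) _; rewrite !normrM (ger0_norm (x := 1 - _)) ?subr_ge0//.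
  rewrite (ger0_norm (x := l)) ?(ltW l_gt0)// (ger0_norm (x := eta R k)); last first.
    by have [] := eta_01 k.
  rewrite -normrM; have := abs_zC s c hmu hj.
  set t := l * _ in t0 t1 *; set y := `|cJ * _|; set y' := `|gJ z| in hc * => hy.
  have t1' : 0 <= 1 - t by lra.
  have := ler_wpM2l t0 hy; have := ler_wpM2l t1' hc; lra.
- rewrite step_h; apply: norm2_convex => //.
  by apply: le_trans B0_h; exact: norm2_unitv_sub.
Qed.

Lemma move_th k (z : state) s c s' : norm2 (th (step k z s c s') - th z) = a * eta R k * norm2 (fv z).
Proof.
rewrite step_th addrC addKr norm2Z ger0_norm//.
by rewrite mulr_ge0 ?(ltW a_gt0)//; have [] := eta_01 k.
Qed.

Lemma move_mu k (z : state) s c s' : dom z ->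
  norm2 (muh (step k z s c s') - muh z) <= x * eta R k * norm2 (hv z).
Proof.
move=> [hmu _ _ _]; rewrite step_mu.
have [_ /(_ _ hmu) h] := proj_simplexP s0 (muh z + (x * eta R k) *: hv z).
apply: le_trans h _; rewrite addrC addKr norm2Z ger0_norm//.
by rewrite mulr_ge0 ?(ltW x_gt0)//; have [] := eta_01 k.
Qed.

Lemma move_V k (z : state) s c s' : dom z ->
  norm2 (Vh (step k z s c s') - Vh z) <= b * eta R k * norm2 (gV z).
Proof.
move=> [_ hV _ _]; rewrite step_V.
have [_ /(_ _ hV) h] := proj_ballP (Vh z + (b * eta R k) *: gV z) (BV_gt0 reg).
apply: le_trans h _; rewrite addrC addKr norm2Z ger0_norm//.
by rewrite mulr_ge0 ?(ltW b_gt0)//; have [] := eta_01 k.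
Qed.

Lemma proj01_contracts (y t : R) : 0 <= t <= 1 -> `|proj_01 y - t| <= `|y - t|.
Proof.
move=> /andP[t0 t1]; have [_ h1 h2 h3] := proj_01P y.
have [y0|y0] := leP y 0; first by rewrite h2// !ler0_norm; lra.
have [y1|y1] := leP y 1; first by rewrite h1// y1 ltW.
by rewrite h3 ?(ltW y1)// !ger0_norm; lra.
Qed.

Lemma move_J k (z : state) s c s' : dom z ->
  `|Jh (step k z s c s') - Jh z| <= b * eta R k * `|gJ z|.
Proof.
move=> [_ _ hj _]; rewrite step_J; apply: le_trans (proj01_contracts _ hj) _.
rewrite addrC addKr normrM ger0_norm//.
by rewrite mulr_ge0 ?(ltW b_gt0)//; have [] := eta_01 k.
Qed.

Definition moveK : R := (a + x + b + b) * B0 + 4 * (l * (B0 + B0)).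

Lemma sdist_step k (z : state) s c s' : dom z -> sdist (step k z s c s') z <= moveK * eta R k.
Proof.
move=> dz; have [hmu hV hj [hf hg hc hh]] := dz; have [e0 e1] := eta_01 k.
have m1 := move_th k z s c s'; have m2 := move_mu k s c s' dz.
have m3 := move_V k s c s' dz; have m4 := move_J k s c s' dz.
have conv (I : finType) (u w : {ffun I -> R}) : norm2 u <= B0 -> norm2 w <= B0 ->
    norm2 ((1 - l * eta R k) *: u + (l * eta R k) *: w - u) <= l * (B0 + B0) * eta R k.
  move=> hu hw; have -> : (1 - l * eta R k) *: u + (l * eta R k) *: w - u =
      (l * eta R k) *: (w - u).
    by apply/ffunP => i; rewrite !ffunE /GRing.scale/=; ring.
  rewrite norm2Z ger0_norm; last by case/andP: (l_eta_01 k).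
  rewrite mulrAC ler_wpM2r// ler_wpM2l ?(ltW l_gt0)//.
  by apply: le_trans (norm2B _ _) _; exact: lerD.
have m5 : norm2 (fv (step k z s c s') - fv z) <= l * (B0 + B0) * eta R k.
  by rewrite step_f; apply: conv => //; exact: norm2_zF.
have m6 : norm2 (gV (step k z s c s') - gV z) <= l * (B0 + B0) * eta R k.
  by rewrite step_gV; apply: conv => //; exact: norm2_zG.
have m8 : norm2 (hv (step k z s c s') - hv z) <= l * (B0 + B0) * eta R k.
  rewrite step_h; apply: conv => //.
  by apply: le_trans B0_h; exact: norm2_unitv_sub.
have m7 : `|gJ (step k z s c s') - gJ z| <= l * (B0 + B0) * eta R k.
  rewrite step_gJ; set w := cJ * _.
  have -> : (1 - l * eta R k) * gJ z + l * eta R k * w - gJ z = l * eta R k * (w - gJ z) by ring.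
  rewrite normrM ger0_norm; last by case/andP: (l_eta_01 k).
  rewrite mulrAC ler_wpM2r// ler_wpM2l ?(ltW l_gt0)//.
  apply: le_trans (ler_normB _ _) _; apply: lerD => //; exact: abs_zC.
have n1 : a * eta R k * norm2 (fv z) <= a * B0 * eta R k.
  by rewrite mulrAC ler_wpM2r// ler_wpM2l ?(ltW a_gt0).
have n2 : x * eta R k * norm2 (hv z) <= x * B0 * eta R k.
  by rewrite mulrAC ler_wpM2r// ler_wpM2l ?(ltW x_gt0).
have n3 : b * eta R k * norm2 (gV z) <= b * B0 * eta R k.
  by rewrite mulrAC ler_wpM2r// ler_wpM2l ?(ltW b_gt0).
have n4 : b * eta R k * `|gJ z| <= b * B0 * eta R k.
  by rewrite mulrAC ler_wpM2r// ler_wpM2l ?(ltW b_gt0).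
rewrite /sdist m1 /moveK; lra.
Qed.

Lemma gradJE (z : state) : gradJ z = Fbar P r (th z) (mus z) (Vfun P r (pi z) (mus z)).
Proof.
by rewrite /gradJ (grad_J reg s0 a0)//; have [] := mustarP reg (spol (th z)).
Qed.

Lemma sizeF_ge0 (z : state) : [/\ 0 <= eG z, 0 <= em z, 0 <= ev z & 0 <= ej z].
Proof. by split; rewrite ?norm2_ge0 ?normr_ge0. Qed.

(** Three replacements lead from the actor momentum to the gradient: its stationary target, the true
    value function in place of the critic, and the induced mean field in place of its estimate. *)
Lemma fv_sub_gradJ (z : state) : dom z ->
  norm2 (fv z - gradJ z) <= norm2 (rF z) + LV * em z + ev z.
Proof.
move=> [hmu hV hj _]; have [hms _] := mustarP reg (spol (th z)).
apply: le_trans (norm2_dist (Fz z) _ _) _; rewrite -addrA lerD2l.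
apply: le_trans (norm2_dist (Fbar P r (th z) (muh z) (Vz z)) _ _) _.
rewrite (addrC (LV * em z)); apply: lerD.
  exact: (Fbar_V_diff reg s0 a0 (th z) (Vh z) (Vz z) hmu).
have [_ /(_ (th z) (th z) (muh z) (mus z) hmu hms)[_ _ h _]] := reg_LV reg.
rewrite -(grad_J reg s0 a0 (th z) hmu) /gradJ; apply: le_trans h _.
by rewrite subrr norm2_0 add0r.
Qed.

Lemma fv_size (z : state) : dom z -> norm2 (fv z) <= sizeF z.
Proof.
move=> dz; apply: le_trans (norm2_subr_le _ (gradJ z)) _.
by rewrite /sizeF -!addrA lerD2l !addrA fv_sub_gradJ.
Qed.

Lemma gradJ_dot_f (z : state) : dom z ->
  eG z ^+ 2 - eG z * (norm2 (rF z) + LV * em z + ev z) <= dot (gradJ z) (fv z).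
Proof.
move=> dz; have h := fv_sub_gradJ dz.
have -> : fv z = gradJ z + (fv z - gradJ z) by rewrite addrC subrK.
rewrite dotDr -norm2_sqr lerD2l.
have := dot_CS (gradJ z) (fv z - gradJ z); rewrite ler_norml => /andP[h1 _].
apply: le_trans h1; rewrite lerN2; apply: ler_wpM2l => //; exact: norm2_ge0.
Qed.

Lemma hv_size (z : state) : dom z -> norm2 (hv z) <= sizeH z.
Proof.
move=> [hmu _ _ _]; apply: le_trans (norm2_subr_le _ (nuz z - muh z)) _.
by rewrite lerD2r; exact: (norm2_nu_sub reg (spol (th z))).
Qed.

Lemma gV_size (z : state) : dom z -> norm2 (gV z) <= sizeG z.
Proof.
move=> [hmu _ _ _]; apply: le_trans (norm2_subr_le _ (Gz z)) _.
rewrite lerD2r; apply: le_trans (norm2_Gbar reg s0 a0 _ _ _ hmu) _.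
by rewrite distrC addrC.
Qed.

Lemma gJ_size (z : state) : `|gJ z| <= sizeC z.
Proof.
have -> : gJ z = cJ * (Jz z - Jh z) + rC z by rewrite /rC addrC subrK.
apply: le_trans (ler_normD _ _) _; rewrite lerD2r normrM distrC ger0_norm//.
by have := cJ_ge1; lra.
Qed.

Lemma norm2_joint_mean_le (I : finType) th mu (Z : S -> A -> S -> {ffun I -> R}) B :
  simplex mu -> (forall s c s', norm2 (Z s c s') <= B) ->
  norm2 (joint_mean P th mu Z) <= B.
Proof.
move=> hmu ZB; apply: le_trans (norm2_wsum _ (fun y => ZB y.1.1 y.1.2 y.2)) _.
have [j0 j1] := joint_simplex reg s0 a0 th hmu.
by under eq_bigr do rewrite ger0_norm//; rewrite j1 mul1r.
Qed.

Lemma dom_bounds (z : state) : dom z -> [/\ norm2 (Fz z) <= B0, norm2 (Gz z) <= B0,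
  `|cJ * (Jz z - Jh z)| <= B0 & norm2 (nuz z - muh z) <= B0].
Proof.
move=> [hmu hV hj _]; split.
- by apply: norm2_joint_mean_le => // s c s'; exact: norm2_zF.
- by apply: norm2_joint_mean_le => // s c s'; exact: norm2_zG.
- apply: le_trans B0_c; rewrite normrM ger0_norm; last by have := cJ_ge1; lra.
  have /andP[? ?] := J_01 reg s0 (spol (th z)) hmu; case/andP: hj => ? ?.
  rewrite ler_piMr//; first by have := cJ_ge1; lra.
  by rewrite ler_norml; apply/andP; split; lra.
- apply: le_trans B0_h; apply: le_trans (norm2B _ _) _.
  have := simplex_norm2 hmu; have := simplex_norm2 (nu_mfg_simplex reg s0 (spol (th z)) hmu); lra.
Qed.

(** [E] and [E'] are the distances to the old and new targets, [N] the distance of the new iterate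
    to the old target, [w] the displacement of the target and [dt] the inner product of the update
    with the error. The analogous lemma for the average reward uses the same scheme. *)
Lemma drift_m_arith (E' N E e w rh sF dt D : R) :
  N ^+ 2 <= E ^+ 2 + 2 * (x * e) * dt + (x * B0 * e) ^+ 2 ->
  E' ^+ 2 <= N ^+ 2 + 2 * N * w + (L * (a * B0) * e) ^+ 2 ->
  x * e * dt <= x * e * (rh * E - D * E ^+ 2) ->
  N * w <= E * (L * (a * e * sF)) + x * e * B0 * (L * (a * B0) * e) ->
  E' ^+ 2 <= E ^+ 2 + e * (- 2 * x * D * E ^+ 2 + 2 * E * (x * rh + L * a * sF))
    + (2 * (x * B0) * (L * (a * B0)) + (L * (a * B0)) ^+ 2 + (x * B0) ^+ 2) * e ^+ 2.
Proof. by move=> q1 q2 q3 q4; lra. Qed.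

Lemma drift_j_arith (E' N E e w rc M dt : R) :
  N ^+ 2 <= E ^+ 2 + 2 * (b * e) * dt + (b * B0 * e) ^+ 2 ->
  E' ^+ 2 <= N ^+ 2 + 2 * N * w + (LV * (e * ((a + x) * B0))) ^+ 2 ->
  b * e * dt <= b * e * (- cJ * E ^+ 2 + E * rc) ->
  N * w <= E * (LV * (e * M)) + b * e * B0 * (LV * (e * ((a + x) * B0))) ->
  E' ^+ 2 <= E ^+ 2 + e * (- 2 * b * cJ * E ^+ 2 + 2 * E * (b * rc + LV * M))
    + (2 * (b * B0) * (LV * ((a + x) * B0)) + (LV * ((a + x) * B0)) ^+ 2 + (b * B0) ^+ 2) * e ^+ 2.
Proof. by move=> q1 q2 q3 q4; lra. Qed.

Hypothesis LF_ge0 : 0 <= cL_F BV L LTV.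
Hypothesis LG_ge0 : 0 <= cL_G BV cJ L LTV.
Local Notation LF := (cL_F BV L LTV).
Local Notation LG := (cL_G BV cJ L LTV).
Local Notation LH := (cL_H L).

Definition sizeM z := a * sizeF z + x * sizeH z.

Lemma move_thmu k (z : state) s c s' : dom z ->
  let z' := step k z s c s' in
  norm2 (th z - th z') + norm2 (muh z - muh z') <= eta R k * sizeM z /\
  norm2 (th z - th z') + norm2 (muh z - muh z') <= eta R k * ((a + x) * B0).
Proof.
move=> dz z'; have [e0 e1] := eta_01 k; have [_ _ _ [hf _ _ hh]] := dz.
rewrite norm2_subC move_th (norm2_subC (muh z)).
have m2 := move_mu k s c s' dz.
have af := ler_wpM2l (ltW a_gt0) (fv_size dz); have xh := ler_wpM2l (ltW x_gt0) (hv_size dz).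
have af' := ler_wpM2l (ltW a_gt0) hf; have xh' := ler_wpM2l (ltW x_gt0) hh.
have := ler_wpM2l e0 (lerD af xh); have := ler_wpM2l e0 (lerD af' xh').
by rewrite /sizeM; split; lra.
Qed.

Lemma move_V2 k (z : state) s c s' : dom z ->
  norm2 (Vh z - Vh (step k z s c s')) <= eta R k * (b * sizeG z) /\
  norm2 (Vh z - Vh (step k z s c s')) <= eta R k * (b * B0).
Proof.
move=> dz; have [e0 e1] := eta_01 k; have [_ _ _ [_ hg _ _]] := dz.
have m := move_V k s c s' dz; rewrite norm2_subC.
have h1 := ler_wpM2l (ltW b_gt0) (gV_size dz); have h2 := ler_wpM2l (ltW b_gt0) hg.
by have := ler_wpM2l e0 h1; have := ler_wpM2l e0 h2; split; lra.
Qed.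

Lemma move_J2 k (z : state) s c s' : dom z ->
  `|Jh z - Jh (step k z s c s')| <= eta R k * (b * sizeC z) /\
  `|Jh z - Jh (step k z s c s')| <= eta R k * (b * B0).
Proof.
move=> dz; have [e0 e1] := eta_01 k; have [_ _ _ [_ _ hc _]] := dz.
have m := move_J k s c s' dz; rewrite distrC.
have h1 := ler_wpM2l (ltW b_gt0) (gJ_size z); have h2 := ler_wpM2l (ltW b_gt0) hc.
by have := ler_wpM2l e0 h1; have := ler_wpM2l e0 h2; split; lra.
Qed.

Lemma drift_F : exists2 C, 0 <= C & forall k (z : state) s c s', dom z ->
  norm2 (rF (step k z s c s')) ^+ 2 <= norm2 (rF z) ^+ 2 +
    eta R k * (- 2 * l * norm2 (rF z) ^+ 2
      + 2 * norm2 (rF z) * (4 * LF * (sizeM z + b * sizeG z))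
      + 2 * l * dot (rF z) (zF r (th z) (muh z) (Vh z) s c s' - Fz z)) + C * eta R k ^+ 2.
Proof.
(* A single constant for the three uniform bounds of [tracking_drift]: momentum error, sampling
   error and displacement of the target per unit of [eta]. *)
pose B := B0 + B0 + 4 * LF * ((a + x) * B0 + b * B0).
have B00 := B0_ge0.
have F0 : 0 <= 4 * LF * ((a + x) * B0 + b * B0).
  rewrite mulr_ge0//; first exact: mulr_ge0 (ler0n _ _) LF_ge0.
  by apply: addr_ge0; apply: mulr_ge0 => //; [apply: addr_ge0|]; exact: ltW.
exists (((2 * l + 1) * B) ^+ 2); first exact: sqr_ge0.
move=> k z s c s' dz; have [hmu hV hj [hf hg hc hh]] := dz.
have [hmu' hV' _ _] := dom_step k s c s' dz; have [bF _ _ _] := dom_bounds dz.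
have [e0 e1] := eta_01 k.
have [m1 m2] := move_thmu k s c s' dz; have [v1 v2] := move_V2 k s c s' dz.
have lip := Fbar_lipschitz reg s0 a0 (th z) (th (step k z s c s')) hmu hmu' hV hV'.
have F4 : 0 <= 4 * LF by exact: mulr_ge0 (ler0n _ _) LF_ge0.
have l1 := ler_wpM2l F4 (lerD m1 v1); have l2 := ler_wpM2l F4 (lerD m2 v2).
rewrite {1}/rF step_f; apply: tracking_drift => //.
- exact: ltW.
- by rewrite addr_ge0// addr_ge0.
- by apply: le_trans (norm2B _ _) _; rewrite /B; lra.
- by apply: le_trans (norm2B _ _) _; have := norm2_zF s c s' hmu hV; rewrite /B; lra.
- by apply: le_trans lip _; apply: le_trans l1 _; lra.
apply: le_trans lip _; apply: le_trans l2 _.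
by have := mulr_ge0 e0 B00; rewrite /B; lra.
Qed.

Lemma drift_G : exists2 C, 0 <= C & forall k (z : state) s c s', dom z ->
  norm2 (rG (step k z s c s')) ^+ 2 <= norm2 (rG z) ^+ 2 +
    eta R k * (- 2 * l * norm2 (rG z) ^+ 2
      + 2 * norm2 (rG z) * (LG * (sizeM z + b * sizeG z + b * sizeC z))
      + 2 * l * dot (rG z) (zG r (muh z) (Vh z) (Jh z) s c s' - Gz z)) + C * eta R k ^+ 2.
Proof.
pose B := B0 + B0 + LG * ((a + x) * B0 + b * B0 + b * B0).
have B00 := B0_ge0.
have F0 : 0 <= LG * ((a + x) * B0 + b * B0 + b * B0).
  have bB := mulr_ge0 (ltW b_gt0) B00.
  apply: mulr_ge0 => //; apply: addr_ge0 => //; apply: addr_ge0 => //.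
  by apply: mulr_ge0 => //; apply: addr_ge0; exact: ltW.
exists (((2 * l + 1) * B) ^+ 2); first exact: sqr_ge0.
move=> k z s c s' dz; have [hmu hV hj [hf hg hc hh]] := dz.
have [hmu' hV' _ _] := dom_step k s c s' dz; have [_ bG _ _] := dom_bounds dz.
have [e0 e1] := eta_01 k.
have [m1 m2] := move_thmu k s c s' dz; have [v1 v2] := move_V2 k s c s' dz.
have [j1 j2] := move_J2 k s c s' dz.
have lip := Gbar_lipschitz reg s0 a0 (th z) (th (step k z s c s')) (Jh (step k z s c s'))
  cJ_ge1 hmu hmu' hV hV' hj.
have l1 := ler_wpM2l LG_ge0 (lerD (lerD m1 v1) j1).
have l2 := ler_wpM2l LG_ge0 (lerD (lerD m2 v2) j2).
rewrite {1}/rG step_gV; apply: tracking_drift => //.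
- exact: ltW.
- by rewrite addr_ge0// addr_ge0.
- by apply: le_trans (norm2B _ _) _; rewrite /B; lra.
- by apply: le_trans (norm2B _ _) _; have := norm2_zG s c s' hmu hV hj; rewrite /B; lra.
- by apply: le_trans lip _; apply: le_trans l1 _; lra.
apply: le_trans lip _; apply: le_trans l2 _.
by have := mulr_ge0 e0 B00; rewrite /B; lra.
Qed.

Lemma drift_H : exists2 C, 0 <= C & forall k (z : state) s c s', dom z ->
  norm2 (rH (step k z s c s')) ^+ 2 <= norm2 (rH z) ^+ 2 +
    eta R k * (- 2 * l * norm2 (rH z) ^+ 2
      + 2 * norm2 (rH z) * (2 * LH * sizeM z)
      + 2 * l * dot (rH z) (unitv R s - muh z - (nuz z - muh z))) + C * eta R k ^+ 2.
Proof.
pose B := B0 + B0 + 2 * LH * ((a + x) * B0).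
have B00 := B0_ge0; have L0 := L_gt0 reg.
have H2 : 0 <= 2 * LH by rewrite /cL_H; lra.
have F0 : 0 <= 2 * LH * ((a + x) * B0).
  by apply: mulr_ge0 => //; apply: mulr_ge0 => //; apply: addr_ge0; exact: ltW.
exists (((2 * l + 1) * B) ^+ 2); first exact: sqr_ge0.
move=> k z s c s' dz; have [hmu hV hj [hf hg hc hh]] := dz.
have [hmu' hV' _ _] := dom_step k s c s' dz; have [_ _ _ bH] := dom_bounds dz.
have [e0 e1] := eta_01 k.
have [m1 m2] := move_thmu k s c s' dz.
have lip := hbar_lipschitz reg a0 (th z) (th (step k z s c s')) hmu hmu'.
have l1 := ler_wpM2l H2 m1; have l2 := ler_wpM2l H2 m2.
rewrite {1}/rH step_h; apply: tracking_drift => //.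
- exact: ltW.
- by rewrite addr_ge0// addr_ge0.
- by apply: le_trans (norm2B _ _) _; rewrite /B; lra.
- apply: le_trans (norm2B _ _) _; have := norm2_unitv_sub s hmu; have := B0_h.
  by rewrite /B; lra.
- by apply: le_trans lip _; apply: le_trans l1 _; lra.
apply: le_trans lip _; apply: le_trans l2 _.
by have := mulr_ge0 e0 B00; rewrite /B; lra.
Qed.

Lemma J_lipschitz (z z' : state) : dom z -> dom z' ->
  `|Jz z - Jz z'| <= LV * (norm2 (th z - th z') + norm2 (muh z - muh z')).
Proof.
move=> [h1 _ _ _] [h2 _ _ _].
by have [_ /(_ (th z) (th z') _ _ h1 h2)[_ hJ _ _]] := reg_LV reg.
Qed.

Lemma drift_C : exists2 C, 0 <= C & forall k (z : state) s c s', dom z ->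
  rC (step k z s c s') ^+ 2 <= rC z ^+ 2 +
    eta R k * (- 2 * l * rC z ^+ 2 + 2 * `|rC z| * (cJ * (LV * sizeM z + b * sizeC z))
      + 2 * l * (rC z * (cJ * (r s c (muh z) - Jh z) - cJ * (Jz z - Jh z))))
    + C * eta R k ^+ 2.
Proof.
pose B := B0 + B0 + cJ * (LV * ((a + x) * B0) + b * B0).
have B00 := B0_ge0; have V1 := LV_ge1 reg; have c1 := cJ_ge1.
have V0 : 0 <= LV by lra.
have c0 : 0 <= cJ by lra.
have F0 : 0 <= cJ * (LV * ((a + x) * B0) + b * B0).
  apply: mulr_ge0 => //; apply: addr_ge0; last exact: mulr_ge0 (ltW b_gt0) B00.
  by apply: mulr_ge0 => //; apply: mulr_ge0 => //; apply: addr_ge0; exact: ltW.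
exists (((2 * l + 1) * B) ^+ 2); first exact: sqr_ge0.
move=> k z s c s' dz; have [hmu hV hj [hf hg hc hh]] := dz.
have dz' := dom_step k s c s' dz; have [_ _ bC _] := dom_bounds dz.
have [e0 e1] := eta_01 k.
have [m1 m2] := move_thmu k s c s' dz; have [j1 j2] := move_J2 k s c s' dz.
have lip : `|cJ * (Jz z - Jh z) - cJ * (Jz (step k z s c s') - Jh (step k z s c s'))| <=
    cJ * (LV * (norm2 (th z - th (step k z s c s')) + norm2 (muh z - muh (step k z s c s')))
       + `|Jh z - Jh (step k z s c s')|).
  rewrite -mulrBr normrM ger0_norm// ler_wpM2l//.
  have E (p q u v : R) : p - q - (u - v) = (p - u) - (q - v) by ring.
  rewrite E; apply: le_trans (ler_normB _ _) _; rewrite lerD2r.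
  exact: J_lipschitz.
have l1 := ler_wpM2l c0 (lerD (ler_wpM2l V0 m1) j1).
have l2 := ler_wpM2l c0 (lerD (ler_wpM2l V0 m2) j2).
rewrite {1}/rC step_gJ; apply: tracking_drift1 => //.
- exact: ltW.
- by rewrite addr_ge0// addr_ge0.
- by apply: le_trans (ler_normB _ _) _; rewrite /B; lra.
- by apply: le_trans (ler_normB _ _) _; have := abs_zC s c hmu hj; rewrite /B; lra.
- by apply: le_trans lip _; apply: le_trans l1 _; lra.
apply: le_trans lip _; apply: le_trans l2 _.
by have := mulr_ge0 e0 B00; rewrite /B; lra.
Qed.

Lemma mus_simplex (z : state) : simplex (mus z).
Proof. by have [] := mustarP reg (spol (th z)). Qed.

Lemma drift_m : exists2 C, 0 <= C & forall k (z : state) s c s', dom z ->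
  em (step k z s c s') ^+ 2 <= em z ^+ 2 +
    eta R k * (- 2 * x * (1 - delta) * em z ^+ 2
      + 2 * em z * (x * norm2 (rH z) + L * a * sizeF z)) + C * eta R k ^+ 2.
Proof.
have B00 := B0_ge0; have L0 := L_gt0 reg.
have xB := mulr_ge0 (ltW x_gt0) B00; have aB := mulr_ge0 (ltW a_gt0) B00.
exists (2 * (x * B0) * (L * (a * B0)) + (L * (a * B0)) ^+ 2 + (x * B0) ^+ 2).
  by rewrite !addr_ge0 ?sqr_ge0// !mulr_ge0// ltW.
move=> k z s c s' dz; have [hmu hV hj [hf hg hc hh]] := dz.
have [e0 e1] := eta_01 k; set e := eta R k in e0 e1 *.
set z' := step k z s c s'.
have em0 := norm2_ge0 (muh z - mus z).
have dmu : norm2 (mus z - mus z') <= L * (a * e * norm2 (fv z)).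
  apply: le_trans (mustar_lipschitz reg (spol _) (spol _)) _; rewrite ler_wpM2l ?(ltW L0)//.
  by apply: le_trans (softmax_lipschitz a0 _ _) _; rewrite norm2_subC move_th.
have step1 : em z' <= norm2 (muh z' - mus z) + L * (a * e * norm2 (fv z)).
  by apply: le_trans (norm2_dist (mus z) _ _) _; rewrite lerD2l.
(* The projection is compared with the old target; the displacement of the target is added
   afterwards. *)
have [_ /(_ _ (mus_simplex z)) pr] := proj_simplexP s0 (muh z + (x * e) *: hv z).
rewrite -/(muh z') in pr.
have xe0 : 0 <= x * e by rewrite mulr_ge0// ltW.
have ae0 : 0 <= a * e by rewrite mulr_ge0// ltW.
have q1 : norm2 (muh z' - mus z) ^+ 2 <= em z ^+ 2 + 2 * (x * e) * dot (hv z) (muh z - mus z)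
     + (x * B0 * e) ^+ 2.
  apply: le_trans (norm2_step_sqr (muh z) (mus z) (ltW x_gt0) e0 hh).
  by rewrite ler_pXn2r ?nnegrE ?norm2_ge0.
have u1 : norm2 (muh z' - mus z) <= em z + x * e * B0.
  apply: le_trans (norm2_dist (muh z) _ _) _; rewrite addrC lerD2l.
  by apply: le_trans (move_mu k s c s' dz) _; rewrite ler_wpM2l.
have wB : L * (a * e * norm2 (fv z)) <= L * (a * B0) * e.
  have -> : L * (a * B0) * e = L * (a * B0 * e) by ring.
  by rewrite ler_wpM2l ?(ltW L0)// mulrAC ler_wpM2r// ler_wpM2l// ltW.
have w0 : 0 <= L * (a * e * norm2 (fv z)).
  by rewrite mulr_ge0 ?(ltW L0)// mulr_ge0// norm2_ge0.
have q2 := sqr_le_add (norm2_ge0 _) step1 (norm2_ge0 _) w0 wB.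
have hd : dot (hv z) (muh z - mus z) <= norm2 (rH z) * em z - (1 - delta) * em z ^+ 2.
  have -> : hv z = rH z + (nuz z - muh z) by rewrite /rH subrK.
  rewrite dotDl; apply: lerD; first exact: dot_le.
  by have := dot_nu_mustar reg (spol (th z)) hmu; rewrite mulNr.
have q3 := ler_wpM2l xe0 hd.
have q4 : norm2 (muh z' - mus z) * (L * (a * e * norm2 (fv z))) <=
    em z * (L * (a * e * sizeF z)) + x * e * B0 * (L * (a * B0) * e).
  apply: le_trans (ler_wpM2r w0 u1) _; rewrite mulrDl; apply: lerD.
    rewrite ler_wpM2l// ler_wpM2l ?(ltW L0)// ler_wpM2l//; exact: fv_size.
  by rewrite ler_wpM2l// mulr_ge0.
exact: drift_m_arith q1 q2 q3 q4.
Qed.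

Lemma drift_j : exists2 C, 0 <= C & forall k (z : state) s c s', dom z ->
  ej (step k z s c s') ^+ 2 <= ej z ^+ 2 +
    eta R k * (- 2 * b * cJ * ej z ^+ 2
      + 2 * ej z * (b * `|rC z| + LV * sizeM z)) + C * eta R k ^+ 2.
Proof.
have B00 := B0_ge0; have V1 := LV_ge1 reg.
have V0 : 0 <= LV by lra.
have bB := mulr_ge0 (ltW b_gt0) B00.
have axB : 0 <= (a + x) * B0 by rewrite mulr_ge0// addr_ge0// ltW.
exists (2 * (b * B0) * (LV * ((a + x) * B0)) + (LV * ((a + x) * B0)) ^+ 2 + (b * B0) ^+ 2).
  exact: addr_ge0 (addr_ge0 (mulr_ge0 (mulr_ge0 (ler0n R 2) bB) (mulr_ge0 V0 axB)) (sqr_ge0 _)) (sqr_ge0 _).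
move=> k z s c s' dz; have [hmu hV hj [hf hg hc hh]] := dz.
have [e0 e1] := eta_01 k; set e := eta R k in e0 e1 *.
set z' := step k z s c s'; have dz' : dom z' := dom_step k s c s' dz.
have [m1 m2] := move_thmu k s c s' dz.
have J01 := J_01 reg s0 (spol (th z)) hmu.
have ej0 : 0 <= ej z by exact: normr_ge0.
have be0 : 0 <= b * e by rewrite mulr_ge0// ltW.
have step1 : ej z' <= `|Jh z' - Jz z| + `|Jz z - Jz z'|.
  exact: ler_distD.
have lip := J_lipschitz dz dz'.
have l1 := le_trans lip (ler_wpM2l V0 m1); have l2 := le_trans lip (ler_wpM2l V0 m2).
have pr := proj01_contracts (Jh z + b * e * gJ z) J01; rewrite -/(Jh z') in pr.
have q1 : `|Jh z' - Jz z| ^+ 2 <= ej z ^+ 2 + 2 * (b * e) * ((Jh z - Jz z) * gJ z)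
     + (b * B0 * e) ^+ 2.
  apply: (@le_trans _ _ (`|Jh z + b * e * gJ z - Jz z| ^+ 2)).
    by rewrite ler_pXn2r ?nnegrE.
  rewrite real_normK ?num_real//.
  have : (b * e * `|gJ z|) ^+ 2 <= (b * B0 * e) ^+ 2.
    rewrite ler_pXn2r ?nnegrE ?mulr_ge0 ?(ltW b_gt0)//.
    by rewrite mulrAC ler_wpM2r// ler_wpM2l// ltW.
  by rewrite exprMn real_normK ?num_real// /ej real_normK ?num_real//; lra.
have u1 : `|Jh z' - Jz z| <= ej z + b * e * B0.
  apply: le_trans (ler_distD (Jh z) _ _) _; rewrite addrC lerD2l.
  by apply: le_trans (move_J k s c s' dz) _; rewrite ler_wpM2l.
have w0 : 0 <= `|Jz z - Jz z'| := normr_ge0 _.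
have q2 := sqr_le_add (normr_ge0 _) step1 (normr_ge0 _) w0 l2.
have hd : (Jh z - Jz z) * gJ z <= - cJ * ej z ^+ 2 + ej z * `|rC z|.
  have -> : gJ z = - cJ * (Jh z - Jz z) + rC z by rewrite /rC; ring.
  rewrite mulrDr; apply: lerD.
    by rewrite /ej real_normK ?num_real// le_eqVlt; apply/orP; left; apply/eqP; ring.
  by apply: le_trans (ler_norm _) _; rewrite normrM.
have q3 := ler_wpM2l be0 hd.
have q4 : `|Jh z' - Jz z| * `|Jz z - Jz z'| <=
    ej z * (LV * (e * sizeM z)) + b * e * B0 * (LV * (e * ((a + x) * B0))).
  apply: le_trans (ler_wpM2r w0 u1) _; rewrite mulrDl; apply: lerD.
    by rewrite ler_wpM2l.
  by rewrite ler_wpM2l// mulr_ge0.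
exact: drift_j_arith q1 q2 q3 q4.
Qed.

End OneStep.

(** * Constant mode of the critic *)

Section BallReference.
Variables (R : realType) (S : finType) (s0 : S).
Implicit Types v y : {ffun S -> R}.

Definition sqrt_card : R := Num.sqrt #|S|%:R.
Local Notation sn := sqrt_card.

Lemma sqrt_card_ge1 : 1 <= sn.
Proof.
rewrite -sqrtr1; apply: ler_wsqrtr; rewrite ler1n; apply/card_gt0P; by exists s0.
Qed.

Lemma sqrt_card_gt0 : 0 < sn.
Proof. exact: lt_le_trans ltr01 sqrt_card_ge1. Qed.

Lemma sqrt_card_sqr : sn ^+ 2 = #|S|%:R.
Proof. by rewrite sqr_sqrtr. Qed.

(** Coordinate along the normalised all-ones vector, so that it complements [proj_perp] in
    Pythagoras' identity. *)
Definition mode v : R := (\sum_s v s) / sn.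
(** The vector that agrees with [y] modulo constants and has mode [c]. *)
Definition vref y (c : R) : {ffun S -> R} := proj_perp y + [ffun=> c / sn].

Lemma norm2_const_mode (c : R) : (c / sn) ^+ 2 * #|S|%:R = c ^+ 2.
Proof. by rewrite -sqrt_card_sqr -exprMn divfK// gt_eqF// sqrt_card_gt0. Qed.

Lemma mode_le v : `|mode v| <= norm2 v.
Proof.
have n0 := sqrt_card_gt0; rewrite /mode normrM normfV (gtr0_norm n0) ler_pdivrMr//.
have -> : \sum_s v s = dot v [ffun=> 1] by rewrite dot_const mul1r.
apply: le_trans (dot_CS _ _) _; rewrite ler_wpM2l ?norm2_ge0//.
by rewrite -(@ler_pXn2r _ 2) ?nnegrE ?norm2_ge0 ?(ltW n0)// norm2_const expr1n mul1r sqrt_card_sqr.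
Qed.

Lemma modeB u v : mode (u - v) = mode u - mode v.
Proof.
rewrite /mode -mulrBl -sumrB; congr (_ / _); apply: eq_bigr => s _.
by rewrite !ffunE.
Qed.

Lemma vref_decomp v y c : v - vref y c = proj_perp (v - y) + [ffun=> (mode v - c) / sn].
Proof.
have n0 := gt_eqF sqrt_card_gt0.
have E1 (u w k : {ffun S -> R}) s : (u - (w + k)) s = u s - (w s + k s) by rewrite !ffunE.
have E2 (u w k : {ffun S -> R}) s : (u - w + k) s = u s - w s + k s by rewrite !ffunE.
apply/ffunP => s; rewrite proj_perpB /vref E1 E2 [X in _ - (_ + X)]ffunE [X in _ = _ + X]ffunE.
rewrite !proj_perpE.
rewrite /avg /mode -sqrt_card_sqr; field.
by rewrite n0.
Qed.

Lemma norm2_vref v y c :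
  norm2 (v - vref y c) ^+ 2 = norm2 (proj_perp (v - y)) ^+ 2 + (mode v - c) ^+ 2.
Proof.
by rewrite vref_decomp norm2_perp_const ?(proj_perp_sum0 s0)// norm2_const_mode.
Qed.

Lemma vref_ball y c B Y : 0 <= B -> norm2 (proj_perp y) <= Y -> c ^+ 2 <= B ^+ 2 - Y ^+ 2 ->
  norm2 (vref y c) <= B.
Proof.
move=> B0 hy hc; rewrite -(@ler_pXn2r _ 2) ?nnegrE ?norm2_ge0//.
rewrite norm2_perp_const ?(proj_perp_sum0 s0)// norm2_const_mode.
have : norm2 (proj_perp y) ^+ 2 <= Y ^+ 2.
  by rewrite ler_pXn2r ?nnegrE ?norm2_ge0// (le_trans (norm2_ge0 _) hy).
by lra.
Qed.

Lemma dot_vref g v y c :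
  dot g (v - vref y c) = dot g (proj_perp (v - y)) + (mode v - c) / sn * \sum_s g s.
Proof. by rewrite vref_decomp dotDr dot_const. Qed.

End BallReference.

Section CriticDrift.
Variables (R : realType) (S A : finType).
Variables (P : {ffun S -> R} -> S -> A -> S -> R) (r : S -> A -> {ffun S -> R} -> R).
Variables (C0 C1 delta L BV LV LTV gamma : R).
Hypothesis reg : regular_mfg P r C0 C1 delta L BV LV LTV gamma.
Variables (s0 : S) (a0 : A) (cJ a b x l B0 : R).
Hypotheses (a_gt0 : 0 < a) (b_gt0 : 0 < b) (x_gt0 : 0 < x) (l_gt0 : 0 < l).
Hypotheses (l_le : l <= 1 / 4) (cJ_ge1 : 1 <= cJ).
Hypotheses (B0_F : 2 * (1 + 2 * BV) <= B0) (B0_c : cJ <= B0) (B0_h : 2 <= B0).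

Local Notation state := (astate R S A).
Local Notation spol := (spol a0).
Local Notation step := (Defs.step r cJ BV (stepsz a) (stepsz b) (stepsz x) (stepsz l)).
Local Notation mus z := (mustar P (softmax (th z))).
Local Notation Jz z := (J P r (softmax (th z)) (muh z)).
Local Notation Vz z := (Vfun P r (softmax (th z)) (muh z)).
Local Notation Gz z := (Gbar P r (th z) (muh z) (Vh z) (Jh z)).
Local Notation dom := (dom BV B0).
Local Notation sn := (sqrt_card R S).
Local Notation eG := (eG P r).
Local Notation em := (em P).
Local Notation ev := (ev P r).
Local Notation ej := (ej P r).
Local Notation rG := (rG P r).
Local Notation rC := (rC P r cJ).
Local Notation sizeG := (sizeG P r).
Local Notation sizeM := (sizeM P r LV a x).

(* The projection onto the ball does not contract the error modulo constants. It does contract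
   the distance to a point of the ball that differs from the target by a constant, so the
   constant mode of the critic enters through its distance [oz] to [-cut, cut]. *)
Definition perp_max : R := Num.min BV (2 * gamma)^-1.
(** By Pythagoras, a reference point with mode in [-cut, cut] and perpendicular part of norm at most
    [perp_max] lies in the ball. *)
Definition cut : R := Num.sqrt (BV ^+ 2 - perp_max ^+ 2).
Definition oz (z : state) : R := resid cut (mode (Vh z)).

Lemma perp_max_ge0 : 0 <= perp_max.
Proof.
have /andP[g0 _] := gamma_01 reg; have B := BV_gt0 reg.
by rewrite /perp_max le_min (ltW B) invr_ge0 mulr_ge0// ltW.
Qed.

Lemma perp_max_le : perp_max <= BV /\ perp_max <= (2 * gamma)^-1.
Proof. by rewrite /perp_max !ge_min !lexx orbT. Qed.

Lemma cut_sqr : cut ^+ 2 = BV ^+ 2 - perp_max ^+ 2.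
Proof.
have [h _] := perp_max_le; have B := BV_gt0 reg.
by rewrite sqr_sqrtr// subr_ge0 ler_pXn2r ?nnegrE ?perp_max_ge0// ltW.
Qed.

(** From [BV ^+ 2 = cut ^+ 2 + perp_max ^+ 2 <= (cut + perp_max) ^+ 2]. This makes [perp_max] a
    bound for [oz]. *)
Lemma cut_ge : 0 <= cut /\ BV - cut <= perp_max.
Proof.
have c0 : 0 <= cut := sqrtr_ge0 _; split=> //.
have [h _] := perp_max_le; have B := BV_gt0 reg; have Y := perp_max_ge0; have := cut_sqr.
have [//|lt] := leP (BV - cut) perp_max; nra.
Qed.

Lemma cut_le : cut <= BV.
Proof.
have [c0 _] := cut_ge; have B := BV_gt0 reg.
rewrite -(@ler_pXn2r _ 2) ?nnegrE//; last exact: ltW.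
by rewrite cut_sqr lerBlDr lerDl sqr_ge0.
Qed.

Lemma oz_bound (z : state) : dom z -> `|oz z| <= perp_max.
Proof.
move=> [_ hV _ _]; have [c0 c1] := cut_ge; apply: le_trans c1.
apply: resid_bound => //; last exact: cut_le.
exact: le_trans (mode_le s0 _) hV.
Qed.

Lemma oz_move (z z' : state) : `|oz z - oz z'| <= norm2 (Vh z - Vh z').
Proof.
have [c0 _] := cut_ge; apply: le_trans (resid_lipschitz _ _ c0) _.
by rewrite -modeB; exact: mode_le.
Qed.

Lemma drift_V_arith (E' O' N2 u t2 W E w j g so dt M e : R) :
  N2 <= W + 2 * (b * e) * dt + (b * B0 * e) ^+ 2 -> N2 = u ^+ 2 + t2 ->
  E' ^+ 2 <= u ^+ 2 + 2 * u * w + (LV * (e * ((a + x) * B0))) ^+ 2 -> O' ^+ 2 <= t2 ->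
  b * e * dt <= b * e * (- gamma * E ^+ 2 + j * E + g * E + so) ->
  u * w <= E * (LV * (e * M)) + b * e * B0 * (LV * (e * ((a + x) * B0))) ->
  E' ^+ 2 + O' ^+ 2 <= W + e * (- 2 * b * gamma * E ^+ 2 + 2 * b * E * (j + g)
     + 2 * E * LV * M + 2 * b * so)
    + (2 * (b * B0) * (LV * ((a + x) * B0)) + (LV * ((a + x) * B0)) ^+ 2 + (b * B0) ^+ 2) * e ^+ 2.
Proof. by move=> q1 q5 q2 q0 q3 q4; lra. Qed.

(** Contraction towards the reference point controls [ev ^+ 2 + oz ^+ 2] as one quantity. The price
    is the last first-order term, linear in [oz] and without a sign. *)
Lemma drift_V : exists2 C, 0 <= C & forall k (z : state) s c s', dom z ->
  ev (step k z s c s') ^+ 2 + oz (step k z s c s') ^+ 2 <= ev z ^+ 2 + oz z ^+ 2 +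
    eta R k * (- 2 * b * gamma * ev z ^+ 2 + 2 * b * ev z * (ej z + norm2 (rG z))
      + 2 * ev z * LV * sizeM z + 2 * b * (oz z / sn * \sum_i gV z i)) + C * eta R k ^+ 2.
Proof.
have B00 := B0_ge0 B0_h; have V1 := LV_ge1 reg.
have V0 : 0 <= LV by lra.
have bB := mulr_ge0 (ltW b_gt0) B00.
have axB : 0 <= (a + x) * B0 by rewrite mulr_ge0// addr_ge0// ltW.
exists (2 * (b * B0) * (LV * ((a + x) * B0)) + (LV * ((a + x) * B0)) ^+ 2 + (b * B0) ^+ 2).
  exact: addr_ge0 (addr_ge0 (mulr_ge0 (mulr_ge0 (ler0n R 2) bB) (mulr_ge0 V0 axB)) (sqr_ge0 _)) (sqr_ge0 _).
move=> k z s c s' dz; have [hmu hV hj [hf hg hc hh]] := dz.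
have [e0 e1] := eta_01 R k; set e := eta R k in e0 e1 *.
set z' := step k z s c s'.
have dz' : dom z' := dom_step reg s0 a0 a b x l_gt0 l_le cJ_ge1 B0_F B0_c B0_h k s c s' dz.
have [hmu' _ _ _] := dz'.
have [m1 m2] := move_thmu reg s0 a0 cJ b l a_gt0 x_gt0 k s c s' dz.
rewrite -/e in m1 m2.
have be0 : 0 <= b * e by rewrite mulr_ge0// ltW.
have ev0 : 0 <= ev z := norm2_ge0 _.
have [c0 c1] := cut_ge.
(* Among the admissible modes, [cl] is the one nearest to that of the current critic, so its
   distance to the reference point has exactly the components [ev] and [oz]. *)
set cl := clamp cut (mode (Vh z)); have clb : - cut <= cl <= cut := clamp_bound _ c0.
have refB : norm2 (vref (Vz z) cl) <= BV.
  have [p1 p2] := perp_max_le.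
  apply: (vref_ball s0 (ltW (BV_gt0 reg)) (Y := perp_max)).
    rewrite /perp_max le_min (Vperp_bound reg s0 a0 (th z) hmu) andbT.
    apply: le_trans (norm2_proj_perp s0 _) _; exact: (V_norm reg (spol _) hmu).
  rewrite -cut_sqr -[cl ^+ 2]real_normK ?num_real//.
  by rewrite ler_pXn2r ?nnegrE// ler_norml.
have [_ /(_ _ refB) pr] := proj_ballP (Vh z + (b * e) *: gV z) (BV_gt0 reg).
rewrite -/(Vh z') in pr.
have q1 : norm2 (Vh z' - vref (Vz z) cl) ^+ 2 <= ev z ^+ 2 + oz z ^+ 2
    + 2 * (b * e) * dot (gV z) (Vh z - vref (Vz z) cl) + (b * B0 * e) ^+ 2.
  rewrite /ev /dV /oz /resid -/cl -(norm2_vref s0).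
  apply: le_trans (norm2_step_sqr (Vh z) (vref (Vz z) cl) (ltW b_gt0) e0 hg).
  by rewrite ler_pXn2r ?nnegrE ?norm2_ge0.
have q0 := norm2_vref s0 (Vh z') (Vz z) cl.
have r2 : oz z' ^+ 2 <= (mode (Vh z') - cl) ^+ 2 by exact: resid_min.
have lip : norm2 (proj_perp (Vz z - Vz z')) <= LV * (norm2 (th z - th z') + norm2 (muh z - muh z')).
  by have [_ /(_ (th z) (th z') _ _ hmu hmu')[]] := reg_LV reg.
have l1 := le_trans lip (ler_wpM2l V0 m1); have l2 := le_trans lip (ler_wpM2l V0 m2).
set u := norm2 (proj_perp (Vh z' - Vz z)) in q0 *.
have step1 : ev z' <= u + norm2 (proj_perp (Vz z - Vz z')).
  rewrite /ev /dV /u !proj_perpB; exact: norm2_dist.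
have u1 : u <= ev z + b * e * B0.
  have mv : norm2 (proj_perp (Vh z') - proj_perp (Vh z)) <= b * e * B0.
    rewrite -proj_perpB; apply: le_trans (norm2_proj_perp s0 _) _.
    exact: le_trans (move_V reg cJ a x l b_gt0 k s c s' dz) (ler_wpM2l be0 hg).
  rewrite /u /ev /dV !proj_perpB; apply: le_trans (norm2_dist (proj_perp (Vh z)) _ _) _.
  rewrite [leRHS]addrC; exact: lerD.
have w0 : 0 <= norm2 (proj_perp (Vz z - Vz z')) := norm2_ge0 _.
have q2 := sqr_le_add (norm2_ge0 _) step1 (norm2_ge0 _) w0 l2.
have hd : dot (gV z) (Vh z - vref (Vz z) cl) <= - gamma * ev z ^+ 2 + ej z * ev z
    + norm2 (rG z) * ev z + oz z / sn * \sum_i gV z i.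
  rewrite (dot_vref s0) lerD2r -/(dV P r z).
  have -> : gV z = Gz z + rG z by rewrite /rG addrC subrK.
  rewrite dotDl; apply: lerD; last exact: dot_le.
  by rewrite /ej distrC; exact: (dot_Gbar reg s0 a0).
have q3 := ler_wpM2l be0 hd.
have q4 : u * norm2 (proj_perp (Vz z - Vz z')) <=
    ev z * (LV * (e * sizeM z)) + b * e * B0 * (LV * (e * ((a + x) * B0))).
  apply: le_trans (ler_wpM2r w0 u1) _; rewrite mulrDl; apply: lerD.
    exact: (ler_wpM2l ev0 l1).
  exact: (ler_wpM2l (mulr_ge0 be0 B00) l2).
exact: drift_V_arith q1 q0 q2 r2 q3 q4.
Qed.

Definition ellz (z : state) : R := ell P r (softmax (th z)).

Lemma ellz_01 (z : state) : 0 <= ellz z <= 1.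
Proof. exact: (J_01 reg s0 (spol (th z)) (mus_simplex reg a0 z)). Qed.

Lemma ellz_sub_Jh (z : state) : dom z -> `|ellz z - Jh z| <= ej z + 2 * L * em z.
Proof.
move=> [hmu _ _ _]; apply: le_trans (ler_distD (Jz z) _ _) _.
rewrite [leRHS]addrC; apply: lerD; last by rewrite distrC.
rewrite distrC; exact: (J_mu_lipschitz reg s0 (spol (th z)) hmu (mus_simplex reg a0 z)).
Qed.

Lemma ellz_move k (z : state) s c s' : dom z ->
  `|ellz (step k z s c s') - ellz z| <= eta R k * (LV * (1 + L) * (a * B0)).
Proof.
move=> [_ _ _ [hf _ _ _]]; set z' := step k z s c s'.
have [e0 _] := eta_01 R k; have V1 := LV_ge1 reg; have L0 := L_gt0 reg.
have V0 : 0 <= LV by lra.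
have tm : norm2 (th z' - th z) <= eta R k * (a * B0).
  rewrite (move_th r BV cJ b x l a_gt0 k z) mulrA (mulrC _ a).
  by rewrite ler_wpM2l// mulr_ge0// ltW.
have mm : norm2 (mus z' - mus z) <= L * norm2 (th z' - th z).
  apply: le_trans (mustar_lipschitz reg (spol _) (spol _)) _.
  by rewrite ler_wpM2l ?(ltW L0)// (softmax_lipschitz a0).
have [_ /(_ (th z') (th z) _ _ (mus_simplex reg a0 z') (mus_simplex reg a0 z))[_ h _ _]] := reg_LV reg.
apply: le_trans h _; rewrite -mulrA mulrCA; apply: ler_wpM2l => //.
apply: le_trans (lerD (lexx _) mm) _.
have L1 : 0 <= 1 + L by lra.
have := ler_wpM2l L1 tm; lra.
Qed.

Lemma oz_step k (z : state) s c s' : dom z ->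
  let z' := step k z s c s' in
  `|oz z' - oz z| <= eta R k * (b * sizeG z) /\ `|oz z' - oz z| <= eta R k * (b * B0).
Proof.
move=> dz z'; rewrite distrC.
have [v1 v2] := move_V2 reg s0 a0 cJ a x l b_gt0 k s c s' dz.
by split; exact: le_trans (oz_move _ _) _.
Qed.

Lemma drift_o1_arith (o o' w w' j j' g e p sG d M B : R) :
  `|j' - j - b * e * g| <= b * cJ * e * p -> `|o| <= B ->
  `|o' - o| <= e * (b * sG) -> `|o' - o| <= e * (b * B0) -> `|w - j| <= d ->
  `|w' - w| <= e * M -> `|j - j'| <= e * (b * B0) -> 0 <= d ->
  o' * (w' - j') <= o * (w - j) + o * (w' - w)
    + e * (- b * (o * g) + B * (b * cJ * p) + b * sG * d)
    + b * B0 * (M + b * B0) * e ^+ 2.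
Proof.
move=> h1 h2 h3 h4 h5 h6 h7 d0.
have -> : o' * (w' - j') = o * (w - j) + o * (w' - w) - o * (b * e * g)
   - o * (j' - j - b * e * g) + (o' - o) * (w - j) + (o' - o) * ((w' - w) + (j - j')) by ring.
have k1 : - (o * (j' - j - b * e * g)) <= B * (b * cJ * e * p).
  rewrite -mulrN; apply: le_trans (ler_norm _) _; rewrite normrM normrN.
  by apply: ler_pM.
have k2 : (o' - o) * (w - j) <= e * (b * sG) * d.
  by apply: le_trans (ler_norm _) _; rewrite normrM; apply: ler_pM.
have k3 : (o' - o) * ((w' - w) + (j - j')) <= e * (b * B0) * (e * M + e * (b * B0)).
  apply: le_trans (ler_norm _) _; rewrite normrM; apply: ler_pM => //.
  by apply: le_trans (ler_normD _ _) _; exact: lerD.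
lra.
Qed.

(** Without clipping, [Jh] moves by [b * eta * gJ], which produces the cancelling term
    [- b * (oz * gJ)]; [p] measures the clipping. Comparing with [ell] keeps the factor of order
    [ej + em], and the change of [ell] is kept exactly because it will be absorbed by the actor
    term. *)
Lemma drift_o1 : exists2 C, 0 <= C & forall k (z : state) s c s' p, dom z ->
  let z' := step k z s c s' in
  `|Jh z' - Jh z - b * eta R k * gJ z| <= b * cJ * eta R k * p ->
  oz z' * (ellz z' - Jh z') <= oz z * (ellz z - Jh z) + oz z * (ellz z' - ellz z)
    + eta R k * (- b * (oz z * gJ z) + BV * (b * cJ * p) + b * sizeG z * (ej z + 2 * L * em z))
    + C * eta R k ^+ 2.
Proof.
have B00 := B0_ge0 B0_h; have V1 := LV_ge1 reg; have L0 := L_gt0 reg.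
exists (b * B0 * (LV * (1 + L) * (a * B0) + b * B0)).
  have bB := mulr_ge0 (ltW b_gt0) B00; apply: mulr_ge0 => //; apply: addr_ge0 => //.
  by apply: mulr_ge0; last exact: mulr_ge0 (ltW a_gt0) B00; apply: mulr_ge0; lra.
move=> k z s c s' p dz z' hp.
have [d1 d2] := oz_step k s c s' dz.
have [_ j2] := move_J2 P r a x l b_gt0 cJ_ge1 k s c s' dz.
apply: drift_o1_arith => //; last 2 first.
- exact: ellz_move.
- rewrite addr_ge0 ?normr_ge0// mulr_ge0 ?norm2_ge0// mulr_ge0// ltW//.
- by have [h _] := perp_max_le; exact: le_trans (oz_bound dz) h.
- exact: ellz_sub_Jh.
Qed.

(** Rewards and [Jh] cancel here, so [qz] is a momentum average of the increments [Vh s' - Vh s],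
    whose stationary mean is zero. *)
Definition qz (z : state) : R := \sum_i gV z i - gJ z / cJ.

Lemma cJ_gt0 : 0 < cJ. Proof. exact: lt_le_trans ltr01 cJ_ge1. Qed.

Lemma qz_step k (z : state) s c s' :
  qz (step k z s c s') = qz z + l * eta R k * (Vh z s' - Vh z s - qz z).
Proof.
have cn := gt_eqF cJ_gt0.
rewrite /qz step_gV step_gJ.
have -> : \sum_i ((1 - l * eta R k) *: gV z + (l * eta R k) *: zG r (muh z) (Vh z) (Jh z) s c s') i
   = (1 - l * eta R k) * \sum_i gV z i
     + l * eta R k * (r s c (muh z) - Jh z + Vh z s' - Vh z s).
  have -> : r s c (muh z) - Jh z + Vh z s' - Vh z s =
      \sum_i (r s c (muh z) - Jh z + Vh z s' - Vh z s) * unitv R s i.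
    rewrite -mulr_sumr (bigD1 s)//= big1 ?addr0 ?unitvE ?eqxx ?mulr1// => i /negbTE si.
    by rewrite unitvE si.
  rewrite !mulr_sumr -big_split; apply: eq_bigr => i _ /=.
  by rewrite !ffunE.
by field; rewrite cn.
Qed.

Lemma sum_le_card (v : {ffun S -> R}) : `|\sum_i v i| <= sn * norm2 v.
Proof.
have n0 := sqrt_card_gt0 R s0.
by rewrite -ler_pdivrMl// mulrC; have := mode_le s0 v; rewrite normrM normfV (gtr0_norm n0).
Qed.

(** By [Gbar_sum] the stationary targets of the two momenta cancel and only tracking errors
    remain. *)
Lemma qz_size (z : state) : dom z -> `|qz z| <= sn * (norm2 (rG z) + `|rC z|).
Proof.
move=> [hmu _ _ _]; have cn := gt_eqF cJ_gt0.
have -> : qz z = \sum_i rG z i - rC z / cJ.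
  have -> : \sum_i rG z i = \sum_i gV z i - \sum_i Gz z i.
    rewrite -sumrB; apply: eq_bigr => i _; rewrite /rG.
    have E (u w : {ffun S -> R}) y : (u - w) y = u y - w y by rewrite !ffunE.
    exact: E.
  rewrite (Gbar_sum reg s0 a0)// /qz /rC; field; rewrite cn//.
apply: le_trans (ler_normB _ _) _; rewrite mulrDr; apply: lerD; first exact: sum_le_card.
rewrite normrM normfV (gtr0_norm cJ_gt0) ler_pdivrMr ?cJ_gt0//.
rewrite mulrAC ler_peMl//; apply: mulr_ege1 => //; exact: sqrt_card_ge1.
Qed.

Lemma qz_bound (z : state) : dom z -> `|qz z| <= sn * B0 + B0.
Proof.
move=> [_ _ _ [_ hg hc _]]; apply: le_trans (ler_normB _ _) _; apply: lerD.
  apply: le_trans (sum_le_card _) _; rewrite ler_wpM2l// ltW//; exact: sqrt_card_gt0.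
rewrite normrM normfV (gtr0_norm cJ_gt0) ler_pdivrMr ?cJ_gt0//.
by apply: le_trans hc _; rewrite ler_peMr// (B0_ge0 B0_h).
Qed.

Lemma drift_o2_arith (o o' q q' D e sG Q : R) :
  q' = q + l * e * (D - q) -> 0 <= e -> `|o' - o| <= e * (b * sG) ->
  `|o' - o| <= e * (b * B0) -> `|D - q| <= Q ->
  o' * q' <= o * q + e * (- l * (o * q) + l * (o * D) + b * sG * `|q|) + b * B0 * (l * Q) * e ^+ 2.
Proof.
move=> -> e0 h1 h2 h3.
have -> : o' * (q + l * e * (D - q)) = o * q + e * (- l * (o * q) + l * (o * D))
   + (o' - o) * q + (o' - o) * (l * e * (D - q)) by ring.
have k2 : (o' - o) * q <= e * (b * sG) * `|q|.
  by apply: le_trans (ler_norm _) _; rewrite normrM; apply: ler_pM.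
have k3 : (o' - o) * (l * e * (D - q)) <= e * (b * B0) * (l * e * Q).
  apply: le_trans (ler_norm _) _; rewrite normrM; apply: ler_pM => //.
  have le0 : 0 <= l * e by rewrite mulr_ge0// ltW.
  by rewrite normrM (ger0_norm le0) ler_wpM2l.
lra.
Qed.

Lemma drift_o2 : exists2 C, 0 <= C & forall k (z : state) s c s', dom z ->
  oz (step k z s c s') * qz (step k z s c s') <= oz z * qz z
    + eta R k * (- l * (oz z * qz z) + l * (oz z * (Vh z s' - Vh z s)) + b * sizeG z * `|qz z|)
    + C * eta R k ^+ 2.
Proof.
have B00 := B0_ge0 B0_h; have B1 := BV_gt0 reg; have n0 := sqrt_card_gt0 R s0.
exists (b * B0 * (l * (2 * BV + (sn * B0 + B0)))).
  have bB := mulr_ge0 (ltW b_gt0) B00; have nB := mulr_ge0 (ltW n0) B00.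
  by apply: mulr_ge0 => //; apply: mulr_ge0; [exact: ltW|lra].
move=> k z s c s' dz; have [d1 d2] := oz_step k s c s' dz; have [e0 _] := eta_01 R k.
apply: drift_o2_arith => //; first exact: qz_step.
apply: le_trans (ler_normB _ _) _; apply: lerD; last exact: qz_bound.
have [_ hV _ _] := dz; apply: le_trans (ler_normB _ _) _.
have := norm2_coord (Vh z) s; have := norm2_coord (Vh z) s'; lra.
Qed.

End CriticDrift.

(** * Clipping of the running average reward *)

Section Clipping.
Variable R : realType.

Lemma proj01_mono (j u : R) : 0 <= j <= 1 ->
  (j <= u -> j <= proj_01 u <= u) /\ (u <= j -> u <= proj_01 u <= j).
Proof.
move=> /andP[j0 j1]; have [/andP[p0 p1] h1 h2 h3] := proj_01P u.
have [u0|/ltW u0] := leP u 0; first by move: (h2 u0) => ->; split=> ?; apply/andP; split; lra.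
have [u1|/ltW u1] := leP 1 u; first by move: (h3 u1) => ->; split=> ?; apply/andP; split; lra.
rewrite h1 ?u0//; split=> ?; apply/andP; split; lra.
Qed.

(** The momentum [g] averages past values of [rr - j], hence cannot lie far below [- j] unless [j]
    has dropped. The factor 2 leaves room for that drop: with [4 * t <= le] the momentum forgets
    fast enough for the inequality to persist, with an excess [p] shrinking by [1 - le / 2]. *)
Lemma clip_lower (j j' g rr t le p : R) : 0 <= j -> 0 <= rr -> 0 <= t -> 4 * t <= le ->
  le <= 1 -> 0 <= p -> - 2 * j - p <= g -> (0 <= g -> j <= j') -> (g <= 0 -> j + t * g <= j') ->
  - 2 * j' - (1 - le / 2) * p <= (1 - le) * g + le * (rr - j).
Proof.
move=> j0 r0 t0 tle le1 p0 hg h1 h2; have le0 : 0 <= le by lra.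
have lr := mulr_ge0 le0 r0.
have [g0|/ltW g0] := leP 0 g.
  have k1 : 0 <= (1 - le) * g by rewrite mulr_ge0//; lra.
  have k2 : le * j <= j by rewrite ler_piMl.
  have k3 : 0 <= (1 - le / 2) * p by rewrite mulr_ge0//; lra.
  have := h1 g0; lra.
have c0 : 0 <= 1 - le + 2 * t by lra.
have k1 := ler_wpM2l c0 hg.
have k2 : 4 * t * j <= le * j by rewrite ler_wpM2r.
have k3 : 4 * t * p <= le * p by rewrite ler_wpM2r.
have := h2 g0; lra.
Qed.

Lemma clip_error (j g t p : R) : 0 <= j <= 1 -> 0 <= t -> 2 * t <= 1 -> 0 <= p ->
  - 2 * j - p <= g <= 2 * (1 - j) + p -> `|proj_01 (j + t * g) - j - t * g| <= t * p.
Proof.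
move=> /andP[j0 j1] t0 t1 p0 /andP[g1 g2]; have [_ h1 h2 h3] := proj_01P (j + t * g).
have tp := mulr_ge0 t0 p0.
have k1 := ler_wpM2l t0 g1; have k2 := ler_wpM2l t0 g2.
have j'0 : 0 <= 1 - j by lra.
have q1 : 2 * t * j <= j by rewrite ler_piMl.
have q2 : 2 * t * (1 - j) <= 1 - j by rewrite ler_piMl.
have [u0|/ltW u0] := leP (j + t * g) 0.
  by rewrite h2// ler_norml; apply/andP; split; lra.
have [u1|/ltW u1] := leP 1 (j + t * g).
  by rewrite h3// ler_norml; apply/andP; split; lra.
by rewrite h1 ?u0// -addrA -opprD subrr normr0.
Qed.

(* Bounds the amount by which the projection onto [0, 1] may clip the running reward. *)
Fixpoint pen (l p0 : R) (k : nat) : R :=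
  if k is k'.+1 then (1 - l * eta R k' / 2) * pen l p0 k' else p0.

Lemma pen_ge0 l p0 k : 0 <= l <= 1 -> 0 <= p0 -> 0 <= pen l p0 k.
Proof.
move=> /andP[l0 l1] p00; elim: k => //= k IH; rewrite mulr_ge0//.
have := eta_le1 R k; have := ltW (eta_gt0 R k) => e0 e1.
by have := ler_pM l0 e0 l1 e1; lra.
Qed.

End Clipping.

(** * Invariance of the clipping bound and ascent of the actor *)

Section ActorDrift.
Variables (R : realType) (S A : finType).
Variables (P : {ffun S -> R} -> S -> A -> S -> R) (r : S -> A -> {ffun S -> R} -> R).
Variables (C0 C1 delta L BV LV LTV gamma : R).
Hypothesis reg : regular_mfg P r C0 C1 delta L BV LV LTV gamma.
Variables (s0 : S) (a0 : A) (cJ a b x l B0 : R).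
Hypotheses (a_gt0 : 0 < a) (b_gt0 : 0 < b) (x_gt0 : 0 < x) (l_gt0 : 0 < l).
Hypotheses (l_le : l <= 1 / 4) (cJ_ge1 : 1 <= cJ) (bcJ_le : 4 * (b * cJ) <= l).
Hypotheses (B0_F : 2 * (1 + 2 * BV) <= B0) (B0_c : cJ <= B0) (B0_h : 2 <= B0).

Local Notation state := (astate R S A).
Local Notation spol := (spol a0).
Local Notation step := (Defs.step r cJ BV (stepsz a) (stepsz b) (stepsz x) (stepsz l)).
Local Notation mus z := (mustar P (softmax (th z))).
Local Notation dom := (dom BV B0).
Local Notation eG := (eG P r).
Local Notation em := (em P).
Local Notation ev := (ev P r).
Local Notation rF := (rF P r).
Local Notation ellz := (ellz P r).

Definition clip_ok (p : R) (z : state) : Prop := - 2 * Jh z - p <= gJ z / cJ <= 2 * (1 - Jh z) + p.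

Lemma clip_step k (z : state) s c s' p : dom z -> 0 <= p -> clip_ok p z ->
  clip_ok ((1 - l * eta R k / 2) * p) (step k z s c s') /\
  `|Jh (step k z s c s') - Jh z - b * eta R k * gJ z| <= b * cJ * eta R k * p.
Proof.
move=> [hmu _ hj _] p0 hz; have [e0 e1] := eta_01 R k.
have c0 : 0 < cJ by exact: lt_le_trans ltr01 cJ_ge1.
have cn := gt_eqF c0.
have /andP[le0 le1] := l_eta_01 l_gt0 l_le k.
pose g := gJ z / cJ; pose t := b * cJ * eta R k.
have t0 : 0 <= t by rewrite /t !mulr_ge0// ltW.
have t4 : 4 * t <= l * eta R k.
  by have := ler_wpM2r e0 bcJ_le; rewrite /t; lra.
have tg : b * eta R k * gJ z = t * g by rewrite /t /g; field; rewrite cn.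
have /andP[g1 g2] := hz; have /andP[j0 j1] := hj; rewrite -/g in g1 g2.
have [m1 m2] := proj01_mono (Jh z + t * g) hj.
have gJ' : gJ (step k z s c s') / cJ =
    (1 - l * eta R k) * g + l * eta R k * (r s c (muh z) - Jh z).
  by rewrite step_gJ /g; field; rewrite cn.
have Jh' : Jh (step k z s c s') = proj_01 (Jh z + t * g) by rewrite step_J tg.
have /andP[r0 r1] := reg_reward reg s c hmu.
split; last first.
  by rewrite Jh' tg; apply: clip_error => //; lra.
rewrite /clip_ok gJ' Jh'; set j' := proj_01 _ in m1 m2 *.
have tgp : 0 <= g -> 0 <= t * g by move=> ?; exact: mulr_ge0.
have tgn : g <= 0 -> t * g <= 0 by move=> ?; exact: mulr_ge0_le0.
apply/andP; split.
  apply: (@clip_lower _ (Jh z) j' g (r s c (muh z)) t (l * eta R k) p) => // h.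
    by have := tgp h => h'; have /andP[] : Jh z <= j' <= Jh z + t * g by apply: m1; lra.
  by have := tgn h => h'; have /andP[] : Jh z + t * g <= j' <= Jh z by apply: m2; lra.
(* The upper bound is the lower bound after the reflection of rewards and averages at 1/2. *)
have := @clip_lower _ (1 - Jh z) (1 - j') (- g) (1 - r s c (muh z)) t (l * eta R k) p.
have q1 : 0 <= 1 - Jh z by lra.
have q2 : 0 <= 1 - r s c (muh z) by lra.
have q3 : - 2 * (1 - Jh z) - p <= - g by lra.
move=> /(_ q1 q2 t0 t4 le1 p0 q3) H.
have : - 2 * (1 - j') - (1 - l * eta R k / 2) * p <=
    (1 - l * eta R k) * - g + l * eta R k * (1 - r s c (muh z) - (1 - Jh z)).
  apply: H => h.
    have h'' : g <= 0 by lra.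
    have h' := tgn h''.
    have /andP[_ ?] : Jh z + t * g <= j' <= Jh z by apply: m2; lra.
    by lra.
  have h'' : 0 <= g by lra.
  have h' := tgp h''.
  have /andP[_ ?] : Jh z <= j' <= Jh z + t * g by apply: m1; lra.
  by lra.
by move: (r s c (muh z)) => rr; lra.
Qed.

Lemma actor_arith (om rho w w' J1 J2 dt d2 G q e TK N2 : R) :
  0 < rho -> 0 <= om <= 3 / 2 -> w - w' <= rho * (J1 - J2) ->
  `|J2 - J1 - a * e * dt| <= TK * d2 -> 0 <= TK -> d2 <= N2 -> 0 <= e ->
  0 <= N2 -> G ^+ 2 - G * q <= dt ->
  om / rho * (w - w') <= e * (a * (- om * G ^+ 2 + om * (G * q))) + 3 / 2 * TK * N2.
Proof.
move=> r0 /andP[m0 m1] h1 h2 T0 hd e0 N0 hG; have oR : 0 <= om / rho by rewrite divr_ge0// ltW.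
have {}h1 : om / rho * (w - w') <= om * (J1 - J2).
  by have := ler_wpM2l oR h1; rewrite mulrA divfK ?gt_eqF.
apply: le_trans h1 _.
have h3 : J1 - J2 <= - (a * e * dt) + TK * N2.
  by move: h2; rewrite ler_norml => /andP[h2 _]; have := ler_wpM2l T0 hd; lra.
apply: le_trans (ler_wpM2l m0 h3) _.
have ae : 0 <= om * (a * e) by rewrite !mulr_ge0// ltW.
have h4 := ler_wpM2l ae hG.
have h5 := ler_wpM2r (mulr_ge0 T0 N0) m1; lra.
Qed.

(** Herding compares [ell] at the old and the new policy through [J] at the old induced mean field,
    which stays frozen. Hence the Taylor expansion in the policy parameter applies, although
    [mustar] is only Lipschitz. *)
Lemma drift_ell rho : herding P r 0 rho ->
  exists2 C, 0 <= C & forall k (z : state) s c s' om, dom z -> 0 <= om <= 3 / 2 ->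
  om / rho * (ellz z - ellz (step k z s c s')) <=
    eta R k * (a * (- om * eG z ^+ 2 + om * (eG z * (norm2 (rF z) + LV * em z + ev z))))
    + C * eta R k ^+ 2.
Proof.
move=> [rho0 herd]; have B1 := BV_gt0 reg; have L0 := L_gt0 reg.
have T0 : 0 <= taylorK A L BV.
  rewrite /taylorK; have B2 : 0 <= 1 + BV by lra.
  apply: addr_ge0; last by rewrite !mulr_ge0// addr_ge0.
  by rewrite !mulr_ge0// ltW.
exists (3 / 2 * taylorK A L BV * (a * B0) ^+ 2); first exact: mulr_ge0 (mulr_ge0 (divr_ge0 (ler0n _ _) (ler0n _ _)) T0) (sqr_ge0 _).
move=> k z s c s' om dz hom; have [_ _ _ [hf _ _ _]] := dz; have [e0 e1] := eta_01 R k.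
have h1 := herd _ _ (spol (th z)) (spol (th (step k z s c s'))); rewrite mul0r addr0 in h1.
have h2 := J_taylor reg s0 a0 (th z) ((a * eta R k) *: fv z) (mus_simplex reg a0 z).
rewrite -(gradJE reg s0 a0) dotZr -(step_th r BV cJ a b x l k z s c s') in h2.
have h3 := gradJ_dot_f reg s0 a0 dz.
have := actor_arith rho0 hom h1 h2 T0 _ e0 (sqr_ge0 (a * B0 * eta R k)) h3.
rewrite [(a * B0 * _) ^+ 2]exprMn [3 / 2 * _ * (_ * _)]mulrA; apply.
have ae : 0 <= a * eta R k by rewrite mulr_ge0// ltW.
rewrite -exprMn norm2Z (ger0_norm ae) ler_pXn2r ?nnegrE ?mulr_ge0 ?norm2_ge0 ?(ltW a_gt0)//; last first.
  exact: B0_ge0.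
by rewrite mulrAC ler_wpM2r// ler_wpM2l// ltW.
Qed.

End ActorDrift.

(** * Lyapunov function *)

Section LyapunovArithmetic.
Variable R : realType.
Variables (cJ gamma delta rho L LV LTV BV a b x l sn : R).
Hypotheses (cJ0 : 0 < cJ) (b0 : 0 < b) (l0 : 0 < l) (sn1 : 1 <= sn) (rho0 : 0 < rho).
Local Notation wm := (wt_m delta L LV a x).
Local Notation wv := (wt_v gamma a b).
Local Notation wj := (wt_j cJ gamma a b).
Local Notation wf := (wt_f a l).
Local Notation wg := (wt_g gamma a l).
Local Notation wc := (wt_c a l).
Local Notation wh := (wt_h delta L LV a l).
Local Notation k1 := (wv * (2 / (sn * cJ))).
Local Notation k2 := (wv * (2 * b / (sn * l))).
Local Notation LF := (cL_F BV L LTV).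
Local Notation LG := (cL_G BV cJ L LTV).
Local Notation LH := (cL_H L).

Lemma bonus_arith1 (O O' o dl g sG d p e C w : R) : 0 <= w -> 0 <= e -> 0 <= d -> 0 <= sG ->
  O' <= O + o * dl + e * (- b * (o * g) + BV * (b * cJ * p) + b * sG * d) + C * e ^+ 2 ->
  w * (2 / (sn * cJ)) * O' <= w * (2 / (sn * cJ)) * O + w * (2 / (sn * cJ)) * (o * dl)
    + e * (- (w * (2 * b / sn)) * (o * (g / cJ)) + w * (2 * b / sn) * (BV * p)
        + w * (2 / cJ * (d * (b * sG))))
    + w * (2 / (sn * cJ)) * C * e ^+ 2.
Proof.
move=> w0 e0 d0 s0 h; have sn0 : 0 < sn := lt_le_trans ltr01 sn1.
have k0 : 0 <= w * (2 / (sn * cJ)) by rewrite mulr_ge0// divr_ge0// mulr_ge0// ltW.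
have X0 : 0 <= w * (2 / cJ * (d * (b * sG))).
  by rewrite mulr_ge0// mulr_ge0 ?divr_ge0 ?(ltW cJ0)// mulr_ge0// mulr_ge0// ltW.
have Xs : w * (2 / cJ * (d * (b * sG))) / sn <= w * (2 / cJ * (d * (b * sG))).
  by rewrite ler_pdivrMr// ler_peMr.
apply: le_trans (ler_wpM2l k0 h) _.
have -> : w * (2 / (sn * cJ)) * (O + o * dl + e * (- b * (o * g) + BV * (b * cJ * p) + b * sG * d)
      + C * e ^+ 2) =
   w * (2 / (sn * cJ)) * O + w * (2 / (sn * cJ)) * (o * dl)
    + e * (- (w * (2 * b / sn)) * (o * (g / cJ)) + w * (2 * b / sn) * (BV * p)
        + w * (2 / cJ * (d * (b * sG))) / sn)
    + w * (2 / (sn * cJ)) * C * e ^+ 2.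
  by field; rewrite !gt_eqF.
by rewrite lerD2r lerD2l ler_wpM2l// lerD2l.
Qed.

Lemma bonus_arith2 (O O' q o D sG Q aq e C w : R) : 0 <= w -> 0 <= e -> 0 <= sG ->
  aq <= sn * Q ->
  O' <= O + e * (- l * (o * q) + l * (o * D) + b * sG * aq) + C * e ^+ 2 ->
  w * (2 * b / (sn * l)) * O' <= w * (2 * b / (sn * l)) * O
    + e * (- (w * (2 * b / sn)) * (o * q) + w * (2 * b / sn) * (o * D)
        + w * (2 * b / l * (Q * (b * sG))))
    + w * (2 * b / (sn * l)) * C * e ^+ 2.
Proof.
move=> w0 e0 s0 hq h; have sn0 : 0 < sn := lt_le_trans ltr01 sn1.
have k0 : 0 <= w * (2 * b / (sn * l)).
  by rewrite mulr_ge0// divr_ge0 ?mulr_ge0// ltW.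
have bs : 0 <= b * sG by rewrite mulr_ge0// ltW.
have h' : e * (- l * (o * q) + l * (o * D) + b * sG * aq) <=
    e * (- l * (o * q) + l * (o * D) + b * sG * (sn * Q)).
  by rewrite ler_wpM2l// lerD2l ler_wpM2l.
have {}h : O' <= O + e * (- l * (o * q) + l * (o * D) + b * sG * (sn * Q)) + C * e ^+ 2 by lra.
apply: le_trans (ler_wpM2l k0 h) _; rewrite le_eqVlt; apply/orP; left; apply/eqP.
by field; rewrite !gt_eqF.
Qed.

(* The cross terms [O1] and [O2] cancel the first-order term linear in the constant mode of the
   critic that the ball projection leaves behind. *)
Definition lyap_form (w m W O1 O2 j f g c h : R) : R :=
  - (w / rho) + wm * m + wv * W + k1 * O1 + k2 * O2 + wj * j + wf * f + wg * g + wc * c + wh * h.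

Definition noise_form (nf ng nc nh oD : R) : R :=
  wf * (2 * l * nf) + wg * (2 * l * ng) + wc * (2 * l * nc) + wh * (2 * l * nh)
  + wv * (2 * b / sn) * oD.

Lemma lyap_arith (w w' m2' W W' O1 O1' O2 O2' j2' f2' g2' c c2' h2' : R)
    (G m v j f g h o D p sg gJ nf ng nc nh e aq CE Cm CV C1 C2 Cj Cf Cg Cc Ch : R) :
  let phi := G + f + LV * m + v in let hh := 2 * m + h in
  let gg := 2 * v + j + g in let gj := cJ * j + `|c| in
  let M := a * phi + x * hh in let om := 1 - rho * k1 * o in
  0 <= e -> 0 <= m -> 0 <= v -> 0 <= j -> 0 <= f -> 0 <= g -> 0 <= h -> 0 <= L ->
  [/\ 0 <= wm, 0 <= wv, 0 <= wj, 0 <= wf & [/\ 0 <= wg, 0 <= wc & 0 <= wh]] ->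
  om / rho * (w - w') <= e * (a * (- om * G ^+ 2 + om * (G * (f + LV * m + v)))) + CE * e ^+ 2 ->
  m2' <= m ^+ 2 + e * (- 2 * x * (1 - delta) * m ^+ 2 + 2 * m * (x * h + L * a * phi)) + Cm * e ^+ 2 ->
  W' <= W + e * (- 2 * b * gamma * v ^+ 2 + 2 * b * v * (j + g) + 2 * v * LV * M
     + 2 * b * (o / sn * sg)) + CV * e ^+ 2 ->
  O1' <= O1 + o * (w' - w) + e * (- b * (o * gJ) + BV * (b * cJ * p) + b * gg * (j + 2 * L * m))
     + C1 * e ^+ 2 ->
  O2' <= O2 + e * (- l * (o * (sg - gJ / cJ)) + l * (o * D) + b * gg * aq) + C2 * e ^+ 2 ->
  aq <= sn * (g + `|c|) ->
  j2' <= j ^+ 2 + e * (- 2 * b * cJ * j ^+ 2 + 2 * j * (b * `|c| + LV * M)) + Cj * e ^+ 2 ->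
  f2' <= f ^+ 2 + e * (- 2 * l * f ^+ 2 + 2 * f * (4 * LF * (M + b * gg)) + 2 * l * nf) + Cf * e ^+ 2 ->
  g2' <= g ^+ 2 + e * (- 2 * l * g ^+ 2 + 2 * g * (LG * (M + b * gg + b * gj)) + 2 * l * ng)
     + Cg * e ^+ 2 ->
  c2' <= c ^+ 2 + e * (- 2 * l * c ^+ 2 + 2 * `|c| * (cJ * (LV * M + b * gj)) + 2 * l * nc)
     + Cc * e ^+ 2 ->
  h2' <= h ^+ 2 + e * (- 2 * l * h ^+ 2 + 2 * h * (2 * LH * M) + 2 * l * nh) + Ch * e ^+ 2 ->
  lyap_form w' m2' W' O1' O2' j2' f2' g2' c2' h2' <=
  lyap_form w (m ^+ 2) W O1 O2 (j ^+ 2) (f ^+ 2) (g ^+ 2) (c ^+ 2) (h ^+ 2)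
  + e * raw_drift cJ gamma delta L LV LTV BV a b x l om G m v j f g `|c| h
  + e * noise_form nf ng nc nh (o * D) + e * (wv * (2 * b / sn) * (BV * p))
  + (CE + wm * Cm + wv * CV + k1 * C1 + k2 * C2 + wj * Cj + wf * Cf + wg * Cg + wc * Cc + wh * Ch)
    * e ^+ 2.
Proof.
move=> phi hh gg gj M om e0 m0 v0 j0 f0 g0 h0 L0 [wm0 wv0 wj0 wf0 [wg0 wc0 wh0]].
move=> hE hm hV hO1 hO2 haq hj hf hg hc hhh.
have gg0 : 0 <= gg by rewrite /gg; lra.
have sn0 : 0 < sn := lt_le_trans ltr01 sn1.
have d0 : 0 <= j + 2 * L * m by have := mulr_ge0 L0 m0; lra.
have B1 := bonus_arith1 wv0 e0 d0 gg0 hO1.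
have B2 := bonus_arith2 wv0 e0 gg0 haq hO2.
have rn : rho != 0 by rewrite gt_eqF.
(* The change of [ell] occurring in the first cross term is merged with that of [- ell / rho]; their
   sum is [om / rho * (w - w')], which is the origin of [om]. *)
have {}hE : - (w' / rho) + k1 * (o * (w' - w)) <= - (w / rho)
    + e * (a * (- om * G ^+ 2 + om * (G * (f + LV * m + v)))) + CE * e ^+ 2.
  have E : om / rho * (w - w') = w / rho - w' / rho + k1 * (o * (w' - w)).
    by rewrite /om; field; rewrite rn !gt_eqF.
  by move: hE; rewrite E; set u := k1 * _; lra.
(* The sum of the critic momentum is split into [gJ / cJ] and the rest. The coefficients of the
   cross terms are chosen to give each part the opposite contribution. *)
have {}hV : wv * W' <= wv * W + e * (wv * (- 2 * b * gamma * v ^+ 2 + 2 * b * v * (j + g)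
     + 2 * v * LV * M) + wv * (2 * b / sn) * (o * (gJ / cJ))
     + wv * (2 * b / sn) * (o * (sg - gJ / cJ))) + wv * CV * e ^+ 2.
  apply: le_trans (ler_wpM2l wv0 hV) _; rewrite le_eqVlt; apply/orP; left; apply/eqP.
  by field; rewrite !gt_eqF.
have {}hm := ler_wpM2l wm0 hm; have {}hj := ler_wpM2l wj0 hj.
have {}hf := ler_wpM2l wf0 hf; have {}hg := ler_wpM2l wg0 hg.
have {}hc := ler_wpM2l wc0 hc; have {}hhh := ler_wpM2l wh0 hhh.
have cE : `|c| ^+ 2 = c ^+ 2 by rewrite real_normK ?num_real.
have RE : raw_drift cJ gamma delta L LV LTV BV a b x l om G m v j f g `|c| h =
  a * (- om * G ^+ 2 + om * (G * (f + LV * m + v)))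
  + wm * (- 2 * x * (1 - delta) * m ^+ 2 + 2 * m * (x * h + L * a * phi))
  + wv * (- 2 * b * gamma * v ^+ 2 + 2 * b * v * (j + g) + 2 * v * LV * M)
  + wv * (2 / cJ * ((j + 2 * L * m) * (b * gg)))
  + wv * (2 * b / l * ((g + `|c|) * (b * gg)))
  + wj * (- 2 * b * cJ * j ^+ 2 + 2 * j * (b * `|c| + LV * M))
  + wf * (- 2 * l * f ^+ 2 + 2 * f * (4 * LF * (M + b * gg)))
  + wg * (- 2 * l * g ^+ 2 + 2 * g * (LG * (M + b * gg + b * gj)))
  + wc * (- 2 * l * c ^+ 2 + 2 * `|c| * (cJ * (LV * M + b * gj)))
  + wh * (- 2 * l * h ^+ 2 + 2 * h * (2 * LH * M)).
  by rewrite /raw_drift cE.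
rewrite RE /lyap_form /noise_form; move: hE hV hm hj hf hg hc hhh B1 B2.
move: (a * (- om * G ^+ 2 + _)) (- 2 * x * (1 - delta) * m ^+ 2 + _)
  (- 2 * b * gamma * v ^+ 2 + _ + 2 * v * LV * M) (wv * (2 / cJ * _)) (wv * (2 * b / l * _))
  (- 2 * b * cJ * j ^+ 2 + _) (- 2 * l * f ^+ 2 + 2 * f * _) (- 2 * l * g ^+ 2 + 2 * g * _)
  (- 2 * l * c ^+ 2 + 2 * `|c| * _) (- 2 * l * h ^+ 2 + 2 * h * _).
move: (wv * (2 * b / sn)) (k1) (k2) (w' / rho) (w / rho) => cz K1 K2 wr' wr.
move: wm wv wj wf wg wc wh => zm zv zj zf zg zc zh.
move=> T1 T2 T3 T4 T5 T6 T7 T8 T9 T10.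
lra.
Qed.

End LyapunovArithmetic.

Section Lyapunov.
Variables (R : realType) (S A : finType).
Variables (P : {ffun S -> R} -> S -> A -> S -> R) (r : S -> A -> {ffun S -> R} -> R).
Variables (C0 C1 delta L BV LV LTV gamma : R).
Hypothesis reg : regular_mfg P r C0 C1 delta L BV LV LTV gamma.
Variables (s0 : S) (a0 : A) (cJ rho a b x l B0 : R).
Hypotheses (a_gt0 : 0 < a) (b_gt0 : 0 < b) (x_gt0 : 0 < x) (l_gt0 : 0 < l).
Hypothesis herd : herding P r 0 rho.
Hypothesis ok : stepsize_ok #|S| cJ gamma delta rho L LV LTV BV a b x l.
Hypotheses (B0_F : 2 * (1 + 2 * BV) <= B0) (B0_c : cJ <= B0) (B0_h : 2 <= B0).

Local Notation state := (astate R S A).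
Local Notation spol := (spol a0).
Local Notation step := (Defs.step r cJ BV (stepsz a) (stepsz b) (stepsz x) (stepsz l)).
Local Notation Jz z := (J P r (softmax (th z)) (muh z)).
Local Notation nuz z := (nu P (softmax (th z)) (muh z)).
Local Notation Fz z := (Fbar P r (th z) (muh z) (Vh z)).
Local Notation Gz z := (Gbar P r (th z) (muh z) (Vh z) (Jh z)).
Local Notation dom := (dom BV B0).
Local Notation sn := (sqrt_card R S).
Local Notation eG := (eG P r).
Local Notation em := (em P).
Local Notation ev := (ev P r).
Local Notation ej := (ej P r).
Local Notation rF := (rF P r).
Local Notation rG := (rG P r).
Local Notation rC := (rC P r cJ).
Local Notation rH := (rH P).
Local Notation ellz := (ellz P r).
Local Notation oz := (oz BV gamma).
Local Notation qz := (qz cJ).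
Local Notation wv := (wt_v gamma a b).
Local Notation k1 := (wv * (2 / (sn * cJ))).
Local Notation k2 := (wv * (2 * b / (sn * l))).

Definition lyap (z : state) : R :=
  lyap_form cJ gamma delta rho L LV a b x l sn (ellz z) (em z ^+ 2) (ev z ^+ 2 + oz z ^+ 2)
    (oz z * (ellz z - Jh z)) (oz z * qz z) (ej z ^+ 2) (norm2 (rF z) ^+ 2) (norm2 (rG z) ^+ 2)
    (rC z ^+ 2) (norm2 (rH z) ^+ 2).

Definition noise (z : state) (s : S) (c : A) (s' : S) : R :=
  noise_form gamma delta L LV a b l sn
    (dot (rF z) (zF r (th z) (muh z) (Vh z) s c s' - Fz z))
    (dot (rG z) (zG r (muh z) (Vh z) (Jh z) s c s' - Gz z))
    (rC z * (cJ * (r s c (muh z) - Jh z) - cJ * (Jz z - Jh z)))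
    (dot (rH z) (unitv R s - muh z - (nuz z - muh z)))
    (oz z * (Vh z s' - Vh z s)).

Lemma rho_gt0 : 0 < rho. Proof. by case: herd. Qed.

Lemma card_gt0 : (0 < #|S|)%N. Proof. by apply/card_gt0P; exists s0. Qed.

Lemma cJ_ge1 : 1 <= cJ. Proof. exact: ltW (cJ_gt1 (gamma_01 reg) ok). Qed.

Lemma l_le : l <= 1 / 4. Proof. by have [] := steps_le ok. Qed.

Lemma LF_ge0 : 0 <= cL_F BV L LTV.
Proof.
apply: le_trans (LF_ge L (reg_LTV_ge0 reg) (BV_gt0 reg)).
by have := L_gt0 reg; lra.
Qed.

Lemma LG_ge0 : 0 <= cL_G BV cJ L LTV.
Proof.
apply: le_trans (LG_ge (gamma_01 reg) (L_gt0 reg) (reg_LTV_ge0 reg) (BV_gt0 reg) ok).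
by have := cJ_ge1; lra.
Qed.

Lemma weights_ge0 : [/\ 0 <= wt_m delta L LV a x, 0 <= wv, 0 <= wt_j cJ gamma a b, 0 <= wt_f a l &
  [/\ 0 <= wt_g gamma a l, 0 <= wt_c a l & 0 <= wt_h delta L LV a l]].
Proof. exact: (wt_ge0 a_gt0 b_gt0 x_gt0 l_gt0 (gamma_01 reg) (delta_01 reg) ok). Qed.

Lemma bcJ_le : 4 * (b * cJ) <= l.
Proof.
have [_ _ _] := ratio_c a_gt0 b_gt0 x_gt0 l_gt0 rho_gt0 (gamma_01 reg) (delta_01 reg) (L_gt0 reg)
  (LV_ge1 reg) (reg_LTV_ge0 reg) (BV_gt0 reg) card_gt0 ok.
rewrite mulrA ler_pdivrMr// => h; have := l_gt0; lra.
Qed.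

(** The perturbation is at most the product of [rho * wv <= 1 / 2], [2 / (sn * cJ) <= 2 * gamma] and
    [oz <= 1 / (2 * gamma)] in absolute value. *)
Lemma actor_weight (z : state) : dom z -> 1 / 2 <= 1 - rho * k1 * oz z <= 3 / 2.
Proof.
move=> dz; have [h1 _] := Cbe_parts b_gt0 rho_gt0 (gamma_01 reg) (delta_01 reg) (LV_ge1 reg) card_gt0 ok.
have /andP[g0 _] := gamma_01 reg; have c1 := cJ_ge1; have n1 := sqrt_card_ge1 R s0.
have c0 : 0 < cJ := lt_le_trans ltr01 c1; have n0 : 0 < sn := lt_le_trans ltr01 n1.
have gc := gamma_cJ_ge1 (gamma_01 reg) ok.
have hr : rho * wv <= 1 / 2.
  by rewrite /wt_v mulrA ler_pdivrMr ?mulr_gt0//; lra.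
have ho : `|oz z| <= (2 * gamma)^-1.
  by have [_ h] := perp_max_le BV gamma; exact: le_trans (oz_bound reg s0 dz) h.
have rw0 : 0 <= rho * wv by rewrite mulr_ge0 ?(ltW rho_gt0)//; have [] := weights_ge0.
have k0 : 0 <= 2 / (sn * cJ) by rewrite divr_ge0// mulr_ge0// ltW.
have hk : 2 / (sn * cJ) <= 2 * gamma.
  rewrite ler_pdivrMr ?mulr_gt0// -mulrA ler_peMr// (mulrCA gamma).
  by apply: le_trans gc _; rewrite ler_peMl// mulr_ge0// ltW.
have : `|rho * k1 * oz z| <= 1 / 2.
  have -> : rho * k1 * oz z = rho * wv * (2 / (sn * cJ) * oz z) by ring.
  rewrite normrM (ger0_norm rw0) -[1 / 2]mulr1; apply: ler_pM => //.
  rewrite normrM (ger0_norm k0).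
  have E : 2 * gamma * (2 * gamma)^-1 = 1 by rewrite divff// gt_eqF// mulr_gt0.
  by rewrite -[leRHS]E; exact: ler_pM.
by rewrite ler_norml => /andP[? ?]; apply/andP; split; lra.
Qed.

Lemma lyap_combine (y1 y2 rd n u C e g : R) : e * rd <= e * (- (a / 100) * g) ->
  y1 <= y2 + e * rd + e * n + e * u + C * e ^+ 2 ->
  y1 <= y2 - a / 100 * (e * g) + e * n + e * u + C * e ^+ 2.
Proof. by move=> h1 h2; lra. Qed.

Lemma lyap_step : exists2 C, 0 <= C & forall k (z : state) s c s' p, dom z ->
  `|Jh (step k z s c s') - Jh z - b * eta R k * gJ z| <= b * cJ * eta R k * p ->
  lyap (step k z s c s') <= lyap z - a / 100 * (eta R k * eps_total P r z)
    + eta R k * noise z s c s' + eta R k * (wv * (2 * b / sn) * (BV * p)) + C * eta R k ^+ 2.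
Proof.
have lle := l_le; have c1 := cJ_ge1; have n1 := sqrt_card_ge1 R s0.
have c0 : 0 < cJ := lt_le_trans ltr01 c1; have n0 : 0 < sn := lt_le_trans ltr01 n1.
have [CE cE hE] := drift_ell reg s0 a0 cJ b x l a_gt0 B0_h herd.
have [Cm cm hm] := drift_m reg s0 a0 cJ b l a_gt0 x_gt0 B0_h.
have [CV cV hV] := drift_V reg s0 a0 a_gt0 b_gt0 x_gt0 l_gt0 lle c1 B0_F B0_c B0_h.
have [D1 d1 h1] := drift_o1 reg s0 a0 x l a_gt0 b_gt0 c1 B0_h.
have [D2 d2 h2] := drift_o2 reg s0 a0 a x b_gt0 l_gt0 c1 B0_h.
have [Cj cj hj] := drift_j reg s0 a0 a_gt0 b_gt0 x_gt0 l_gt0 lle c1 B0_F B0_c B0_h.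
have [Cf cf hf] := drift_F reg s0 a0 a_gt0 b_gt0 x_gt0 l_gt0 lle c1 B0_F B0_c B0_h LF_ge0.
have [Cg cg hg] := drift_G reg s0 a0 a_gt0 b_gt0 x_gt0 l_gt0 lle c1 B0_F B0_c B0_h LG_ge0.
have [Cc cc hc] := drift_C reg s0 a0 a_gt0 b_gt0 x_gt0 l_gt0 lle c1 B0_F B0_c B0_h.
have [Ch ch hh] := drift_H reg s0 a0 b a_gt0 x_gt0 l_gt0 lle c1 B0_F B0_c B0_h.
have W := weights_ge0; have [wm0 wv0 wj0 wf0 [wg0 wc0 wh0]] := W.
have K1 : 0 <= k1 by rewrite mulr_ge0// divr_ge0// mulr_ge0// ltW.
have K2 : 0 <= k2 by rewrite mulr_ge0// divr_ge0 ?mulr_ge0// ltW.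
exists (CE + wt_m delta L LV a x * Cm + wv * CV + k1 * D1 + k2 * D2 + wt_j cJ gamma a b * Cj
  + wt_f a l * Cf + wt_g gamma a l * Cg + wt_c a l * Cc + wt_h delta L LV a l * Ch).
  by do 9 (apply: addr_ge0; last exact: mulr_ge0).
move=> k z s c s' p dz hp; have [e0 e1] := eta_01 R k.
have hom := actor_weight dz.
have [G0 m0 v0 j0] := sizeF_ge0 P r z.
have hom0 : 0 <= 1 - rho * k1 * oz z <= 3 / 2.
  case/andP: hom => hom1 hom2; apply/andP; split=> //; apply: le_trans hom1.
  exact: divr_ge0 ler01 (ler0n _ _).
have rawle := raw_drift_le a_gt0 b_gt0 x_gt0 l_gt0 rho_gt0 (gamma_01 reg) (delta_01 reg) (L_gt0 reg)
  (LV_ge1 reg) (reg_LTV_ge0 reg) (BV_gt0 reg) card_gt0 ok hom G0 m0 v0 j0 (norm2_ge0 (rF z))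
  (norm2_ge0 (rG z)) (normr_ge0 (rC z)) (norm2_ge0 (rH z)).
have H := lyap_arith c0 b_gt0 l_gt0 n1 rho_gt0 e0 m0 v0 j0 (norm2_ge0 (rF z)) (norm2_ge0 (rG z))
  (norm2_ge0 (rH z)) (ltW (L_gt0 reg)) W (hE k z s c s' _ dz hom0) (hm k z s c s' dz)
  (hV k z s c s' dz) (h1 k z s c s' p dz hp) (h2 k z s c s' dz) (qz_size reg s0 a0 c1 dz)
  (hj k z s c s' dz) (hf k z s c s' dz) (hg k z s c s' dz) (hc k z s c s' dz) (hh k z s c s' dz).
rewrite eps_totalE; exact: lyap_combine (ler_wpM2l e0 rawle) H.
Qed.

Lemma lower_arith (r' w A1 A2 X1 X2 p1 p2 p3 p4 p5 p6 p7 : R) : w <= r' -> - A1 <= X1 ->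
  - A2 <= X2 -> 0 <= p1 -> 0 <= p2 -> 0 <= p3 -> 0 <= p4 -> 0 <= p5 -> 0 <= p6 -> 0 <= p7 ->
  - (r' + A1 + A2) <= - w + p1 + p2 + X1 + X2 + p3 + p4 + p5 + p6 + p7.
Proof. by move=> *; lra. Qed.

Lemma lyap_lower : exists2 B, 0 <= B & forall z : state, dom z -> - B <= lyap z.
Proof.
have c1 := cJ_ge1; have n1 := sqrt_card_ge1 R s0; have r0 := rho_gt0.
have c0 : 0 < cJ := lt_le_trans ltr01 c1; have n0 : 0 < sn := lt_le_trans ltr01 n1.
have [wm0 wv0 wj0 wf0 [wg0 wc0 wh0]] := weights_ge0.
have K1 : 0 <= k1 by rewrite mulr_ge0// divr_ge0// mulr_ge0// ltW.
have K2 : 0 <= k2 by rewrite mulr_ge0// divr_ge0 ?mulr_ge0// ltW.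
have BB := BV_gt0 reg; have B00 := B0_ge0 B0_h.
have Q0 : 0 <= sn * B0 + B0 by rewrite addr_ge0// mulr_ge0// ltW.
exists (rho^-1 + k1 * (BV * 1) + k2 * (BV * (sn * B0 + B0))).
  apply: addr_ge0; last by rewrite mulr_ge0// mulr_ge0// ltW.
  by apply: addr_ge0; [rewrite invr_ge0 ltW|rewrite mulr_ge0// mulr1 ltW].
move=> z dz; have [_ _ /andP[j0 j1] _] := dz.
have /andP[e0 e1] := ellz_01 reg s0 a0 z.
have ho : `|oz z| <= BV.
  by have [h _] := perp_max_le BV gamma; exact: le_trans (oz_bound reg s0 dz) h.
have o1' : - (BV * 1) <= oz z * (ellz z - Jh z).
  suff : `|oz z * (ellz z - Jh z)| <= BV * 1 by rewrite ler_norml => /andP[].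
  by rewrite normrM; apply: ler_pM => //; rewrite ler_norml; apply/andP; split; lra.
have o2' : - (BV * (sn * B0 + B0)) <= oz z * qz z.
  suff : `|oz z * qz z| <= BV * (sn * B0 + B0) by rewrite ler_norml => /andP[].
  by rewrite normrM; apply: ler_pM => //; exact: (qz_bound s0 c1 B0_h dz).
have t1 := ler_wpM2l K1 o1'; have t2 := ler_wpM2l K2 o2'.
have t3 : ellz z / rho <= rho^-1 by rewrite ler_pdivrMr// mulVf// gt_eqF.
have p2 := mulr_ge0 wv0 (addr_ge0 (sqr_ge0 (ev z)) (sqr_ge0 (oz z))).
rewrite !mulrN in t1 t2.
exact: lower_arith t3 t1 t2 (mulr_ge0 wm0 (sqr_ge0 _)) p2 (mulr_ge0 wj0 (sqr_ge0 _))
  (mulr_ge0 wf0 (sqr_ge0 _)) (mulr_ge0 wg0 (sqr_ge0 _)) (mulr_ge0 wc0 (sqr_ge0 _))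
  (mulr_ge0 wh0 (sqr_ge0 _)).
Qed.

Local Notation BLs := (BL BV B0).

Lemma BL_dot (I : finType) (u w : state -> {ffun I -> R}) :
  (forall i, BLs (fun z => u z i)) -> (forall i, BLs (fun z => w z i)) ->
  BLs (fun z => dot (u z) (w z)).
Proof. by move=> hu hw; apply: BL_bigsum => i; apply: BLM. Qed.

Lemma BL_coordB (I : finType) (u w : state -> {ffun I -> R}) i :
  BLs (fun z => u z i) -> BLs (fun z => w z i) -> BLs (fun z => (u z - w z) i).
Proof.
have E (y v : {ffun I -> R}) : (y - v) i = y i - v i by rewrite !ffunE.
by move=> hu hw; have := BLB hu hw; congr BL; apply/funext => z; rewrite E.
Qed.

Lemma BL_oz : BLs (fun z : state => oz z).
Proof.
have BB := ltW (BV_gt0 reg).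
apply: (@BL_intro _ _ _ BV B0 _ BV 1) => //.
  by move=> z dz; have [h _] := perp_max_le BV gamma; exact: le_trans (oz_bound reg s0 dz) h.
move=> z z' _ _; rewrite mul1r; apply: le_trans (oz_move reg s0 z z') _.
by have [_ _ h _] := sdist_ge z z'.
Qed.

Lemma BL_noise s c s' : BLs (fun z => noise z s c s').
Proof.
have B00 := B0_ge0 B0_h.
have bF i : BLs (fun z => Fz z i) := BL_Fbar reg s0 a0 B0 i.
have bG i : BLs (fun z => Gz z i) := BL_Gbar reg s0 a0 B0 i.
have bn i : BLs (fun z => nuz z i) := BL_nu reg s0 a0 B0 i.
have bm i : BLs (fun z : state => muh z i) := BL_mu A BV B0 i.
have bJ : BLs (fun z : state => Jh z) := BL_Jh S A BV B0.
have bN i : BLs (fun z => (nuz z - muh z) i) by exact: BL_coordB.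
have bR : BLs (fun z : state => r s c (muh z)) := BL_reward reg B0 s c.
have bj := BL_J reg s0 a0 B0.
apply: BLD; last first.
  by apply: BLZ; apply: BLM; [exact: BL_oz|apply: BLB; exact: (BL_V reg)].
apply: BLD; last first.
  do 2 apply: BLZ; apply: BL_dot => i.
    apply: (BL_coordB (u := fun z : state => hv z)) => //; exact: BL_h.
  apply: (BL_coordB (u := fun z : state => unitv R s - muh z)) => //.
  by apply: (BL_coordB (u := fun z : state => unitv R s)) => //; exact: BL_const.
apply: BLD; last first.
  do 2 apply: BLZ; apply: BLM; last by apply: BLB; apply: BLZ; exact: BLB.
  by apply: BLB; [exact: BL_gJ|apply: BLZ; exact: BLB].
apply: BLD.
  do 2 apply: BLZ; apply: BL_dot => i.
    by apply: (BL_coordB (u := fun z : state => fv z)) => //; exact: BL_f.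
  by apply: (BL_coordB (u := fun z : state => zF r (th z) (muh z) (Vh z) s c s')) => //;
    exact: (BL_zF reg a0).
do 2 apply: BLZ; apply: BL_dot => i.
  by apply: (BL_coordB (u := fun z : state => gV z)) => //; exact: BL_gV.
by apply: (BL_coordB (u := fun z : state => zG r (muh z) (Vh z) (Jh z) s c s')) => //;
  exact: (BL_zG reg).
Qed.

Lemma noise_form_sum (I : finType) (p f1 f2 f3 f4 f5 : I -> R) :
  \sum_i p i * noise_form gamma delta L LV a b l sn (f1 i) (f2 i) (f3 i) (f4 i) (f5 i) =
  noise_form gamma delta L LV a b l sn (\sum_i p i * f1 i) (\sum_i p i * f2 i)
    (\sum_i p i * f3 i) (\sum_i p i * f4 i) (\sum_i p i * f5 i).
Proof.
rewrite /noise_form !mulr_sumr -!big_split; apply: eq_bigr => i _ /=; ring.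
Qed.

(** Each sample is compared with its own stationary mean, and critic increments average to zero
    under the stationary law; the coefficients depend on [z] alone. *)
Lemma noise_mean0 (z : state) : dom z ->
  stat_mean P (th z) (muh z) (noise z) = 0.
Proof.
move=> [hmu _ _ _]; have [_ p1] := joint_simplex reg s0 a0 (th z) hmu.
have [_ n1] := nu_mfg_simplex reg s0 (spol (th z)) hmu.
have dotm (I : finType) (Z : S -> A -> S -> {ffun I -> R}) (w : {ffun I -> R}) :
    \sum_y joint P (softmax (th z)) (muh z) y *
      dot w (Z y.1.1 y.1.2 y.2 - joint_mean P (th z) (muh z) Z) = 0.
  under eq_bigr do rewrite dotC dotBl mulrBr.
  rewrite sumrB -mulr_suml p1 mul1r.
  by rewrite (joint_sum _ _ _ (fun s c s' => dot (Z s c s') w)) -dot_joint_mean subrr.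
have cst (f : S -> R) : stat_mean P (th z) (muh z) (fun s _ _ => f s) = \sum_s nuz z s * f s.
  apply: eq_bigr => s _; congr (_ * _).
  exact: (mean_step_const (reg_kernel reg) a0 s (f s) hmu).
rewrite -joint_sum /noise noise_form_sum /Fbar /Gbar.
rewrite (dotm _ (zF r (th z) (muh z) (Vh z))) (dotm _ (zG r (muh z) (Vh z) (Jh z))).
rewrite (joint_sum _ _ _ (fun s c _ => rC z * (cJ * (r s c (muh z) - Jh z) - cJ * (Jz z - Jh z)))).
rewrite (joint_sum _ _ _ (fun s _ _ => dot (rH z) (unitv R s - muh z - (nuz z - muh z)))).
rewrite (joint_sum _ _ _ (fun s _ s' => oz z * (Vh z s' - Vh z s))).
have -> : stat_mean P (th z) (muh z) (fun s _ s' => oz z * (Vh z s' - Vh z s)) = 0.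
  rewrite -joint_sum; under eq_bigr do rewrite mulrCA.
  rewrite -mulr_sumr (joint_sum _ _ _ (fun s _ s' => Vh z s' - Vh z s)).
  by rewrite (stat_mean_telescope reg s0 a0)// mulr0.
have -> : stat_mean P (th z) (muh z)
    (fun s _ _ => dot (rH z) (unitv R s - muh z - (nuz z - muh z))) = 0.
  rewrite cst.
  have E s : unitv R s - muh z - (nuz z - muh z) = unitv R s - nuz z.
    by rewrite opprB addrA subrK.
  under eq_bigr do rewrite E dotBr mulrBr dot_unitv.
  rewrite sumrB -mulr_suml n1 mul1r /dot -sumrB big1// => s _; ring.
have -> : stat_mean P (th z) (muh z)
    (fun s c _ => rC z * (cJ * (r s c (muh z) - Jh z) - cJ * (Jz z - Jh z))) = 0.
  have E (s : S) (c : A) : rC z * (cJ * (r s c (muh z) - Jh z) - cJ * (Jz z - Jh z)) =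
    rC z * cJ * (r s c (muh z) - Jz z) by ring.
  rewrite -joint_sum; under eq_bigr do rewrite E mulrCA mulrBr.
  rewrite -mulr_sumr sumrB -mulr_suml p1 mul1r (joint_sum _ _ _ (fun s c _ => r s c (muh z))).
  suff -> : stat_mean P (th z) (muh z) (fun s c _ => r s c (muh z)) = Jz z by rewrite subrr mulr0.
  apply: eq_bigr => s _; congr (_ * _); apply: eq_bigr => c _; congr (_ * _).
  by rewrite -mulr_suml (kernel_sum1 (reg_kernel reg) s c hmu) mul1r.
by rewrite /noise_form !mulr0 !addr0.
Qed.

End Lyapunov.

(** * Convergence *)

Section FirstStep.
Variables (R : realType) (S A : finType).
Variables (P : {ffun S -> R} -> S -> A -> S -> R) (r : S -> A -> {ffun S -> R} -> R).
Variables (cJ BV : R) (al be xi la : nat -> R).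
Local Notation step := (Defs.step r cJ BV al be xi la).
Local Notation expect := (expect P r cJ BV al be xi la).

(** Bounds available from every possible state at iteration 1 are averaged over the first
    transition. Their starting constants [W] may depend on that transition; only finitely many
    occur. *)
Lemma rate_after_first_step (a0 : A) (e : astate R S A -> R) (z : astate R S A) (s : S)
    (W : A -> S -> R) (C : R) :
  is_kernel P -> simplex (muh z) -> 0 <= C ->
  (forall T c s', \sum_(t < T) eta R t.+1 * expect e t 1 (step 0 z s c s') s' <=
    W c s' + C * \sum_(t < T) eta R t.+1 ^+ 2) ->
  exists2 C' : R, 0 < C' & forall k, (1 < k)%N -> exists t, (t < k)%N /\
    expect e t 0 z s <= C' * (ln (k%:R + 1) ^+ 3 / Num.sqrt (k%:R + 1)).
Proof.
move=> Ker hmu C_0 hW; pose M := mean_step P z s W.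
apply: (@min_rate _ (fun t => expect e t 0 z s) `|M| C) => // T.
have E : \sum_(t < T) eta R t.+1 * expect e t.+1 0 z s =
    mean_step P z s (fun c s' => \sum_(t < T) eta R t.+1 * expect e t 1 (step 0 z s c s') s').
  by rewrite mean_step_sum; apply: eq_bigr => t _; rewrite mean_stepZ.
rewrite E; apply: le_trans (mean_step_le Ker a0 s hmu (hW T)) _.
rewrite mean_stepD (mean_step_const Ker a0)// lerD2r; exact: ler_norm.
Qed.

End FirstStep.

Section Convergence.
Variables (R : realType) (S A : finType).
Variables (P : {ffun S -> R} -> S -> A -> S -> R) (r : S -> A -> {ffun S -> R} -> R).
Variables (C0 C1 delta L BV LV LTV gamma : R).
Hypothesis reg : regular_mfg P r C0 C1 delta L BV LV LTV gamma.
Variables (s0 : S) (a0 : A) (cJ rho a b x l : R).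
Hypotheses (a_gt0 : 0 < a) (b_gt0 : 0 < b) (x_gt0 : 0 < x) (l_gt0 : 0 < l).
Hypothesis herd : herding P r 0 rho.
Hypothesis ok : stepsize_ok #|S| cJ gamma delta rho L LV LTV BV a b x l.

Local Notation state := (astate R S A).
Local Notation step := (Defs.step r cJ BV (stepsz a) (stepsz b) (stepsz x) (stepsz l)).
Local Notation expect := (expect P r cJ BV (stepsz a) (stepsz b) (stepsz x) (stepsz l)).
Local Notation Ker := (reg_kernel reg).

Lemma l_01 : 0 <= l <= 1.
Proof. by have := l_le ok; have := l_gt0 => ? ?; apply/andP; split; lra. Qed.

Lemma combine_step (n' y' y K e e' p kp E C N : R) : K * l / 2 = kp ->
  n' <= y - a / 100 * (e * E) + e * N + e * kp * p + C * e ^+ 2 ->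
  n' + K * ((1 - l * e / 2) * p) + e' * y' <=
  (y + K * p - a / 100 * e * E + C * e ^+ 2) + (e * N + e' * y').
Proof. by move=> <- h; lra. Qed.

(** The drift inequality and the corrector feed [expect_supermartingale], started at iteration 1. *)
Lemma weighted_sum_le (B0 p0 : R) : 2 * (1 + 2 * BV) <= B0 -> cJ <= B0 -> 2 <= B0 -> 0 <= p0 ->
  exists (W : state -> S -> R) (C : R), 0 <= C /\
  forall T (z : state) s, dom BV B0 z -> clip_ok cJ (pen l p0 1) z ->
    \sum_(t < T) eta R t.+1 * expect (eps_total P r) t 1 z s <=
    W z s + C * \sum_(t < T) eta R t.+1 ^+ 2.
Proof.
move=> B0_F B0_c B0_h p00; have lle := l_le ok; have c1 := cJ_ge1 reg ok.
have [CL cL hL] := lyap_step reg s0 a0 a_gt0 b_gt0 x_gt0 l_gt0 herd ok B0_F B0_c B0_h.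
have [BL bL hB] := lyap_lower reg s0 a0 a_gt0 b_gt0 x_gt0 l_gt0 herd ok B0_h.
set lyap := lyap P r delta L BV LV gamma cJ rho a b x l in hL hB.
set noise := noise P r delta L BV LV gamma cJ a b l in hL.
(* The noise depends on a whole transition, Poisson's equation on the state only; averaging over
   action and next state first bridges the two. *)
pose N (z : state) s := mean_step P z s (fun c s' => noise z s c s').
have [Phi [C2 [C20 PhiB hPhi]]] := corrector reg s0 a0 (N := N)
  (fun s => BL_mean_step reg a0 (fun c s' => BL_noise reg s0 a0 cJ a b l B0_h s c s'))
  (fun z dz => noise_mean0 reg s0 a0 cJ a b l dz).
set kp := wt_v gamma a b * (2 * b / sqrt_card R S) * BV in hL.
have n0 := sqrt_card_gt0 R s0; have BB := BV_gt0 reg.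
have kp0 : 0 <= kp.
  have [_ wv0 _ _ _] := weights_ge0 reg a_gt0 b_gt0 x_gt0 l_gt0 ok.
  by apply: mulr_ge0 (ltW BB); apply: mulr_ge0 => //; rewrite divr_ge0 ?mulr_ge0// ltW.
(* One step decreases [K * pen] by [K * l / 2 * eta * pen], which is exactly the clipping loss
   [kp * eta * pen]. *)
pose K := 2 * kp / l.
have KE : K * l / 2 = kp by rewrite /K; field; rewrite gt_eqF.
have K0 : 0 <= K := divr_ge0 (mulr_ge0 (ler0n R 2) kp0) (ltW l_gt0).
have mK0 : 0 <= moveK a b x l B0.
  have B00 := B0_ge0 B0_h; have ll := ltW l_gt0.
  by rewrite /moveK addr_ge0// !mulr_ge0// !addr_ge0// ltW.
pose C := CL + C2 * (1 + moveK a b x l B0).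
have C_0 : 0 <= C by rewrite /C addr_ge0// mulr_ge0// addr_ge0.
pose pk := pen l p0; have pk0 k : 0 <= pk k := pen_ge0 k l_01 p00.
(* The three summands compensate the errors, the clipping and the Markovian noise, respectively. *)
pose Wk k (z : state) (s : S) := lyap z + K * pk k + eta R k * Phi z s.
pose Inv k (z : state) := dom BV B0 z /\ clip_ok cJ (pk k) z.
have cstep k (z : state) s c s' : dom BV B0 z -> clip_ok cJ (pk k) z -> _ := fun dz hz =>
  clip_step reg a x b_gt0 l_gt0 lle c1 (bcJ_le reg s0 a_gt0 b_gt0 x_gt0 l_gt0 herd ok) k s c s'
    dz (pk0 k) hz.
have dstep k (z : state) s c s' : dom BV B0 z -> dom BV B0 (step k z s c s') := fun dz =>
  dom_step reg s0 a0 a b x l_gt0 lle c1 B0_F B0_c B0_h k s c s' dz.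
have inv1 k z : Inv k z -> simplex (muh z) by move=> [[hmu _ _ _] _].
have inv2 k z s c s' : Inv k z -> Inv k.+1 (step k z s c s').
  by move=> [dz hz]; split; [exact: dstep|have [] := cstep k z s c s' dz hz].
have drift k z s : Inv k z ->
    mean_step P z s (fun c s' => Wk k.+1 (step k z s c s') s') + a / 100 * eta R k * eps_total P r z
    <= Wk k z s + C * eta R k ^+ 2.
  move=> [dz hz]; have [hmu _ _ _] := dz; have [e0 e1] := eta_01 R k.
  have pt c s' : Wk k.+1 (step k z s c s') s' <=
      (lyap z + K * pk k - a / 100 * eta R k * eps_total P r z + CL * eta R k ^+ 2)
      + (eta R k * noise z s c s' + eta R k.+1 * Phi (step k z s c s') s').
    rewrite /Wk; apply: (combine_step _ _ KE).
    have [_ hp] := cstep k z s c s' dz hz.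
    have := hL k z s c s' (pk k) dz hp.
    have -> : wt_v gamma a b * (2 * b / sqrt_card R S) * (BV * pk k) = kp * pk k by rewrite /kp mulrA.
    by rewrite [eta R k * (kp * _)]mulrA.
  have RE (Q : R) : mean_step P z s (fun c s' =>
      Q + (eta R k * noise z s c s' + eta R k.+1 * Phi (step k z s c s') s')) =
      Q + (eta R k * N z s + mean_step P z s (fun c s' => eta R k.+1 * Phi (step k z s c s') s')).
    rewrite mean_stepD (mean_step_const Ker a0)// mean_stepD; congr (_ + (_ + _)).
    exact: mean_stepZ.
  have := mean_step_le Ker a0 s hmu pt; rewrite RE.
  have := hPhi z s (step k z s) (moveK a b x l B0) (eta R k) (eta R k.+1) dz
    (fun c s' => dstep k z s c s' dz)
    (fun c s' => sdist_step reg s0 a0 a_gt0 b_gt0 x_gt0 l_gt0 lle c1 B0_F B0_c B0_h k s c s' dz)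
    e0 mK0 (eta_diff R k) (ltW (eta_gt0 R k.+1)).
  have WE : Wk k z s = lyap z + K * pk k + eta R k * Phi z s by [].
  rewrite /C WE; move: (mean_step _ _ _ _) (mean_step _ _ _ _) (N z s).
  move: (lyap z) (eps_total P r z) (Phi z s) (moveK a b x l B0) => y1 y2 y3 y4 m1 m2 m3.
  lra.
have low k z s : Inv k z -> - (BL + C2) <= Wk k z s.
  move=> [dz _]; have h1 := hB z dz; have h2 := PhiB z s dz; have [e0 e1] := eta_01 R k.
  have h3 : - C2 <= eta R k * Phi z s.
    have : `|eta R k * Phi z s| <= C2.
      by rewrite normrM ger0_norm// -[leRHS]mul1r; apply: ler_pM.
    by rewrite ler_norml => /andP[].
  have h4 : 0 <= K * pk k by exact: mulr_ge0.
  by rewrite /Wk; move: h1 h3 h4; move: (lyap z) (eta R k * _) (K * _) => *; lra.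
pose c' := 100 / a.
have c'0 : 0 <= c' by rewrite divr_ge0// ltW.
exists (fun z s => c' * (Wk 1%N z s + (BL + C2))), (c' * C); split; first exact: mulr_ge0.
move=> T z s dz hz; have Iz : Inv 1%N z by split.
have := expect_supermartingale Ker a0 inv1 inv2 drift low T s Iz.
under eq_bigr do rewrite add1n -mulrA.
under [X in _ <= _ + X]eq_bigr do rewrite add1n.
rewrite -!mulr_sumr => h.
have := ler_wpM2l c'0 h; rewrite mulrA.
have -> : c' * (a / 100) = 1 by rewrite /c'; field; rewrite gt_eqF.
by rewrite mul1r [c' * (_ + C * _)]mulrDr [c' * (C * _)]mulrA.
Qed.

Section InitialState.
Variables (theta0 : {ffun S * A -> R}) (mu0 V0 : {ffun S -> R}) (J0 : R).
Hypothesis mu0_simplex : simplex mu0.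
Local Notation z0 := (init_state theta0 mu0 V0 J0).

(** Large enough for the bounds that hold once the projections have acted and for the first momenta,
    which are built from the unprojected [V0] and [J0]. *)
Definition size0 : R :=
  2 * (1 + 2 * BV) + 2 * (1 + 2 * norm2 V0) + (1 + cJ) * (1 + `|J0|) + 2.

Lemma size0_ge : [/\ 2 * (1 + 2 * BV) <= size0, cJ <= size0, 2 <= size0,
  2 * (1 + 2 * norm2 V0) <= size0 & (1 + cJ) * (1 + `|J0|) <= size0].
Proof.
have BB := BV_gt0 reg; have v0 := norm2_ge0 V0; have j0 := normr_ge0 J0.
have c1 := cJ_ge1 reg ok; have c0 : 0 <= cJ := le_trans ler01 c1.
have cj := mulr_ge0 c0 j0; rewrite /size0; split; lra.
Qed.

Lemma first_step_scaled (I : finType) (w : {ffun I -> R}) B : norm2 w <= B ->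
  norm2 ((1 - l * eta R 0) *: (0 : {ffun I -> R}) + (l * eta R 0) *: w) <= B.
Proof.
move=> wB; rewrite scaler0 add0r norm2Z.
have /andP[t0 t1] := l_eta_01 l_gt0 (l_le ok) 0; rewrite ger0_norm//.
by apply: le_trans wB; rewrite ler_piMl ?norm2_ge0.
Qed.

Lemma first_reward_abs s c : `|r s c mu0 - J0| <= 1 + `|J0|.
Proof. by apply: le_trans (ler_normB _ _) _; rewrite lerD2r; exact: (reward_abs reg). Qed.

Lemma first_step s c s' : dom BV size0 (step 0 z0 s c s') /\
  clip_ok cJ (pen l (2 * (1 + `|J0|)) 1) (step 0 z0 s c s').
Proof.
have [h1 h2 h3 h4 h5] := size0_ge; have BB := BV_gt0 reg.
have c1 := cJ_ge1 reg ok; have c0 : 0 < cJ := lt_le_trans ltr01 c1.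
have j0 := normr_ge0 J0; have v0 := norm2_ge0 V0.
have /andP[t0 t1] := l_eta_01 l_gt0 (l_le ok) 0; have rJ := first_reward_abs s c.
have V1 := norm2_coord V0 s; have V2 := norm2_coord V0 s'.
have rr := reward_abs reg s c mu0_simplex.
have jh : 0 <= Jh (step 0 z0 s c s') <= 1 by rewrite step_J; have [] := proj_01P (J0 + b * eta R 0 * 0).
have cj := mulr_ge0 (ltW c0) j0.
split; last first.
  rewrite /clip_ok step_gJ mulr0 add0r /pen.
  have -> : l * eta R 0 * (cJ * (r s c mu0 - J0)) / cJ = l * eta R 0 * (r s c mu0 - J0).
    by field; rewrite gt_eqF.
  have e1 : eta R 0 <= 1 := eta_le1 R 0.
  have l4 := l_le ok; have lt : l * eta R 0 <= 1 / 4.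
    by apply: le_trans l4; rewrite ler_piMr// ltW.
  have : `|l * eta R 0 * (r s c mu0 - J0)| <= 1 + `|J0|.
    by rewrite normrM ger0_norm//; apply: le_trans rJ; rewrite ler_piMl.
  (* The initial excess is doubled so that [pen] at iteration 1 still covers the first sample. *)
  have p1 : (1 + `|J0|) <= (1 - l * eta R 0 / 2) * (2 * (1 + `|J0|)).
    have : 0 <= (1 / 4 - l * eta R 0) * (1 + `|J0|) by rewrite mulr_ge0; lra.
    by move: (l * eta R 0) => t; lra.
  rewrite ler_norml; move: p1 jh => p1 /andP[q1 q2] /andP[q3 q4].
  by apply/andP; split; lra.
split=> //.
- by rewrite step_mu; have [] := proj_simplexP s0 (mu0 + (x * eta R 0) *: 0).
- by rewrite step_V; have [] := proj_ballP (V0 + (b * eta R 0) *: 0) BB.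
split.
- rewrite (step_f r BV a0); apply: first_step_scaled; apply: le_trans h4.
  rewrite norm2Z mulrC; apply: ler_pM; rewrite ?norm2_ge0 ?norm2_score//.
  apply: le_trans (ler_normB _ _) _; have := ler_normD (r s c mu0) (V0 s').
  rewrite /=; lra.
- rewrite step_gV; apply: first_step_scaled; rewrite norm2Z norm2_unitv mulr1 /=.
  apply: le_trans (ler_normB _ _) _; have := ler_normD (r s c mu0 - J0) (V0 s').
  rewrite /size0; lra.
- rewrite step_gJ mulr0 add0r normrM ger0_norm//=.
  apply: (@le_trans _ _ (1 * (cJ * (1 + `|J0|)))); last by lra.
  apply: ler_pM => //; rewrite normrM ger0_norm ?(ltW c0)// ler_wpM2l// ltW//.
- by rewrite step_h; apply: first_step_scaled; apply: le_trans h3; exact: norm2_unitv_sub.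
Qed.

Lemma convergence_rate s : exists2 C : R, 0 < C & forall k, (1 < k)%N -> exists t, (t < k)%N /\
  expect (eps_total P r) t 0 z0 s <= C * (ln (k%:R + 1) ^+ 3 / Num.sqrt (k%:R + 1)).
Proof.
have [h1 h2 h3 _ _] := size0_ge.
have p0 : 0 <= 2 * (1 + `|J0|) by rewrite mulr_ge0// addr_ge0.
have [W [C [C_0 hW]]] := weighted_sum_le h1 h2 h3 p0.
apply: (rate_after_first_step a0 (W := fun c s' => W (step 0 z0 s c s') s') Ker _ C_0) => //.
by move=> T c s'; have [dz hz] := first_step s c s'; exact: hW.
Qed.

End InitialState.
End Convergence.

(** * One state and one action *)

Section Degenerate.
Variables (R : realType) (S A : finType).
Variables (P : {ffun S -> R} -> S -> A -> S -> R) (r : S -> A -> {ffun S -> R} -> R).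
Variables (C0 C1 delta L BV LV gamma : R).
Hypothesis reg : regular_mfg P r C0 C1 delta L BV LV 0 gamma.
Variables (s0 : S) (a0 : A) (cJ a b x l : R).
Hypotheses (cJ_gt0 : 0 < cJ) (b_gt0 : 0 < b) (l_gt0 : 0 < l) (l_le : l <= 1 / 4).
Hypothesis all_eq : forall (pi1 pi2 : {ffun S * A -> R}) (mu1 mu2 : {ffun S -> R}),
  is_policy pi1 -> is_policy pi2 -> simplex mu1 -> simplex mu2 -> pi1 = pi2 /\ mu1 = mu2.

Local Notation state := (astate R S A).
Local Notation spol := (spol a0).
Local Notation step := (Defs.step r cJ BV (stepsz a) (stepsz b) (stepsz x) (stepsz l)).
Local Notation expect := (expect P r cJ BV (stepsz a) (stepsz b) (stepsz x) (stepsz l)).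
Local Notation Ker := (reg_kernel reg).
Local Notation Jz z := (J P r (softmax (th z)) (muh z)).

Lemma unitv_simplex (s : S) : simplex (unitv R s).
Proof.
split=> [i|]; first by rewrite unitvE.
rewrite (bigD1 s)//= big1 ?addr0 ?unitvE ?eqxx// => i /negbTE si.
by rewrite unitvE si.
Qed.

Lemma all_states_eq (s1 s2 : S) : s1 = s2.
Proof.
have [_ /ffunP/(_ s1)] := all_eq (spol 0) (spol 0) (unitv_simplex s1) (unitv_simplex s2).
rewrite !unitvE eqxx; case: eqP => // _ /eqP; by rewrite oner_eq0.
Qed.

Lemma all_actions_eq (c1 c2 : A) : c1 = c2.
Proof.
pose pd c : {ffun S * A -> R} := [ffun sc => (sc.2 == c)%:R].
have pol c : is_policy (pd c).
  move=> s; have -> : [ffun c' => pd c (s, c')] = unitv R c.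
    by apply/ffunP => c'; rewrite unitvE !ffunE.
  split=> [i|]; first by rewrite unitvE.
  rewrite (bigD1 c)//= big1 ?addr0 ?unitvE ?eqxx// => i /negbTE si.
  by rewrite unitvE si.
have [/ffunP/(_ (s0, c1)) + _] := all_eq (pol c1) (pol c2) (unitv_simplex s0) (unitv_simplex s0).
rewrite !ffunE /= eqxx; case: eqP => // _ /eqP; by rewrite oner_eq0.
Qed.

Lemma reward_J (z : state) s c : simplex (muh z) -> r s c (muh z) = Jz z.
Proof.
move=> hmu; have [_ n1] := nu_mfg_simplex reg s0 (spol (th z)) hmu.
rewrite (JE P r) /ravg.
under eq_bigr => s' _.
  have -> : \sum_c' softmax (th z) (s', c') * r s' c' (muh z) = r s c (muh z).
    rewrite -[RHS]mul1r -(softmax_sum1 a0 (th z) s') mulr_suml; apply: eq_bigr => c' _.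
    by rewrite (all_states_eq s' s) (all_actions_eq c' c).
  over.
by rewrite -mulr_suml n1 mul1r.
Qed.

Lemma J_const (z z' : state) : simplex (muh z) -> simplex (muh z') -> Jz z = Jz z'.
Proof. by move=> h h'; have [-> ->] := all_eq (spol (th z)) (spol (th z')) h h'. Qed.

Lemma eps_degenerate (z : state) : simplex (muh z) -> eps_total P r z = (Jh z - Jz z) ^+ 2.
Proof.
move=> hmu; have [hms _] := mustarP reg (spol (th z)).
rewrite eps_totalE /ej real_normK ?num_real//.
have -> : eG P r z = 0.
  have -> : eG P r z = norm2 (0 : {ffun S * A -> R}); last exact: norm2_0.
  congr norm2; apply/ffunP => i; rewrite /gradJ ffunE [RHS]ffunE.
  have -> : (fun t : R => J P r (softmax (th z + t *: unitv R i)) (mustar P (softmax (th z)))) =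
      cst (J P r (softmax (th z)) (mustar P (softmax (th z)))).
    apply/funext => t /=; by have [-> _] := all_eq (spol (th z + t *: unitv R i)) (spol (th z)) hms hms.
  exact: derive1_cst.
have -> : em P z = 0.
  have [_ E] := all_eq (spol 0) (spol 0) hmu hms.
  by rewrite /em {1}E subrr norm2_0.
have -> : ev P r z = 0.
  have -> : ev P r z = norm2 (0 : {ffun S -> R}); last exact: norm2_0.
  congr norm2; apply/ffunP => s; rewrite [RHS]ffunE.
  have := proj_perp_sum0 s0 (Vh z - Vfun P r (softmax (th z)) (muh z)).
  rewrite (bigD1 s)//= big1 ?addr0// => i.
  by rewrite (all_states_eq i s) eqxx.
by rewrite expr0n/= !add0r.
Qed.

(** For the oscillator e' = b g, g' = - l (cJ e + g), the sum [cJ * l * e ^+ 2 + b * g ^+ 2] loses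
    energy only through [g]. The cross term transfers dissipation to [e]; [tilt] solves [2 * b * l -
    tilt * b = tilt * l / (2 * cJ)], which completes a square in [g + cJ * e]. *)
Definition tilt : R := 2 * b * l / (b + l / (2 * cJ)).
Definition energy (e g : R) : R := cJ * l * e ^+ 2 + b * g ^+ 2 + tilt * (e * g).

Lemma tilt_gt0 : 0 < tilt.
Proof. by rewrite /tilt divr_gt0 ?mulr_gt0// addr_gt0// divr_gt0// mulr_gt0. Qed.

(** [u] is the error without clipping. The premises say that clipping moves the error back against
    [g] without enlarging the square of [u], so no part of the energy grows to first order. *)
Lemma energy_step (e e' g G t : R) : let d := - cJ * e - g in let u := e + b * t * g in
  0 <= t -> `|e| <= 1 -> `|g| <= G -> e' ^+ 2 <= u ^+ 2 -> (e' - u) * g <= 0 ->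
  `|e' - u| <= b * t * G ->
  energy e' (g + l * t * d) + tilt * l * cJ / 2 * t * e ^+ 2 <= energy e g +
    (cJ * l * b ^+ 2 * G ^+ 2 + b * l ^+ 2 * (cJ + G) ^+ 2 + 2 * (tilt * b * l * (G * (cJ + G))))
      * t ^+ 2.
Proof.
move=> d u t0 e1 gG h1 h2 h3; have T0 := tilt_gt0.
have G0 : 0 <= G := le_trans (normr_ge0 _) gG.
have dB : `|d| <= cJ + G.
  apply: le_trans (ler_normB _ _) _; apply: lerD => //.
  by rewrite normrM normrN (gtr0_norm cJ_gt0) ler_piMr// ltW.
have D0 : 0 <= cJ + G by rewrite addr_ge0// ltW.
have lt0 : 0 <= l * t by rewrite mulr_ge0// ltW.
have k1 : (e' - u) * (l * t * d) <= b * t * G * (l * t * (cJ + G)).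
  apply: le_trans (ler_norm _) _; rewrite normrM; apply: ler_pM => //.
  by rewrite normrM (ger0_norm lt0) ler_wpM2l.
have k2 : g ^+ 2 <= G ^+ 2 by rewrite -[g ^+ 2]real_normK ?num_real// ler_pXn2r ?nnegrE.
have k3 : d ^+ 2 <= (cJ + G) ^+ 2 by rewrite -[d ^+ 2]real_normK ?num_real// ler_pXn2r ?nnegrE.
have k4 : g * d <= G * (cJ + G).
  by apply: le_trans (ler_norm _) _; rewrite normrM; apply: ler_pM.
have c1 : 0 <= cJ * l by rewrite mulr_ge0// ltW.
have m1 := ler_wpM2l c1 h1.
have m2 := ler_wpM2l (ltW T0) (lerD h2 k1).
have w2 : 0 <= cJ * l * b ^+ 2 * t ^+ 2 := mulr_ge0 (mulr_ge0 c1 (sqr_ge0 b)) (sqr_ge0 t).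
have m3 := ler_wpM2l w2 k2.
have w3 : 0 <= b * l ^+ 2 * t ^+ 2 := mulr_ge0 (mulr_ge0 (ltW b_gt0) (sqr_ge0 l)) (sqr_ge0 t).
have m4 := ler_wpM2l w3 k3.
have w4 : 0 <= tilt * b * l * t ^+ 2 :=
  mulr_ge0 (mulr_ge0 (mulr_ge0 (ltW T0) (ltW b_gt0)) (ltW l_gt0)) (sqr_ge0 t).
have m5 := ler_wpM2l w4 k4.
(* Half of the dissipation in [e] is used for this square; the other half remains in the
   conclusion. *)
have sq : 0 <= t * (tilt * l / (2 * cJ) * (g + cJ * e) ^+ 2).
  apply: mulr_ge0 => //; apply: mulr_ge0; last exact: sqr_ge0.
  exact: divr_ge0 (mulr_ge0 (ltW T0) (ltW l_gt0)) (mulr_ge0 (ler0n _ _) (ltW cJ_gt0)).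
have TE : 2 * b * l - tilt * b = tilt * l / (2 * cJ).
  have q : b + l / (2 * cJ) != 0 by rewrite gt_eqF// addr_gt0// divr_gt0// mulr_gt0.
  have q' : b * (2 * cJ) + l != 0 by rewrite gt_eqF// addr_gt0// !mulr_gt0.
  by rewrite /tilt; field; rewrite (gt_eqF cJ_gt0).
have SE : tilt * l / (2 * cJ) * (g + cJ * e) ^+ 2 =
    tilt * l / (2 * cJ) * g ^+ 2 + tilt * l * (e * g) + tilt * l * cJ / 2 * e ^+ 2.
  by field; rewrite gt_eqF.
rewrite SE -TE in sq.
rewrite /energy /d /u in m1 m2 m3 m4 m5 *.
move: tilt sq m1 m2 m3 m4 m5 => T.
lra.
Qed.

Lemma step_between (j t g : R) : 0 <= j <= 1 -> 0 <= t ->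
  (proj_01 (j + t * g) - (j + t * g)) * g <= 0 /\
  `|proj_01 (j + t * g) - (j + t * g)| <= t * `|g|.
Proof.
move=> j01 t0; have [m1 m2] := proj01_mono (j + t * g) j01.
have [g0|/ltW g0] := leP 0 g.
  have tg := mulr_ge0 t0 g0; have /andP[p1 p2] : j <= proj_01 (j + t * g) <= j + t * g.
    by apply: m1; lra.
  split; first by rewrite mulr_le0_ge0// subr_le0.
  by rewrite (ger0_norm g0) ler_norml; apply/andP; split; lra.
have tg := mulr_ge0_le0 t0 g0; have /andP[p1 p2] : j + t * g <= proj_01 (j + t * g) <= j.
  by apply: m2; lra.
split; first by rewrite mulr_ge0_le0// subr_ge0.
by rewrite (ler0_norm g0) ler_norml; apply/andP; split; lra.
Qed.

Lemma degenerate_rate (theta0 : {ffun S * A -> R}) (mu0 V0 : {ffun S -> R}) (J0 : R) s :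
  simplex mu0 ->
  exists2 C : R, 0 < C & forall k, (1 < k)%N -> exists t, (t < k)%N /\
    expect (eps_total P r) t 0 (init_state theta0 mu0 V0 J0) s
      <= C * (ln (k%:R + 1) ^+ 3 / Num.sqrt (k%:R + 1)).
Proof.
move=> hmu0; set z0 := init_state _ _ _ _; set G := cJ * (1 + `|J0|).
have j00 := normr_ge0 J0.
have G0 : 0 <= G by rewrite mulr_ge0 ?(ltW cJ_gt0)// addr_ge0.
have cG : cJ <= G by rewrite ler_peMr ?(ltW cJ_gt0)// lerDl.
have T0 := tilt_gt0.
pose Inv (k : nat) (z : state) := [/\ simplex (muh z), 0 <= Jh z <= 1 & `|gJ z| <= G].
pose W (k : nat) (z : state) (s : S) := energy (Jh z - Jz z) (gJ z).
set K := cJ * l * b ^+ 2 * G ^+ 2 + b * l ^+ 2 * (cJ + G) ^+ 2 + 2 * (tilt * b * l * (G * (cJ + G))).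
have cG0 : 0 <= cJ + G by rewrite addr_ge0// ltW.
have K0 : 0 <= K.
  have c0 := ltW cJ_gt0; have b0 := ltW b_gt0; have l0 := ltW l_gt0.
  apply: addr_ge0; last exact: mulr_ge0 (ler0n R 2) (mulr_ge0 (mulr_ge0 (mulr_ge0 (ltW T0) b0) l0) (mulr_ge0 G0 cG0)).
  apply: addr_ge0; last exact: mulr_ge0 (mulr_ge0 b0 (sqr_ge0 _)) (sqr_ge0 _).
  exact: mulr_ge0 (mulr_ge0 (mulr_ge0 c0 l0) (sqr_ge0 _)) (sqr_ge0 _).
pose w := tilt * l * cJ / 2; have w0 : 0 < w := divr_gt0 (mulr_gt0 (mulr_gt0 T0 l_gt0) cJ_gt0) (ltr0Sn R 1).
have smu k (z : state) s1 c s2 : simplex (muh (step k z s1 c s2)).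
  by rewrite step_mu; have [] := proj_simplexP s0 (muh z + (x * eta R k) *: hv z).
have sJh k (z : state) s1 c s2 : 0 <= Jh (step k z s1 c s2) <= 1.
  by rewrite step_J; have [] := proj_01P (Jh z + b * eta R k * gJ z).
have inv1 k z : Inv k z -> simplex (muh z) by case.
have dev (z : state) : simplex (muh z) -> 0 <= Jh z <= 1 -> `|Jh z - Jz z| <= 1.
  move=> hmu /andP[j0 j1]; have /andP[? ?] := J_01 reg s0 (spol (th z)) hmu.
  by rewrite ler_norml; apply/andP; split; lra.
have gJE k (z : state) s1 c s2 : simplex (muh z) -> gJ (step k z s1 c s2) =
    gJ z + l * eta R k * (- cJ * (Jh z - Jz z) - gJ z).
  by move=> hmu; rewrite step_gJ (reward_J s1 c hmu); ring.
have inv2 k z s1 c s2 : Inv k z -> Inv k.+1 (step k z s1 c s2).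
  move=> [hmu hj hg]; split=> //; have /andP[t0 t1] := l_eta_01 l_gt0 l_le k.
  rewrite gJE//.
  have -> : gJ z + l * eta R k * (- cJ * (Jh z - Jz z) - gJ z) =
    (1 - l * eta R k) * gJ z + l * eta R k * (- cJ * (Jh z - Jz z)) by ring.
  apply: le_trans (ler_normD _ _) _; rewrite normrM [X in _ + X]normrM.
  rewrite (ger0_norm t0) ger0_norm ?subr_ge0//.
  have dB : `|- cJ * (Jh z - Jz z)| <= G.
    apply: le_trans cG; rewrite normrM normrN (gtr0_norm cJ_gt0) ler_piMr ?(ltW cJ_gt0)//.
    exact: dev.
  have t1' : 0 <= 1 - l * eta R k by rewrite subr_ge0.
  have := ler_wpM2l t1' hg; have := ler_wpM2l t0 dB; lra.
have drift k z s1 : Inv k z ->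
    mean_step P z s1 (fun c s' => W k.+1 (step k z s1 c s') s') + w * eta R k * eps_total P r z
    <= W k z s1 + K * eta R k ^+ 2.
  move=> [hmu hj hg]; have [e0 e1] := eta_01 R k.
  have pt c s' : W k.+1 (step k z s1 c s') s' <=
      W k z s1 + K * eta R k ^+ 2 - w * eta R k * eps_total P r z.
    rewrite /W (J_const (smu k z s1 c s') hmu) gJE// eps_degenerate// step_J.
    have be0 : 0 <= b * eta R k by rewrite mulr_ge0// ltW.
    have [q1 q2] := step_between (gJ z) hj be0.
    have J1 := J_01 reg s0 (spol (th z)) hmu.
    have q3 := proj01_contracts (Jh z + b * eta R k * gJ z) J1.
    rewrite lerBrDr; apply: energy_step => //; first exact: dev.
    - rewrite -[leLHS]real_normK ?num_real// -[leRHS]real_normK ?num_real//.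
      by rewrite ler_pXn2r ?nnegrE// -addrAC.
    - by move: q1; congr (_ * _ <= _); ring.
    - have -> : proj_01 (Jh z + b * eta R k * gJ z) - Jz z - (Jh z - Jz z + b * eta R k * gJ z) =
        proj_01 (Jh z + b * eta R k * gJ z) - (Jh z + b * eta R k * gJ z) by ring.
      by apply: le_trans q2 _; rewrite ler_wpM2l.
  by have := mean_step_le Ker a0 s1 hmu pt; rewrite (mean_step_const Ker a0)// lerBrDr.
(* The cross term is bounded on the invariant set, so the energy need not be a positive form. *)
have low k z s1 : Inv k z -> - (tilt * G) <= W k z s1.
  move=> [hmu hj hg]; have h := dev z hmu hj.
  have : `|(Jh z - Jz z) * gJ z| <= G by rewrite normrM -[leRHS]mul1r; exact: ler_pM.
  rewrite ler_norml => /andP[/(ler_wpM2l (ltW T0)) + _]; rewrite mulrN => h1.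
  apply: le_trans h1 _; rewrite lerDr; apply: addr_ge0.
    exact: mulr_ge0 (mulr_ge0 (ltW cJ_gt0) (ltW l_gt0)) (sqr_ge0 _).
  exact: mulr_ge0 (ltW b_gt0) (sqr_ge0 _).
have iw0 : 0 <= w^-1 by rewrite invr_ge0 ltW.
apply: (rate_after_first_step a0
  (W := fun c s' => w^-1 * (W 1%N (step 0 z0 s c s') s' + tilt * G)) Ker _ (mulr_ge0 iw0 K0)) => //.
move=> T c s'; have Iz : Inv 1%N (step 0 z0 s c s').
  split=> //; rewrite step_gJ mulr0 add0r normrM.
  have /andP[t0 t1] := l_eta_01 l_gt0 l_le 0; rewrite (ger0_norm t0).
  apply: (@le_trans _ _ (1 * G)); last by rewrite mul1r.
  apply: ler_pM => //; rewrite normrM (gtr0_norm cJ_gt0) ler_wpM2l ?(ltW cJ_gt0)//=.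
  by apply: le_trans (ler_normB _ _) _; rewrite lerD2r; exact: (reward_abs reg).
have := expect_supermartingale Ker a0 inv1 inv2 drift low T s' Iz.
under eq_bigr do rewrite add1n -mulrA.
under [X in _ <= _ + X]eq_bigr do rewrite add1n.
rewrite -!mulr_sumr => /(ler_wpM2l iw0); rewrite mulKf ?gt_eqF//.
by rewrite [w^-1 * (_ + K * _)]mulrDr [w^-1 * (K * _)]mulrA.
Qed.

End Degenerate.

Section Assembly.
Variable R : realType.

Lemma rate_with_herding (u : nat -> R) (kappa : R) : 0 <= kappa ->
  (kappa = 0 -> exists2 C : R, 0 < C & forall k, (1 < k)%N -> exists t, (t < k)%N /\
     u t <= C * (ln (k%:R + 1) ^+ 3 / Num.sqrt (k%:R + 1))) ->
  exists C : R, 0 < C /\ forall k, (0 < k)%N -> exists t, (t < k)%N /\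
    u t <= C * (ln (k%:R + 1) ^+ 3 / Num.sqrt (k%:R + 1) + kappa).
Proof.
move=> k0 h; pose y (k : nat) : R := ln (k%:R + 1) ^+ 3 / Num.sqrt (k%:R + 1).
have y0 k : (0 < k)%N -> 0 < y k.
  move=> kp; have k1 : 1 <= k%:R :> R by rewrite ler1n.
  by rewrite /y divr_gt0 ?sqrtr_gt0 ?exprn_gt0 ?ln_gt0//; lra.
have u0 := normr_ge0 (u 0%N).
have pos (d : R) : 0 < d -> 0 < (`|u 0%N| + 1) / d /\ u 0%N <= (`|u 0%N| + 1) / d * d.
  move=> d0; rewrite divr_gt0 ?ltr_wpDl// divfK ?gt_eqF//; split=> //.
  by have := ler_norm (u 0%N); lra.
have [kap|kap] := eqVneq kappa 0; last first.
  have kp : 0 < kappa by rewrite lt_neqAle eq_sym kap.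
  have [c0 cu] := pos _ kp; exists ((`|u 0%N| + 1) / kappa); split=> // k kk.
  exists 0%N; split=> //; apply: le_trans cu _; rewrite ler_wpM2l ?(ltW c0)//.
  by rewrite lerDr -/(y k) ltW// y0.
have [C C_0 hC] := h kap; have [c0 cu] := pos _ (y0 1%N isT).
exists (C + (`|u 0%N| + 1) / y 1%N); split; first exact: addr_gt0.
move=> k kk; rewrite kap addr0 -/(y k).
(* For [k = 1] only the index 0 is available; the second summand of the constant is chosen for
   it. *)
have [k1|k1] := leqP k 1.
  have -> : k = 1%N by apply/eqP; rewrite eqn_leq k1.
  exists 0%N; split=> //; apply: le_trans cu _.
  by rewrite ler_wpM2r ?(ltW (y0 1%N isT))// lerDr ltW.
have [t [tk ht]] := hC k k1; exists t; split=> //; apply: le_trans ht _.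
by rewrite -/(y k) ler_wpM2r ?(ltW (y0 k kk))// lerDl ltW.
Qed.

End Assembly.

Theorem theorem1 (R : realType) (S A : finType)
  (P : {ffun S -> R} -> S -> A -> S -> R) (r : S -> A -> {ffun S -> R} -> R)
  (kappa rho delta L BV LV LTV gamma cJ la0 al0 be0 xi0 : R)
  (theta0 : {ffun S * A -> R}) (V0 : {ffun S -> R}) (J0 : R)
  (mu0 : {ffun S -> R}) (s0 : S) :
  is_kernel P -> reward_bounded r ->
  Assumption1 P -> Assumption2 P delta -> Assumption3 P r L BV ->
  mf_unique P ->
  0 <= kappa -> herding P r kappa rho ->
  LV_prop P r LV -> LTV_prop P LTV -> gamma_prop P gamma ->
  0 < cJ -> 0 < la0 -> 0 < al0 -> 0 < be0 -> 0 < xi0 ->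
  stepsize_ok #|S| cJ gamma delta rho L LV LTV BV al0 be0 xi0 la0 ->
  simplex mu0 ->
  exists C : R, 0 < C /\
    forall k : nat, (0 < k)%N ->
      (* k >= tau_k = sup_{pi,mu} tau^{pi,mu}(alpha_k) *)
      (forall pi mu, is_policy pi -> simplex mu ->
         (mixing_time P pi mu (stepsz al0 k) <= k)%N) ->
      (* min_{0 <= t < k} E[eps_t^pi + eps_t^mu + eps_t^V + eps_t^J] <= ... *)
      exists t : nat, (t < k)%N /\
        expect P r cJ BV (stepsz al0) (stepsz be0) (stepsz xi0) (stepsz la0)
          (eps_total P r) t 0 (init_state theta0 mu0 V0 J0) s0
        <= C * (ln (k%:R + 1) ^+ 3 / Num.sqrt (k%:R + 1) + kappa).
Proof.
move=> Ker rew [_ [C0 [C1 [hC0 hC1 erg]]]] A2 A3 uniq k0 herd hLV hTV hg c0 l0 a0' b0 x0 ok hmu.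
pose u t := expect P r cJ BV (stepsz al0) (stepsz be0) (stepsz xi0) (stepsz la0)
  (eps_total P r) t 0 (init_state theta0 mu0 V0 J0) s0.
suff [C [C_0 hC]] : exists C : R, 0 < C /\ forall k, (0 < k)%N -> exists t, (t < k)%N /\
    u t <= C * (ln (k%:R + 1) ^+ 3 / Num.sqrt (k%:R + 1) + kappa).
  by exists C; split=> // k kk _; exact: hC.
apply: rate_with_herding => // kap; rewrite kap in herd.
(* Without actions every expectation after at least one iteration is an empty sum, so [t = 1]
   works. *)
have [a0 _|noA] := pickP {: A}; last first.
  exists 1 => // k k1; exists 1%N; split=> //.
  rewrite /u /= big1; last by move=> c; have := noA c.
  rewrite mul1r divr_ge0 ?sqrtr_ge0// exprn_ge0// ln_ge0//.
  by rewrite lerDr.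
have [LTV0|LTV0] := leP 0 LTV.
  have reg : regular_mfg P r C0 C1 delta L BV LV LTV gamma by [].
  exact: (convergence_rate reg s0 a0 a0' b0 x0 l0 herd ok).
have all_eq (pi1 pi2 : {ffun S * A -> R}) (mu1 mu2 : {ffun S -> R}) : is_policy pi1 ->
    is_policy pi2 -> simplex mu1 -> simplex mu2 -> pi1 = pi2 /\ mu1 = mu2.
  move=> p1 p2 m1 m2; have := le_trans (dTV_ge0 _ _) (hTV _ _ _ _ p1 p2 m1 m2).
  rewrite nmulr_rge0// => h.
  have n1 := norm2_ge0 (pi1 - pi2); have n2 := norm2_ge0 (mu1 - mu2).
  split; apply: subr0_eq; apply: norm2_eq0; apply/eqP; rewrite eq_le ?n1 ?n2 andbT; lra.
(* With a single policy and a single mean field the constant may be replaced by 0, as [regular_mfg]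
   asks for a nonnegative one. *)
have hTV0 : LTV_prop P 0.
  move=> pi1 pi2 mu1 mu2 p1 p2 m1 m2; have [-> ->] := all_eq _ _ _ _ p1 p2 m1 m2.
  by rewrite dTV_refl mul0r.
have reg : regular_mfg P r C0 C1 delta L BV LV 0 gamma by [].
have [_ _ _ l4] := steps_le ok.
exact: (degenerate_rate reg s0 a0).
Qed.
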